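(* Let $Q=\mathbb{R}^+\times\mathbb{R}^+$, where $\mathbb{R}^+=(0,\infty)$, and let $u_0\in\mathcal{S}([0,\infty))$, $g_0\in C^\infty([0,\infty))$ and $f\in\mathcal{S}(\overline{Q})$. Consider the problem $$(\ast)\qquad \begin{cases} \dfrac{\partial U}{\partial t}+\dfrac{\partial^3 U}{\partial x^3}=f, & (x,t)\in Q,\\ \lim_{t\to0^+}U(x,t)=u_0(x), & x\in\mathbb{R}^+,\\ \lim_{x\to0^+}U(x,t)=g_0(t), & t\in\mathbb{R}^+.\end{cases}$$ For $x>0$, $t>0$ define $$2\pi U(x,t)=\int_{-\infty}^{\infty}e^{i\lambda x-\omega(\lambda)t}\hat u_0(\lambda)\,d\lambda+\int_{\Gamma}e^{i\lambda x-\omega(\lambda)t}\big[\alpha\hat u_0(\alpha\lambda)+\alpha^2\hat u_0(\alpha^2\lambda)\big]d\lambda-\int_{\Gamma}e^{i\lambda x-\omega(\lambda)t}\,3\lambda^2\,\tilde g_0(\omega(\lambda),t)\,d\lambda$$ $$\qquad+\int_{-\infty}^{\infty}e^{i\lambda x-\omega(\lambda)t}\tilde{\hat f}(\lambda,\omega(\lambda),t)\,d\lambda+\int_{\Gamma}e^{i\lambda x-\omega(\lambda)t}\big[\alpha\tilde{\hat f}(\alpha\lambda,\omega(\lambda),t)+\alpha^2\tilde{\hat f}(\alpha^2\lambda,\omega(\lambda),t)\big]d\lambda,$$ with the notation of the context. Then $U$ is the unique solution of $(\ast)$ in the following sense. Suppose in addition that $u_0(0)=g_0(0)$ and $g_0'(0)=-u_0'''(0)+f(0,0)$,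 and let $V(x,t)$ be a $C^3$ function in $\overline{Q}\setminus\{(0,0)\}$ which solves $(\ast)$ and satisfies: (i) $\lim_{x\to\infty}V(x,t)=\lim_{x\to\infty}V_x(x,t)=0$ and $\sup_{x\ge1}|V_{xx}(x,t)|<\infty$ for every $t>0$; (ii) for every $T>0$ there exists a positive function $B_T(x)$ with $\int_0^\infty B_T(x)\,dx<+\infty$ such that, for $0<t\le T$, $$|V(x,t)|^2\le B_T(x)\quad\text{and}\quad|V_t(x,t)|^2\le B_T(x)\qquad(\forall x>0).$$ Then $V\equiv U$.
   Context: $\mathcal{S}([0,\infty))$ and $\mathcal{S}(\overline{Q})$, with $\overline{Q}=[0,\infty)\times[0,\infty)$, denote the Schwartz spaces of functions that are smooth up to the boundary and rapidly decreasing together with all their derivatives. Notation: $\alpha=e^{2\pi i/3}$ and $\omega(\lambda)=-i\lambda^3$ for $\lambda\in\mathbb{C}$. For $\lambda\in\mathbb{C}$ with $\operatorname{Im}\lambda\le0$, $$\hat u_0(\lambda)=\int_0^\infty e^{-i\lambda y}u_0(y)\,dy,\qquad \hat f(\lambda,t)=\int_0^\infty e^{-i\lambda y}f(y,t)\,dy.$$ Furthermore $$\tilde g_0(\omega(\lambda),t)=\int_0^t e^{\omega(\lambda)\tau}g_0(\tau)\,d\tau\quad(\lambda\in\mathbb{C}),\qquad \tilde{\hat f}(\mu,\omega(\lambda),t)=\int_0^t e^{\omega(\lambda)\tau}\hat f(\mu,\tau)\,d\tau\quad(\operatorname{Im}\mu\le0),$$ the latter being used with $\mu=\lambda$, $\mu=\alpha\lambda$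 and $\mu=\alpha^2\lambda$. The contour $\Gamma=\partial\Omega^-$ is the oriented boundary of $\Omega^-=\{\lambda\in\mathbb{C}:\operatorname{Im}\lambda\ge0\text{ and }\operatorname{Re}\omega(\lambda)\le0\}=\{\lambda:\pi/3\le\arg\lambda\le2\pi/3\}\cup\{0\}$. It is traversed with $\Omega^-$ on the left, i.e. from $\infty e^{2\pi i/3}$ along a ray to $0$ and then from $0$ along a ray to $\infty e^{\pi i/3}$. Integrals over unbounded contours are understood as improper integrals. *)

(* Defs.v *)
(* All functions are total on R (or R x R) and complex-valued; only their values
   on the closed half-line [0, oo) or on the relevant part of the closed quadrant
   matter, because every derivative, limit and integral below is relative to it. *)
From Stdlib Require Import Reals.
From Coquelicot Require Import Coquelicot.
Open Scope R_scope.

Definition Cexp (z : C) : C := (exp (Re z) * cos (Im z), exp (Re z) * sin (Im z)).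

Definition alpha : C := Cexp (Ci * RtoC (2 * PI / 3))%C.

Definition omega (l : C) : C := (- Ci * l ^ 3)%C.

Definition is_derive_on (D : R -> Prop) (h : R -> C) (x : R) (l : C) : Prop :=
  filterlim (fun y : R => ((h y - h x) / RtoC (y - x))%C)
            (within D (locally' x)) (locally l).

Definition ex_derive_on (D : R -> Prop) (h : R -> C) (x : R) : Prop :=
  exists l : C, is_derive_on D h x l.

(* Arbitrary where the derivative does not exist. *)
Definition Derive_on (D : R -> Prop) (h : R -> C) (x : R) : C :=
  @iota C_R_CompleteNormedModule (is_derive_on D h x).

Definition ex_pdx (E : R -> R -> Prop) (W : R -> R -> C) (x t : R) : Prop :=
  ex_derive_on (fun y => E y t) (fun y => W y t) x.
Definition ex_pdt (E : R -> R -> Prop) (W : R -> R -> C) (x t : R) : Prop :=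
  ex_derive_on (fun s => E x s) (fun s => W x s) t.
Definition pdx (E : R -> R -> Prop) (W : R -> R -> C) (x t : R) : C :=
  Derive_on (fun y => E y t) (fun y => W y t) x.
Definition pdt (E : R -> R -> Prop) (W : R -> R -> C) (x t : R) : C :=
  Derive_on (fun s => E x s) (fun s => W x s) t.

Definition halfline (x : R) : Prop := 0 <= x.
Definition Q (x t : R) : Prop := 0 < x /\ 0 < t.
Definition Qbar (x t : R) : Prop := 0 <= x /\ 0 <= t.
Definition Qbar_minus_origin (x t : R) : Prop := Qbar x t /\ ~ (x = 0 /\ t = 0).

Definition Cinfty_halfline (u : R -> C) : Prop :=
  forall (n : nat) (x : R), 0 <= x ->
    ex_derive_on halfline (Nat.iter n (Derive_on halfline) u) x.

Definition Schwartz_halfline (u : R -> C) : Prop :=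
  Cinfty_halfline u /\
  forall j n : nat, exists M : R, forall x : R, 0 <= x ->
    x ^ j * Cmod (Nat.iter n (Derive_on halfline) u x) <= M.

Definition continuous_in (E : R -> R -> Prop) (W : R -> R -> C) : Prop :=
  forall x t : R, E x t ->
    filterlim (fun p : R * R => W (fst p) (snd p))
              (within (fun p : R * R => E (fst p) (snd p)) (locally (x, t)))
              (locally (W x t)).

Fixpoint Ck (E : R -> R -> Prop) (k : nat) (W : R -> R -> C) : Prop :=
  continuous_in E W /\
  match k with
  | O => True
  | S k' =>
      (forall x t : R, E x t -> ex_pdx E W x t /\ ex_pdt E W x t) /\
      Ck E k' (pdx E W) /\ Ck E k' (pdt E W)
  end.

Definition Schwartz_Qbar (f : R -> R -> C) : Prop :=
  (forall k : nat, Ck Qbar k f) /\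
  forall j k m n : nat, exists M : R, forall x t : R, Qbar x t ->
    x ^ j * t ^ k * Cmod (Nat.iter m (pdx Qbar) (Nat.iter n (pdt Qbar) f) x t) <= M.

(* Applied to u0, and to f(., t) for fixed t. *)
Definition hat (h : R -> C) (l : C) : C :=
  @RInt_gen C_R_CompleteNormedModule
    (fun y : R => (Cexp (- Ci * l * RtoC y) * h y)%C)
    (at_point 0) (Rbar_locally p_infty).

Definition tilde (g : R -> C) (k : C) (t : R) : C :=
  @RInt C_R_CompleteNormedModule
    (fun tau : R => (Cexp (k * RtoC tau) * g tau)%C) 0 t.

Definition tilde_hat (f : R -> R -> C) (mu k : C) (t : R) : C :=
  tilde (fun tau : R => hat (fun y : R => f y tau) mu) k t.

Definition is_int_line (F : C -> C) (I : C) : Prop :=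
  @is_RInt_gen C_R_NormedModule (fun l : R => F (RtoC l))
    (Rbar_locally m_infty) (Rbar_locally p_infty) I.

(* Gamma comes in from infinity to 0 along the ray of argument 2 pi / 3, then
   goes out to infinity along the ray of argument pi / 3; each ray is
   parametrised by the modulus r. *)
Definition is_int_Gamma (F : C -> C) (I : C) : Prop :=
  let e1 := Cexp (Ci * RtoC (2 * PI / 3))%C in
  let e2 := Cexp (Ci * RtoC (PI / 3))%C in
  exists I1 I2 : C,
    @is_RInt_gen C_R_NormedModule (fun r : R => (F (RtoC r * e1) * e1)%C)
      (Rbar_locally p_infty) (at_point 0) I1 /\
    @is_RInt_gen C_R_NormedModule (fun r : R => (F (RtoC r * e2) * e2)%C)
      (at_point 0) (Rbar_locally p_infty) I2 /\
    I = (I1 + I2)%C.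

(* All five improper integrals converge, and together they give 2 pi v. *)
Definition is_UTM_value (u0 g0 : R -> C) (f : R -> R -> C) (x t : R) (v : C) : Prop :=
  let ker := fun l : C => Cexp (Ci * l * RtoC x - omega l * RtoC t)%C in
  exists I1 I2 I3 I4 I5 : C,
    is_int_line (fun l => ker l * hat u0 l)%C I1 /\
    is_int_Gamma (fun l =>
      ker l * (alpha * hat u0 (alpha * l) + alpha ^ 2 * hat u0 (alpha ^ 2 * l)))%C I2 /\
    is_int_Gamma (fun l => ker l * (RtoC 3 * l ^ 2 * tilde g0 (omega l) t))%C I3 /\
    is_int_line (fun l => ker l * tilde_hat f l (omega l) t)%C I4 /\
    is_int_Gamma (fun l =>
      ker l * (alpha * tilde_hat f (alpha * l) (omega l) t
               + alpha ^ 2 * tilde_hat f (alpha ^ 2 * l) (omega l) t))%C I5 /\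
    (RtoC (2 * PI) * v = I1 + I2 - I3 + I4 + I5)%C.

Definition solves_ibvp (u0 g0 : R -> C) (f : R -> R -> C) (W : R -> R -> C) : Prop :=
  (forall x t : R, 0 < x -> 0 < t ->
     ex_pdt Q W x t /\
     ex_pdx Q W x t /\ ex_pdx Q (pdx Q W) x t /\ ex_pdx Q (pdx Q (pdx Q W)) x t /\
     (pdt Q W x t + pdx Q (pdx Q (pdx Q W)) x t = f x t)%C) /\
  (forall x : R, 0 < x -> filterlim (fun t : R => W x t) (at_right 0) (locally (u0 x))) /\
  (forall t : R, 0 < t -> filterlim (fun x : R => W x t) (at_right 0) (locally (g0 t))).

Definition compatible (u0 g0 : R -> C) (f : R -> R -> C) : Prop :=
  u0 0 = g0 0 /\
  Derive_on halfline g0 0 = (- Nat.iter 3 (Derive_on halfline) u0 0 + f 0 0)%C.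

Definition decay_at_infinity (V : R -> R -> C) : Prop :=
  forall t : R, 0 < t ->
    filterlim (fun x : R => V x t) (Rbar_locally p_infty) (locally (RtoC 0)) /\
    filterlim (fun x : R => pdx Q V x t) (Rbar_locally p_infty) (locally (RtoC 0)) /\
    exists M : R, forall x : R, 1 <= x -> Cmod (pdx Q (pdx Q V) x t) <= M.

(* For V of class C^3 on the closed quadrant minus the origin, Riemann and Lebesgue
   integrability of the dominating function give the same condition: the
   least dominating function, a maximum over t in [0, T], is continuous in x > 0. *)
Definition L2_dominated (V : R -> R -> C) : Prop :=
  forall T : R, 0 < T ->
    exists B : R -> R,
      (forall x : R, 0 < x -> 0 < B x) /\
      ex_RInt_gen B (at_right 0) (Rbar_locally p_infty) /\
      forall x t : R, 0 < x -> 0 < t <= T ->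
        Cmod (V x t) ^ 2 <= B x /\ Cmod (pdt Q V x t) ^ 2 <= B x.

(* Main.v *)
(* Existence. Subtract from the solution the initial datum and a combination of the functions
   x^k e^(-x) / k!, k < 7, whose time-dependent coefficients are chosen to cancel the first seven jets
   of the forcing at x = 0. These pieces are sums of products a(t) phi(x), for which the formula
   reduces to Fourier inversion on the half-line together with the vanishing of the transforms
   rotated by alpha. What remains is a boundary datum, treated by rotating Gamma to the rays
   of argument pi/6 and 5pi/6, on which omega is positive, and a forcing whose transform is
   O(|lambda|^-7), so that all limits and derivatives can be taken under the integral sign.

   Uniqueness. Under the compatibility conditions U and U_t are O(1/(1+x)) uniformly on
   bounded time intervals, so that W = V - U satisfies |W(x,t)| <= t sqrt(B(x)) with B integrable,
   and the energy int |W|^2 is nonincreasing: its derivative is the limit as x -> 0 of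
   2 Re(W conj(W_xx)) - |W_x|^2, where W -> 0 and W_xx is bounded. *)

Require Import Defs.
From Stdlib Require Import Reals Lra Lia Psatz Factorial ClassicalEpsilon FunctionalExtensionality PropExtensionality.
From Coquelicot Require Import Coquelicot.
Open Scope R_scope.

(** The transforms of [u0] and [f] decay only like 1/|lambda| when these functions do not vanish at
    x = 0, so the integrals over the real line converge conditionally and cannot be differentiated
    under the sign. The decomposition confines this difficulty to products a(t) phi(x), whose value
    is known beforehand. Fourier inversion is reduced to e^(-x), with transform 1/(1 + i lambda): a
    multiple of it is subtracted so that the rest vanishes at the point x, where Riemann-Lebesgue
    applies; the constant 2 pi comes from the integral of 4/(1 + r^2) over the half-line. Contours
    move only across circular sectors, where Cauchy's theorem follows by differentiating ray
    integrals in the angle. The trace g(t) at x = 0 is a singular limit, since the rotated integrand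
    decays only like 1/r once e^(i lambda x) is lost; comparison with the exact solution e^(t - x)
    of the homogeneous equation leaves an absolutely integrable difference. Jets are taken for d/dx
    + 1 because its multiplier 1 + i lambda has no zero in the closed lower half-plane. *)

Ltac eqR := match goal with |- ?a = ?b => change (@eq R a b) end.
Ltac ringC := cbv beta; match goal with |- @eq _ ?a ?b => change (@eq C a b) end; first [ring | symmetry; ring].

(** * Limits and continuity of complex-valued functions *)

Lemma ball_Cmod (x y : C) (e : posreal) : Cmod (y - x) < e -> ball x e y.
Proof. apply C_NormedModule_mixin_compat1. Qed.

(** The uniform structure of [C] is that of the product, so a ball controls the modulus only up to
    sqrt 2, rounded up to 2. *)
Lemma Cmod_ball (x y : C) (e : posreal) : ball x e y -> Cmod (y - x) < 2 * e.
Proof.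
  intros H; apply C_NormedModule_mixin_compat2 in H.
  eapply Rlt_le_trans; [exact H|].
  apply Rmult_le_compat_r; [left; apply cond_pos|].
  rewrite <- (sqrt_square 2) at 2 by lra; apply sqrt_le_1; lra.
Qed.

Lemma lim_Cmod {T} (F : (T -> Prop) -> Prop) {FF : Filter F} (f : T -> C) (l : C) :
  filterlim f F (locally l) <->
  forall e : R, 0 < e -> F (fun x => Cmod (f x - l) < e).
Proof.
  split.
  - intros H e He.
    assert (He2 : 0 < e / 2) by lra.
    generalize (proj1 (filterlim_locally f l) H (mkposreal _ He2)).
    apply filter_imp; intros x Hx; apply Cmod_ball in Hx; simpl in Hx; lra.
  - intros H; apply filterlim_locally; intros e.
    generalize (H e (cond_pos e)); apply filter_imp; intros x; apply ball_Cmod.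
Qed.

Lemma ct_Cmod {U : UniformSpace} (f : U -> C) (p : U) :
  continuous f p <-> forall e : R, 0 < e -> locally p (fun x => Cmod (f x - f p) < e).
Proof. apply lim_Cmod; apply locally_filter. Qed.

Lemma ct_pair {U : UniformSpace} (f g : U -> R) p :
  continuous f p -> continuous g p -> continuous (fun x => (f x, g x) : C) p.
Proof.
  intros Hf Hg; apply filterlim_locally; intros e.
  generalize (proj1 (filterlim_locally _ _) Hf e) (proj1 (filterlim_locally _ _) Hg e).
  intros A B; generalize (filter_and _ _ A B); apply filter_imp.
  intros x [Hx1 Hx2]; split; assumption.
Qed.

Lemma ct_fst {U : UniformSpace} (f : U -> C) p :
  continuous f p -> continuous (fun x => fst (f x)) p.
Proof. intros H; apply (continuous_comp f fst); [exact H|]. destruct (f p); apply continuous_fst. Qed.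
Lemma ct_snd {U : UniformSpace} (f : U -> C) p :
  continuous f p -> continuous (fun x => snd (f x)) p.
Proof. intros H; apply (continuous_comp f snd); [exact H|]. destruct (f p); apply continuous_snd. Qed.

Ltac ctp := lazymatch goal with
  | |- continuous (fun x => fst (@?f x)) _ => apply (ct_fst f); assumption
  | |- continuous (fun x => snd (@?f x)) _ => apply (ct_snd f); assumption
  end.

Section Rct.
Context {U : UniformSpace}.
Implicit Types f g : U -> R.
Lemma rct_plus f g p : continuous f p -> continuous g p -> continuous (fun x => f x + g x) p.
Proof. apply (continuous_plus (V := R_NormedModule)). Qed.
Lemma rct_opp f p : continuous f p -> continuous (fun x => - f x) p.
Proof. apply (continuous_opp (V := R_NormedModule)). Qed.
Lemma rct_minus f g p : continuous f p -> continuous g p -> continuous (fun x => f x - g x) p.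
Proof. apply (continuous_minus (V := R_NormedModule)). Qed.
Lemma rct_mult f g p : continuous f p -> continuous g p -> continuous (fun x => f x * g x) p.
Proof. apply (continuous_mult (K := R_AbsRing)). Qed.
Lemma rct_comp (h : R -> R) f p :
  (forall x, continuous h x) -> continuous f p -> continuous (fun x => h (f x)) p.
Proof. intros Hh Hf; apply (continuous_comp f h); auto. Qed.
Lemma rct_pow f n p : continuous f p -> continuous (fun x => f x ^ n) p.
Proof.
  intros Hf; induction n; simpl.
  - apply continuous_const.
  - now apply rct_mult.
Qed.
Lemma rct_inv f p : continuous f p -> f p <> 0 -> continuous (fun x => / f x) p.
Proof. intros Hf H0; apply (continuous_comp f Rinv); auto; now apply continuous_Rinv. Qed.
Lemma rct_div f g p : continuous f p -> continuous g p -> g p <> 0 -> continuous (fun x => f x / g x) p.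
Proof. intros; apply rct_mult; auto; now apply rct_inv. Qed.
Lemma rct_exp f p : continuous f p -> continuous (fun x => exp (f x)) p.
Proof. apply rct_comp; intros; apply continuous_exp. Qed.
Lemma rct_cos f p : continuous f p -> continuous (fun x => cos (f x)) p.
Proof. apply rct_comp; intros; apply continuous_cos. Qed.
Lemma rct_sin f p : continuous f p -> continuous (fun x => sin (f x)) p.
Proof. apply rct_comp; intros; apply continuous_sin. Qed.
Lemma rct_abs f p : continuous f p -> continuous (fun x => Rabs (f x)) p.
Proof. apply rct_comp; intros; apply continuous_Rabs. Qed.

Lemma rct_max f g p : continuous f p -> continuous g p -> continuous (fun x => Rmax (f x) (g x)) p.
Proof.
  intros Hf Hg.
  apply (continuous_ext (fun x => (f x + g x + Rabs (f x - g x)) * / 2)).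
  - intros x; unfold Rmax; destruct (Rle_dec (f x) (g x)); eqR.
    + rewrite Rabs_left1; lra.
    + rewrite Rabs_pos_eq; lra.
  - apply rct_mult; [|apply continuous_const].
    apply rct_plus; [now apply rct_plus|]. apply rct_abs; now apply rct_minus.
Qed.
Lemma rct_min f g p : continuous f p -> continuous g p -> continuous (fun x => Rmin (f x) (g x)) p.
Proof.
  intros Hf Hg.
  apply (continuous_ext (fun x => - Rmax (- f x) (- g x))).
  - intros x; eqR; rewrite <- Ropp_Rmin; ring.
  - apply rct_opp, rct_max; now apply rct_opp.
Qed.
End Rct.

Ltac ctr := repeat lazymatch goal with
  | |- continuous (fun x => exp (@?f x)) _ => apply (rct_exp f)
  | |- continuous (fun x => cos (@?f x)) _ => apply (rct_cos f)
  | |- continuous (fun x => sin (@?f x)) _ => apply (rct_sin f)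
  | |- continuous (fun x => Rmult (@?f x) (@?g x)) _ => apply (rct_mult f g)
  | |- continuous (fun x => Rdiv (@?f x) (@?g x)) _ => apply (rct_div f g)
  | |- continuous (fun x => Rplus (@?f x) (@?g x)) _ => apply (rct_plus f g)
  | |- continuous (fun x => Ropp (@?f x)) _ => apply (rct_opp f)
  | |- continuous (fun x => pow (@?f x) ?n) _ => apply (rct_pow f n)
  | |- continuous (fun x => fst (@?f x)) _ => apply (ct_fst f); assumption
  | |- continuous (fun x => snd (@?f x)) _ => apply (ct_snd f); assumption
  end.

Section Cct.
Context {U : UniformSpace}.
Implicit Types f g : U -> C.
Lemma ct_plus f g p : continuous f p -> continuous g p -> continuous (fun x => f x + g x)%C p.
Proof. apply (continuous_plus (V := C_R_NormedModule)). Qed.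
Lemma ct_opp f p : continuous f p -> continuous (fun x => - f x)%C p.
Proof. apply (continuous_opp (V := C_R_NormedModule)). Qed.
Lemma ct_minus f g p : continuous f p -> continuous g p -> continuous (fun x => f x - g x)%C p.
Proof. apply (continuous_minus (V := C_R_NormedModule)). Qed.
Lemma ct_mult f g p : continuous f p -> continuous g p -> continuous (fun x => f x * g x)%C p.
Proof.
  intros Hf Hg; unfold Cmult; apply ct_pair.
  - apply rct_minus; apply rct_mult; ctp.
  - apply rct_plus; apply rct_mult; ctp.
Qed.
Lemma ct_RtoC (f : U -> R) p : continuous f p -> continuous (fun x => RtoC (f x)) p.
Proof. intros H; apply ct_pair; [exact H|apply continuous_const]. Qed.
Lemma ct_pow f n p : continuous f p -> continuous (fun x => f x ^ n)%C p.
Proof.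
  intros Hf; induction n; simpl.
  - apply continuous_const.
  - now apply ct_mult.
Qed.
Lemma ct_exp f p : continuous f p -> continuous (fun x => Cexp (f x)) p.
Proof.
  intros Hf; unfold Cexp, Re, Im.
  apply ct_pair; ctr.
Qed.
Lemma ct_inv f p : continuous f p -> f p <> 0%C -> continuous (fun x => / f x)%C p.
Proof.
  intros Hf H0; unfold Cinv.
  assert (Hn : fst (f p) ^ 2 + snd (f p) ^ 2 <> 0).
  { intros E; apply H0. destruct (f p) as [a b]; simpl in E.
    assert (a = 0) by nra. assert (b = 0) by nra. subst; reflexivity. }
  apply ct_pair; ctr; assumption.
Qed.
Lemma ct_div f g p : continuous f p -> continuous g p -> g p <> 0%C -> continuous (fun x => f x / g x)%C p.
Proof. intros; apply ct_mult; auto; now apply ct_inv. Qed.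
Lemma ct_Re f p : continuous f p -> continuous (fun x => Re (f x)) p.
Proof. apply ct_fst. Qed.
Lemma ct_Im f p : continuous f p -> continuous (fun x => Im (f x)) p.
Proof. apply ct_snd. Qed.
Lemma rct_Cmod f p : continuous f p -> continuous (fun x => Cmod (f x)) p.
Proof.
  intros Hf; apply (continuous_comp f Cmod); auto.
  apply (continuous_ext (norm (V := C_R_NormedModule))).
  - intros z; unfold norm; simpl; unfold prod_norm, norm; simpl; unfold abs, Cmod; simpl.
    now rewrite <- !(Rmult_assoc (Rabs _)), <- !Rabs_mult, !Rmult_1_r,
      !(Rabs_pos_eq (_ * _)) by apply Rle_0_sqr.
  - apply filterlim_norm.
Qed.
End Cct.

Lemma rct_fst_id {U V : UniformSpace} (p : U * V) : continuous (fun q : U * V => fst q) p.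
Proof. destruct p; apply continuous_fst. Qed.
Lemma rct_snd_id {U V : UniformSpace} (p : U * V) : continuous (fun q : U * V => snd q) p.
Proof. destruct p; apply continuous_snd. Qed.

Lemma ct_ffst {U V W : UniformSpace} (f : U -> V * W) p :
  continuous f p -> continuous (fun x => fst (f x)) p.
Proof. intros H; apply (continuous_comp f fst); [exact H|]. destruct (f p); apply continuous_fst. Qed.
Lemma ct_fsnd {U V W : UniformSpace} (f : U -> V * W) p :
  continuous f p -> continuous (fun x => snd (f x)) p.
Proof. intros H; apply (continuous_comp f snd); [exact H|]. destruct (f p); apply continuous_snd. Qed.

Lemma ct_comp {U V : UniformSpace} {W : UniformSpace} (g : V -> W) (f : U -> V) p :
  (forall x, continuous g x) -> continuous f p -> continuous (fun x => g (f x)) p.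
Proof. intros Hg Hf; apply (continuous_comp f g); auto. Qed.

Lemma ct_comp2 {U : UniformSpace} {V1 V2 W : UniformSpace} (g : V1 -> V2 -> W) (f1 : U -> V1) (f2 : U -> V2) p :
  (forall q, continuous (fun q => g (fst q) (snd q)) q) ->
  continuous f1 p -> continuous f2 p -> continuous (fun x => g (f1 x) (f2 x)) p.
Proof. intros Hg H1 H2; apply continuous_comp_2; auto. Qed.

(** Constants are tried first, so that a subterm free of the variable is closed before its head
    symbol is examined. *)
Ltac ct1 :=
  first [ lazymatch goal with |- continuous (fun x => ?c) _ => apply (continuous_const c) end |
  lazymatch goal with
  | H : continuous ?f ?p |- continuous ?f ?p => exact H
  | H : continuous ?f ?p |- continuous (fun x => ?f x) ?p => exact H
  | |- continuous (fun x => x) _ => apply continuous_id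
  | |- continuous (fun x => fst x) _ => apply rct_fst_id
  | |- continuous fst _ => apply rct_fst_id
  | |- continuous (Rmax ?c) ?p => change (continuous (fun x => Rmax c x) p)
  | |- continuous (Rmin ?c) ?p => change (continuous (fun x => Rmin c x) p)
  | |- continuous (Rplus ?c) ?p => change (continuous (fun x => Rplus c x) p)
  | |- continuous (Rminus ?c) ?p => change (continuous (fun x => Rminus c x) p)
  | |- continuous (Rmult ?c) ?p => change (continuous (fun x => Rmult c x) p)
  | |- continuous (Cmult ?c) ?p => change (continuous (fun x => Cmult c x) p)
  | |- continuous RtoC ?p => change (continuous (fun x => RtoC x) p)
  | |- continuous snd _ => apply rct_snd_id
  | |- continuous (fun x => snd x) _ => apply rct_snd_id
  | |- continuous (fun x => RtoC (@?f x)) _ => apply (ct_RtoC f)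
  | |- continuous (fun x => Cplus (@?f x) (@?g x)) _ => apply (ct_plus f g)
  | |- continuous (fun x => Cminus (@?f x) (@?g x)) _ => apply (ct_minus f g)
  | |- continuous (fun x => Copp (@?f x)) _ => apply (ct_opp f)
  | |- continuous (fun x => Cmult (@?f x) (@?g x)) _ => apply (ct_mult f g)
  | |- continuous (fun x => Cpow (@?f x) ?n) _ => apply (ct_pow f n)
  | |- continuous (fun x => Cexp (@?f x)) _ => apply (ct_exp f)
  | |- continuous (fun x => Cdiv (@?f x) (@?g x)) _ => apply (ct_div f g)
  | |- continuous (fun x => Cinv (@?f x)) _ => apply (ct_inv f)
  | |- continuous (fun x => Re (@?f x)) _ => apply (ct_Re f)
  | |- continuous (fun x => Im (@?f x)) _ => apply (ct_Im f)
  | |- continuous (fun x => Cmod (@?f x)) _ => apply (rct_Cmod f)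
  | |- continuous (fun x => Rplus (@?f x) (@?g x)) _ => apply (rct_plus f g)
  | |- continuous (fun x => Rminus (@?f x) (@?g x)) _ => apply (rct_minus f g)
  | |- continuous (fun x => Ropp (@?f x)) _ => apply (rct_opp f)
  | |- continuous (fun x => Rmult (@?f x) (@?g x)) _ => apply (rct_mult f g)
  | |- continuous (fun x => pow (@?f x) ?n) _ => apply (rct_pow f n)
  | |- continuous (fun x => exp (@?f x)) _ => apply (rct_exp f)
  | |- continuous (fun x => cos (@?f x)) _ => apply (rct_cos f)
  | |- continuous (fun x => sin (@?f x)) _ => apply (rct_sin f)
  | |- continuous (fun x => Rabs (@?f x)) _ => apply (rct_abs f)
  | |- continuous (fun x => Rmax (@?f x) (@?g x)) _ => apply (rct_max f g)
  | |- continuous (fun x => Rmin (@?f x) (@?g x)) _ => apply (rct_min f g)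
  | |- continuous (fun x => Rdiv (@?f x) (@?g x)) _ => apply (rct_div f g)
  | |- continuous (fun x => Rinv (@?f x)) _ => apply (rct_inv f)
  | |- continuous (fun x => pair (@?f x) (@?g x)) _ => apply (ct_pair f g)
  | |- continuous (fun x => fst (@?f x)) _ => apply (ct_ffst f)
  | |- continuous (fun x => snd (@?f x)) _ => apply (ct_fsnd f)
  | H : forall x, continuous ?h x |- continuous (fun x => ?h (@?f x)) _ => apply (ct_comp h f _ H)
  | |- _ => assumption
  end ].
Ltac ct := repeat ct1.

(** * Derivatives of complex-valued functions of a real variable *)

Lemma is_derive_C (f : R -> C) (x : R) (l : C) :
  is_derive f x l <->
  is_derive (fun x => fst (f x)) x (fst l) /\ is_derive (fun x => snd (f x)) x (snd l).
Proof.
  split.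
  - intros H; split.
    + apply (filterdiff_comp' f (fun z : R * R => fst z) x _ (fun z => fst z) H).
      apply filterdiff_linear, is_linear_fst.
    + apply (filterdiff_comp' f (fun z : R * R => snd z) x _ (fun z => snd z) H).
      apply filterdiff_linear, is_linear_snd.
  - intros [H1 H2].
    (* The coordinates are recombined along the basis (1, 0), (0, 1), so that only the rules for
       sums and scalar multiples are used. *)
    apply (is_derive_ext (fun x => plus (scal (fst (f x)) ((1, 0) : C_R_NormedModule))
                                        (scal (snd (f x)) ((0, 1) : C_R_NormedModule)))).
    + intros t; destruct (f t); unfold plus, scal; simpl; unfold prod_plus, prod_scal, plus, scal; simpl.
      unfold mult; simpl. f_equal; ring.
    + replace l with (plus (scal (fst l) ((1, 0) : C_R_NormedModule))
                           (scal (snd l) ((0, 1) : C_R_NormedModule))).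
      * apply (is_derive_plus (V := C_R_NormedModule)); apply (is_derive_scal_l (V := C_R_NormedModule)); assumption.
      * destruct l; unfold plus, scal; simpl; unfold prod_plus, prod_scal, plus, scal; simpl.
        unfold mult; simpl. f_equal; ring.
Qed.

Section Rdr.
Implicit Types f g : R -> R.
Lemma rdr_eq f (x a b : R) : is_derive f x a -> @eq R a b -> is_derive f x b.
Proof. now intros H <-. Qed.
Lemma rdr_const (c : R) x : is_derive (fun _ : R => c) x 0.
Proof. apply (is_derive_const (V := R_NormedModule)). Qed.
Lemma rdr_id (x : R) : is_derive (fun x : R => x) x 1.
Proof. apply (is_derive_id (K := R_AbsRing)). Qed.
Lemma rdr_plus f g (x a b : R) : is_derive f x a -> is_derive g x b -> is_derive (fun x => f x + g x) x (a + b).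
Proof. apply (is_derive_plus (V := R_NormedModule)). Qed.
Lemma rdr_minus f g (x a b : R) : is_derive f x a -> is_derive g x b -> is_derive (fun x => f x - g x) x (a - b).
Proof. apply (is_derive_minus (V := R_NormedModule)). Qed.
Lemma rdr_opp f (x a : R) : is_derive f x a -> is_derive (fun x => - f x) x (- a).
Proof. apply (is_derive_opp (V := R_NormedModule)). Qed.
Lemma rdr_mult f g (x a b : R) :
  is_derive f x a -> is_derive g x b -> is_derive (fun x => f x * g x) x (a * g x + f x * b).
Proof. intros Hf Hg; apply (is_derive_mult (K := R_AbsRing) f g x a b Hf Hg); intros; apply Rmult_comm. Qed.
Lemma rdr_comp (h : R -> R) f (x a b : R) :
  is_derive h (f x) b -> is_derive f x a -> is_derive (fun x => h (f x)) x (a * b).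
Proof. intros Hh Hf; exact (is_derive_comp h f x b a Hh Hf). Qed.
Lemma rdr_exp f (x a : R) : is_derive f x a -> is_derive (fun x => exp (f x)) x (a * exp (f x)).
Proof. apply (rdr_comp exp); apply is_derive_exp. Qed.
Lemma rdr_cos f (x a : R) : is_derive f x a -> is_derive (fun x => cos (f x)) x (a * - sin (f x)).
Proof. apply (rdr_comp cos); apply is_derive_cos. Qed.
Lemma rdr_sin f (x a : R) : is_derive f x a -> is_derive (fun x => sin (f x)) x (a * cos (f x)).
Proof. apply (rdr_comp sin); apply is_derive_sin. Qed.
Lemma rdr_inv f (x a : R) : is_derive f x a -> f x <> 0 -> is_derive (fun x => / f x) x (- a / (f x) ^ 2).
Proof. intros; now apply is_derive_inv. Qed.
Lemma rdr_div f g (x a b : R) : is_derive f x a -> is_derive g x b -> g x <> 0 ->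
  is_derive (fun x => f x / g x) x ((a * g x - f x * b) / (g x) ^ 2).
Proof.
  intros Hf Hg H0; eapply rdr_eq; [apply rdr_mult; [exact Hf|apply rdr_inv; eassumption]|].
  cbv beta; field; exact H0.
Qed.
Lemma rdr_pow f n (x a : R) : is_derive f x a -> is_derive (fun x => f x ^ n) x (INR n * a * f x ^ pred n).
Proof. intros; now apply is_derive_pow. Qed.
End Rdr.

Ltac rdr1 :=
  match goal with
  | H : is_derive ?f ?x _ |- is_derive ?f ?x _ => exact H
  | H : is_derive ?f ?x _ |- is_derive (fun y => ?f y) ?x _ => exact H
  | |- is_derive (fun x => ?c) _ _ => apply (rdr_const c)
  | |- is_derive (fun x => x) _ _ => apply rdr_id
  | |- is_derive (fun x => Rplus (@?f x) (@?g x)) _ _ => apply (rdr_plus f g)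
  | |- is_derive (fun x => Rminus (@?f x) (@?g x)) _ _ => apply (rdr_minus f g)
  | |- is_derive (fun x => Ropp (@?f x)) _ _ => apply (rdr_opp f)
  | |- is_derive (fun x => Rmult (@?f x) (@?g x)) _ _ => apply (rdr_mult f g)
  | |- is_derive (fun x => Rdiv (@?f x) (@?g x)) _ _ => apply (rdr_div f g)
  | |- is_derive (fun x => Rinv (@?f x)) _ _ => apply (rdr_inv f)
  | |- is_derive (fun x => pow (@?f x) ?n) _ _ => apply (rdr_pow f n)
  | |- is_derive (fun x => exp (@?f x)) _ _ => apply (rdr_exp f)
  | |- is_derive (fun x => cos (@?f x)) _ _ => apply (rdr_cos f)
  | |- is_derive (fun x => sin (@?f x)) _ _ => apply (rdr_sin f)
  end.
Ltac rdr := eapply rdr_eq; [repeat rdr1 | cbv beta].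

Lemma dr_const (c : C) x : is_derive (fun _ : R => c) x (RtoC 0).
Proof. apply (is_derive_const (V := C_R_NormedModule)). Qed.
Lemma dr_RtoC (f : R -> R) x l : is_derive f x l -> is_derive (fun x => RtoC (f x)) x (RtoC l).
Proof. intros H; apply (proj2 (is_derive_C _ _ _)); simpl; split; [exact H|apply rdr_const]. Qed.
Lemma dr_plus (f g : R -> C) x a b :
  is_derive f x a -> is_derive g x b -> is_derive (fun x => f x + g x)%C x (a + b)%C.
Proof. apply (is_derive_plus (V := C_R_NormedModule)). Qed.
Lemma dr_minus (f g : R -> C) x a b :
  is_derive f x a -> is_derive g x b -> is_derive (fun x => f x - g x)%C x (a - b)%C.
Proof. apply (is_derive_minus (V := C_R_NormedModule)). Qed.
Lemma dr_opp (f : R -> C) x a : is_derive f x a -> is_derive (fun x => - f x)%C x (- a)%C.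
Proof. apply (is_derive_opp (V := C_R_NormedModule)). Qed.
Lemma dr_eq (f : R -> C) (x : R) (a b : C) : is_derive f x a -> @eq C a b -> is_derive f x b.
Proof. now intros H <-. Qed.
Lemma dr_mult (f g : R -> C) x a b :
  is_derive f x a -> is_derive g x b ->
  is_derive (fun x => f x * g x)%C x (a * g x + f x * b)%C.
Proof.
  intros Hf Hg; apply (proj1 (is_derive_C _ _ _)) in Hf; apply (proj1 (is_derive_C _ _ _)) in Hg.
  destruct Hf as [f1 f2], Hg as [g1 g2]; apply (proj2 (is_derive_C _ _ _)); unfold Cmult, Cplus; simpl; split; rdr; simpl; eqR; ring.
Qed.
Lemma dr_scal (c : C) (f : R -> C) x a : is_derive f x a -> is_derive (fun x => c * f x)%C x (c * a)%C.
Proof. intros H; eapply dr_eq; [apply dr_mult; [apply dr_const|exact H]|]. cbv beta; ring. Qed.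
Lemma dr_scalr (c : C) (f : R -> C) x a : is_derive f x a -> is_derive (fun x => f x * c)%C x (a * c)%C.
Proof. intros H; eapply dr_eq; [apply dr_mult; [exact H|apply dr_const]|]. cbv beta; ring. Qed.
Lemma dr_id x : is_derive (fun x : R => RtoC x) x (RtoC 1).
Proof. apply dr_RtoC; apply rdr_id. Qed.
Lemma dr_exp (f : R -> C) x a :
  is_derive f x a -> is_derive (fun x => Cexp (f x)) x (a * Cexp (f x))%C.
Proof.
  intros Hf; apply (proj1 (is_derive_C _ _ _)) in Hf; destruct Hf as [f1 f2].
  apply (proj2 (is_derive_C _ _ _)); unfold Cexp, Re, Im, Cmult; simpl; split; rdr; simpl; eqR; ring.
Qed.
Lemma dr_ct (f : R -> C) x a : is_derive f x a -> continuous f x.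
Proof. intros H; apply (ex_derive_continuous (V := C_R_NormedModule)); now exists a. Qed.

Lemma dr_inv (f : R -> C) x a :
  is_derive f x a -> f x <> 0%C -> is_derive (fun x => / f x)%C x (- a * (/ f x * / f x))%C.
Proof.
  intros Hf H0; apply (proj1 (is_derive_C _ _ _)) in Hf; destruct Hf as [f1 f2].
  assert (Hn : fst (f x) ^ 2 + snd (f x) ^ 2 <> 0).
  { intros E; apply H0. destruct (f x) as [c d]; simpl in E.
    assert (c = 0) by nra. assert (d = 0) by nra. subst; reflexivity. }
  apply (proj2 (is_derive_C _ _ _)); unfold Cinv, Cmult, Copp; simpl fst; simpl snd; split; (rdr; [exact Hn|]);
    simpl; simpl in Hn; field; rewrite !Rmult_1_r in Hn; exact Hn.
Qed.

Lemma dr_pow (f : R -> C) n x a :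
  is_derive f x a -> is_derive (fun x => f x ^ n)%C x (INR n * a * f x ^ (pred n))%C.
Proof.
  intros Hf; induction n.
  - apply (dr_eq (fun _ => RtoC 1) x (RtoC 0)); [apply dr_const|simpl; ring].
  - change (is_derive (fun x => f x * f x ^ n)%C x (INR (S n) * a * f x ^ n)%C).
    eapply dr_eq; [apply (dr_mult f (fun x => f x ^ n)%C); eassumption|].
    cbv beta; rewrite S_INR, RtoC_plus. destruct n; cbv beta; simpl; ring.
Qed.

Ltac dr1 :=
  match goal with
  | H : is_derive ?f ?x _ |- is_derive ?f ?x _ => exact H
  | H : is_derive ?f ?x _ |- is_derive (fun y => ?f y) ?x _ => exact H
  | |- is_derive (fun x => ?c) _ _ => apply (dr_const c)
  | |- is_derive (fun x => RtoC x) _ _ => apply dr_id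
  | |- is_derive (fun x => Cplus (@?f x) (@?g x)) _ _ => apply (dr_plus f g)
  | |- is_derive (fun x => Cminus (@?f x) (@?g x)) _ _ => apply (dr_minus f g)
  | |- is_derive (fun x => Copp (@?f x)) _ _ => apply (dr_opp f)
  | |- is_derive (fun x => Cmult ?c (@?f x)) _ _ => apply (dr_scal c f)
  | |- is_derive (fun x => Cmult (@?f x) ?c) _ _ => apply (dr_scalr c f)
  | |- is_derive (fun x => Cmult (@?f x) (@?g x)) _ _ => apply (dr_mult f g)
  | |- is_derive (fun x => Cpow (@?f x) ?n) _ _ => apply (dr_pow f n)
  | |- is_derive (fun x => Cexp (@?f x)) _ _ => apply (dr_exp f)
  | |- is_derive (fun x => Cinv (@?f x)) _ _ => apply (dr_inv f)
  | |- is_derive (fun x => RtoC (@?f x)) _ _ => apply (dr_RtoC f); repeat rdr1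
  end.
Ltac dr := eapply dr_eq; [repeat dr1 | cbv beta].

(** * The complex exponential *)

Lemma Ci2 : (Ci * Ci = - 1)%C.
Proof. unfold Ci, Cmult, Copp, RtoC; simpl; f_equal; ring. Qed.
Lemma RtoC_m1 : RtoC (-1) = (- RtoC 1)%C.
Proof. apply RtoC_opp. Qed.
Lemma RtoC_2 : RtoC 2 = (1 + 1)%C.
Proof. unfold Cplus, RtoC; simpl; f_equal; ring. Qed.
Lemma RtoC_3 : RtoC 3 = (1 + 1 + 1)%C.
Proof. unfold Cplus, RtoC; simpl; f_equal; ring. Qed.

Lemma locally_pos (P : R -> Prop) x : 0 < x -> (forall y, 0 < y -> P y) -> locally x P.
Proof. intros Hx HP; apply (filter_imp (fun y => 0 < y)); [exact HP|now apply (open_gt 0)]. Qed.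
Lemma locally_interval (a b x : R) : a < x < b -> locally x (fun y => a < y < b).
Proof. apply (open_and (fun y => a < y) (fun y => y < b)); [apply open_gt|apply open_lt]. Qed.
Lemma ball_right (x y : R) (d : posreal) : x <= y < x + d -> ball x d y.
Proof.
  intros H; unfold ball; simpl; unfold AbsRing_ball, abs, minus, plus, opp; simpl. rewrite Rabs_pos_eq; lra.
Qed.

Lemma Cexp_plus z w : Cexp (z + w) = (Cexp z * Cexp w)%C.
Proof.
  unfold Cexp, Cmult, Re, Im; simpl; rewrite exp_plus, cos_plus, sin_plus; f_equal; ring.
Qed.
Lemma Cexp_0 : Cexp 0 = 1%C.
Proof. unfold Cexp, Re, Im; simpl; rewrite exp_0, cos_0, sin_0; unfold RtoC; f_equal; ring. Qed.
Lemma Cmod_Cexp z : Cmod (Cexp z) = exp (Re z).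
Proof.
  unfold Cmod, Cexp; simpl.
  match goal with |- sqrt ?e = _ => replace e with (Rsqr (exp (Re z))) end.
  - apply sqrt_Rsqr; left; apply exp_pos.
  - unfold Rsqr; pose proof (sin2_cos2 (Im z)) as H; unfold Rsqr in H.
    transitivity (exp (Re z) * exp (Re z) * (sin (Im z) * sin (Im z) + cos (Im z) * cos (Im z)));
      [rewrite H; ring|ring].
Qed.
Lemma Cexp_opp z : (Cexp z * Cexp (- z) = 1)%C.
Proof. rewrite <- Cexp_plus; replace (z + - z)%C with (RtoC 0) by ring; apply Cexp_0. Qed.
Lemma exp_le x y : x <= y -> exp x <= exp y.
Proof. intros [H| ->]; [left; now apply exp_increasing|right; reflexivity]. Qed.

(** * Integrals of complex-valued functions over bounded intervals *)

Notation CInt := (@RInt C_R_CompleteNormedModule).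

Lemma normC (z : C) : norm (V := C_R_NormedModule) z = Cmod z.
Proof.
  unfold norm; simpl; unfold prod_norm, norm; simpl; unfold abs, Cmod; simpl.
  now rewrite <- !(Rmult_assoc (Rabs _)), <- !Rabs_mult, !Rmult_1_r,
    !(Rabs_pos_eq (_ * _)) by apply Rle_0_sqr.
Qed.

Lemma CInt_ex (f : R -> C) a b :
  (forall x, Rmin a b <= x <= Rmax a b -> continuous f x) -> ex_RInt (V := C_R_NormedModule) f a b.
Proof. apply (ex_RInt_continuous (V := C_R_CompleteNormedModule)). Qed.

Lemma CInt_is (f : R -> C) a b :
  (forall x, Rmin a b <= x <= Rmax a b -> continuous f x) -> is_RInt (V := C_R_NormedModule) f a b (CInt f a b).
Proof. intros H; apply (RInt_correct (V := C_R_CompleteNormedModule)), CInt_ex, H. Qed.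

Lemma CInt_ext (f g : R -> C) a b :
  (forall x, Rmin a b < x < Rmax a b -> f x = g x) -> CInt f a b = CInt g a b.
Proof. apply (RInt_ext (V := C_R_CompleteNormedModule) f g). Qed.

Lemma CInt_Chasles (f : R -> C) a b c :
  (forall x, continuous f x) -> (CInt f a b + CInt f b c = CInt f a c)%C.
Proof. intros H; apply (RInt_Chasles (V := C_R_CompleteNormedModule)); apply CInt_ex; auto. Qed.

Lemma CInt_norm (f : R -> C) (g : R -> R) a b :
  a <= b -> (forall x, a <= x <= b -> continuous f x) ->
  (forall x, a <= x <= b -> Cmod (f x) <= g x) ->
  ex_RInt g a b -> Cmod (CInt f a b) <= RInt g a b.
Proof.
  intros Hab Hc Hg Ig; rewrite <- normC.
  apply (norm_RInt_le f g a b); auto.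
  - intros x Hx; rewrite normC; auto.
  - apply CInt_is; rewrite Rmin_left, Rmax_right by lra; auto.
  - apply (RInt_correct (V := R_CompleteNormedModule)), Ig.
Qed.

Lemma CInt_norm_const (f : R -> C) M a b :
  a <= b -> (forall x, a <= x <= b -> continuous f x) ->
  (forall x, a <= x <= b -> Cmod (f x) <= M) ->
  Cmod (CInt f a b) <= M * (b - a).
Proof.
  intros Hab Hc Hg.
  replace (M * (b - a)) with (RInt (fun _ => M) a b).
  - apply CInt_norm; auto. apply ex_RInt_const.
  - rewrite RInt_const. unfold scal; simpl; unfold mult; simpl; ring.
Qed.

Lemma is_CInt_C (f : R -> C) a b (l : C) :
  is_RInt (V := C_R_NormedModule) f a b l <->
  is_RInt (fun x => fst (f x)) a b (fst l) /\ is_RInt (fun x => snd (f x)) a b (snd l).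
Proof.
  split.
  - intros H; split.
    + apply (is_RInt_fct_extend_fst (U := R_NormedModule) (V := R_NormedModule) f a b l H).
    + apply (is_RInt_fct_extend_snd (U := R_NormedModule) (V := R_NormedModule) f a b l H).
  - intros [H1 H2]; destruct l.
    apply (is_RInt_fct_extend_pair (U := R_NormedModule) (V := R_NormedModule)); auto.
Qed.

Lemma is_CInt_scal (c : C) (f : R -> C) a b (l : C) :
  is_RInt (V := C_R_NormedModule) f a b l ->
  is_RInt (V := C_R_NormedModule) (fun x => c * f x)%C a b (c * l)%C.
Proof.
  intros H; apply is_CInt_C in H; destruct H as [H1 H2]; apply is_CInt_C; split; simpl.
  - apply (is_RInt_minus (V := R_NormedModule)); apply (is_RInt_scal (V := R_NormedModule)); assumption.
  - apply (is_RInt_plus (V := R_NormedModule)); apply (is_RInt_scal (V := R_NormedModule)); assumption.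
Qed.

Lemma CInt_scal (c : C) (f : R -> C) a b :
  (forall x, Rmin a b <= x <= Rmax a b -> continuous f x) ->
  CInt (fun x => c * f x)%C a b = (c * CInt f a b)%C.
Proof.
  intros H; apply (is_RInt_unique (V := C_R_CompleteNormedModule)), is_CInt_scal, CInt_is, H.
Qed.
Lemma CInt_scalr (c : C) (f : R -> C) a b :
  (forall x, Rmin a b <= x <= Rmax a b -> continuous f x) ->
  CInt (fun x => f x * c)%C a b = (CInt f a b * c)%C.
Proof.
  intros H; rewrite Cmult_comm, <- CInt_scal by auto.
  apply CInt_ext; intros; ringC.
Qed.
Lemma CInt_plus (f g : R -> C) a b :
  (forall x, Rmin a b <= x <= Rmax a b -> continuous f x) ->
  (forall x, Rmin a b <= x <= Rmax a b -> continuous g x) ->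
  CInt (fun x => f x + g x)%C a b = (CInt f a b + CInt g a b)%C.
Proof. intros Hf Hg; apply (RInt_plus (V := C_R_CompleteNormedModule)); now apply CInt_ex. Qed.
Lemma CInt_minus (f g : R -> C) a b :
  (forall x, Rmin a b <= x <= Rmax a b -> continuous f x) ->
  (forall x, Rmin a b <= x <= Rmax a b -> continuous g x) ->
  CInt (fun x => f x - g x)%C a b = (CInt f a b - CInt g a b)%C.
Proof. intros Hf Hg; apply (RInt_minus (V := C_R_CompleteNormedModule)); now apply CInt_ex. Qed.

Lemma CInt_point (f : R -> C) a : CInt f a a = RtoC 0.
Proof. apply (RInt_point (V := C_R_CompleteNormedModule)). Qed.

Lemma scalC (k : R) (z : C) : scal k z = (RtoC k * z)%C.
Proof.
  unfold scal; simpl; unfold prod_scal, scal; simpl; unfold mult; simpl.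
  destruct z; unfold Cmult; simpl; f_equal; eqR; ring.
Qed.

Lemma CInt_const (c : C) a b : CInt (fun _ => c) a b = (RtoC (b - a) * c)%C.
Proof. rewrite (RInt_const (V := C_R_CompleteNormedModule)). apply scalC. Qed.

Lemma CInt_derive (f df : R -> C) a b :
  (forall x, Rmin a b <= x <= Rmax a b -> is_derive f x (df x)) ->
  (forall x, Rmin a b <= x <= Rmax a b -> continuous df x) ->
  CInt df a b = (f b - f a)%C.
Proof.
  intros H1 H2; apply (is_RInt_unique (V := C_R_CompleteNormedModule)).
  apply (is_RInt_derive (V := C_R_CompleteNormedModule)); auto.
Qed.

Lemma dr_CInt (f : R -> C) a x :
  (forall y, continuous f y) -> is_derive (fun x => CInt f a x) x (f x).
Proof.
  intros H; apply (is_derive_RInt (V := C_R_NormedModule) f _ a); auto.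
  apply filter_forall; intros b; apply CInt_is; auto.
Qed.

(** The primitive need not be differentiable at the end points: this serves the functions clamped at
    0 and the data differentiable only for positive arguments. *)
Lemma CInt_derive_open (f df : R -> C) a b :
  a <= b ->
  (forall x, a < x < b -> is_derive f x (df x)) ->
  (forall x, continuous f x) -> (forall x, continuous df x) ->
  CInt df a b = (f b - f a)%C.
Proof.
  intros Hab Hd Hf Hdf.
  set (h := fun x => (f x - CInt df a x)%C).
  assert (Hh : forall x, continuous h x).
  { intros x; unfold h; apply ct_minus; auto. eapply dr_ct, dr_CInt; auto. }
  assert (Hz : forall x, a < x < b -> is_derive h x (RtoC 0)).
  { intros x Hx; unfold h; eapply dr_eq; [apply dr_minus; [now apply Hd|now apply dr_CInt]|ringC]. }
  assert (E : h b = h a).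
  (* The mean value theorem is real, hence it is applied to each coordinate of [h], whose derivative
     vanishes inside. *)
  { assert (P : forall p : C -> R, (forall z : C, continuous p z) ->
        (forall x, a < x < b -> is_derive (fun x => p (h x)) x 0) -> p (h b) = p (h a)).
    { intros p Hp Hpd.
      destruct (MVT_gen (fun x => p (h x)) a b (fun _ => 0)) as [c [_ Hc]].
      - rewrite Rmin_left, Rmax_right by lra; apply Hpd.
      - intros x _; apply continuity_pt_filterlim.
        apply (continuous_comp h p); auto.
      - clear - Hc; eqR; lra. }
    apply injective_projections; apply P.
    - intros z; apply (ct_fst (fun z : C => z)), continuous_id.
    - intros x Hx; apply Hz in Hx; apply is_derive_C in Hx; tauto.
    - intros z; apply (ct_snd (fun z : C => z)), continuous_id.
    - intros x Hx; apply Hz in Hx; apply is_derive_C in Hx; tauto. }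
  unfold h in E; rewrite CInt_point in E.
  replace (CInt df a b) with (f b - (f b - CInt df a b))%C by ringC.
  rewrite E; ringC.
Qed.

Lemma C_increment (f df : R -> C) M a b :
  (forall x, Rmin a b <= x <= Rmax a b -> is_derive f x (df x)) ->
  (forall x, Rmin a b <= x <= Rmax a b -> continuous df x) ->
  (forall x, Rmin a b <= x <= Rmax a b -> Cmod (df x) <= M) ->
  Cmod (f b - f a) <= M * Rabs (b - a).
Proof.
  intros Hd Hc HM; rewrite <- (CInt_derive f df a b) by auto.
  destruct (Rle_dec a b) as [Hab|Hab].
  - rewrite Rabs_pos_eq by lra; rewrite Rmin_left, Rmax_right in * by lra.
    now apply CInt_norm_const.
  - rewrite Rabs_left1 by lra; rewrite Rmin_right, Rmax_left in * by lra.
    rewrite <- (opp_RInt_swap (V := C_R_CompleteNormedModule)).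
    + change (Cmod (- CInt df b a) <= M * - (b - a)); rewrite Cmod_opp.
      replace (- (b - a)) with (a - b) by ring. apply CInt_norm_const; auto; lra.
    + apply CInt_ex; rewrite Rmin_left, Rmax_right by lra; auto.
Qed.

(** * Integrals depending on a parameter *)

Definition jct {U : UniformSpace} (f : U -> R -> C) (p : U) (r : R) : Prop :=
  continuous (fun q : U * R => f (fst q) (snd q)) (p, r).

Lemma jct_r {U : UniformSpace} (f : U -> R -> C) p r : jct f p r -> continuous (f p) r.
Proof.
  intros H; apply (continuous_comp (fun r => (p, r)) (fun q : U * R => f (fst q) (snd q))); [|exact H].
  apply filterlim_locally; intros e; exists e; intros y Hy; split; [apply ball_center|exact Hy].
Qed.

Lemma jct_p {U : UniformSpace} (f : U -> R -> C) p r : jct f p r -> continuous (fun p => f p r) p.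
Proof.
  intros H; apply (continuous_comp (fun p => (p, r)) (fun q : U * R => f (fst q) (snd q))); [|exact H].
  apply filterlim_locally; intros e; exists e; intros y Hy; split; [exact Hy|apply ball_center].
Qed.

(** Heine-Borel for the gauge that joint continuity provides at each point of the interval. *)
Lemma unif_compact {U : UniformSpace} (f : U -> R -> C) (p0 : U) a b :
  (forall r, a <= r <= b -> jct f p0 r) ->
  forall e, 0 < e -> locally p0 (fun p => forall r, a <= r <= b -> Cmod (f p r - f p0 r) < e).
Proof.
  intros H e He.
  assert (He2 : 0 < e / 2) by lra.
  assert (D : forall r, exists d : posreal, a <= r <= b ->
     forall p s, ball p0 d p -> ball r d s -> Cmod (f p s - f p0 r) < e / 2).
  { intros r; destruct (Rle_dec a r); [destruct (Rle_dec r b)|].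
    - destruct (proj1 (ct_Cmod _ _) (H r (conj r0 r1)) _ He2) as [d Hd].
      exists d; intros _ p s Hp Hs; apply (Hd (p, s)); split; assumption.
    - exists (mkposreal 1 Rlt_0_1); intros; lra.
    - exists (mkposreal 1 Rlt_0_1); intros; lra. }
  set (delta := fun r => proj1_sig (constructive_indefinite_description _ (D r))).
  assert (Hdelta := fun r => proj2_sig (constructive_indefinite_description _ (D r))).
  change (forall r, a <= r <= b ->
     forall p s, ball p0 (delta r) p -> ball r (delta r) s -> Cmod (f p s - f p0 r) < e / 2) in Hdelta.
  destruct (compactness_value_1d a b delta) as [d Hd].
  exists d; intros p Hp r Hr.
  (* Compactness yields a tag only up to double negation; deciding the real inequality removes
     it. *)
  destruct (Rlt_dec (Cmod (f p r - f p0 r)) e) as [Hlt|Hn]; [exact Hlt|exfalso].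
  apply (Hd r Hr); intros [t [Ht [Htr Hdt]]]; apply Hn.
  assert (Bs : ball t (delta t) r) by exact Htr.
  assert (Bp : ball p0 (delta t) p) by (eapply ball_le; eauto).
  pose proof (Hdelta t Ht p r Bp Bs) as A1.
  pose proof (Hdelta t Ht p0 r (ball_center _ _) Bs) as A2.
  replace (f p r - f p0 r)%C with ((f p r - f p0 t) + - (f p0 r - f p0 t))%C by ring.
  eapply Rle_lt_trans; [apply Cmod_triangle|]; rewrite Cmod_opp; lra.
Qed.

Lemma CInt_ct {U : UniformSpace} (f : U -> R -> C) (p0 : U) a b :
  a <= b ->
  (forall p r, a <= r <= b -> jct f p r) ->
  continuous (fun p => CInt (f p) a b) p0.
Proof.
  intros Hab H; apply ct_Cmod; intros e He.
  (* The summand 1 keeps the quotient meaningful when a = b. *)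
  assert (Hk : 0 < e / (b - a + 1)) by (apply Rdiv_lt_0_compat; lra).
  generalize (unif_compact f p0 a b (H p0) _ Hk); apply filter_imp; intros p Hp.
  assert (Cp : forall q x, Rmin a b <= x <= Rmax a b -> continuous (f q) x).
  { intros q x Hx; rewrite Rmin_left, Rmax_right in Hx by lra; now apply jct_r, H. }
  rewrite <- CInt_minus by auto.
  eapply Rle_lt_trans; [apply (CInt_norm_const _ (e / (b - a + 1)))|]; auto.
  - intros x Hx; apply ct_minus; apply Cp; rewrite Rmin_left, Rmax_right; lra.
  - intros x Hx; left; auto.
  - assert (e / (b - a + 1) * (b - a) + e / (b - a + 1) = e) by (field; lra). lra.
Qed.

(** The mean value inequality for q -> f q - q g(p), whose derivative g q - g p is small. *)
Lemma quotient_bound (f g : R -> C) p h e :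
  (forall q, Rmin p (p + h) <= q <= Rmax p (p + h) -> is_derive f q (g q)) ->
  (forall q, Rmin p (p + h) <= q <= Rmax p (p + h) -> continuous g q) ->
  (forall q, Rmin p (p + h) <= q <= Rmax p (p + h) -> Cmod (g q - g p) <= e) ->
  Cmod (f (p + h) - f p - RtoC h * g p) <= e * Rabs h.
Proof.
  intros Hd Hc He.
  assert (E : (f (p + h)%R - f p - RtoC h * g p =
     (f (p + h)%R - RtoC (p + h) * g p) - (f p - RtoC p * g p))%C)
    by (rewrite RtoC_plus; ringC).
  rewrite E.
  replace (Rabs h) with (Rabs (p + h - p)) by (f_equal; ring).
  apply (C_increment (fun q => f q - RtoC q * g p)%C (fun q => g q - g p)%C).
  - intros q Hq; eapply dr_eq; [apply dr_minus; [now apply Hd|apply dr_mult; [apply dr_id|apply dr_const]]|].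
    ringC.
  - intros q Hq; apply ct_minus; auto. apply continuous_const.
  - exact He.
Qed.

Lemma dr_char (f : R -> C) p (l : C) :
  (forall e, 0 < e -> exists d : posreal, forall h, Rabs h < d ->
      Cmod (f (p + h) - f p - RtoC h * l) <= e * Rabs h) ->
  is_derive f p l.
Proof.
  intros H; split; [apply is_linear_scal_l|].
  intros x Hx; apply (is_filter_lim_locally_unique (V := R_NormedModule)) in Hx; subst x.
  intros e; destruct (H e (cond_pos e)) as [d Hd]; exists d; intros y Hy.
  rewrite normC.
  specialize (Hd (y - p) Hy).
  assert (Ey : @eq R (p + (y - p)) y) by ring; rewrite Ey in Hd.
  refine (Rle_trans _ _ _ (Req_le _ _ (f_equal Cmod _)) Hd).
  unfold scal, minus, plus, opp; simpl; unfold prod_scal, prod_plus, prod_opp, scal, plus, opp; simpl.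
  unfold mult, plus, opp; simpl. destruct l; unfold Cminus, Cplus, Copp, Cmult; simpl; f_equal; eqR; ring.
Qed.

Lemma CInt_dr (f g : R -> R -> C) (p0 : R) a b :
  a <= b ->
  locally p0 (fun p => forall r, a <= r <= b ->
     jct f p r /\ jct g p r /\ is_derive (fun p => f p r) p (g p r)) ->
  is_derive (fun p => CInt (f p) a b) p0 (CInt (g p0) a b).
Proof.
  intros Hab H; apply dr_char; intros e He.
  assert (Hk : 0 < e / (b - a + 1)) by (apply Rdiv_lt_0_compat; lra).
  assert (Hg : forall r, a <= r <= b -> jct g p0 r).
  { intros r Hr; apply (locally_singleton _ _ H r Hr). }
  destruct (filter_and _ _ H (unif_compact g p0 a b Hg _ Hk)) as [d Hd].
  exists d; intros h Hh.
  assert (Bq : forall q, Rmin p0 (p0 + h) <= q <= Rmax p0 (p0 + h) -> ball p0 d q).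
  { intros q Hq; change (Rabs (q - p0) < d). revert Hq; unfold Rmin, Rmax; destruct (Rle_dec p0 (p0 + h));
    revert Hh; unfold Rabs; repeat destruct Rcase_abs; lra. }
  assert (B0 : ball p0 d p0) by apply ball_center.
  assert (Bh : ball p0 d (p0 + h)).
  { apply Bq; split; [apply Rmin_r|apply Rmax_r]. }
  assert (Jf : forall q r, ball p0 d q -> a <= r <= b -> jct f q r).
  { intros q r Hq Hr; destruct (Hd q Hq) as [Hx _]; destruct (Hx r Hr) as [Hj _]; exact Hj. }
  assert (Jg : forall q r, ball p0 d q -> a <= r <= b -> jct g q r).
  { intros q r Hq Hr; destruct (Hd q Hq) as [Hx _]; destruct (Hx r Hr) as [_ [Hj _]]; exact Hj. }
  assert (Jd : forall q r, ball p0 d q -> a <= r <= b -> is_derive (fun p => f p r) q (g q r)).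
  { intros q r Hq Hr; destruct (Hd q Hq) as [Hx _]; destruct (Hx r Hr) as [_ [_ Hj]]; exact Hj. }
  assert (Je : forall q r, ball p0 d q -> a <= r <= b -> Cmod (g q r - g p0 r) < e / (b - a + 1)).
  { intros q r Hq Hr; destruct (Hd q Hq) as [_ Hx]; exact (Hx r Hr). }
  assert (Cf' : forall q x, ball p0 d q -> a <= x <= b -> continuous (f q) x).
  { intros q x Hq Hx; apply jct_r; exact (Jf q x Hq Hx). }
  assert (Cg' : forall x, a <= x <= b -> continuous (g p0) x).
  { intros x Hx; apply jct_r; exact (Jg p0 x B0 Hx). }
  assert (Cf : forall q, ball p0 d q -> forall x, Rmin a b <= x <= Rmax a b -> continuous (f q) x).
  { intros q Hq x Hx; rewrite Rmin_left, Rmax_right in Hx by lra; exact (Cf' q x Hq Hx). }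
  assert (Cg : forall x, Rmin a b <= x <= Rmax a b -> continuous (g p0) x).
  { intros x Hx; rewrite Rmin_left, Rmax_right in Hx by lra; exact (Cg' x Hx). }
  rewrite <- CInt_minus by auto. rewrite <- CInt_scal by auto.
  assert (Cs : forall x, Rmin a b <= x <= Rmax a b -> continuous (fun x => RtoC h * g p0 x)%C x).
  { intros x Hx; apply ct_mult; auto. apply continuous_const. }
  rewrite <- (CInt_minus (fun x => f (p0 + h)%R x - f p0 x)%C); auto.
  2: { intros; apply ct_minus; auto. }
  eapply Rle_trans; [apply (CInt_norm_const _ (e / (b - a + 1) * Rabs h))|]; auto.
  - intros x Hx; apply ct_minus; [apply ct_minus; apply Cf'; assumption|].
    apply ct_mult; [apply continuous_const|apply Cg'; exact Hx].
  - intros x Hx; apply (quotient_bound (fun p => f p x) (fun p => g p x)).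
    + intros q Hq; exact (Jd q x (Bq q Hq) Hx).
    + intros q Hq; apply jct_p; exact (Jg q x (Bq q Hq) Hx).
    + intros q Hq; left; exact (Je q x (Bq q Hq) Hx).
  - assert (e / (b - a + 1) * (b - a) + e / (b - a + 1) = e) by (field; lra).
    pose proof (Rabs_pos h). nra.
Qed.

(** Both sides vanish when b = a and have the same derivative in the upper limit, so no theory of
    double integrals is needed. *)
Lemma CInt_Fubini (f : R -> R -> C) a b c d :
  a <= b -> c <= d ->
  (forall p r, jct f p r) ->
  CInt (fun p => CInt (f p) c d) a b = CInt (fun r => CInt (fun p => f p r) a b) c d.
Proof.
  intros Hab Hcd Hf.
  assert (C1 : forall r x, continuous (fun p => f p r) x) by (intros; now apply jct_p).
  assert (HC : forall p, continuous (fun p => CInt (f p) c d) p).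
  { intros p; apply CInt_ct; auto. }
  rewrite (CInt_derive (fun u => CInt (fun r => CInt (fun p => f p r) a u) c d) (fun p => CInt (f p) c d) a b).
  - rewrite (CInt_ext (fun r => CInt (fun p => f p r) a a) (fun _ => RtoC 0)).
    + rewrite CInt_const; ringC.
    + intros; apply CInt_point.
  - intros u Hu; apply (CInt_dr (fun u r => CInt (fun p => f p r) a u) f); auto.
    apply filter_forall; intros u' r Hr; split; [|split].
    + unfold jct.
      (* rescale to a fixed interval *)
      apply (continuous_ext (fun q : R * R => RtoC (fst q - a) * CInt (fun s => f (a + s * (fst q - a))%R (snd q)) 0 1)%C).
      * intros q; simpl.
        rewrite <- CInt_scal by (intros x Hx; apply (continuous_comp (fun s => a + s * (fst q - a)) (fun p => f p (snd q))); [ct|apply C1]).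
        transitivity (CInt (fun y => scal (fst q - a) (f ((fst q - a) * y + a) (snd q)) : C) 0 1).
        { apply CInt_ext; intros x _. replace ((fst q - a) * x + a) with (a + x * (fst q - a)) by ring.
          symmetry; apply scalC. }
        rewrite (RInt_comp_lin (V := C_R_CompleteNormedModule) (fun y => f y (snd q))).
        -- replace ((fst q - a) * 0 + a) with a by (symmetry; eqR; ring); replace ((fst q - a) * 1 + a) with (fst q) by (symmetry; eqR; ring); reflexivity.
        -- apply CInt_ex; intros; apply C1.
      * apply ct_mult; [ct|].
        apply (CInt_ct (fun (q : R * R) s => f (a + s * (fst q - a)) (snd q)) (u', r)); [lra|].
        intros p s _; unfold jct.
        apply (ct_comp2 f); [intros [? ?]; apply Hf| |]; ct.
    + apply Hf.
    + apply (dr_CInt (fun p => f p r)). intros y; apply C1.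
  - intros; apply HC.
Qed.

(** * Improper integrals over the half-line *)

Definition is_J (h : R -> C) (I : C) : Prop :=
  is_RInt_gen (V := C_R_NormedModule) h (at_point 0) (Rbar_locally p_infty) I.
Definition J (h : R -> C) : C :=
  RInt_gen (V := C_R_CompleteNormedModule) h (at_point 0) (Rbar_locally p_infty).
(* Clamping the argument turns one-sided continuity at 0 into continuity. *)
Definition cl (h : R -> C) (r : R) : C := h (Rmax 0 r).
Definition cont0 (h : R -> C) : Prop := forall r, continuous (cl h) r.
(* All absolutely convergent integrals below are dominated by a multiple of [1/(1+r)^2]. *)
Definition dom (M : R) (h : R -> C) : Prop := forall r, 0 <= r -> Cmod (h r) <= M / (1 + r) ^ 2.

Lemma cl_pos h r : 0 <= r -> cl h r = h r.
Proof. intros Hr; unfold cl; rewrite Rmax_right; auto. Qed.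

Lemma cont0_is h b : cont0 h -> 0 <= b -> is_RInt (V := C_R_NormedModule) h 0 b (CInt (cl h) 0 b).
Proof.
  intros H Hb; apply (is_RInt_ext (cl h)).
  - intros x Hx; rewrite Rmin_left in Hx by lra; apply cl_pos; lra.
  - apply CInt_is; intros; apply H.
Qed.

(** Replaces the product of filters in the definition of an improper integral by an ordinary limit
    of truncated integrals. *)
Lemma is_J_char h I :
  cont0 h -> (is_J h I <-> filterlim (fun b => CInt (cl h) 0 b) (Rbar_locally p_infty) (locally I)).
Proof.
  intros Hc; unfold is_J, is_RInt_gen; split.
  - intros H P HP; destruct (H P HP) as [A B HA HB HAB].
    assert (Q : Rbar_locally p_infty (fun b => 0 <= b)) by (exists 0; intros; lra).
    unfold filtermap; generalize (filter_and _ _ HB Q); apply filter_imp.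
    intros b [Hb Hb0]; destruct (HAB 0 b HA Hb) as [y [Hy HPy]]; simpl in Hy.
    replace (CInt (cl h) 0 b) with y; [exact HPy|].
    rewrite <- (is_RInt_unique (V := C_R_CompleteNormedModule) h 0 b y Hy).
    apply (is_RInt_unique (V := C_R_CompleteNormedModule)); apply cont0_is; auto.
  - intros H P HP; specialize (H P HP).
    assert (Q : Rbar_locally p_infty (fun b => 0 <= b)) by (exists 0; intros; lra).
    exists (fun a => a = 0) (fun b => P (CInt (cl h) 0 b) /\ 0 <= b).
    + reflexivity.
    + apply filter_and; [exact H|exact Q].
    + intros x y -> [HPy Hy]; exists (CInt (cl h) 0 y); split; [|exact HPy].
      simpl; apply cont0_is; auto.
Qed.

Lemma is_J_unique h I : is_J h I -> J h = I.
Proof. intros H; exact (@is_RInt_gen_unique C_R_CompleteNormedModule (at_point 0) (Rbar_locally p_infty) _ _ h I H). Qed.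

Lemma pos_eventually (P : R * R -> Prop) :
  (forall b, 0 <= b -> P (0, b)) -> filter_prod (at_point 0) (Rbar_locally p_infty) P.
Proof.
  intros H; exists (fun a => a = 0) (fun b => 0 <= b).
  - reflexivity.
  - exists 0; intros; lra.
  - intros x y -> Hy; auto.
Qed.

Lemma is_J_ext h k I : (forall r, 0 <= r -> h r = k r) -> is_J h I -> is_J k I.
Proof.
  intros E; apply (@is_RInt_gen_ext C_R_NormedModule (at_point 0) (Rbar_locally p_infty) _ _ h k I).
  apply pos_eventually; simpl; intros b Hb x Hx; rewrite Rmin_left in Hx by lra; apply E; lra.
Qed.

(** [RInt_gen] is a description operator: once the two defining predicates are identified by
    extensionality, equality holds without any convergence. *)
Lemma J_ext h k : (forall r, 0 <= r -> h r = k r) -> J h = J k.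
Proof.
  intros E; unfold J, RInt_gen.
  f_equal. apply functional_extensionality; intros I.
  apply propositional_extensionality; split; apply is_J_ext; auto.
  intros; symmetry; auto.
Qed.

Lemma is_J_plus h k I K : is_J h I -> is_J k K -> is_J (fun r => h r + k r)%C (I + K)%C.
Proof. exact (@is_RInt_gen_plus C_R_NormedModule (at_point 0) (Rbar_locally p_infty) _ _ h k I K). Qed.
Lemma is_J_minus h k I K : is_J h I -> is_J k K -> is_J (fun r => h r - k r)%C (I - K)%C.
Proof. exact (@is_RInt_gen_minus C_R_NormedModule (at_point 0) (Rbar_locally p_infty) _ _ h k I K). Qed.
(** The module structure is real, so complex scalars act through continuity of the multiplication by
    [c]. *)
Lemma is_J_scal c h I : is_J h I -> is_J (fun r => c * h r)%C (c * I)%C.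
Proof.
  intros H P HP.
  assert (HQ : locally I (fun z => P (c * z)%C)).
  { apply (ct_mult (fun _ => c) (fun z => z) I); [apply continuous_const|apply continuous_id|exact HP]. }
  generalize (H _ HQ); unfold filtermapi; apply filter_imp.
  intros ab [y [Hy HPy]]; exists (c * y)%C; split; auto.
  now apply is_CInt_scal.
Qed.

Lemma dom_int M b c :
  0 <= b <= c -> is_RInt (fun r => M / (1 + r) ^ 2) b c (M / (1 + b) - M / (1 + c)).
Proof.
  intros Hbc.
  replace (M / (1 + b) - M / (1 + c)) with (minus (- M / (1 + c)) (- M / (1 + b)))
    by (unfold minus, plus, opp; simpl; field; lra).
  apply (is_RInt_derive (V := R_CompleteNormedModule) (fun r => - M / (1 + r))).
  - intros x Hx; rewrite Rmin_left in Hx by lra. eapply rdr_eq.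
    + apply (rdr_div (fun _ => - M) (fun r => 1 + r)); [apply rdr_const| |lra].
      apply (rdr_plus (fun _ => 1) (fun r => r)); [apply rdr_const|apply rdr_id].
    + field; lra.
  - intros x Hx; rewrite Rmin_left in Hx by lra. ct. assert (0 < (1 + x) ^ 2) by nra. lra.
Qed.

Lemma dom_tail M h b c :
  cont0 h -> dom M h -> 0 <= b <= c -> Cmod (CInt (cl h) b c) <= M / (1 + b) - M / (1 + c).
Proof.
  intros Hc Hd Hbc.
  pose proof (dom_int M b c Hbc) as HI.
  rewrite <- (is_RInt_unique _ _ _ _ HI).
  apply CInt_norm; try lra; auto.
  - intros x Hx; rewrite cl_pos by lra; apply Hd; lra.
  - eexists; exact HI.
Qed.

Lemma dom_pos M h : dom M h -> 0 <= M.
Proof. intros H; specialize (H 0 (Rle_refl 0)); pose proof (Cmod_ge_0 (h 0)); simpl in H; lra. Qed.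

Lemma dom_le M M' h : dom M h -> M <= M' -> dom M' h.
Proof.
  intros H HM r Hr; eapply Rle_trans; [apply H; auto|].
  apply Rmult_le_compat_r; auto. left; apply Rinv_0_lt_compat; nra.
Qed.

Lemma small_tail M e : 0 <= M -> 0 < e -> exists b, 0 <= b /\ M / (1 + b) < e.
Proof.
  intros HM He; exists (M / e); split.
  - apply Rmult_le_pos; auto. left; now apply Rinv_0_lt_compat.
  - assert (H : 0 < 1 + M / e).
    { assert (0 <= M / e) by (apply Rmult_le_pos; auto; left; now apply Rinv_0_lt_compat). lra. }
    apply (Rmult_lt_reg_r (1 + M / e)); auto.
    unfold Rdiv at 1; rewrite Rmult_assoc, Rinv_l by lra.
    replace (e * (1 + M / e)) with (e + M) by (field; lra). lra.
Qed.

Lemma inv_tail_mono M b c : 0 <= M -> 0 <= b <= c -> M / (1 + c) <= M / (1 + b).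
Proof. intros HM Hb; apply Rmult_le_compat_l; auto. apply Rinv_le_contravar; lra. Qed.
Lemma inv_tail_pos M b : 0 <= M -> 0 <= b -> 0 <= M / (1 + b).
Proof. intros; apply Rmult_le_pos; auto; left; apply Rinv_0_lt_compat; lra. Qed.

Lemma J_is M h : cont0 h -> dom M h -> is_J h (J h).
Proof.
  intros Hc Hd.
  assert (E : exists I, is_J h I).
  { destruct (proj1 (filterlim_locally_cauchy (F := Rbar_locally p_infty) (fun b => CInt (cl h) 0 b : C_R_CompleteNormedModule)))
      as [I HI].
    - intros e; destruct (small_tail M e (dom_pos _ _ Hd) (cond_pos e)) as [b [Hb Hbe]].
      exists (fun c => b < c); split; [exists b; auto|].
      assert (K : forall u v, b < u <= v -> Cmod (CInt (cl h) 0 v - CInt (cl h) 0 u) < e).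
      { intros u v Huv. rewrite <- (CInt_Chasles (cl h) 0 u v) by auto.
        replace (CInt (cl h) 0 u + CInt (cl h) u v - CInt (cl h) 0 u)%C with (CInt (cl h) u v) by ringC.
        eapply Rle_lt_trans; [apply (dom_tail M); auto; lra|].
        pose proof (inv_tail_mono M b u (dom_pos _ _ Hd)).
        pose proof (inv_tail_pos M v (dom_pos _ _ Hd)). lra. }
      intros u v Hu Hv; apply ball_Cmod.
      destruct (Rle_dec u v).
      + apply K; lra.
      + rewrite <- Cmod_opp.
        replace (- (CInt (cl h) 0 v - CInt (cl h) 0 u))%C with (CInt (cl h) 0 u - CInt (cl h) 0 v)%C by ringC.
        apply K; lra.
    - exists I; apply is_J_char; auto. }
  destruct E as [I HI]; rewrite (is_J_unique h I HI); exact HI.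
Qed.

Lemma J_tail M h b : cont0 h -> dom M h -> 0 <= b -> Cmod (J h - CInt (cl h) 0 b) <= M / (1 + b).
Proof.
  intros Hc Hd Hb.
  pose proof (proj1 (is_J_char h _ Hc) (J_is M h Hc Hd)) as HJ.
  apply Rnot_lt_le; intros Hlt.
  set (e := Cmod (J h - CInt (cl h) 0 b) - M / (1 + b)).
  assert (He : 0 < e) by (unfold e; lra).
  destruct (proj1 (lim_Cmod _ _ _) HJ e He) as [B HB].
  set (c := Rmax b B + 1).
  assert (Hbc : b <= c /\ B < c) by (unfold c; pose proof (Rmax_l b B); pose proof (Rmax_r b B); lra).
  specialize (HB c (proj2 Hbc)).
  assert (T : Cmod (CInt (cl h) b c) <= M / (1 + b)).
  { eapply Rle_trans; [apply (dom_tail M); auto; lra|].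
    pose proof (inv_tail_pos M c (dom_pos _ _ Hd)). lra. }
  rewrite <- (CInt_Chasles (cl h) 0 b c) in HB by auto.
  pose proof (Cmod_triangle (- (CInt (cl h) 0 b + CInt (cl h) b c - J h)) (CInt (cl h) b c)) as Tr.
  replace (- (CInt (cl h) 0 b + CInt (cl h) b c - J h) + CInt (cl h) b c)%C with (J h - CInt (cl h) 0 b)%C in Tr by ringC.
  rewrite Cmod_opp in Tr. unfold e in HB. lra.
Qed.

Lemma J_bound M h : cont0 h -> dom M h -> Cmod (J h) <= M.
Proof.
  intros Hc Hd; pose proof (J_tail M h 0 Hc Hd (Rle_refl 0)) as H.
  rewrite CInt_point in H.
  replace (J h - 0)%C with (J h) in H by ringC.
  replace (M / (1 + 0)) with M in H by field. exact H.
Qed.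

Lemma cont0_plus h k : cont0 h -> cont0 k -> cont0 (fun r => h r + k r)%C.
Proof. intros Hh Hk r; apply (ct_plus (cl h) (cl k)); auto. Qed.
Lemma cont0_minus h k : cont0 h -> cont0 k -> cont0 (fun r => h r - k r)%C.
Proof. intros Hh Hk r; apply (ct_minus (cl h) (cl k)); auto. Qed.
Lemma cont0_scal c h : cont0 h -> cont0 (fun r => c * h r)%C.
Proof. intros Hh r; apply (ct_mult (fun _ => c) (cl h)); auto; apply continuous_const. Qed.
Lemma cont0_mult h k : cont0 h -> cont0 k -> cont0 (fun r => h r * k r)%C.
Proof. intros Hh Hk r; apply (ct_mult (cl h) (cl k)); auto. Qed.
Lemma cont0_ct h : (forall r, continuous h r) -> cont0 h.
Proof. intros H r; apply (ct_comp h (fun r => Rmax 0 r)); auto. ct. Qed.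

Lemma J_minus M h k : cont0 h -> dom M h -> cont0 k -> dom M k -> J (fun r => h r - k r)%C = (J h - J k)%C.
Proof. intros; apply is_J_unique, is_J_minus; eapply J_is; eauto. Qed.
Lemma J_scal M c h : cont0 h -> dom M h -> J (fun r => c * h r)%C = (c * J h)%C.
Proof. intros; apply is_J_unique, is_J_scal; eapply J_is; eauto. Qed.

Lemma J_scalr M c h : cont0 h -> dom M h -> J (fun r => h r * c)%C = (J h * c)%C.
Proof.
  intros Hc Hd; rewrite Cmult_comm, <- (J_scal M) by auto.
  apply J_ext; intros; ringC.
Qed.

(** The estimate behind the limits and derivatives of [J]: smallness up to b, domination beyond. *)
Lemma J_split M h e b :
  cont0 h -> dom M h -> 0 <= b ->
  (forall r, 0 <= r <= b -> Cmod (h r) <= e) -> Cmod (J h) <= e * b + M / (1 + b).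
Proof.
  intros Hc Hd Hb He.
  pose proof (J_tail M h b Hc Hd Hb) as T.
  assert (B : Cmod (CInt (cl h) 0 b) <= e * (b - 0)).
  { apply CInt_norm_const; auto. intros x Hx; rewrite cl_pos by lra; apply He; lra. }
  pose proof (Cmod_triangle (J h - CInt (cl h) 0 b) (CInt (cl h) 0 b)) as Tr.
  replace (J h - CInt (cl h) 0 b + CInt (cl h) 0 b)%C with (J h) in Tr by ringC. lra.
Qed.

(** Dominated convergence with locally uniform instead of pointwise convergence, so that Riemann
    integrals suffice. *)
Lemma J_lim {T} (F : (T -> Prop) -> Prop) {FF : Filter F} (f : T -> R -> C) (f0 : R -> C) M :
  F (fun u => cont0 (f u) /\ dom M (f u)) -> cont0 f0 -> dom M f0 ->
  (forall b e, 0 <= b -> 0 < e -> F (fun u => forall r, 0 <= r <= b -> Cmod (f u r - f0 r) < e)) ->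
  filterlim (fun u => J (f u)) F (locally (J f0)).
Proof.
  intros H1 Hc0 Hd0 H2; apply lim_Cmod; auto; intros e He.
  pose proof (dom_pos _ _ Hd0) as HM.
  destruct (small_tail (2 * M) (e / 2)) as [b [Hb Hbe]]; try lra.
  assert (Hk : 0 < e / 2 / (b + 1)) by (apply Rdiv_lt_0_compat; lra).
  generalize (filter_and _ _ H1 (H2 b _ Hb Hk)); apply filter_imp.
  intros u [[Hc Hd] Hu].
  rewrite <- (J_minus M) by auto.
  eapply Rle_lt_trans; [apply (J_split (2 * M) _ (e / 2 / (b + 1)) b)|].
  - now apply cont0_minus.
  - intros r Hr; unfold Cminus; eapply Rle_trans; [apply Cmod_triangle|]; rewrite Cmod_opp.
    specialize (Hd r Hr); specialize (Hd0 r Hr).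
    replace (2 * M / (1 + r) ^ 2) with (M / (1 + r) ^ 2 + M / (1 + r) ^ 2) by (field; lra). lra.
  - exact Hb.
  - intros r Hr; left; auto.
  - assert (e / 2 / (b + 1) * b + e / 2 / (b + 1) = e / 2) by (field; lra). lra.
Qed.

Definition jct0 {U : UniformSpace} (f : U -> R -> C) (p : U) : Prop :=
  forall r, jct (fun p => cl (f p)) p r.

Lemma jct0_cont0 {U : UniformSpace} (f : U -> R -> C) p : jct0 f p -> cont0 (f p).
Proof. intros H r; apply (jct_r (fun p => cl (f p))), H. Qed.

Lemma unif_compact0 {U : UniformSpace} (f : U -> R -> C) (p0 : U) :
  jct0 f p0 ->
  forall b e, 0 < e -> locally p0 (fun p => forall r, 0 <= r <= b -> Cmod (f p r - f p0 r) < e).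
Proof.
  intros H b e He.
  generalize (unif_compact (fun p => cl (f p)) p0 0 b (fun r _ => H r) e He); apply filter_imp.
  intros p Hp r Hr; specialize (Hp r Hr); rewrite !cl_pos in Hp by lra; exact Hp.
Qed.

Lemma J_ct {U : UniformSpace} (f : U -> R -> C) (p0 : U) M :
  locally p0 (fun p => jct0 f p /\ dom M (f p)) -> continuous (fun p => J (f p)) p0.
Proof.
  intros H.
  destruct (locally_singleton _ _ H) as [H0 D0].
  apply (J_lim (locally p0) f (f p0) M); auto.
  - generalize H; apply filter_imp; intros p [Hp Dp]; split; auto; now apply jct0_cont0.
  - now apply jct0_cont0.
  - intros b e _ He; now apply unif_compact0.
Qed.

(** The splitting of [J_split] applied to difference quotients: up to b they are uniformly close to
    g p0, beyond b the domination alone gives 2 M |h|. *)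
Lemma J_dr (f g : R -> R -> C) (p0 : R) M :
  locally p0 (fun p => (jct0 f p /\ dom M (f p)) /\ (jct0 g p /\ dom M (g p)) /\
     forall r, 0 <= r -> is_derive (fun p => f p r) p (g p r)) ->
  is_derive (fun p => J (f p)) p0 (J (g p0)).
Proof.
  intros H.
  destruct (locally_singleton _ _ H) as [[F0 DF0] [[G0 DG0] _]].
  pose proof (dom_pos _ _ DG0) as HM.
  apply dr_char; intros e He.
  destruct (small_tail (2 * M) (e / 2)) as [b [Hb Hbe]]; try lra.
  assert (Hk : 0 < e / 2 / (b + 1)) by (apply Rdiv_lt_0_compat; lra).
  destruct (filter_and _ _ H (unif_compact0 g p0 G0 b _ Hk)) as [d Hd].
  exists d; intros h Hh.
  assert (Bq : forall q, Rmin p0 (p0 + h) <= q <= Rmax p0 (p0 + h) -> ball p0 d q).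
  { intros q Hq; change (Rabs (q - p0) < d). revert Hq; unfold Rmin, Rmax; destruct (Rle_dec p0 (p0 + h));
    revert Hh; unfold Rabs; repeat destruct Rcase_abs; lra. }
  assert (Bh : ball p0 d (p0 + h)).
  { apply Bq; split; [apply Rmin_r|apply Rmax_r]. }
  assert (Fh : jct0 f (p0 + h) /\ dom M (f (p0 + h))).
  { destruct (Hd _ Bh) as [[Hx _] _]; exact Hx. }
  assert (Jg : forall q r, ball p0 d q -> 0 <= r -> continuous (fun p => g p r) q).
  { intros q r Hq Hr; destruct (Hd q Hq) as [[_ [[Hj _] _]] _].
    apply (continuous_ext (fun p => cl (g p) r)).
    - intros p; now apply cl_pos.
    - exact (jct_p (fun p => cl (g p)) q r (Hj r)). }
  assert (Dg : forall q r, ball p0 d q -> 0 <= r -> Cmod (g q r) <= M / (1 + r) ^ 2).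
  { intros q r Hq Hr; destruct (Hd q Hq) as [[_ [[_ Hj] _]] _]; apply Hj; exact Hr. }
  assert (Jd : forall q r, ball p0 d q -> 0 <= r -> is_derive (fun p => f p r) q (g q r)).
  { intros q r Hq Hr; destruct (Hd q Hq) as [[_ [_ Hj]] _]; exact (Hj r Hr). }
  assert (Je : forall q r, ball p0 d q -> 0 <= r <= b -> Cmod (g q r - g p0 r) < e / 2 / (b + 1)).
  { intros q r Hq Hr; destruct (Hd q Hq) as [_ Hx]; exact (Hx r Hr). }
  assert (Cq : cont0 (fun r => f (p0 + h)%R r - f p0 r - RtoC h * g p0 r)%C).
  { apply (cont0_minus (fun r => f (p0 + h)%R r - f p0 r)%C (fun r => RtoC h * g p0 r)%C).
    - apply (cont0_minus (f (p0 + h)) (f p0)); apply jct0_cont0; tauto.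
    - apply (cont0_scal (RtoC h) (g p0)); now apply jct0_cont0. }
  replace (J (f (p0 + h)%R) - J (f p0) - RtoC h * J (g p0))%C
    with (J (fun r => f (p0 + h)%R r - f p0 r - RtoC h * g p0 r)%C).
  2: { apply is_J_unique.
       apply (is_J_minus (fun r => f (p0 + h)%R r - f p0 r)%C (fun r => RtoC h * g p0 r)%C).
       - apply (is_J_minus (f (p0 + h)) (f p0)); apply (J_is M); try apply jct0_cont0; tauto.
       - apply (is_J_scal (RtoC h) (g p0)); apply (J_is M); auto; now apply jct0_cont0. }
  eapply Rle_trans; [apply (J_split (2 * M * Rabs h) _ (e / 2 / (b + 1) * Rabs h) b)|]; auto.
  - intros r Hr.
    replace (2 * M * Rabs h / (1 + r) ^ 2) with (2 * (M / (1 + r) ^ 2) * Rabs h) by (field; lra).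
    apply (quotient_bound (fun p => f p r) (fun p => g p r)).
    + intros q Hq; exact (Jd q r (Bq q Hq) Hr).
    + intros q Hq; exact (Jg q r (Bq q Hq) Hr).
    + intros q Hq; unfold Cminus; eapply Rle_trans; [apply Cmod_triangle|]; rewrite Cmod_opp.
      pose proof (Dg q r (Bq q Hq) Hr). pose proof (DG0 r Hr). lra.
  - intros r Hr; apply (quotient_bound (fun p => f p r) (fun p => g p r)).
    + intros q Hq; exact (Jd q r (Bq q Hq) (proj1 Hr)).
    + intros q Hq; exact (Jg q r (Bq q Hq) (proj1 Hr)).
    + intros q Hq; left; exact (Je q r (Bq q Hq) Hr).
  - assert (e / 2 / (b + 1) * b + e / 2 / (b + 1) = e / 2) by (field; lra).
    pose proof (Rabs_pos h).
    replace (2 * M * Rabs h / (1 + b)) with (2 * M / (1 + b) * Rabs h) by (field; lra). nra.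
Qed.

(** Fubini on [0, c] leaves an error bounded by the tail M (b - a)/(1 + c). *)
Lemma J_Fubini (f : R -> R -> C) a b M :
  a <= b -> (forall p, jct0 f p) -> (forall p, dom M (f p)) ->
  is_J (fun r => CInt (fun p => f p r) a b) (CInt (fun p => J (f p)) a b).
Proof.
  intros Hab Hj Hd.
  pose proof (dom_pos _ _ (Hd 0)) as HM.
  assert (CJ : forall p, continuous (fun p => J (f p)) p).
  { intros p; apply (J_ct f p M); apply filter_forall; auto. }
  assert (Hc : cont0 (fun r => CInt (fun p => f p r) a b)).
  { intros r; apply (CInt_ct (fun r p => cl (f p) r) r a b Hab).
    intros r' p _; unfold jct.
    apply (ct_comp2 (fun p r => cl (f p) r)); [intros [? ?]; apply Hj| |]; ct. }
  apply is_J_char; auto; apply lim_Cmod; [apply Rbar_locally_filter|]; intros e He.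
  destruct (small_tail (M * (b - a)) e) as [B [HB HBe]]; auto.
  { apply Rmult_le_pos; lra. }
  exists B; intros c Hc'.
  replace (CInt (cl (fun r => CInt (fun p => f p r) a b)) 0 c) with
     (CInt (fun p => CInt (cl (f p)) 0 c) a b).
  2: { rewrite (CInt_Fubini (fun p => cl (f p)) a b 0 c); auto; try lra; try (intros; apply Hj). }
  assert (CF : forall p, continuous (fun p => CInt (cl (f p)) 0 c) p).
  { intros p; apply (CInt_ct (fun p => cl (f p))); [lra|]. intros; apply Hj. }
  rewrite <- CInt_minus by auto.
  eapply Rle_lt_trans; [apply (CInt_norm_const _ (M / (1 + c)))|]; auto.
  - intros; apply ct_minus; auto.
  - intros p _; rewrite <- Cmod_opp.
    replace (- (CInt (cl (f p)) 0 c - J (f p)))%C with (J (f p) - CInt (cl (f p)) 0 c)%C by ringC.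
    apply J_tail; auto; [now apply jct0_cont0|lra].
  - eapply Rle_lt_trans; [|exact HBe].
    replace (M / (1 + c) * (b - a)) with (M * (b - a) / (1 + c)) by (field; lra).
    apply inv_tail_mono; [apply Rmult_le_pos; lra|lra].
Qed.

(** * Cauchy's theorem on circular sectors *)

Definition ex (th : R) : C := Cexp (Ci * RtoC th)%C.
Definition pol (r th : R) : C := (RtoC r * ex th)%C.

Lemma ex_eq th : ex th = (cos th, sin th).
Proof.
  unfold ex, Cexp; simpl. f_equal.
  - replace (0 * th - 1 * 0) with 0 by ring; replace (0 * 0 + 1 * th) with th by ring; rewrite exp_0; ring.
  - replace (0 * th - 1 * 0) with 0 by ring; replace (0 * 0 + 1 * th) with th by ring; rewrite exp_0; ring.
Qed.
Lemma pol_eq r th : pol r th = (r * cos th, r * sin th).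
Proof. unfold pol; rewrite ex_eq; unfold Cmult, RtoC; simpl; f_equal; ring. Qed.
Lemma Cmod_ex th : Cmod (ex th) = 1.
Proof. unfold ex; rewrite Cmod_Cexp. simpl. replace (0 * th - 1 * 0) with 0 by ring; apply exp_0. Qed.
Lemma Cmod_pol r th : 0 <= r -> Cmod (pol r th) = r.
Proof. intros Hr; unfold pol; rewrite Cmod_mult, Cmod_ex, Cmod_R, Rabs_pos_eq by auto; ring. Qed.
Lemma ex_plus a b : ex (a + b) = (ex a * ex b)%C.
Proof. unfold ex; rewrite RtoC_plus, <- Cexp_plus; f_equal; ring. Qed.
Lemma pol_0 r : pol r 0 = RtoC r.
Proof. rewrite pol_eq, cos_0, sin_0; unfold RtoC; f_equal; ring. Qed.
Lemma pol_PI r : pol r PI = RtoC (- r).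
Proof. rewrite pol_eq, cos_PI, sin_PI; unfold RtoC; f_equal; ring. Qed.

Lemma ct_ex {U : UniformSpace} (f : U -> R) p : continuous f p -> continuous (fun x => ex (f x)) p.
Proof. intros; unfold ex; ct. Qed.
Lemma ct_pol {U : UniformSpace} (f g : U -> R) p :
  continuous f p -> continuous g p -> continuous (fun x => pol (f x) (g x)) p.
Proof. intros; unfold pol, ex; ct. Qed.

Lemma dr_ex th : is_derive ex th (Ci * ex th)%C.
Proof. unfold ex; dr. ringC. Qed.

(* Complex differentiability at [z], tested on differentiable real curves through [z]. *)
Definition hol (G G' : C -> C) (z : C) : Prop :=
  forall (gm : R -> C) (u : R) (d : C),
    gm u = z -> is_derive gm u d -> is_derive (fun x => G (gm x)) u (G' z * d)%C.

Lemma hol_eq G G1 G2 z : hol G G1 z -> G1 z = G2 z -> hol G G2 z.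
Proof. intros H E gm u d Hu Hd; rewrite <- E; now apply H. Qed.
Lemma hol_const c z : hol (fun _ => c) (fun _ => RtoC 0) z.
Proof. intros gm u d _ _; eapply dr_eq; [apply dr_const|ringC]. Qed.
Lemma hol_id z : hol (fun z => z) (fun _ => RtoC 1) z.
Proof. intros gm u d _ Hd; eapply dr_eq; [exact Hd|ringC]. Qed.
Lemma hol_plus F G F' G' z : hol F F' z -> hol G G' z -> hol (fun z => F z + G z)%C (fun z => F' z + G' z)%C z.
Proof. intros HF HG gm u d Hu Hd; eapply dr_eq; [apply dr_plus; [exact (HF gm u d Hu Hd)|exact (HG gm u d Hu Hd)]|ringC]. Qed.
Lemma hol_minus F G F' G' z : hol F F' z -> hol G G' z -> hol (fun z => F z - G z)%C (fun z => F' z - G' z)%C z.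
Proof. intros HF HG gm u d Hu Hd; eapply dr_eq; [apply dr_minus; [exact (HF gm u d Hu Hd)|exact (HG gm u d Hu Hd)]|ringC]. Qed.
Lemma hol_opp F F' z : hol F F' z -> hol (fun z => - F z)%C (fun z => - F' z)%C z.
Proof. intros HF gm u d Hu Hd; eapply dr_eq; [apply dr_opp; exact (HF gm u d Hu Hd)|ringC]. Qed.
Lemma hol_mult F G F' G' z :
  hol F F' z -> hol G G' z -> hol (fun z => F z * G z)%C (fun z => F' z * G z + F z * G' z)%C z.
Proof. intros HF HG gm u d Hu Hd; eapply dr_eq; [apply dr_mult; [exact (HF gm u d Hu Hd)|exact (HG gm u d Hu Hd)]|]. cbv beta; rewrite Hu; ringC. Qed.
Lemma hol_exp F F' z : hol F F' z -> hol (fun z => Cexp (F z)) (fun z => F' z * Cexp (F z))%C z.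
Proof. intros HF gm u d Hu Hd; eapply dr_eq; [apply dr_exp; exact (HF gm u d Hu Hd)|]. cbv beta; rewrite Hu; ringC. Qed.
Lemma hol_pow F F' n z : hol F F' z -> hol (fun z => F z ^ n)%C (fun z => INR n * F' z * F z ^ pred n)%C z.
Proof. intros HF gm u d Hu Hd; eapply dr_eq; [apply dr_pow; exact (HF gm u d Hu Hd)|]. cbv beta; rewrite Hu; ringC. Qed.
Lemma hol_inv (F F' : C -> C) z : F z <> 0%C -> hol F F' z -> hol (fun z => / F z)%C (fun z => - F' z * (/ F z * / F z))%C z.
Proof.
  intros H0 HF gm u d Hu Hd; eapply dr_eq; [apply dr_inv; [exact (HF gm u d Hu Hd)|rewrite Hu; exact H0]|].
  cbv beta; rewrite Hu; ringC.
Qed.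

Ltac hol1 :=
  lazymatch goal with
  | |- hol (fun z => z) _ _ => apply hol_id
  | |- hol (fun z => Cplus (@?f z) (@?g z)) _ _ => eapply (hol_plus f g)
  | |- hol (fun z => Cminus (@?f z) (@?g z)) _ _ => eapply (hol_minus f g)
  | |- hol (fun z => Cmult (@?f z) (@?g z)) _ _ => eapply (hol_mult f g)
  | |- hol (fun z => Cpow (@?f z) ?n) _ _ => eapply (hol_pow f _ n)
  | |- hol (fun z => Cexp (@?f z)) _ _ => eapply (hol_exp f)
  | |- hol (fun z => Cinv (@?f z)) _ _ => eapply (hol_inv f)
  | |- hol (fun z => Copp (@?f z)) _ _ => eapply (hol_opp f)
  | |- hol (fun z => ?c) _ _ => apply (hol_const c)
  end.
Ltac hol := repeat hol1.

(* Cauchy's theorem for [G] on truncated sectors. *)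
Definition CI (G : C -> C) (t1 t2 : R) : Prop :=
  forall R0, 0 <= R0 ->
    (CInt (fun r => G (pol r t2) * ex t2) 0 R0 - CInt (fun r => G (pol r t1) * ex t1) 0 R0 =
     CInt (fun th => Ci * pol R0 th * G (pol R0 th)) t1 t2)%C.

Lemma CI_ext G H t1 t2 :
  t1 <= t2 ->
  (forall r th, 0 <= r -> t1 <= th <= t2 -> G (pol r th) = H (pol r th)) -> CI G t1 t2 -> CI H t1 t2.
Proof.
  intros Ht E HG R0 HR; specialize (HG R0 HR).
  rewrite (CInt_ext _ (fun r => H (pol r t2) * ex t2)%C) in HG.
  2: { intros x Hx; rewrite Rmin_left in Hx by lra; rewrite E; auto; lra. }
  rewrite (CInt_ext (fun r => G (pol r t1) * ex t1)%C (fun r => H (pol r t1) * ex t1)%C) in HG.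
  2: { intros x Hx; rewrite Rmin_left in Hx by lra; rewrite E; auto; lra. }
  rewrite HG; apply CInt_ext; intros x Hx; rewrite Rmin_left, Rmax_right in Hx by lra.
  rewrite E; auto; lra.
Qed.

(** Cauchy's theorem by differentiation in the angle. The function [g] is at once the angular
    derivative of the ray integrand and the radial derivative of i z G(z), so the derivative of the
    ray integral is the boundary term at radius [R0]. The open range (a, b) gives room to
    differentiate at t1 and t2. *)
Lemma sector_identity G G' a b t1 t2 :
  a < t1 -> t1 <= t2 -> t2 < b ->
  (forall r th, 0 <= r -> a < th < b ->
     hol G G' (pol r th) /\ continuous G (pol r th) /\ continuous G' (pol r th)) ->
  CI G t1 t2.
Proof.
  intros Ha Ht Hb H R0 HR.
  assert (Jp : forall (g : C -> C) r th, continuous g (pol r th) -> jct (fun th r => g (pol r th)) th r).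
  { intros g r th Hg; apply (continuous_comp (fun q : R * R => pol (snd q) (fst q)) g); [|exact Hg].
    apply ct_pol; [apply rct_snd_id|apply rct_fst_id]. }
  set (f := fun th r => (G (pol r th) * ex th)%C).
  set (g := fun th r => (Ci * ex th * (G (pol r th) + pol r th * G' (pol r th)))%C).
  assert (D : forall th, t1 <= th <= t2 ->
     is_derive (fun th => CInt (f th) 0 R0) th (CInt (g th) 0 R0)).
  { intros th Hth; apply (CInt_dr f g); auto.
    assert (L : locally th (fun th => a < th < b)).
    { apply locally_interval; lra. }
    revert L; apply filter_imp; intros t Hab r Hr.
    destruct (H r t (proj1 Hr) Hab) as [H1 [H2 H3]].
    unfold f, g; split; [|split].
    - apply ct_mult; [apply (Jp G); auto|apply ct_ex, rct_fst_id].
    - apply ct_mult; [apply ct_mult; [apply continuous_const|apply ct_ex, rct_fst_id]|].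
      apply ct_plus; [apply (Jp G); auto|].
      apply ct_mult; [apply ct_pol; [apply rct_snd_id|apply rct_fst_id]|apply (Jp G'); auto].
    - eapply dr_eq; [apply dr_mult; [apply (H1 (fun th => pol r th) t); [reflexivity|]|apply dr_ex]|].
      + unfold pol; apply dr_scal, dr_ex.
      + unfold pol; ringC. }
  assert (E : forall th, t1 <= th <= t2 -> CInt (g th) 0 R0 = (Ci * pol R0 th * G (pol R0 th))%C).
  { intros th Hth.
    rewrite (CInt_derive (fun r => Ci * pol r th * G (pol r th))%C (g th)).
    - unfold pol at 3; ringC.
    - intros r Hr; rewrite Rmin_left, Rmax_right in Hr by lra.
      destruct (H r th (proj1 Hr)) as [H1 [H2 H3]]; [lra|].
      assert (Dp : is_derive (fun r => pol r th) r (ex th)).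
      { unfold pol; eapply dr_eq; [apply dr_scalr, dr_id|ringC]. }
      eapply dr_eq; [apply dr_mult; [apply dr_scal, Dp|apply (H1 _ r _ eq_refl Dp)]|].
      unfold g; ringC.
    - intros r Hr; rewrite Rmin_left, Rmax_right in Hr by lra.
      destruct (H r th (proj1 Hr)) as [H1 [H2 H3]]; [lra|].
      apply (jct_r g); unfold g.
      apply ct_mult; [apply ct_mult; [apply continuous_const|apply ct_ex, rct_fst_id]|].
      apply ct_plus; [apply (Jp G); auto|].
      apply ct_mult; [apply ct_pol; [apply rct_snd_id|apply rct_fst_id]|apply (Jp G'); auto]. }
  transitivity (CInt (fun th => CInt (g th) 0 R0) t1 t2).
  2: { apply CInt_ext; intros th Hth; rewrite Rmin_left, Rmax_right in Hth by lra; apply E; lra. }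
  symmetry; apply (CInt_derive (fun th => CInt (f th) 0 R0)).
  - intros th Hth; rewrite Rmin_left, Rmax_right in Hth by lra; apply D; lra.
  - intros th Hth; rewrite Rmin_left, Rmax_right in Hth by lra.
    (* Joint continuity of [g] is available only for angles in (a, b), so continuity of the integral
       is proved locally instead of by [CInt_ct]. *)
    apply ct_Cmod; intros e He.
    assert (Hk : 0 < e / (R0 + 1)) by (apply Rdiv_lt_0_compat; lra).
    assert (L : locally th (fun th => a < th < b)).
    { apply locally_interval; lra. }
    assert (Jg : forall t r, a < t < b -> 0 <= r <= R0 -> jct g t r).
    { intros t r Hab Hr; destruct (H r t (proj1 Hr) Hab) as [H1 [H2 H3]]; unfold g.
      apply ct_mult; [apply ct_mult; [apply continuous_const|apply ct_ex, rct_fst_id]|].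
      apply ct_plus; [apply (Jp G); auto|].
      apply ct_mult; [apply ct_pol; [apply rct_snd_id|apply rct_fst_id]|apply (Jp G'); auto]. }
    assert (Hg : forall r, 0 <= r <= R0 -> jct g th r) by (intros; apply Jg; auto; lra).
    generalize (filter_and _ _ L (unif_compact g th 0 R0 Hg _ Hk)); apply filter_imp.
    intros t [Hab Hu].
    rewrite <- CInt_minus.
    + eapply Rle_lt_trans; [apply (CInt_norm_const _ (e / (R0 + 1)))|]; auto.
      * intros r Hr; apply ct_minus; apply (jct_r g); apply Jg; auto; lra.
      * intros r Hr; left; auto.
      * assert (e / (R0 + 1) * R0 + e / (R0 + 1) = e) by (field; lra). lra.
    + intros r Hr; rewrite Rmin_left, Rmax_right in Hr by lra; apply (jct_r g); apply Jg; auto.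
    + intros r Hr; rewrite Rmin_left, Rmax_right in Hr by lra; apply (jct_r g); apply Jg; auto; lra.
Qed.

(** By Fubini, Cauchy's theorem passes to integrals over a parameter. Together with [CI_J] this
    spares a proof that the transforms themselves are holomorphic: only explicit exponentials
    are. *)
Lemma CI_CInt (f : C -> R -> C) a b t1 t2 :
  a <= b -> t1 <= t2 ->
  (forall z s, jct f z s) ->
  (forall s, a <= s <= b -> CI (fun z => f z s) t1 t2) ->
  CI (fun z => CInt (f z) a b) t1 t2.
Proof.
  intros Hab Ht Hj H R0 HR.
  assert (Cf : forall z s, continuous (f z) s) by (intros; now apply jct_r).
  assert (S : forall th, CInt (fun r => CInt (f (pol r th)) a b * ex th)%C 0 R0 =
     CInt (fun s => CInt (fun r => f (pol r th) s * ex th)%C 0 R0) a b).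
  { intros th; rewrite <- (CInt_Fubini (fun r s => f (pol r th) s * ex th)%C); auto.
    - apply CInt_ext; intros r _; symmetry; apply CInt_scalr; auto.
    - intros r s; apply ct_mult; [|apply continuous_const].
      apply (ct_comp2 f); [intros [? ?]; apply Hj|apply ct_pol; [apply rct_fst_id|apply continuous_const]|apply rct_snd_id]. }
  rewrite !S.
  assert (A : CInt (fun th => Ci * pol R0 th * CInt (f (pol R0 th)) a b)%C t1 t2 =
     CInt (fun s => CInt (fun th => Ci * pol R0 th * f (pol R0 th) s)%C t1 t2) a b).
  { rewrite <- (CInt_Fubini (fun th s => Ci * pol R0 th * f (pol R0 th) s)%C); auto.
    - apply CInt_ext; intros th _; symmetry; apply CInt_scal; auto.
    - intros th s; apply ct_mult; [apply ct_mult; [apply continuous_const|apply ct_pol; [apply continuous_const|apply rct_fst_id]]|].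
      apply (ct_comp2 f); [intros [? ?]; apply Hj|apply ct_pol; [apply continuous_const|apply rct_fst_id]|apply rct_snd_id]. }
  rewrite A.
  assert (K : forall th s, continuous (fun s => CInt (fun r => f (pol r th) s * ex th)%C 0 R0) s).
  { intros th s; apply (CInt_ct (fun s r => f (pol r th) s * ex th)%C); auto.
    intros s' r _; apply ct_mult; [|apply continuous_const].
    apply (ct_comp2 f); [intros [? ?]; apply Hj|apply ct_pol; [apply rct_snd_id|apply continuous_const]|apply rct_fst_id]. }
  rewrite <- CInt_minus by auto.
  apply CInt_ext; intros s Hs; rewrite Rmin_left, Rmax_right in Hs by lra.
  apply (H s); auto; lra.
Qed.

(** Clamping a parameter to [a, b] turns a bound valid on that interval into the global one that
    [J_Fubini] asks for. *)
Definition clab (a b x : R) : R := Rmax a (Rmin b x).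
Lemma clab_in a b x : a <= b -> a <= clab a b x <= b.
Proof. intros; unfold clab, Rmax, Rmin; destruct (Rle_dec b x); destruct (Rle_dec a _); lra. Qed.
Lemma clab_id a b x : a <= x <= b -> clab a b x = x.
Proof. intros; unfold clab; rewrite Rmin_right, Rmax_right; lra. Qed.

Lemma J_Fubini_loc (f : R -> R -> C) a b M :
  a <= b -> (forall p, jct0 f p) -> (forall p, a <= p <= b -> dom M (f p)) ->
  is_J (fun r => CInt (fun p => f p r) a b) (CInt (fun p => J (f p)) a b).
Proof.
  intros Hab Hj Hd.
  pose proof (J_Fubini (fun p => f (clab a b p)) a b M Hab) as H.
  assert (E : CInt (fun p => J (f (clab a b p))) a b = CInt (fun p => J (f p)) a b).
  { apply CInt_ext; intros p Hp; rewrite Rmin_left, Rmax_right in Hp by lra; rewrite clab_id; auto; lra. }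
  cbv beta in H; rewrite E in H.
  apply (is_J_ext (fun r => CInt (fun p => f (clab a b p) r) a b)).
  { intros r _; apply CInt_ext; intros p Hp; rewrite Rmin_left, Rmax_right in Hp by lra; rewrite clab_id; auto; lra. }
  apply H.
  - intros p r; unfold jct.
    apply (ct_comp2 (fun p r => cl (f p) r)); [intros [? ?]; apply Hj| |apply rct_snd_id].
    unfold clab; ct.
  - intros p; apply Hd, clab_in, Hab.
Qed.

Lemma CI_J (f : C -> R -> C) t1 t2 :
  t1 <= t2 ->
  (forall z, jct0 f z) ->
  (forall R0, exists M, forall z, Cmod z <= R0 -> dom M (f z)) ->
  (forall y, 0 <= y -> CI (fun z => f z y) t1 t2) ->
  CI (fun z => J (f z)) t1 t2.
Proof.
  intros Ht Hj Hd H R0 HR.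
  destruct (Hd R0) as [M HM].
  assert (HM0 : 0 <= M).
  { apply (dom_pos M (f 0%C)); apply HM. rewrite Cmod_0; auto. }
  assert (Hj' : forall q : C * R, continuous (fun q => cl (f (fst q)) (snd q)) q) by (intros [? ?]; apply Hj).
  assert (D1 : forall th r, 0 <= r <= R0 -> dom M (fun y => f (pol r th) y * ex th)%C).
  { intros th r Hr y Hy; rewrite Cmod_mult, Cmod_ex, Rmult_1_r; apply HM; auto.
    rewrite Cmod_pol; lra. }
  assert (C1 : forall th r, cont0 (f (pol r th))) by (intros; apply jct0_cont0, Hj).
  assert (S : forall th, is_J (fun y => CInt (fun r => f (pol r th) y * ex th)%C 0 R0)
                (CInt (fun r => J (f (pol r th)) * ex th)%C 0 R0)).
  { intros th; rewrite (CInt_ext _ (fun r => J (fun y => f (pol r th) y * ex th)%C)).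
    - apply (J_Fubini_loc (fun r y => f (pol r th) y * ex th)%C 0 R0 M); auto.
      intros r y; unfold jct, cl; apply ct_mult; [|apply continuous_const].
      apply (ct_comp2 (fun z y => cl (f z) y)); [exact Hj'|apply ct_pol; [apply rct_fst_id|apply continuous_const]|apply rct_snd_id].
    - intros r Hr; rewrite Rmin_left, Rmax_right in Hr by lra.
      symmetry; apply (J_scalr M); auto. apply HM; rewrite Cmod_pol; lra. }
  assert (A : is_J (fun y => CInt (fun th => Ci * pol R0 th * f (pol R0 th) y)%C t1 t2)
                (CInt (fun th => Ci * pol R0 th * J (f (pol R0 th)))%C t1 t2)).
  { rewrite (CInt_ext _ (fun th => J (fun y => Ci * pol R0 th * f (pol R0 th) y)%C)).
    - apply (J_Fubini_loc (fun th y => Ci * pol R0 th * f (pol R0 th) y)%C t1 t2 (R0 * M)); auto.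
      + intros th y; unfold jct, cl; apply ct_mult; [apply ct_mult; [apply continuous_const|apply ct_pol; [apply continuous_const|apply rct_fst_id]]|].
        apply (ct_comp2 (fun z y => cl (f z) y)); [exact Hj'|apply ct_pol; [apply continuous_const|apply rct_fst_id]|apply rct_snd_id].
      + intros th _ y Hy; rewrite !Cmod_mult, Cmod_Ci, Cmod_pol by auto.
        assert (Hb : dom M (f (pol R0 th))) by (apply HM; rewrite Cmod_pol; lra).
        specialize (Hb y Hy). unfold Rdiv in *. nra.
    - intros th _; symmetry; apply (J_scal M); auto. apply HM; rewrite Cmod_pol; lra. }
  pose proof (is_J_minus _ _ _ _ (S t2) (S t1)) as B.
  rewrite <- (is_J_unique _ _ B), <- (is_J_unique _ _ A).
  apply J_ext; intros y Hy; apply (H y Hy); auto.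
Qed.

(** * Rotation of rays *)

Definition ray (F : C -> C) (th : R) (I : C) : Prop :=
  is_J (fun r => F (RtoC r * ex th) * ex th)%C I.

Definition ctray (G : C -> C) (th : R) : Prop := forall r, 0 <= r -> continuous G (pol r th).

Lemma ctray_cont0 G th : ctray G th -> cont0 (fun r => G (RtoC r * ex th) * ex th)%C.
Proof.
  intros H r; apply ct_mult; [|apply continuous_const].
  apply (continuous_comp (fun r => pol (Rmax 0 r) th) G).
  - apply ct_pol; [ct|apply continuous_const].
  - apply H, Rmax_l.
Qed.

Definition arc (G : C -> C) (t1 t2 R0 : R) : C := CInt (fun th => Ci * pol R0 th * G (pol R0 th))%C t1 t2.

Lemma CInt_cl h b : 0 <= b -> CInt (cl h) 0 b = CInt h 0 b.
Proof. intros Hb; apply CInt_ext; intros x Hx; rewrite Rmin_left in Hx by lra; apply cl_pos; lra. Qed.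

(** The truncated ray integrals differ exactly by the arc, so convergence passes from one ray to the
    other even when it is only conditional. *)
Lemma ray_rot_gen G t1 t2 I :
  CI G t1 t2 -> ctray G t1 -> ctray G t2 ->
  filterlim (fun R0 => arc G t1 t2 R0) (Rbar_locally p_infty) (locally (RtoC 0)) ->
  ray G t2 I <-> ray G t1 I.
Proof.
  intros HC H1 H2 HA.
  assert (Ev : Rbar_locally p_infty (fun b => 0 <= b)) by (exists 0; intros; lra).
  unfold ray; rewrite !is_J_char by now apply ctray_cont0.
  split; intros HI; apply lim_Cmod; try apply Rbar_locally_filter; intros e He;
    pose proof (proj1 (lim_Cmod _ _ _) HI (e / 2) ltac:(lra)) as P1;
    pose proof (proj1 (lim_Cmod _ _ _) HA (e / 2) ltac:(lra)) as P2;
    generalize (filter_and _ _ Ev (filter_and _ _ P1 P2)); apply filter_imp;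
    intros b [Hb [Q1 Q2]]; rewrite CInt_cl in * by auto;
    pose proof (HC b Hb) as E; fold (arc G t1 t2 b) in E; unfold pol in E.
  - replace (CInt (fun r => G (r * ex t1) * ex t1) 0 b - I)%C with
      ((CInt (fun r => G (r * ex t2) * ex t2) 0 b - I) + - (arc G t1 t2 b - 0))%C by (rewrite <- E; ringC).
    eapply Rle_lt_trans; [apply Cmod_triangle|]; rewrite Cmod_opp; lra.
  - replace (CInt (fun r => G (r * ex t2) * ex t2) 0 b - I)%C with
      ((CInt (fun r => G (r * ex t1) * ex t1) 0 b - I) + (arc G t1 t2 b - 0))%C by (rewrite <- E; ringC).
    eapply Rle_lt_trans; [apply Cmod_triangle|]; lra.
Qed.

(** A crude form of the concavity bound for the sine: a - a^3/6 is at least a/3 because a <= pi/2 <=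
    2. *)
Lemma sin_third a : 0 <= a <= PI / 2 -> a / 3 <= sin a.
Proof.
  intros Ha; pose proof PI_4.
  destruct (pre_sin_bound a 0) as [H1 _]; try lra.
  unfold sin_approx, sin_term in H1; simpl in H1.
  replace (-1 * 1) with (-1) in H1 by ring.
  assert (a * a <= 4) by nra. nra.
Qed.

Lemma exp_int k a b : 0 < k -> 0 <= a <= b ->
  ex_RInt (fun t => exp (- (k * t))) a b /\ RInt (fun t => exp (- (k * t))) a b <= / k.
Proof.
  intros Hk Hab.
  assert (HI : is_RInt (fun t => exp (- (k * t))) a b (minus (- / k * exp (- (k * b))) (- / k * exp (- (k * a))))).
  { apply (is_RInt_derive (V := R_CompleteNormedModule) (fun t => - / k * exp (- (k * t)))).
    - intros t _; rdr. field; lra.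
    - intros; ct. }
  split; [eexists; exact HI|].
  rewrite (is_RInt_unique _ _ _ _ HI); unfold minus, plus, opp; simpl.
  pose proof (Rinv_0_lt_compat _ Hk).
  assert (exp (- (k * a)) <= 1) by (rewrite <- exp_0; apply exp_le; nra).
  pose proof (exp_pos (- (k * b))). nra.
Qed.

(** Jordan's lemma. The integrand on the arc is bounded by a sum of two exponentials, one effective
    for th <= pi/2 and the other for th >= pi/2, which treats all sectors of the upper half-plane
    alike. *)
Lemma jordan (G : C -> C) t1 t2 x B :
  0 < x -> 0 <= t1 <= t2 -> t2 <= PI -> 0 <= B ->
  (forall r th, 0 <= r -> t1 <= th <= t2 -> continuous G (pol r th)) ->
  (forall r th, 1 <= r -> t1 <= th <= t2 -> Cmod (G (pol r th)) <= B / r * exp (- (x * (r * sin th)))) ->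
  filterlim (fun R0 => arc G t1 t2 R0) (Rbar_locally p_infty) (locally (RtoC 0)).
Proof.
  intros Hx Ht HPI HB HGc HG; apply lim_Cmod; [apply Rbar_locally_filter|]; intros e He.
  (* With k = x r / 3 each exponential has integral at most 1/k, so the arc is at most 2 B / k = K /
     r. *)
  set (K := 6 * B / x).
  assert (HK : 0 <= K) by (unfold K; apply Rmult_le_pos; [lra|left; now apply Rinv_0_lt_compat]).
  exists (1 + K / e); intros r Hr.
  assert (HKe : 0 <= K / e) by (apply Rmult_le_pos; auto; left; now apply Rinv_0_lt_compat).
  assert (Hr1 : 1 <= r) by lra.
  replace (arc G t1 t2 r - 0)%C with (arc G t1 t2 r) by ringC.
  set (k := x * r / 3).
  assert (Hk : 0 < k) by (unfold k; nra).
  destruct (exp_int k t1 t2 Hk Ht) as [E1 I1].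
  destruct (exp_int k (PI - t2) (PI - t1) Hk) as [E2 I2]; [lra|].
  (* The reflection t -> pi - t reduces the second exponential to the first. *)
  assert (I3 : is_RInt (fun t => exp (- (k * (PI - t)))) t1 t2 (RInt (fun t => exp (- (k * t))) (PI - t2) (PI - t1))).
  { apply (is_RInt_ext (fun t => opp (scal (-1) (exp (- (k * (-1 * t + PI))))))).
    - intros t _; unfold opp, scal; simpl; unfold mult; simpl.
      replace (-1 * t + PI) with (PI - t) by ring. ring.
    - replace (RInt (fun t => exp (- (k * t))) (PI - t2) (PI - t1)) with
        (opp (RInt (fun t => exp (- (k * t))) (PI - t1) (PI - t2))).
      + apply (is_RInt_opp (V := R_NormedModule)).
        apply (is_RInt_comp_lin (V := R_NormedModule) (fun t => exp (- (k * t))) (-1) PI).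
        replace (-1 * t1 + PI) with (PI - t1) by ring; replace (-1 * t2 + PI) with (PI - t2) by ring.
        apply (RInt_correct (V := R_CompleteNormedModule)); apply ex_RInt_swap; exact E2.
      + apply (opp_RInt_swap (V := R_CompleteNormedModule)); apply ex_RInt_swap; exact E2. }
  assert (Main : Cmod (arc G t1 t2 r) <= B * (/ k + / k)).
  { unfold arc.
    eapply Rle_trans; [apply (CInt_norm _ (fun t => B * (exp (- (k * t)) + exp (- (k * (PI - t))))))|]; try lra.
    - intros th Hth; apply ct_mult; [apply ct_mult; [apply continuous_const|apply ct_pol; [apply continuous_const|apply continuous_id]]|].
      apply (continuous_comp (fun th => pol r th) G); [apply ct_pol; [apply continuous_const|apply continuous_id]|].
      apply HGc; lra.
    - intros th Hth; rewrite !Cmod_mult, Cmod_Ci, Cmod_pol by lra.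
      specialize (HG r th Hr1 Hth).
      replace (B * (exp (- (k * th)) + exp (- (k * (PI - th))))) with
        (1 * r * (B / r * (exp (- (k * th)) + exp (- (k * (PI - th)))))) by (field; lra).
      apply Rmult_le_compat_l; [lra|].
      eapply Rle_trans; [exact HG|]. apply Rmult_le_compat_l.
      { apply Rmult_le_pos; auto; left; apply Rinv_0_lt_compat; lra. }
      destruct (Rle_dec th (PI / 2)) as [Hth2|Hth2].
      + pose proof (sin_third th ltac:(lra)). pose proof (exp_pos (- (k * (PI - th)))).
        assert (exp (- (x * (r * sin th))) <= exp (- (k * th))).
        { apply exp_le. unfold k. assert (0 < x * r) by nra. nra. } lra.
      + pose proof (sin_third (PI - th) ltac:(lra)) as S. rewrite sin_PI_x in S. pose proof (exp_pos (- (k * th))).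
        assert (exp (- (x * (r * sin th))) <= exp (- (k * (PI - th)))).
        { apply exp_le. unfold k. assert (0 < x * r) by nra. nra. } lra.
    - apply (ex_RInt_scal (V := R_NormedModule)); apply (ex_RInt_plus (V := R_NormedModule)); [exact E1|eexists; exact I3].
    - rewrite (RInt_scal (V := R_CompleteNormedModule)).
      2: { apply (ex_RInt_plus (V := R_NormedModule)); [exact E1|eexists; exact I3]. }
      rewrite (RInt_plus (V := R_CompleteNormedModule)); [|exact E1|eexists; exact I3].
      rewrite (is_RInt_unique _ _ _ _ I3).
      unfold scal, plus; simpl; unfold mult; simpl. apply Rmult_le_compat_l; lra. }
  eapply Rle_lt_trans; [exact Main|].
  replace (B * (/ k + / k)) with (K / r) by (unfold K, k; field; lra).
  apply (Rmult_lt_reg_r r); [lra|]. unfold Rdiv; rewrite Rmult_assoc, Rinv_l by lra.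
  assert (K / e * e = K) by (field; lra). nra.
Qed.

Lemma arc_small (G : C -> C) t1 t2 B :
  t1 <= t2 -> 0 <= B ->
  (forall r th, 0 <= r -> t1 <= th <= t2 -> continuous G (pol r th)) ->
  (forall r th, 1 <= r -> t1 <= th <= t2 -> Cmod (G (pol r th)) <= B / r ^ 2) ->
  filterlim (fun R0 => arc G t1 t2 R0) (Rbar_locally p_infty) (locally (RtoC 0)).
Proof.
  intros Ht HB HGc HG; apply lim_Cmod; [apply Rbar_locally_filter|]; intros e He.
  set (K := B * (t2 - t1)).
  assert (HK : 0 <= K) by (unfold K; nra).
  assert (HKe : 0 <= K / e) by (apply Rmult_le_pos; auto; left; now apply Rinv_0_lt_compat).
  exists (1 + K / e); intros r Hr.
  replace (arc G t1 t2 r - 0)%C with (arc G t1 t2 r) by ringC.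
  eapply Rle_lt_trans; [apply (CInt_norm_const _ (B / r)); auto|].
  - intros th Hth; apply ct_mult; [apply ct_mult; [apply continuous_const|apply ct_pol; [apply continuous_const|apply continuous_id]]|].
    apply (continuous_comp (fun th => pol r th) G); [apply ct_pol; [apply continuous_const|apply continuous_id]|].
    apply HGc; lra.
  - intros th Hth; rewrite !Cmod_mult, Cmod_Ci, Cmod_pol by lra.
    specialize (HG r th ltac:(lra) Hth).
    replace (B / r) with (1 * r * (B / r ^ 2)) by (field; lra).
    apply Rmult_le_compat_l; lra.
  - replace (B / r * (t2 - t1)) with (K / r) by (unfold K; field; lra).
    apply (Rmult_lt_reg_r r); [lra|]. unfold Rdiv; rewrite Rmult_assoc, Rinv_l by lra.
    assert (K / e * e = K) by (field; lra). nra.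
Qed.

(** * The half-line Fourier transform *)

(** Projection onto the closed lower half-plane: it keeps the transform kernel bounded for every
    complex argument, so that continuity can be asserted on all of [C] without side conditions. *)
Definition dn (mu : C) : C := (Re mu, Rmin 0 (Im mu)).
Definition ek (mu : C) (y : R) : C := Cexp (- (Ci * dn mu * RtoC y)).
(* [HH phi] extends [hat phi] continuously from the closed lower half-plane to [C]. *)
Definition HH (phi : R -> C) (mu : C) : C := J (fun y => ek mu y * phi y)%C.

Lemma dn_id mu : Im mu <= 0 -> dn mu = mu.
Proof. intros H; unfold dn; rewrite Rmin_right by exact H; destruct mu; reflexivity. Qed.

Lemma ct_dn {U : UniformSpace} (f : U -> C) p : continuous f p -> continuous (fun x => dn (f x)) p.
Proof. intros; unfold dn; ct. Qed.
Lemma ct_ek {U : UniformSpace} (f : U -> C) (g : U -> R) p :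
  continuous f p -> continuous g p -> continuous (fun x => ek (f x) (g x)) p.
Proof.
  intros Hf Hg; unfold ek; apply ct_exp, ct_opp, ct_mult; [|now apply ct_RtoC].
  apply ct_mult; [apply continuous_const|now apply ct_dn].
Qed.

Lemma ek_bound mu y : 0 <= y -> Cmod (ek mu y) <= 1.
Proof.
  intros Hy; unfold ek; rewrite Cmod_Cexp, <- exp_0; apply exp_le.
  unfold dn, Re, Im; simpl. pose proof (Rmin_l 0 (snd mu)). nra.
Qed.

Lemma hat_HH phi mu : Im mu <= 0 -> hat phi mu = HH phi mu.
Proof.
  intros H; unfold hat, HH, J; f_equal; apply functional_extensionality; intros y.
  unfold ek; rewrite dn_id by exact H. f_equal; f_equal; ring.
Qed.

Lemma ek_dom M mu phi : dom M phi -> dom M (fun y => ek mu y * phi y)%C.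
Proof.
  intros H y Hy; rewrite Cmod_mult; specialize (H y Hy); pose proof (ek_bound mu y Hy).
  pose proof (Cmod_ge_0 (phi y)); pose proof (Cmod_ge_0 (ek mu y)). nra.
Qed.

Lemma ek_cont0 mu phi : cont0 phi -> cont0 (fun y => ek mu y * phi y)%C.
Proof.
  intros H; apply (cont0_mult (ek mu) phi); auto. apply cont0_ct; intros r.
  apply (ct_ek (fun _ => mu) (fun r => r)); [apply continuous_const|apply continuous_id].
Qed.

Lemma HH_bound M phi mu : cont0 phi -> dom M phi -> Cmod (HH phi mu) <= M.
Proof. intros; apply J_bound; [now apply ek_cont0|now apply ek_dom]. Qed.

Lemma HH_is M phi mu : cont0 phi -> dom M phi -> is_J (fun y => ek mu y * phi y)%C (HH phi mu).
Proof. intros; apply (J_is M); [now apply ek_cont0|now apply ek_dom]. Qed.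

Lemma ek_jct0 {U : UniformSpace} (F : U -> R -> C) (q : C * U) :
  (forall u, jct0 F u) -> jct0 (fun (q : C * U) y => ek (fst q) y * F (snd q) y)%C q.
Proof.
  intros H r; unfold jct, cl; apply ct_mult; [apply ct_ek; ct|].
  apply (ct_comp2 (fun u r => cl (F u) r)); [intros [? ?]; apply H| |]; ct.
Qed.

Lemma HH_ct2 {U : UniformSpace} (F : U -> R -> C) M (q : C * U) :
  (forall u, jct0 F u) -> (forall u, dom M (F u)) ->
  continuous (fun q : C * U => HH (F (snd q)) (fst q)) q.
Proof.
  intros Hj Hd; unfold HH; apply (J_ct (fun (q : C * U) y => ek (fst q) y * F (snd q) y)%C q M).
  apply filter_forall; intros q'; split; [now apply ek_jct0|]. now apply (ek_dom M (fst q') (F (snd q'))).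
Qed.

Lemma HH_ct phi M mu : cont0 phi -> dom M phi -> continuous (HH phi) mu.
Proof.
  intros Hc Hd.
  apply (ct_comp (fun q : C * R => HH ((fun _ : R => phi) (snd q)) (fst q)) (fun mu => (mu, 0))).
  - intros q; apply (HH_ct2 (fun _ : R => phi) M); auto.
    intros u r; unfold jct; simpl. apply (ct_comp (cl phi) (fun q : R * R => snd q)); auto. ct.
  - apply filterlim_locally; intros e; exists e; intros y Hy; split; [exact Hy|apply ball_center].
Qed.

Lemma J_FTC (f df : R -> C) :
  cont0 f -> cont0 df -> (forall y, 0 < y -> is_derive f y (df y)) ->
  filterlim f (Rbar_locally p_infty) (locally (RtoC 0)) ->
  is_J df (- f 0)%C.
Proof.
  intros Hf Hdf Hd Hl; apply is_J_char; auto; apply lim_Cmod; [apply Rbar_locally_filter|]; intros e He.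
  assert (Ev : Rbar_locally p_infty (fun b => 0 <= b)) by (exists 0; intros; lra).
  generalize (filter_and _ _ Ev (proj1 (lim_Cmod _ _ _) Hl e He)); apply filter_imp.
  intros b [Hb Hfb].
  rewrite (CInt_derive_open (cl f) (cl df)); auto.
  - rewrite !cl_pos by lra. replace (f b - f 0 - - f 0)%C with (f b - 0)%C by ringC. exact Hfb.
  - intros x Hx; rewrite cl_pos by lra.
    apply (is_derive_ext_loc f); [|apply Hd; lra].
    apply locally_pos; [lra|].
    intros t Ht; symmetry; apply cl_pos; lra.
Qed.

Lemma dom_lim M f : dom M f -> filterlim f (Rbar_locally p_infty) (locally (RtoC 0)).
Proof.
  intros Hd; pose proof (dom_pos _ _ Hd) as HM; apply lim_Cmod; [apply Rbar_locally_filter|]; intros e He.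
  destruct (small_tail M e HM He) as [b [Hb Hbe]].
  exists b; intros y Hy; replace (f y - 0)%C with (f y) by ringC.
  eapply Rle_lt_trans; [apply Hd; lra|].
  eapply Rle_lt_trans; [|exact Hbe].
  apply Rmult_le_compat_l; auto. apply Rinv_le_contravar; nra.
Qed.

(** The derivative of e^(-i mu y) phi(y) is integrated over the half-line; writing phi' as phi1 -
    phi produces the multiplier 1 + i mu. *)
Lemma HH_ibp M phi phi1 mu :
  cont0 phi -> dom M phi -> cont0 phi1 -> dom M phi1 ->
  (forall y, 0 < y -> is_derive phi y (phi1 y - phi y)%C) ->
  Im mu <= 0 -> ((1 + Ci * mu) * HH phi mu = phi 0%R + HH phi1 mu)%C.
Proof.
  intros Hc Hd Hc1 Hd1 HD Hmu.
  assert (A : is_J (fun y => ek mu y * phi1 y - (1 + Ci * mu) * (ek mu y * phi y))%C (- (ek mu 0 * phi 0%R))%C).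
  { apply (J_FTC (fun y => ek mu y * phi y)%C).
    - now apply ek_cont0.
    - apply (cont0_minus (fun y => ek mu y * phi1 y)%C (fun y => (1 + Ci * mu) * (ek mu y * phi y))%C).
      + now apply ek_cont0.
      + apply (cont0_scal (1 + Ci * mu)%C (fun y => ek mu y * phi y)%C); now apply ek_cont0.
    - intros y Hy; unfold ek; rewrite dn_id by exact Hmu.
      pose proof (HD y Hy). dr. ringC.
    - apply (dom_lim M); now apply ek_dom. }
  pose proof (is_J_minus _ _ _ _ (HH_is M phi1 mu Hc1 Hd1) (is_J_scal (1 + Ci * mu)%C _ _ (HH_is M phi mu Hc Hd))) as B.
  apply is_J_unique in A; apply is_J_unique in B; rewrite A in B.
  unfold ek in B; replace (- (Ci * dn mu * RtoC 0))%C with (RtoC 0) in B by ringC; rewrite Cexp_0 in B.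
  replace (phi 0%R) with (- - (1 * phi 0%R))%C by ringC. rewrite B; ringC.
Qed.

(** The inverse multiplier of d/dy + 1. Unlike 1/(i mu) it is bounded on the closed lower
    half-plane, its only pole being mu = i, so that expansions at infinity need no separate
    treatment near 0. *)
Definition rho (mu : C) : C := (/ (1 + Ci * mu))%C.

Lemma rho_den mu : Im mu <= 0 -> 1 + Cmod mu ^ 2 <= Cmod (1 + Ci * mu) ^ 2.
Proof.
  intros H; rewrite !Cmod2_alt; destruct mu as [a b]; unfold Im in *; simpl in *. nra.
Qed.
Lemma rho_nz mu : Im mu <= 0 -> (1 + Ci * mu)%C <> 0%C.
Proof.
  intros H E; pose proof (rho_den mu H) as D; rewrite E, Cmod_0 in D.
  pose proof (pow2_ge_0 (Cmod mu)). lra.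
Qed.
Lemma rho_bound mu : Im mu <= 0 -> Cmod (rho mu) <= 2 / (1 + Cmod mu).
Proof.
  intros H; unfold rho; rewrite Cmod_inv by now apply rho_nz.
  pose proof (rho_den mu H) as D; pose proof (Cmod_ge_0 mu); pose proof (Cmod_ge_0 (1 + Ci * mu)%C).
  set (a := Cmod mu) in *; set (b := Cmod (1 + Ci * mu)%C) in *.
  assert (H2 : (1 + a) / 2 <= b) .
  { apply Rsqr_incr_0_var; [|assumption]; unfold Rsqr. pose proof (pow2_ge_0 (1 - a)); lra || nra. }
  replace (2 / (1 + a)) with (/ ((1 + a) / 2)) by (field; lra).
  apply Rinv_le_contravar; lra.
Qed.
Lemma rho_ct (z : C) : (1 + Ci * z)%C <> 0%C -> continuous rho z.
Proof. intros H; unfold rho; apply ct_inv; [ct|exact H]. Qed.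
Lemma rho_hol (z : C) : (1 + Ci * z)%C <> 0%C -> hol rho (fun z => - Ci * (rho z * rho z))%C z.
Proof.
  intros H; unfold rho; eapply hol_eq; [eapply (hol_inv (fun z => 1 + Ci * z)%C); [exact H|hol]|]. cbv beta; ringC.
Qed.

(* [jets n phi M]: [phi k] is the [k]-th iterate of the operator [d/dy + 1], which
   the transform turns into multiplication by [1 + i mu] (up to boundary terms). *)
Definition jets (n : nat) (phi : nat -> R -> C) (M : R) : Prop :=
  (forall k, (k <= n)%nat -> cont0 (phi k) /\ dom M (phi k)) /\
  forall k, (k < n)%nat -> forall y, 0 < y -> is_derive (phi k) y (phi (S k) y - phi k y)%C.

Lemma HH_jet n phi M k mu :
  jets n phi M -> (k < n)%nat -> Im mu <= 0 ->
  HH (phi k) mu = (rho mu * (phi k 0%R + HH (phi (S k)) mu))%C.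
Proof.
  intros [H1 H2] Hk Hmu.
  destruct (H1 k) as [C1 D1]; [lia|]. destruct (H1 (S k)) as [C2 D2]; [lia|].
  rewrite <- (HH_ibp M (phi k) (phi (S k)) mu); auto.
  unfold rho; field. now apply rho_nz.
Qed.

(** Each vanishing jet at the boundary removes one boundary term and gains one factor [rho]. *)
Lemma HH_jets_van n phi M mu :
  jets n phi M -> (forall k, (k < n)%nat -> phi k 0%R = RtoC 0) -> Im mu <= 0 ->
  HH (phi O) mu = (rho mu ^ n * HH (phi n) mu)%C.
Proof.
  intros HJ H0 Hmu.
  assert (P : forall k, (k <= n)%nat -> HH (phi O) mu = (rho mu ^ k * HH (phi k) mu)%C).
  { induction k; intros Hk.
    - simpl; ringC.
    - rewrite IHk by lia. rewrite (HH_jet n phi M k mu) by (auto; lia). rewrite H0 by lia. simpl; ringC. }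
  apply P; lia.
Qed.

(** * Polynomial growth against exponential decay *)

(** With m = min(1, c/k) one has m (1 + r) <= 1 + c r / k <= e^(c r / k); the k-th power of this is
    the claim. *)
Lemma exp_poly c k r : 0 < c -> (0 < k)%nat -> 0 <= r ->
  (1 + r) ^ k * exp (- (c * r)) <= / (Rmin 1 (c / INR k)) ^ k.
Proof.
  intros Hc Hk Hr.
  assert (HkR : 0 < INR k) by (apply lt_0_INR; lia).
  set (m := Rmin 1 (c / INR k)).
  assert (Hck : 0 < c / INR k) by (apply Rdiv_lt_0_compat; lra).
  assert (Hm : 0 < m) by (unfold m; apply Rmin_glb_lt; lra).
  assert (H1 : (m * (1 + r)) ^ k <= exp (c * r)).
  { replace (exp (c * r)) with ((exp (c * r / INR k)) ^ k).
    - apply pow_incr; split; [nra|].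
      eapply Rle_trans; [|apply exp_ineq1_le].
      pose proof (Rmin_l 1 (c / INR k)); pose proof (Rmin_r 1 (c / INR k)); fold m in H, H0.
      unfold Rdiv in *. nra.
    - assert (P : forall n x, exp x ^ n = exp (INR n * x)).
      { induction n; intros x; [simpl; rewrite Rmult_0_l, exp_0; auto|].
        rewrite S_INR; simpl; rewrite IHn, <- exp_plus; f_equal; ring. }
      rewrite P; f_equal; field; lra. }
  rewrite Rpow_mult_distr in H1.
  assert (Hmk : 0 < m ^ k) by now apply pow_lt.
  apply (Rmult_le_reg_l (m ^ k)); auto. rewrite Rinv_r by lra.
  rewrite exp_Ropp, <- Rmult_assoc. pose proof (exp_pos (c * r)).
  apply (Rmult_le_reg_r (exp (c * r))); auto. rewrite Rmult_assoc, Rinv_l by lra. lra.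
Qed.

Lemma expdom c n : 0 < c -> exists M, 0 <= M /\ forall c' r, c <= c' -> 0 <= r ->
  (1 + r) ^ n * exp (- (c' * r)) <= M / (1 + r) ^ 2.
Proof.
  intros Hc; exists (/ (Rmin 1 (c / INR (n + 2))) ^ (n + 2)).
  assert (HkR : 0 < INR (n + 2)) by (apply lt_0_INR; lia).
  split.
  - left; apply Rinv_0_lt_compat, pow_lt, Rmin_glb_lt; [lra|]. apply Rdiv_lt_0_compat; lra.
  - intros c' r Hcc Hr.
    pose proof (exp_poly c (n + 2) r Hc ltac:(lia) Hr) as H.
    rewrite pow_add in H. assert (0 < (1 + r) ^ 2) by nra.
    apply (Rmult_le_reg_r ((1 + r) ^ 2)); auto.
    unfold Rdiv; rewrite (Rmult_assoc (/ _)), Rinv_l, Rmult_1_r by lra.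
    eapply Rle_trans; [|exact H].
    assert (exp (- (c' * r)) <= exp (- (c * r))) by (apply exp_le; nra).
    assert (0 <= (1 + r) ^ n) by (apply pow_le; lra).
    replace ((1 + r) ^ n * exp (- (c' * r)) * (1 + r) ^ 2) with ((1 + r) ^ n * (1 + r) ^ 2 * exp (- (c' * r))) by ring.
    apply Rmult_le_compat_l; auto. apply Rmult_le_pos; lra.
Qed.

(** * The dispersion relation *)

Lemma omega_eq l : omega l = ((Ci * l) ^ 3)%C.
Proof.
  unfold omega. destruct l as [a b]; unfold Ci, Cmult, Copp; simpl. unfold Cmult; simpl. f_equal; ring.
Qed.

Lemma ex_pow3 th : (ex th ^ 3 = ex (3 * th))%C.
Proof. replace (3 * th) with (th + (th + th)) by ring; rewrite !ex_plus; simpl; ring. Qed.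

Lemma omega_pol r th : omega (pol r th) = (r ^ 3 * sin (3 * th), - (r ^ 3 * cos (3 * th))).
Proof.
  unfold omega, pol. replace (RtoC r * ex th)%C with (ex th * RtoC r)%C by ring.
  replace ((ex th * RtoC r) ^ 3)%C with (RtoC (r ^ 3) * ex th ^ 3)%C.
  - rewrite ex_pow3, ex_eq. unfold Cmult, Copp, Ci, RtoC; simpl; f_equal; ring.
  - rewrite RtoC_pow. simpl; ring.
Qed.

Lemma ct_omega {U : UniformSpace} (f : U -> C) p : continuous f p -> continuous (fun x => omega (f x)) p.
Proof. intros; unfold omega; ct. Qed.

Lemma omega_hol z : hol omega (fun z => - Ci * (3 * (z * z)))%C z.
Proof. unfold omega; eapply hol_eq; [hol|]. cbv beta; replace (INR 3) with 3 by (simpl; ring); simpl; ringC. Qed.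

Definition Kx (x : R) (l : C) : C := Cexp (Ci * l * RtoC x).

Lemma Kx_mod x r th : Cmod (Kx x (pol r th)) = exp (- (x * (r * sin th))).
Proof. unfold Kx; rewrite Cmod_Cexp, pol_eq; f_equal; unfold Re; simpl; ring. Qed.
Lemma ct_Kx {U : UniformSpace} (g : U -> R) (f : U -> C) p :
  continuous g p -> continuous f p -> continuous (fun x => Kx (g x) (f x)) p.
Proof. intros; unfold Kx; ct. Qed.
Lemma Kx_hol x z : hol (Kx x) (fun z => Ci * RtoC x * Kx x z)%C z.
Proof. unfold Kx; eapply hol_eq; [hol|]. cbv beta; ringC. Qed.

Ltac ctx1 :=
  lazymatch goal with
  | |- continuous (fun z => Kx (@?g z) (@?f z)) _ => apply (ct_Kx g f)
  | |- continuous (Kx ?x) ?p => apply (ct_Kx (fun _ => x) (fun z => z))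
  | |- continuous (fun z => omega (@?f z)) _ => apply (ct_omega f)
  | |- continuous omega ?p => apply (ct_omega (fun z => z))
  | |- continuous (fun z => pol (@?g z) (@?f z)) _ => apply (ct_pol g f)
  | |- continuous (fun z => ex (@?f z)) _ => apply (ct_ex f)
  | |- continuous (fun z => ek (@?f z) (@?g z)) _ => apply (ct_ek f g)
  | |- continuous (fun z => dn (@?f z)) _ => apply (ct_dn f)
  | |- _ => ct1
  end.
Ltac ctx := repeat ctx1.

Ltac holx1 :=
  lazymatch goal with
  | |- hol (fun z => omega z) _ _ => apply omega_hol
  | |- hol (fun z => Kx ?x z) _ _ => apply Kx_hol
  | |- hol (fun z => rho z) _ _ => apply rho_hol
  | |- _ => hol1
  end.
Ltac holx := repeat holx1.

(** * Fourier inversion on the half-line *)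

Lemma ray_rot G t1 t2 x B :
  CI G t1 t2 -> 0 < x -> 0 <= t1 <= t2 -> t2 <= PI -> 0 <= B ->
  (forall r th, 0 <= r -> t1 <= th <= t2 -> continuous G (pol r th)) ->
  (forall r th, 1 <= r -> t1 <= th <= t2 -> Cmod (G (pol r th)) <= B / r * exp (- (x * (r * sin th)))) ->
  forall I, ray G t2 I <-> ray G t1 I.
Proof.
  intros HC Hx Ht HPI HB Hc Hb I; apply (ray_rot_gen G t1 t2); auto.
  - intros r Hr; apply Hc; lra.
  - intros r Hr; apply Hc; lra.
  - now apply (jordan G t1 t2 x B).
Qed.

(** The two parts of the closed upper half-plane on which Re omega >= 0. They are what the interior
    of Omega^- leaves over, and integrals containing e^(-omega t) are rotated only inside them. *)
Definition sector_ok (t1 t2 : R) : Prop :=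
  (0 <= t1 <= t2 /\ t2 <= PI / 3) \/ (2 * PI / 3 <= t1 <= t2 /\ t2 <= PI).

Lemma sector_ok_range t1 t2 : sector_ok t1 t2 -> 0 <= t1 <= t2 /\ t2 <= PI.
Proof. pose proof PI_RGT_0; intros [H1|H1]; lra. Qed.

Lemma sin3_pos t1 t2 th : sector_ok t1 t2 -> t1 <= th <= t2 -> 0 <= sin (3 * th).
Proof.
  pose proof PI_RGT_0; intros [H1|H1] H2.
  - apply sin_ge_0; lra.
  - replace (3 * th) with ((3 * th - 2 * PI) + 2 * PI) by ring.
    rewrite sin_plus, sin_2PI, cos_2PI.
    assert (0 <= sin (3 * th - 2 * PI)) by (apply sin_ge_0; lra). lra.
Qed.

Lemma omega_decay r th t : 0 <= r -> 0 <= t -> 0 <= sin (3 * th) -> Cmod (Cexp (- (omega (pol r th) * RtoC t))) <= 1.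
Proof.
  intros Hr Ht Hs; rewrite Cmod_Cexp, omega_pol, <- exp_0; apply exp_le; unfold Re; simpl.
  assert (0 <= r * (r * (r * 1)) * sin (3 * th)) by (apply Rmult_le_pos; auto; repeat apply Rmult_le_pos; lra).
  nra.
Qed.

Lemma cos_half t1 t2 th : sector_ok t1 t2 -> t1 <= th <= t2 -> 1 / 2 <= Rabs (cos th).
Proof.
  pose proof PI_RGT_0; intros [H1|H1] H2.
  - assert (cos (PI / 3) <= cos th).
    { apply cos_decr_1; lra. }
    rewrite cos_PI3 in *. rewrite Rabs_pos_eq; lra.
  - assert (cos th <= cos (2 * (PI / 3))).
    { apply cos_decr_1; lra. }
    rewrite cos_2PI3 in *. rewrite Rabs_left1; lra.
Qed.

Lemma rho_pol_nz r th : cos th <> 0 -> (1 + Ci * pol r th)%C <> 0%C.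
Proof.
  intros Hc E; rewrite pol_eq in E; unfold Ci, Cmult, Cplus, RtoC in E; simpl in E.
  injection E; intros E2 E1.
  assert (r * cos th = 0) by lra. destruct (Rmult_integral _ _ H); [subst r; lra|contradiction].
Qed.

Lemma rhoc_pol_nz r th : cos th <> 0 -> (1 - Ci * pol r th)%C <> 0%C.
Proof.
  intros Hc E; rewrite pol_eq in E; unfold Ci, Cmult, Cminus, Copp, Cplus, RtoC in E; simpl in E.
  injection E; intros E2 E1.
  assert (r * cos th = 0) by lra. destruct (Rmult_integral _ _ H); [subst r; lra|contradiction].
Qed.

(** The pole i of [rho] lies between the two sectors; |cos th| >= 1/2 on them keeps |1 + i z| at
    least r/2. *)
Lemma rho_pol_bound r th t1 t2 : sector_ok t1 t2 -> t1 <= th <= t2 -> 1 <= r -> Cmod (rho (pol r th)) <= 2 / r.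
Proof.
  intros Hs Hth Hr; pose proof (cos_half _ _ _ Hs Hth) as Hc.
  assert (Hc0 : cos th <> 0) by (intros E; rewrite E, Rabs_R0 in Hc; lra).
  unfold rho; rewrite Cmod_inv by now apply rho_pol_nz.
  replace (2 / r) with (/ (r / 2)) by (field; lra).
  apply Rinv_le_contravar; [lra|].
  eapply Rle_trans; [|apply (Rle_trans _ _ _ (Rmax_r _ _) (Rmax_Cmod _))].
  rewrite pol_eq; simpl.
  replace (0 + (0 * (r * sin th) + 1 * (r * cos th))) with (r * cos th) by ring.
  rewrite Rabs_mult, (Rabs_pos_eq r) by lra. nra.
Qed.

(** Provides the open angular range that [sector_identity] asks for: the pole of [rho] has argument
    pi/2, where the cosine vanishes. *)
Lemma cos_nz_sector t1 t2 : sector_ok t1 t2 ->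
  exists a b, a < t1 /\ t2 < b /\ forall th, a < th < b -> cos th <> 0.
Proof.
  pose proof PI_RGT_0; intros [H1|H1].
  - exists (- (PI / 2)), (PI / 2); repeat split; try lra.
    intros th Hth; pose proof (cos_gt_0 th). lra.
  - exists (PI / 2), (3 * (PI / 2)); repeat split; try lra.
    intros th Hth; pose proof (cos_lt_0 th). lra.
Qed.

Lemma rho_rot x t t1 t2 I :
  0 < x -> 0 <= t -> sector_ok t1 t2 ->
  ray (fun l => Kx x l * Cexp (- (omega l * RtoC t)) * rho l)%C t2 I <->
  ray (fun l => Kx x l * Cexp (- (omega l * RtoC t)) * rho l)%C t1 I.
Proof.
  intros Hx Ht Hs; pose proof (sector_ok_range _ _ Hs) as Hr.
  destruct (cos_nz_sector _ _ Hs) as [a [b [Ha [Hb Hab]]]].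
  assert (CG : forall z, (1 + Ci * z)%C <> 0%C ->
    continuous (fun l => Kx x l * Cexp (- (omega l * RtoC t)) * rho l)%C z).
  { intros z Hz; apply ct_mult; [ctx|now apply rho_ct]. }
  apply (ray_rot _ t1 t2 x 2); try lra.
  - eapply (sector_identity _ _ a b); try lra.
    intros r th Hr0 Hth; pose proof (rho_pol_nz r th (Hab th Hth)) as Hz; split; [|split].
    + holx; exact Hz.
    + now apply CG.
    + ctx; now apply rho_ct.
  - intros r th Hr0 Hth; apply CG, rho_pol_nz, Hab; lra.
  - intros r th Hr1 Hth; rewrite !Cmod_mult, Kx_mod.
    pose proof (omega_decay r th t ltac:(lra) Ht (sin3_pos _ _ _ Hs Hth)) as D1.
    pose proof (rho_pol_bound r th t1 t2 Hs Hth Hr1) as D2.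
    pose proof (exp_pos (- (x * (r * sin th)))).
    pose proof (Cmod_ge_0 (Cexp (- (omega (pol r th) * RtoC t)))). pose proof (Cmod_ge_0 (rho (pol r th))).
    rewrite (Rmult_comm (2 / r)), Rmult_assoc. apply Rmult_le_compat_l; [lra|]. nra.
Qed.

(** The companion of [rho] with its pole at -i. Holomorphic in the upper half-plane, it contributes
    nothing to the line integral, and it completes [rho] to the even kernel 1/(1 + i l) + 1/(1 - i
    l) = 2/(1 + l^2). *)
Definition rhoc (l : C) : C := (/ (1 - Ci * l))%C.

Lemma rhoc_nz r th : 0 <= r -> - (PI / 2) < th < 3 * (PI / 2) -> (1 - Ci * pol r th)%C <> 0%C.
Proof.
  intros Hr Hth.
  destruct (Rtotal_order th (PI / 2)) as [H|[H|H]].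
  - apply rhoc_pol_nz. pose proof (cos_gt_0 th). lra.
  - subst th; rewrite pol_eq, sin_PI2, cos_PI2; unfold Ci, Cmult, Cminus, Copp, Cplus, RtoC; simpl.
    intros E; injection E; lra.
  - apply rhoc_pol_nz. pose proof (cos_lt_0 th). lra.
Qed.

Lemma rhoc_pol_bound r th : 1 <= r -> 0 <= th <= PI -> Cmod (rhoc (pol r th)) <= 1 / r.
Proof.
  intros Hr Hth; pose proof PI_RGT_0.
  unfold rhoc; rewrite Cmod_inv by (apply rhoc_nz; lra).
  unfold Rdiv; rewrite Rmult_1_l; apply Rinv_le_contravar; [lra|].
  apply Rsqr_incr_0_var; [|apply Cmod_ge_0].
  rewrite !Rsqr_pow2, Cmod2_alt, pol_eq; unfold Re, Im; simpl.
  pose proof (sin_ge_0 th ltac:(lra) ltac:(lra)). pose proof (sin2_cos2 th) as S; unfold Rsqr in S.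
  assert (0 <= r * sin th) by nra.
  replace (r * (r * 1)) with (r * r * (sin th * sin th + cos th * cos th)) by (rewrite S; ring). nra.
Qed.

Lemma rhoc_rot x t1 t2 I :
  0 < x -> 0 <= t1 <= t2 -> t2 <= PI ->
  ray (fun l => Kx x l * rhoc l)%C t2 I <-> ray (fun l => Kx x l * rhoc l)%C t1 I.
Proof.
  intros Hx Ht H2; pose proof PI_RGT_0.
  assert (CG : forall z, (1 - Ci * z)%C <> 0%C -> continuous (fun l => Kx x l * rhoc l)%C z).
  { intros z Hz; unfold rhoc; ctx; exact Hz. }
  apply (ray_rot _ t1 t2 x 1); try lra.
  - eapply (sector_identity _ _ (- (PI / 2)) (3 * (PI / 2))); try lra.
    intros r th Hr0 Hth; pose proof (rhoc_nz r th Hr0 Hth) as Hz; split; [|split].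
    + unfold rhoc; holx; exact Hz.
    + now apply CG.
    + ctx; exact Hz.
  - intros r th Hr0 Hth; apply CG, rhoc_nz; lra.
  - intros r th Hr1 Hth; rewrite !Cmod_mult, Kx_mod, Rmult_comm.
    apply Rmult_le_compat_r; [left; apply exp_pos|]. apply rhoc_pol_bound; lra.
Qed.

Lemma ray_dom x th (g : R -> C) B m :
  0 < x -> 0 < sin th -> (forall r, 0 <= r -> Cmod (g r) <= B * (1 + r) ^ m) ->
  exists M, forall x', x <= x' -> dom M (fun r => Kx x' (pol r th) * g r)%C.
Proof.
  intros Hx Hs Hg.
  destruct (expdom (x * sin th) m) as [M [HM HE]]; [nra|].
  assert (HB : 0 <= B).
  { specialize (Hg 0 (Rle_refl 0)); rewrite Rplus_0_r, pow1 in Hg; pose proof (Cmod_ge_0 (g 0)); lra. }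
  exists (B * M); intros x' Hx' r Hr; rewrite Cmod_mult, Kx_mod.
  specialize (HE (x' * sin th) r ltac:(nra) Hr); specialize (Hg r Hr).
  replace (x' * (r * sin th)) with (x' * sin th * r) by ring.
  pose proof (exp_pos (- (x' * sin th * r))).
  apply (Rle_trans _ (exp (- (x' * sin th * r)) * (B * (1 + r) ^ m))); [apply Rmult_le_compat_l; lra|].
  unfold Rdiv in *; rewrite (Rmult_assoc B). replace (exp (- (x' * sin th * r)) * (B * (1 + r) ^ m)) with
    (B * ((1 + r) ^ m * exp (- (x' * sin th * r)))) by ring.
  now apply Rmult_le_compat_l.
Qed.

Lemma ray_jct0 th (g : R -> C) x : cont0 g -> jct0 (fun x r => Kx x (pol r th) * g r)%C x.
Proof.
  intros Hg r; unfold jct, cl; apply ct_mult; [ctx|].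
  apply (ct_comp (cl g) (fun q : R * R => snd q)); [exact Hg|ct].
Qed.

Lemma ray_dx x th (g : R -> C) B m :
  0 < x -> 0 < sin th -> cont0 g -> (forall r, 0 <= r -> Cmod (g r) <= B * (1 + r) ^ m) ->
  is_derive (fun x => J (fun r => Kx x (pol r th) * g r)%C) x
            (J (fun r => Kx x (pol r th) * (Ci * pol r th * g r))%C).
Proof.
  intros Hx Hs Hc Hg.
  assert (Hc' : cont0 (fun r => Ci * pol r th * g r)%C).
  { apply (cont0_mult (fun r => Ci * pol r th)%C g); auto. apply cont0_ct; intros; ctx. }
  assert (Hg' : forall r, 0 <= r -> Cmod (Ci * pol r th * g r) <= B * (1 + r) ^ S m).
  { intros r Hr; rewrite !Cmod_mult, Cmod_Ci, Cmod_pol by auto; specialize (Hg r Hr).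
    pose proof (Cmod_ge_0 (g r)). simpl. nra. }
  (* Half of x is given up so that one domination serves a whole neighbourhood of x. *)
  destruct (ray_dom (x / 2) th g B m) as [M1 HM1]; try lra; auto.
  destruct (ray_dom (x / 2) th _ B (S m) ltac:(lra) Hs Hg') as [M2 HM2].
  apply (J_dr (fun x r => Kx x (pol r th) * g r)%C (fun x r => Kx x (pol r th) * (Ci * pol r th * g r))%C x (Rmax M1 M2)).
  apply (filter_imp (fun y => x / 2 < y)); [|apply (open_gt (x / 2)); lra].
  intros y Hy; split; [|split].
  - split; [now apply ray_jct0|]. apply (dom_le M1); [apply HM1; lra|apply Rmax_l].
  - split; [apply (ray_jct0 th (fun r => Ci * pol r th * g r)%C); exact Hc'|].
    apply (dom_le M2); [apply HM2; lra|apply Rmax_r].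
  - intros r Hr; unfold Kx; dr. ringC.
Qed.

Lemma Kx_0r x th : Kx x (pol 0 th) = RtoC 1.
Proof. unfold Kx, pol; replace (Ci * (0 * ex th) * RtoC x)%C with (RtoC 0) by ringC. apply Cexp_0. Qed.

(** The value is independent of the angle, so such terms cancel between two rays. *)
Lemma ray_Kx x th : 0 < x -> 0 < sin th -> ray (Kx x) th (Ci / RtoC x)%C.
Proof.
  intros Hx Hs.
  assert (Hx0 : RtoC x <> 0%C) by (intros E; injection E; lra).
  assert (Hi : Ci <> 0%C) by (unfold Ci; intros E; injection E; lra).
  replace (Ci / RtoC x)%C with (- (Kx x (pol 0 th) * / (Ci * RtoC x)))%C.
  2: { rewrite Kx_0r. 
       replace (- (1 * / (Ci * RtoC x)))%C with (- / (Ci * RtoC x))%C by ringC.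
       assert (E : (Ci * Ci = - 1)%C) by (unfold Ci, Cmult, Copp, RtoC; simpl; f_equal; ring).
       replace (Ci / RtoC x)%C with (Ci * Ci * / (Ci * RtoC x))%C by (field; split; assumption).
       rewrite E; ringC. }
  destruct (ray_dom x th (fun _ => / (Ci * RtoC x))%C (Cmod (/ (Ci * RtoC x))) 0 Hx Hs) as [M HM].
  { intros; simpl; lra. }
  apply (J_FTC (fun r => Kx x (pol r th) * / (Ci * RtoC x))%C).
  - apply cont0_ct; intros; ctx.
  - apply cont0_ct; intros. apply ct_mult; [|ct]. apply (ct_Kx (fun _ => x) (fun r => RtoC r * ex th)%C); ctx.
  - intros y Hy; unfold Kx, pol; dr. field; split; assumption.
  - apply (dom_lim M), HM; lra.
Qed.

Lemma sin_PI3_pos : 1 / 2 < sin (PI / 3).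
Proof.
  rewrite sin_PI3. pose proof (sqrt_lt_1 1 3 ltac:(lra) ltac:(lra) ltac:(lra)) as H. rewrite sqrt_1 in H. lra.
Qed.
Lemma sin_2PI3_eq : sin (2 * PI / 3) = sin (PI / 3).
Proof. replace (2 * PI / 3) with (PI - PI / 3) by field. apply sin_PI_x. Qed.

Lemma rho_gamma_bound th r : th = PI / 3 \/ th = 2 * PI / 3 -> 0 <= r -> Cmod (rho (pol r th) * ex th) <= 6 * (1 + r) ^ 0.
Proof.
  intros Hth Hr; rewrite Cmod_mult, Cmod_ex. simpl.
  assert (Hc : Rabs (cos th) = 1 / 2 /\ 0 <= sin th).
  { destruct Hth as [->| ->].
    - rewrite cos_PI3, Rabs_pos_eq by lra. split; [reflexivity|]. pose proof sin_PI3_pos; lra.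
    - replace (cos (2 * PI / 3)) with (cos (2 * (PI / 3))) by (f_equal; field). rewrite cos_2PI3, Rabs_left1 by lra.
      split; [lra|]. rewrite sin_2PI3_eq; pose proof sin_PI3_pos; lra. }
  destruct Hc as [Hc Hs].
  assert (Hc0 : cos th <> 0) by (intros E; rewrite E, Rabs_R0 in Hc; lra).
  unfold rho; rewrite Cmod_inv by now apply rho_pol_nz.
  (* The rays of Gamma stay at distance 1/2 from the pole i; the cruder 1/6 is enough. *)
  assert (Hl : / 6 <= Cmod (1 + Ci * pol r th)).
  { assert (Hc2 : cos th * cos th = 1 / 4).
    { transitivity (Rabs (cos th) * Rabs (cos th)); [|rewrite Hc; lra].
      rewrite <- Rabs_mult, Rabs_pos_eq; [reflexivity|]. apply Rle_0_sqr. }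
    pose proof (sin2_cos2 th) as S; unfold Rsqr in S.
    apply Rsqr_incr_0_var; [|apply Cmod_ge_0].
    rewrite !Rsqr_pow2, Cmod2_alt, pol_eq; unfold Re, Im; simpl.
    set (s := sin th) in *; set (c := cos th) in *.
    assert (s * s = 3 / 4) by lra.
    assert (A : (1 + (0 * (r * c) - 1 * (r * s))) * ((1 + (0 * (r * c) - 1 * (r * s))) * 1) +
       (0 + (0 * (r * s) + 1 * (r * c))) * ((0 + (0 * (r * s) + 1 * (r * c))) * 1) = 1 - 2 * (r * s) + r * r * (s * s + c * c)) by ring.
    rewrite A. assert (0 <= (s * s) * (r * r) - 2 * (r * s) + 1) by (pose proof (Rle_0_sqr (r * s - 1)); unfold Rsqr in *; nra).
    assert (0 <= (r - s) * (r - s)) by apply Rle_0_sqr.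
    nra. }
  replace 6 with (/ / 6) by field. rewrite !Rmult_1_r. apply Rinv_le_contravar; lra.
Qed.

Definition Egam (th x : R) : C := J (fun r => Kx x (pol r th) * (rho (pol r th) * ex th))%C.

Lemma gam_cos th : th = PI / 3 \/ th = 2 * PI / 3 -> cos th <> 0 /\ 0 < sin th.
Proof.
  pose proof sin_PI3_pos; intros [->| ->]; split.
  - rewrite cos_PI3; lra.
  - lra.
  - replace (2 * PI / 3) with (2 * (PI / 3)) by field. rewrite cos_2PI3; lra.
  - rewrite sin_2PI3_eq; lra.
Qed.

Lemma rho_gamma_cont0 th : th = PI / 3 \/ th = 2 * PI / 3 -> cont0 (fun r => rho (pol r th) * ex th)%C.
Proof.
  intros Hth; destruct (gam_cos th Hth) as [Hc _].
  apply cont0_ct; intros r; unfold rho; ctx. now apply rho_pol_nz.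
Qed.

(** From i z rho(z) = 1 - rho(z): the derivative is the angle-independent integral of [ray_Kx] minus
    [Egam] itself, so the difference over the two rays of Gamma satisfies E' = -E. *)
Lemma Egam_dr th x : th = PI / 3 \/ th = 2 * PI / 3 -> 0 < x ->
  is_derive (Egam th) x (Ci / RtoC x - Egam th x)%C.
Proof.
  intros Hth Hx; destruct (gam_cos th Hth) as [Hc Hs].
  eapply dr_eq; [apply (ray_dx x th (fun r => rho (pol r th) * ex th)%C 6 0); auto|].
  - now apply rho_gamma_cont0.
  - intros r Hr; now apply rho_gamma_bound.
  - destruct (ray_dom x th (fun r => rho (pol r th) * ex th)%C 6 0 Hx Hs) as [M HM].
    { intros r Hr; now apply rho_gamma_bound. }
    apply is_J_unique.
    apply (is_J_ext (fun r => Kx x (pol r th) * ex th - Kx x (pol r th) * (rho (pol r th) * ex th))%C).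
    + intros r Hr; unfold rho. field. now apply rho_pol_nz.
    + unfold Egam; apply (is_J_minus (fun r => Kx x (pol r th) * ex th)%C (fun r => Kx x (pol r th) * (rho (pol r th) * ex th))%C);
        [exact (ray_Kx x th Hx Hs)|].
      apply (J_is M); [|apply HM; lra].
      apply (cont0_mult (fun r => Kx x (pol r th))); [apply cont0_ct; intros; ctx|now apply rho_gamma_cont0].
Qed.

Lemma Egam_ray th x : th = PI / 3 \/ th = 2 * PI / 3 -> 0 < x ->
  ray (fun l => Kx x l * rho l)%C th (Egam th x).
Proof.
  intros Hth Hx; destruct (gam_cos th Hth) as [Hc Hs].
  destruct (ray_dom x th (fun r => rho (pol r th) * ex th)%C 6 0 Hx Hs) as [M HM].
  { intros r Hr; now apply rho_gamma_bound. }
  apply (is_J_ext (fun r => Kx x (pol r th) * (rho (pol r th) * ex th))%C).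
  - intros r _; unfold pol; ringC.
  - apply (J_is M); [|apply HM; lra].
    apply (cont0_mult (fun r => Kx x (pol r th))); [apply cont0_ct; intros; ctx|now apply rho_gamma_cont0].
Qed.

Lemma ray_ext F G th I : (forall r, 0 <= r -> F (pol r th) = G (pol r th)) -> ray F th I -> ray G th I.
Proof. intros E; apply is_J_ext; intros r Hr; fold (pol r th); now rewrite E. Qed.

Lemma rho_rot0 x t1 t2 I :
  0 < x -> sector_ok t1 t2 -> ray (fun l => Kx x l * rho l)%C t2 I <-> ray (fun l => Kx x l * rho l)%C t1 I.
Proof.
  intros Hx Hs.
  assert (E : forall l, (Kx x l * Cexp (- (omega l * RtoC 0)) * rho l = Kx x l * rho l)%C).
  { intros l; replace (- (omega l * RtoC 0))%C with (RtoC 0) by ringC; rewrite Cexp_0; ringC. }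
  pose proof (rho_rot x 0 t1 t2 I Hx (Rle_refl 0) Hs) as H.
  assert (Q : forall th K, ray (fun l => Kx x l * Cexp (- (omega l * RtoC 0)) * rho l)%C th K <->
                           ray (fun l => Kx x l * rho l)%C th K).
  { intros th K; split; apply ray_ext; intros; [apply E|symmetry; apply E]. }
  rewrite !Q in H; exact H.
Qed.

Lemma cos_kernel_J : is_J (fun r => RtoC (4 / (1 + r ^ 2))) (RtoC (2 * PI)).
Proof.
  (* The primitive 4 (arctan r - pi/2) is normalised to vanish at infinity, as [J_FTC] requires. *)
  replace (RtoC (2 * PI)) with (- RtoC (4 * (atan 0 - PI / 2)))%C
    by (rewrite atan_0, <- RtoC_opp; f_equal; field).
  apply (J_FTC (fun r => RtoC (4 * (atan r - PI / 2)))).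
  - apply cont0_ct; intros r. apply ct_RtoC, rct_mult; [ct|]. apply rct_minus; [|ct]. apply continuous_atan.
  - apply cont0_ct; intros r. ct. pose proof (pow2_ge_0 r). lra.
  - intros y _. apply (dr_RtoC (fun r => 4 * (atan r - PI / 2)) y (4 / (1 + y ^ 2))).
    eapply rdr_eq; [apply (rdr_mult (fun _ => 4)); [apply rdr_const|]|].
    + apply (rdr_minus atan (fun _ => PI / 2)); [apply is_derive_atan|apply rdr_const].
    + cbv beta. rewrite <- Rsqr_pow2; field. pose proof (Rle_0_sqr y); lra.
  - apply lim_Cmod; [apply Rbar_locally_filter|]; intros e He.
    assert (L : forall y, 0 < y -> Rabs (4 * (atan y - PI / 2)) <= 4 / y).
    { intros y Hy. assert (Hi : 0 < / y) by now apply Rinv_0_lt_compat.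
      replace (atan y - PI / 2) with (- atan (/ y)) by (rewrite atan_inv by auto; ring).
      assert (0 < atan (/ y)) by (rewrite <- atan_0; now apply atan_increasing).
      assert (atan (/ y) <= / y).
      { destruct (MVT_gen atan 0 (/ y) (fun x => / (1 + x ^ 2))) as [c [Hc E]].
        - intros x _. eapply rdr_eq; [apply is_derive_atan|]. rewrite <- Rsqr_pow2; reflexivity.
        - intros; apply continuity_pt_filterlim, continuous_atan.
        - rewrite atan_0 in E. assert (/ (1 + c ^ 2) <= 1).
          { rewrite <- Rinv_1. apply Rinv_le_contravar; [lra|]. pose proof (pow2_ge_0 c); lra. }
          nra. }
      rewrite Rabs_left1 by lra. unfold Rdiv; lra. }
    exists (4 / e); intros y Hy.
    assert (0 < 4 / e) by (apply Rdiv_lt_0_compat; lra).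
    replace (RtoC (4 * (atan y - PI / 2)) - 0)%C with (RtoC (4 * (atan y - PI / 2))) by ringC.
    rewrite Cmod_R. eapply Rle_lt_trans; [apply L; lra|].
    apply (Rmult_lt_reg_r y); [lra|]. unfold Rdiv; rewrite Rmult_assoc, Rinv_l by lra.
    assert (4 / e * e = 4) by (field; lra). nra.
Qed.

(** The Fourier integral of the even kernel 2/(1 + l^2), folded onto the half-line. It converges
    absolutely, hence is continuous up to x = 0, where it can be evaluated. *)
Definition Acos (x : R) : C := J (fun r => RtoC (4 * cos (r * x) / (1 + r ^ 2))).

Lemma Acos_dom x : dom 8 (fun r => RtoC (4 * cos (r * x) / (1 + r ^ 2))).
Proof.
  intros r Hr; rewrite Cmod_R. unfold Rdiv.
  pose proof (pow2_ge_0 r).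
  rewrite !Rabs_mult, (Rabs_pos_eq 4), (Rabs_pos_eq (/ _)) by (try (left; apply Rinv_0_lt_compat); lra).
  assert (Rabs (cos (r * x)) <= 1) by (apply Rabs_le; apply COS_bound).
  assert (H2 : / (1 + r ^ 2) <= 2 * / (1 + r) ^ 2).
  { apply (Rmult_le_reg_r ((1 + r ^ 2) * (1 + r) ^ 2)); [apply Rmult_lt_0_compat; nra|].
    replace (/ (1 + r ^ 2) * ((1 + r ^ 2) * (1 + r) ^ 2)) with ((1 + r) ^ 2) by (field; lra).
    replace (2 * / (1 + r) ^ 2 * ((1 + r ^ 2) * (1 + r) ^ 2)) with (2 * (1 + r ^ 2)) by (field; lra).
    pose proof (pow2_ge_0 (1 - r)). nra. }
  assert (0 < / (1 + r ^ 2)) by (apply Rinv_0_lt_compat; lra).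
  nra.
Qed.

Lemma Acos_jct0 x : jct0 (fun x r => RtoC (4 * cos (r * x) / (1 + r ^ 2))) x.
Proof. intros r; unfold jct, cl; ct. pose proof (pow2_ge_0 (Rmax 0 r)). simpl snd. lra. Qed.

(** On the real line [rhoc] can be added freely, its integrals over the rays 0 and pi being equal by
    rotation. The sum of both kernels folds into the cosine, while [rho] alone is rotated onto the
    rays of Gamma. *)
Lemma Acos_gamma x : 0 < x -> Acos x = (Egam (PI / 3) x - Egam (2 * PI / 3) x)%C.
Proof.
  intros Hx; pose proof PI_RGT_0.
  pose proof (proj1 (rho_rot0 x 0 (PI / 3) _ Hx ltac:(left; lra)) (Egam_ray (PI / 3) x ltac:(auto) Hx)) as R0.
  pose proof (proj2 (rho_rot0 x (2 * PI / 3) PI _ Hx ltac:(right; lra)) (Egam_ray (2 * PI / 3) x ltac:(auto) Hx)) as R1.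
  (* On the real axis this integral converges only conditionally; existence is obtained on the ray
     pi/3, where e^(izx) decays, and then rotated to 0 and to pi. *)
  assert (Q : exists I, ray (fun l => Kx x l * rhoc l)%C (PI / 3) I).
  { destruct (gam_cos (PI / 3) ltac:(auto)) as [Hc Hs].
    destruct (ray_dom x (PI / 3) (fun r => rhoc (pol r (PI / 3)) * ex (PI / 3))%C 1 0 Hx Hs) as [M HM].
    { intros r Hr; rewrite Cmod_mult, Cmod_ex. unfold rhoc; rewrite Cmod_inv by (apply rhoc_nz; lra).
      simpl; rewrite !Rmult_1_r, <- Rinv_1; apply Rinv_le_contravar; [lra|].
      eapply Rle_trans; [|apply re_le_Cmod].
      rewrite pol_eq; simpl. rewrite Rabs_pos_eq; nra. }
    exists (J (fun r => Kx x (pol r (PI / 3)) * (rhoc (pol r (PI / 3)) * ex (PI / 3)))%C).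
    apply (is_J_ext (fun r => Kx x (pol r (PI / 3)) * (rhoc (pol r (PI / 3)) * ex (PI / 3)))%C).
    - intros r _; unfold pol; ringC.
    - apply (J_is M); [|apply HM; lra]. intros r. unfold cl, rhoc; ctx. apply rhoc_nz; [apply Rmax_l|lra]. }
  destruct Q as [I HI].
  pose proof (proj1 (rhoc_rot x 0 (PI / 3) I Hx ltac:(lra) ltac:(lra)) HI) as S0.
  pose proof (proj2 (rhoc_rot x (PI / 3) PI I Hx ltac:(lra) ltac:(lra)) HI) as S1.
  replace (Egam (PI / 3) x - Egam (2 * PI / 3) x)%C with
    ((Egam (PI / 3) x - Egam (2 * PI / 3) x) + (I - I))%C by ringC.
  apply is_J_unique.
  pose proof (is_J_plus _ _ _ _ (is_J_minus _ _ _ _ R0 R1) (is_J_minus _ _ _ _ S0 S1)) as T.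
  revert T; apply is_J_ext; intros r Hr.
  assert (E0 : ex 0 = RtoC 1) by (rewrite ex_eq, cos_0, sin_0; reflexivity).
  assert (E1 : ex PI = RtoC (-1)) by (rewrite ex_eq, cos_PI, sin_PI; reflexivity).
  rewrite E0, E1; unfold rho, rhoc, Kx.
  assert (Hr2 : 1 + r * r <> 0) by nra.
  assert (K1 : Cexp (Ci * (r * 1) * x) = (cos (r * x), sin (r * x))).
  { unfold Cexp, Ci, Cmult, RtoC, Re, Im; simpl.
    match goal with |- (exp ?a * cos ?b, _) = _ => replace a with 0 by ring; replace b with (r * x) by ring end.
    rewrite exp_0; f_equal; ring. }
  assert (K2 : Cexp (Ci * (r * (-1)%R) * x) = (cos (r * x), - sin (r * x))).
  { unfold Cexp, Ci, Cmult, RtoC, Re, Im; simpl.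
    match goal with |- (exp ?a * cos ?b, _) = _ => replace a with 0 by ring; replace b with (- (r * x)) by ring end.
    rewrite exp_0, cos_neg, sin_neg; f_equal; ring. }
  rewrite K1, K2.
  unfold Cminus, Cplus, Copp, Cmult, Cinv, Ci, RtoC; simpl.
  f_equal; field; nra.
Qed.

(* [A(x) e^x] is constant on [x > 0] because of [E' = -E], and continuous at [0], where it equals [2 pi]. *)
Lemma Acos_eq x : 0 <= x -> Acos x = RtoC (2 * PI * exp (- x)).
Proof.
  intros Hx.
  assert (CA : forall x, continuous Acos x).
  { intros y; apply (J_ct (fun x r => RtoC (4 * cos (r * x) / (1 + r ^ 2))) y 8).
    apply filter_forall; intros z; split; [apply Acos_jct0|apply Acos_dom]. }
  assert (A0 : Acos 0 = RtoC (2 * PI)).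
  { apply is_J_unique. apply (is_J_ext (fun r => RtoC (4 / (1 + r ^ 2)))); [|apply cos_kernel_J].
    intros r _; rewrite Rmult_0_r, cos_0. f_equal; field. pose proof (pow2_ge_0 r); lra. }
  assert (H : (Acos x * RtoC (exp x) - Acos 0 * RtoC (exp 0) = 0)%C).
  { rewrite <- (CInt_derive_open (fun x => Acos x * RtoC (exp x))%C (fun _ => RtoC 0) 0 x); auto.
    - rewrite CInt_const; ringC.
    - intros y Hy.
      assert (D : is_derive Acos y (- Acos y)%C).
      { apply (is_derive_ext_loc (fun x => Egam (PI / 3) x - Egam (2 * PI / 3) x)%C).
        - apply locally_pos; [lra|].
          intros z Hz; symmetry; now apply Acos_gamma.
        - rewrite Acos_gamma by lra. eapply dr_eq; [apply dr_minus; apply Egam_dr; auto; lra|]. ringC. }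
      assert (De : is_derive exp y (exp y)) by apply is_derive_exp.
      eapply dr_eq; [apply dr_mult; [exact D|apply dr_RtoC, De]|]. ringC.
    - intros y; apply ct_mult; auto. ct.
    - intros; ct. }
  rewrite A0, exp_0 in H.
  replace (Acos x) with ((Acos x * RtoC (exp x) - 2 * PI * 1 + 2 * PI) * RtoC (exp (- x)))%C.
  2: { replace (RtoC (exp (- x))) with (/ RtoC (exp x))%C.
       - field. intros E; injection E; pose proof (exp_pos x); lra.
       - rewrite exp_Ropp, RtoC_inv; [reflexivity|]. pose proof (exp_pos x); lra. }
  rewrite RtoC_mult in H. rewrite H, !RtoC_mult; ringC.
Qed.

Lemma inversion_exp x : 0 < x ->
  exists A B, ray (fun l => Kx x l * rho l)%C 0 A /\ ray (fun l => Kx x l * rho l)%C PI B /\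
    (A - B = RtoC (2 * PI * exp (- x)))%C.
Proof.
  intros Hx; pose proof PI_RGT_0.
  exists (Egam (PI / 3) x), (Egam (2 * PI / 3) x); split; [|split].
  - apply (rho_rot0 x 0 (PI / 3) _ Hx ltac:(left; lra)), Egam_ray; auto.
  - apply (rho_rot0 x (2 * PI / 3) PI _ Hx ltac:(right; lra)), Egam_ray; auto.
  - rewrite <- Acos_gamma by auto. apply Acos_eq; lra.
Qed.

(** * Pointwise inversion by the Riemann-Lebesgue lemma *)

Lemma clamp_sum a b : Rmax 0 (Rmax 0 a + Rmax 0 b) = Rmax 0 a + Rmax 0 b.
Proof. apply Rmax_right. pose proof (Rmax_l 0 a); pose proof (Rmax_l 0 b). lra. Qed.

Lemma is_J_shift g I h : 0 <= h -> cont0 g -> is_J g I -> is_J (fun y => g (y + h)%R) (I - CInt (cl g) 0 h)%C.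
Proof.
  intros Hh Hc HI.
  assert (Hc' : cont0 (fun y => g (y + h)%R)).
  { intros r. apply (continuous_ext (fun r => cl g (Rmax 0 r + h))).
    - intros x; unfold cl; f_equal. apply Rmax_right. pose proof (Rmax_l 0 x). lra.
    - apply (ct_comp (cl g) (fun r => Rmax 0 r + h)); [exact Hc|ct]. }
  apply is_J_char; auto; apply is_J_char in HI; auto.
  apply lim_Cmod; [apply Rbar_locally_filter|]; intros e He.
  assert (Ev : Rbar_locally p_infty (fun b => 0 <= b)) by (exists 0; intros; lra).
  destruct (proj1 (lim_Cmod _ _ _) HI e He) as [B HB].
  exists (Rmax 0 B); intros b Hb.
  pose proof (Rmax_l 0 B); pose proof (Rmax_r 0 B).
  specialize (HB (b + h) ltac:(lra)).
  rewrite CInt_cl by lra.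
  replace (CInt (fun y => g (y + h)) 0 b) with (CInt (cl g) h (b + h)).
  - rewrite <- (CInt_Chasles (cl g) 0 h (b + h)) in HB by auto.
    replace (CInt (cl g) h (b + h) - (I - CInt (cl g) 0 h))%C with
      (CInt (cl g) 0 h + CInt (cl g) h (b + h) - I)%C by ringC. exact HB.
  - pose proof (RInt_comp_lin (V := C_R_CompleteNormedModule) (cl g) 1 h 0 b) as E.
    replace (1 * 0 + h) with h in E by ring. replace (1 * b + h) with (b + h) in E by ring.
    rewrite <- E by (apply CInt_ex; auto).
    apply CInt_ext; intros x Hx; rewrite Rmin_left in Hx by lra.
    rewrite scalC, Rmult_1_l, cl_pos by lra. ringC.
Qed.

(** Translation by the half-period h = pi/N changes the sign of the exponential. Hence twice the
    integral is the integral of chi(y) - chi(y + h) against the exponential, plus a boundary piece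
    of length h. *)
Lemma Riemann_Lebesgue chi M (s : R) : s = 1 \/ s = -1 ->
  cont0 chi -> dom M chi ->
  filterlim (fun N => J (fun y => chi y * ex (s * N * y))%C) (Rbar_locally p_infty) (locally (RtoC 0)).
Proof.
  intros Hs Hc Hd; pose proof (dom_pos _ _ Hd) as HM; pose proof PI_RGT_0.
  apply lim_Cmod; [apply Rbar_locally_filter|]; intros e He.
  destruct (small_tail (2 * M) (e / 2)) as [b [Hb Hbe]]; try lra.
  assert (Hk : 0 < e / 2 / (b + 1)) by (apply Rdiv_lt_0_compat; lra).
  assert (Hj : jct0 (fun h y => chi (y + Rmax 0 h)%R) 0).
  { intros r; unfold jct. apply (continuous_ext (fun q : R * R => cl chi (Rmax 0 (snd q) + Rmax 0 (fst q)))).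
    - intros q; unfold cl; f_equal. apply clamp_sum.
    - apply (ct_comp (cl chi) (fun q : R * R => Rmax 0 (snd q) + Rmax 0 (fst q))); [exact Hc|ct]. }
  destruct (unif_compact0 _ 0 Hj b _ Hk) as [d Hu].
  assert (Hdp := cond_pos d).
  (* The first term makes the half-period smaller than [d], the second makes M h smaller than e. *)
  exists (PI / d + M * PI / e); intros N HN.
  assert (HPd : 0 < PI / d) by (apply Rdiv_lt_0_compat; lra).
  assert (HMe : 0 <= M * PI / e) by (apply Rmult_le_pos; [nra|left; now apply Rinv_0_lt_compat]).
  assert (HN0 : 0 < N) by lra.
  set (h := PI / N).
  assert (Hh : 0 < h) by (unfold h; apply Rdiv_lt_0_compat; lra).
  assert (Hhd : h < d).
  { unfold h; apply (Rmult_lt_reg_r N); auto. unfold Rdiv; rewrite Rmult_assoc, Rinv_l, Rmult_1_r by lra.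
    assert (PI / d * d = PI) by (field; lra). nra. }
  assert (HhM : M * h < e).
  { unfold h; apply (Rmult_lt_reg_r N); auto. unfold Rdiv; rewrite !Rmult_assoc, Rinv_l, Rmult_1_r by lra.
    assert (M * PI / e * e = M * PI) by (field; lra). nra. }
  set (g := fun y => (chi y * ex (s * N * y))%C).
  assert (Cex : forall r, continuous (fun y => ex (s * N * y)) r) by (intros; ctx).
  assert (Hg : cont0 g).
  { apply (cont0_mult chi (fun y => ex (s * N * y))); auto. now apply cont0_ct. }
  assert (Dg : dom M g).
  { intros y Hy; unfold g; rewrite Cmod_mult, Cmod_ex, Rmult_1_r; auto. }
  pose proof (J_is M g Hg Dg) as I1.
  pose proof (is_J_shift g _ h ltac:(lra) Hg I1) as I2.
  pose proof (is_J_plus _ _ _ _ I1 I2) as I3.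
  assert (E : J (fun y => (chi y - chi (y + Rmax 0 h)%R) * ex (s * N * y))%C = (J g + (J g - CInt (cl g) 0 h))%C).
  { apply is_J_unique; revert I3; apply is_J_ext; intros y Hy; unfold g.
    rewrite Rmax_right by lra.
    assert (Eh : ex (s * N * (y + h)) = (- ex (s * N * y))%C).
    { replace (s * N * (y + h)) with (s * N * y + s * PI) by (unfold h; field; lra).
      rewrite ex_plus. replace (ex (s * PI)) with (- RtoC 1)%C.
      - ringC.
      - rewrite ex_eq; destruct Hs as [-> | ->].
        + rewrite Rmult_1_l, cos_PI, sin_PI; unfold Copp, RtoC; simpl; f_equal; ring.
        + replace (-1 * PI) with (- PI) by ring; rewrite cos_neg, sin_neg, cos_PI, sin_PI; unfold Copp, RtoC; simpl; f_equal; ring. }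
    rewrite Eh; ringC. }
  assert (B1 : Cmod (J (fun y => (chi y - chi (y + Rmax 0 h)%R) * ex (s * N * y))%C) < e).
  { eapply Rle_lt_trans; [apply (J_split (2 * M) _ (e / 2 / (b + 1)) b)|]; auto.
    - apply (cont0_mult (fun y => chi y - chi (y + Rmax 0 h)%R)%C (fun y => ex (s * N * y))); [|now apply cont0_ct].
      apply (cont0_minus chi (fun y => chi (y + Rmax 0 h)%R)); auto.
      intros r. apply (continuous_ext (fun r => cl chi (Rmax 0 r + Rmax 0 h))).
      + intros x; unfold cl; f_equal. apply clamp_sum.
      + apply (ct_comp (cl chi) (fun r => Rmax 0 r + Rmax 0 h)); [exact Hc|ct].
    - intros r Hr; rewrite Cmod_mult, Cmod_ex, Rmult_1_r.
      unfold Cminus; eapply Rle_trans; [apply Cmod_triangle|]; rewrite Cmod_opp.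
      pose proof (Hd r Hr). pose proof (Hd (r + Rmax 0 h)) as H2. rewrite Rmax_right in * by lra.
      specialize (H2 ltac:(lra)).
      assert (M / (1 + (r + h)) ^ 2 <= M / (1 + r) ^ 2).
      { apply Rmult_le_compat_l; auto. apply Rinv_le_contravar; nra. }
      replace (2 * M / (1 + r) ^ 2) with (M / (1 + r) ^ 2 + M / (1 + r) ^ 2) by (field; lra). lra.
    - intros r Hr; rewrite Cmod_mult, Cmod_ex, Rmult_1_r.
      assert (Bh : ball 0 d h) by (change (Rabs (h - 0) < d); rewrite Rabs_pos_eq; lra).
      specialize (Hu h Bh r Hr). rewrite (Rmax_left 0 0), Rplus_0_r in Hu by lra.
      rewrite <- Cmod_opp. replace (- (chi r - chi (r + Rmax 0 h)%R))%C with (chi (r + Rmax 0 h)%R - chi r)%C by ringC.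
      lra.
    - assert (e / 2 / (b + 1) * b + e / 2 / (b + 1) = e / 2) by (field; lra). lra. }
  assert (B2 : Cmod (CInt (cl g) 0 h) < e).
  { eapply Rle_lt_trans; [apply (CInt_norm_const _ M); auto; try lra|].
    - intros x Hx; rewrite cl_pos by lra. eapply Rle_trans; [apply Dg; lra|].
      rewrite <- (Rmult_1_r M) at 2. apply Rmult_le_compat_l; auto.
      rewrite <- Rinv_1; apply Rinv_le_contravar; nra.
    - lra. }
  rewrite E in B1. replace (J g - 0)%C with (J g) by ringC.
  pose proof (Cmod_triangle (J g + (J g - CInt (cl g) 0 h)) (CInt (cl g) 0 h)) as T.
  replace (J g + (J g - CInt (cl g) 0 h) + CInt (cl g) 0 h)%C with (RtoC 2 * J g)%C in T.
  - rewrite Cmod_mult, Cmod_R, Rabs_pos_eq in T by lra. lra.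
  - replace (RtoC 2) with (RtoC 1 + RtoC 1)%C by (rewrite <- RtoC_plus; f_equal; ring). ringC.
Qed.

Lemma dr_char_conv (f : R -> C) p (l : C) :
  is_derive f p l ->
  forall e, 0 < e -> locally p (fun y => Cmod (f y - f p - RtoC (y - p) * l) <= e * Rabs (y - p)).
Proof.
  intros [_ H] e He.
  specialize (H p (fun P HP => HP) (mkposreal e He)).
  revert H; apply filter_imp; intros y Hy; rewrite normC in Hy; simpl in Hy.
  refine (Rle_trans _ _ _ (Req_le _ _ (f_equal Cmod _)) Hy).
  unfold scal, minus, plus, opp; simpl; unfold prod_scal, prod_plus, prod_opp, scal, plus, opp; simpl.
  unfold mult, plus, opp; simpl. destruct l; unfold Cminus, Cplus, Copp, Cmult; simpl; f_equal; eqR; ring.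
Qed.

Lemma cont0_bounded f b : cont0 f -> 0 <= b -> exists K, forall y, 0 <= y <= b -> Cmod (f y) <= K.
Proof.
  intros Hc Hb.
  destruct (continuity_ab_maj (fun y => Cmod (cl f y)) 0 b Hb) as [m [Hm _]].
  - intros c _; apply continuity_pt_filterlim. apply (rct_Cmod (cl f)), Hc.
  - exists (Cmod (cl f m)); intros y Hy; specialize (Hm y Hy). now rewrite (cl_pos f y) in Hm by lra.
Qed.

(** Dini's argument for pointwise inversion: a zero at x can be divided out, the derivative giving
    the missing value. *)
Lemma divided_difference (h : R -> C) M x l :
  0 < x -> cont0 h -> dom M h -> h x = RtoC 0 -> is_derive h x l ->
  exists chi M', cont0 chi /\ dom M' chi /\ forall y, 0 <= y -> h y = (RtoC (y - x) * chi y)%C.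
Proof.
  intros Hx Hc Hd Hh Hl.
  set (chi := fun y => if Req_EM_T y x then l else (h y / RtoC (y - x))%C).
  assert (Chi : cont0 chi).
  { intros r. destruct (Req_EM_T r x) as [->|Hr].
    - apply ct_Cmod; intros e He.
      assert (L : locally x (fun y => 0 < y)) by (apply (open_gt 0); lra).
      generalize (filter_and _ _ L (dr_char_conv h x l Hl (e / 2) ltac:(lra))); apply filter_imp.
      intros y [Hy Hb]; rewrite !cl_pos by lra. unfold chi; destruct (Req_EM_T x x) as [_|]; [|lra].
      destruct (Req_EM_T y x) as [->|Hyx].
      + replace (l - l)%C with (RtoC 0) by ringC. rewrite Cmod_0; lra.
      + assert (Hyx' : RtoC (y - x) <> 0%C) by (intros E; injection E; lra).
        replace (h y / RtoC (y - x) - l)%C with ((h y - h x - RtoC (y - x) * l) / RtoC (y - x))%C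
          by (rewrite Hh; field; exact Hyx').
        rewrite Cmod_div by exact Hyx'. rewrite Cmod_R.
        assert (0 < Rabs (y - x)) by (apply Rabs_pos_lt; lra).
        apply (Rmult_lt_reg_r (Rabs (y - x))); auto. unfold Rdiv; rewrite Rmult_assoc, Rinv_l, Rmult_1_r by lra. nra.
    - assert (Hm : Rmax 0 r <> x).
      { unfold Rmax; destruct (Rle_dec 0 r); lra. }
      apply (continuous_ext_loc _ (fun r => cl h r / RtoC (Rmax 0 r - x))%C).
      + assert (Co : continuous (fun r => Rmax 0 r - x) r) by ct.
        assert (N : locally (Rmax 0 r - x) (fun z => z <> 0)) by (apply (open_neq 0); lra).
        generalize (Co _ N); unfold filtermap; apply filter_imp; intros y Hy.
        unfold cl, chi; destruct (Req_EM_T (Rmax 0 y) x); [lra|reflexivity].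
      + apply ct_div; [apply Hc|ct|]. intros E; injection E; lra. }
  destruct (cont0_bounded chi (x + 1) Chi ltac:(lra)) as [K HK].
  assert (HK0 : 0 <= K) by (eapply Rle_trans; [apply Cmod_ge_0|apply (HK 0); lra]).
  pose proof (dom_pos _ _ Hd) as HM.
  (* Up to x + 1 the compact bound [K] is used, where (1 + y)^2 <= (x + 2)^2; beyond, y - x >= 1 and
     the division only decreases the modulus. *)
  exists chi, (K * (x + 2) ^ 2 + M); split; [exact Chi|split].
  - intros y Hy.
    assert (Hy2 : 0 < (1 + y) ^ 2) by nra.
    destruct (Rle_dec y (x + 1)) as [Hyx|Hyx].
    + apply (Rmult_le_reg_r ((1 + y) ^ 2)); auto. unfold Rdiv; rewrite Rmult_assoc, Rinv_l, Rmult_1_r by lra.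
      specialize (HK y (conj Hy Hyx)). pose proof (Cmod_ge_0 (chi y)).
      assert ((1 + y) ^ 2 <= (x + 2) ^ 2) by nra.
      assert (Cmod (chi y) * (1 + y) ^ 2 <= K * (x + 2) ^ 2) by (apply Rmult_le_compat; lra). lra.
    + unfold chi; destruct (Req_EM_T y x); [lra|].
      assert (Hyx' : RtoC (y - x) <> 0%C) by (intros E; injection E; lra).
      rewrite Cmod_div, Cmod_R, Rabs_pos_eq by (auto; lra).
      apply (Rle_trans _ (Cmod (h y) * 1)).
      * apply Rmult_le_compat_l; [apply Cmod_ge_0|]. rewrite <- Rinv_1; apply Rinv_le_contravar; lra.
      * rewrite Rmult_1_r; eapply Rle_trans; [apply Hd; auto|].
        apply Rmult_le_compat_r; [left; now apply Rinv_0_lt_compat|].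
        assert (0 <= K * (x + 2) ^ 2) by (apply Rmult_le_pos; auto; apply pow2_ge_0). lra.
  - intros y Hy; unfold chi; destruct (Req_EM_T y x) as [->|Hyx].
    + rewrite Hh; replace (x - x) with 0 by ring. ringC.
    + field. intros E; injection E; lra.
Qed.

Lemma ek_real u y : ek (RtoC u) y = ex (- (u * y)).
Proof.
  unfold ek, ex, dn, Re, Im; simpl. rewrite Rmin_left by lra.
  f_equal. unfold Cmult, Copp, Ci, RtoC; simpl; f_equal; ring.
Qed.

(** The integral of e^(i s r (x - y)) over [0, N] is explicit and its denominator cancels against
    h(y) = (y - x) chi(y). Riemann-Lebesgue removes the term at N, and the term at 0 remains; the
    remainders of the two half-lines cancel each other in [inversion]. *)
Lemma oscillatory_half (h : R -> C) M x l s :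
  s = 1 \/ s = -1 ->
  0 < x -> cont0 h -> dom M h -> h x = RtoC 0 -> is_derive h x l ->
  forall chi M', cont0 chi -> dom M' chi -> (forall y, 0 <= y -> h y = (RtoC (y - x) * chi y)%C) ->
  is_J (fun r => ex (s * r * x) * HH h (RtoC (s * r)))%C (- (Ci * RtoC s * J chi))%C.
Proof.
  intros Hs Hx Hc Hd Hh Hl chi M' Cc Dc Hchi.
  assert (Hs2 : (RtoC s * RtoC s = 1)%C).
  { rewrite <- RtoC_mult; f_equal; destruct Hs as [-> | ->]; ring. }
  pose proof Ci2 as Ii.
  assert (CF : cont0 (fun r => ex (s * r * x) * HH h (RtoC (s * r)))%C).
  { apply cont0_ct; intros r; apply ct_mult; [ctx|].
    apply (ct_comp (HH h) (fun r => RtoC (s * r))); [intros; now apply (HH_ct h M)|ct]. }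
  apply is_J_char; auto.
  assert (Key : forall N, 0 <= N -> CInt (fun r => ex (s * r * x) * HH h (RtoC (s * r)))%C 0 N =
     (Ci * RtoC s * (ex (s * N * x) * J (fun y => chi y * ex (- s * N * y)) - J chi))%C).
  { intros N HN.
    rewrite (CInt_ext _ (fun r => J (fun y => ex (s * r * x) * (ek (RtoC (s * r)) y * h y))%C)).
    2: { intros r _; symmetry; unfold HH; apply (J_scal M); [now apply ek_cont0|now apply ek_dom]. }
    assert (Fub : is_J (fun y => CInt (fun r => ex (s * r * x) * (ek (RtoC (s * r)) y * h y))%C 0 N)
                    (CInt (fun r => J (fun y => ex (s * r * x) * (ek (RtoC (s * r)) y * h y))%C) 0 N)).
    { apply (J_Fubini_loc (fun r y => ex (s * r * x) * (ek (RtoC (s * r)) y * h y))%C 0 N M HN).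
      - intros p y; unfold jct, cl; apply ct_mult; [ctx|apply ct_mult; [ctx|]].
        apply (ct_comp (cl h) (fun q : R * R => snd q)); [exact Hc|ct].
      - intros p _ y Hy; rewrite Cmod_mult, Cmod_ex, Rmult_1_l; now apply (ek_dom M). }
    rewrite <- (is_J_unique _ _ Fub).
    assert (I1 : is_J (fun y => chi y * ex (- s * N * y))%C (J (fun y => chi y * ex (- s * N * y))%C)).
    { apply (J_is M').
      - apply (cont0_mult chi (fun y => ex (- s * N * y))); auto. apply cont0_ct; intros; ctx.
      - intros y Hy; rewrite Cmod_mult, Cmod_ex, Rmult_1_r; auto. }
    pose proof (is_J_scal (Ci * RtoC s)%C _ _ (is_J_minus _ _ _ _ (is_J_scal (ex (s * N * x)) _ _ I1) (J_is M' chi Cc Dc))) as I2.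
    rewrite <- (is_J_unique _ _ I2). apply J_ext; intros y Hy.
    rewrite (CInt_ext _ (fun r => chi y * (RtoC (y - x) * ex (s * (x - y) * r)))%C).
    2: { intros r _; rewrite ek_real, (Hchi y Hy).
         replace (s * (x - y) * r) with (s * r * x + - (s * r * y)) by ring. rewrite ex_plus; ringC. }
    rewrite CInt_scal by (intros; ctx).
    rewrite (CInt_derive (fun r => Ci * RtoC s * ex (s * (x - y) * r))%C).
    - replace (s * (x - y) * N) with (s * N * x + - s * N * y) by ring. rewrite ex_plus.
      replace (ex (s * (x - y) * 0)) with (RtoC 1); [ringC|].
      rewrite Rmult_0_r, ex_eq, cos_0, sin_0; reflexivity.
    - intros r _; unfold ex; dr.
      replace (Ci * RtoC s * (Ci * RtoC (0 * r + s * (x - y) * 1) * Cexp (Ci * RtoC (s * (x - y) * r))))%C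
        with ((Ci * Ci) * (RtoC s * RtoC s) * RtoC (x - y) * Cexp (Ci * RtoC (s * (x - y) * r)))%C.
      + rewrite Ii, Hs2, !RtoC_minus; ringC.
      + replace (0 * r + s * (x - y) * 1) with (s * (x - y)) by ring. rewrite (RtoC_mult s (x - y)); ringC.
    - intros; ctx. }
  assert (Hs' : - s = 1 \/ - s = -1) by lra.
  pose proof (Riemann_Lebesgue chi M' (- s) Hs' Cc Dc) as RL.
  apply lim_Cmod; [apply Rbar_locally_filter|]; intros e He.
  assert (Ev : Rbar_locally p_infty (fun b => 0 <= b)) by (exists 0; intros; lra).
  generalize (filter_and _ _ Ev (proj1 (lim_Cmod _ _ _) RL e He)); apply filter_imp.
  intros N [HN HR]; rewrite CInt_cl, Key by auto.
  replace (Ci * RtoC s * (ex (s * N * x) * J (fun y => chi y * ex (- s * N * y)) - J chi) - - (Ci * RtoC s * J chi))%C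
    with (Ci * RtoC s * (ex (s * N * x) * (J (fun y => chi y * ex (- s * N * y)) - 0)))%C by ringC.
  rewrite !Cmod_mult, Cmod_Ci, Cmod_ex, Cmod_R.
  replace (Rabs s) with 1 by (destruct Hs as [-> | ->]; [rewrite Rabs_pos_eq|rewrite Rabs_left1]; lra).
  lra.
Qed.

Definition expm (y : R) : C := RtoC (exp (- y)).
Lemma expm_cont0 : cont0 expm.
Proof. apply cont0_ct; intros; unfold expm; ct. Qed.
Lemma expm_dom : exists M, dom M expm.
Proof.
  destruct (expdom 1 0 ltac:(lra)) as [M [HM HE]]; exists M; intros r Hr.
  unfold expm; rewrite Cmod_R, Rabs_pos_eq by (left; apply exp_pos).
  specialize (HE 1 r (Rle_refl 1) Hr). rewrite pow_O, !Rmult_1_l in HE; exact HE.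
Qed.
Lemma dr_expm y : is_derive expm y (- expm y)%C.
Proof. unfold expm; dr. rewrite <- RtoC_opp; f_equal; ring. Qed.

Lemma HH_expm mu : Im mu <= 0 -> HH expm mu = rho mu.
Proof.
  intros Hmu; destruct expm_dom as [M HM].
  assert (D0 : dom M (fun _ : R => RtoC 0)).
  { intros r Hr; rewrite Cmod_0; pose proof (dom_pos _ _ HM).
    apply Rmult_le_pos; auto. left; apply Rinv_0_lt_compat; nra. }
  assert (C0 : cont0 (fun _ : R => RtoC 0)) by (apply cont0_ct; intros; ct).
  (* The operator d/dy + 1 annihilates [expm], so its next jet is the zero function. *)
  pose proof (HH_ibp M expm (fun _ => RtoC 0) mu expm_cont0 HM C0 D0) as H.
  assert (E : HH (fun _ : R => RtoC 0) mu = RtoC 0).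
  { unfold HH; rewrite (J_ext _ (fun y => 0 * (ek mu y * expm y))%C) by (intros; ringC).
    rewrite (J_scal M); [ringC|apply ek_cont0, expm_cont0|now apply ek_dom]. }
  assert (E0 : expm 0 = RtoC 1) by (unfold expm; rewrite Ropp_0, exp_0; reflexivity).
  rewrite E, E0 in H.
  unfold rho. replace (HH expm mu) with (((1 + Ci * mu) * HH expm mu) / (1 + Ci * mu))%C by (field; now apply rho_nz).
  rewrite H; [field; now apply rho_nz| |exact Hmu].
  intros y _; eapply dr_eq; [apply dr_expm|ringC].
Qed.

Lemma HH_lin M f g c mu : cont0 f -> dom M f -> cont0 g -> dom M g ->
  HH (fun y => f y + c * g y)%C mu = (HH f mu + c * HH g mu)%C.
Proof.
  intros Hf Df Hg Dg; unfold HH.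
  rewrite (J_ext _ (fun y => ek mu y * f y + c * (ek mu y * g y))%C) by (intros; ringC).
  apply is_J_unique, is_J_plus; [|apply is_J_scal]; apply (J_is M); try apply ek_cont0; try apply ek_dom; auto.
Qed.

(** Subtracting c e^(-y) with c = phi(x) e^x leaves a function vanishing at x, whose two half-line
    integrals cancel. The whole value comes from the explicit case [inversion_exp]. *)
Lemma inversion phi M x l :
  cont0 phi -> dom M phi -> 0 < x -> is_derive phi x l ->
  exists A B, ray (fun z => Kx x z * HH phi z)%C 0 A /\ ray (fun z => Kx x z * HH phi z)%C PI B /\
    (A - B = RtoC (2 * PI) * phi x)%C.
Proof.
  intros Hc Hd Hx Hl.
  destruct expm_dom as [M1 HM1].
  set (c := (phi x * RtoC (exp x))%C).
  set (h := fun y => (phi y + (- c) * expm y)%C).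
  assert (Hch : cont0 h) by (apply (cont0_plus phi (fun y => (- c) * expm y)%C); auto; apply cont0_scal, expm_cont0).
  set (Mh := M + Cmod c * M1).
  assert (Hdh : dom Mh h).
  { intros y Hy; unfold h, Mh; eapply Rle_trans; [apply Cmod_triangle|].
    rewrite Cmod_mult, Cmod_opp. specialize (Hd y Hy); specialize (HM1 y Hy).
    pose proof (Cmod_ge_0 c). unfold Rdiv in *. nra. }
  assert (Hexx : (RtoC (exp x) * expm x = 1)%C).
  { unfold expm; rewrite <- RtoC_mult, <- exp_plus. replace (x + - x) with 0 by ring. rewrite exp_0; reflexivity. }
  assert (Hh0 : h x = RtoC 0).
  { unfold h, c. replace (phi x + - (phi x * RtoC (exp x)) * expm x)%C with (phi x - phi x * (RtoC (exp x) * expm x))%C by ringC.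
    rewrite Hexx; ringC. }
  assert (Hlh : is_derive h x (l + (- c) * (- expm x))%C).
  { unfold h; pose proof (dr_expm x). dr. ringC. }
  destruct (divided_difference h Mh x _ Hx Hch Hdh Hh0 Hlh) as [chi [M' [Cc [Dc Hchi]]]].
  pose proof (oscillatory_half h Mh x _ 1 ltac:(auto) Hx Hch Hdh Hh0 Hlh chi M' Cc Dc Hchi) as P1.
  pose proof (oscillatory_half h Mh x _ (-1) ltac:(auto) Hx Hch Hdh Hh0 Hlh chi M' Cc Dc Hchi) as P2.
  destruct (inversion_exp x Hx) as [A [B [HA [HB HAB]]]].
  assert (Hphi : forall mu, Im mu <= 0 -> HH phi mu = (HH h mu + c * rho mu)%C).
  { intros mu Hmu; rewrite <- HH_expm by auto.
    set (Mm := Rmax Mh M1).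
    rewrite <- (HH_lin Mm); try apply expm_cont0; auto.
    - unfold HH; apply J_ext; intros y _; unfold h; ringC.
    - apply (dom_le Mh); auto; apply Rmax_l.
    - apply (dom_le M1); auto; apply Rmax_r. }
  (* The factor -1 is the direction e^(i pi) of the negative half-axis. *)
  exists (- (Ci * 1 * J chi) + c * A)%C, (-1 * - (Ci * RtoC (-1) * J chi) + c * B)%C; split; [|split].
  - pose proof (is_J_plus _ _ _ _ P1 (is_J_scal c _ _ HA)) as T; revert T; apply is_J_ext; intros r Hr.
    fold (pol r 0); rewrite !pol_0, Hphi by (simpl; lra).
    rewrite !Rmult_1_l. assert (E0 : ex 0 = RtoC 1) by (rewrite ex_eq, cos_0, sin_0; reflexivity). rewrite E0.
    unfold Kx, ex. rewrite RtoC_mult. replace (Ci * RtoC r * RtoC x)%C with (Ci * (RtoC r * RtoC x))%C by ringC. ringC.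
  - pose proof (is_J_plus _ _ _ _ (is_J_scal (-1)%C _ _ P2) (is_J_scal c _ _ HB)) as T; revert T; apply is_J_ext; intros r Hr.
    fold (pol r PI); rewrite !pol_PI, Hphi by (simpl; lra).
    assert (E1 : ex PI = (- RtoC 1)%C) by (rewrite ex_eq, cos_PI, sin_PI; unfold Copp, RtoC; simpl; f_equal; ring). rewrite E1.
    replace (-1 * r) with (- r) by ring. unfold Kx.
    replace (ex (- r * x)) with (Cexp (Ci * RtoC (- r) * RtoC x)); [ringC|].
    unfold ex; rewrite RtoC_mult; f_equal; ringC.
  - replace (- (Ci * 1 * J chi) + c * A - (-1 * - (Ci * RtoC (-1) * J chi) + c * B))%C
      with (c * (A - B))%C.
    + rewrite HAB, RtoC_mult. unfold c.
      transitivity (RtoC (2 * PI) * phi x * (RtoC (exp x) * expm x))%C; [unfold expm; ringC|]. rewrite Hexx; ringC.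
    + rewrite RtoC_m1. ringC.
Qed.

(** * The transform representation of separated functions *)

Lemma alpha_ex : alpha = ex (2 * PI / 3).
Proof. reflexivity. Qed.
Lemma alpha2_ex : (alpha ^ 2)%C = ex (4 * PI / 3).
Proof. rewrite alpha_ex. replace (4 * PI / 3) with (2 * PI / 3 + 2 * PI / 3) by field. rewrite ex_plus; simpl; ring. Qed.
Lemma alpha3 : (alpha ^ 3)%C = RtoC 1.
Proof.
  rewrite alpha_ex, ex_pow3. replace (3 * (2 * PI / 3)) with (2 * PI) by field.
  rewrite ex_eq, cos_2PI, sin_2PI; reflexivity.
Qed.
Lemma alpha_sum : (1 + alpha + alpha ^ 2)%C = RtoC 0.
Proof.
  rewrite alpha2_ex, alpha_ex, !ex_eq.
  replace (4 * PI / 3) with (PI / 3 + PI) by field. replace (2 * PI / 3) with (PI - PI / 3) by field.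
  rewrite neg_cos, neg_sin, sin_PI_x, Rtrigo_facts.cos_pi_minus, cos_PI3.
  unfold Cplus, RtoC; simpl; f_equal; lra.
Qed.
Lemma alpha_pol r th : (alpha * pol r th)%C = pol r (th + 2 * PI / 3).
Proof. rewrite alpha_ex; unfold pol; rewrite ex_plus; ring. Qed.
Lemma alpha2_pol r th : (alpha ^ 2 * pol r th)%C = pol r (th + 4 * PI / 3).
Proof. rewrite alpha2_ex; unfold pol; rewrite ex_plus; ring. Qed.
Lemma omega_alpha l : omega (alpha * l) = omega l.
Proof.
  unfold omega. replace ((alpha * l) ^ 3)%C with (alpha ^ 3 * l ^ 3)%C by (simpl; ring). rewrite alpha3; ring.
Qed.
Lemma omega_alpha2 l : omega (alpha ^ 2 * l) = omega l.
Proof.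
  unfold omega. replace ((alpha ^ 2 * l) ^ 3)%C with (alpha ^ 3 * alpha ^ 3 * l ^ 3)%C by (simpl; ring). rewrite alpha3; ring.
Qed.

Definition gam (th : R) : Prop := th = PI / 3 \/ th = 2 * PI / 3.

Lemma gam_im th r : gam th -> 0 <= r ->
  Im (alpha * pol r th) <= 0 /\ Im (alpha ^ 2 * pol r th) <= 0.
Proof.
  intros Hth Hr; rewrite alpha_pol, alpha2_pol, !pol_eq; unfold Im; simpl.
  pose proof sin_PI3_pos.
  assert (H1 : sin (th + 2 * PI / 3) <= 0 /\ sin (th + 4 * PI / 3) <= 0).
  { destruct Hth as [-> | ->].
    - replace (PI / 3 + 2 * PI / 3) with PI by field. replace (PI / 3 + 4 * PI / 3) with (2 * PI - PI / 3) by field.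
      rewrite sin_PI, sin_minus, sin_2PI, cos_2PI. lra.
    - replace (2 * PI / 3 + 2 * PI / 3) with (PI / 3 + PI) by field. replace (2 * PI / 3 + 4 * PI / 3) with (2 * PI) by field.
      rewrite neg_sin, sin_2PI. lra. }
  nra.
Qed.

Lemma real_im th r : th = 0 \/ th = PI -> Im (pol r th) <= 0.
Proof. intros [-> | ->]; rewrite ?pol_0, ?pol_PI; simpl; lra. Qed.

Definition Ew (t : R) (l : C) : C := Cexp (- (omega l * RtoC t)).
Definition rot (u : C -> C) (l : C) : C := (alpha * u (alpha * l) + alpha ^ 2 * u (alpha ^ 2 * l))%C.

(* The value of the transform formula, with [uh], [b] and [T] in place of the transforms
   of the initial datum, of the boundary datum and of the forcing. *)
Definition utm (x t : R) (uh b T : C -> C) (v : C) : Prop :=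
  exists A0 A1 B1 B2 D1 D2 P0 P1 Q1 Q2,
    (ray (fun l => Kx x l * Ew t l * uh l)%C 0 A0 /\ ray (fun l => Kx x l * Ew t l * uh l)%C PI A1) /\
    (ray (fun l => Kx x l * Ew t l * rot uh l)%C (PI / 3) B1 /\ ray (fun l => Kx x l * Ew t l * rot uh l)%C (2 * PI / 3) B2) /\
    (ray (fun l => Kx x l * (3 * (l * l)) * b l)%C (PI / 3) D1 /\ ray (fun l => Kx x l * (3 * (l * l)) * b l)%C (2 * PI / 3) D2) /\
    (ray (fun l => Kx x l * T l)%C 0 P0 /\ ray (fun l => Kx x l * T l)%C PI P1) /\
    (ray (fun l => Kx x l * rot T l)%C (PI / 3) Q1 /\ ray (fun l => Kx x l * rot T l)%C (2 * PI / 3) Q2) /\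
    (RtoC (2 * PI) * v = (A0 - A1) + (B1 - B2) - (D1 - D2) + (P0 - P1) + (Q1 - Q2))%C.

Lemma ray_plus F G th I K : ray F th I -> ray G th K -> ray (fun l => F l + G l)%C th (I + K)%C.
Proof. intros H1 H2; pose proof (is_J_plus _ _ _ _ H1 H2) as H; revert H; apply is_J_ext; intros; ringC. Qed.
Lemma ray_minus F G th I K : ray F th I -> ray G th K -> ray (fun l => F l - G l)%C th (I - K)%C.
Proof. intros H1 H2; pose proof (is_J_minus _ _ _ _ H1 H2) as H; revert H; apply is_J_ext; intros; ringC. Qed.
Lemma ray_scal c F th I : ray F th I -> ray (fun l => c * F l)%C th (c * I)%C.
Proof. intros H1; pose proof (is_J_scal c _ _ H1) as H; revert H; apply is_J_ext; intros; ringC. Qed.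

Lemma utm_ext x t uh uh' b b' T T' v :
  (forall l, Im l <= 0 -> uh l = uh' l) ->
  (forall th r, gam th -> 0 <= r -> b (pol r th) = b' (pol r th)) ->
  (forall l, Im l <= 0 -> T l = T' l) ->
  utm x t uh b T v -> utm x t uh' b' T' v.
Proof.
  intros Hu Hb HT (A0 & A1 & B1 & B2 & D1 & D2 & P0 & P1 & Q1 & Q2 & [HA0 HA1] & [HB1 HB2] & [HD1 HD2] & [HP0 HP1] & [HQ1 HQ2] & HE).
  exists A0, A1, B1, B2, D1, D2, P0, P1, Q1, Q2.
  repeat split; try exact HE.
  - revert HA0; apply ray_ext; intros r Hr; rewrite Hu; auto. apply real_im; auto.
  - revert HA1; apply ray_ext; intros r Hr; rewrite Hu; auto. apply real_im; auto.
  - revert HB1; apply ray_ext; intros r Hr; unfold rot. destruct (gam_im (PI / 3) r); auto. { now left. } rewrite !Hu; auto.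
  - revert HB2; apply ray_ext; intros r Hr; unfold rot. destruct (gam_im (2 * PI / 3) r); auto. { now right. } rewrite !Hu; auto.
  - revert HD1; apply ray_ext; intros r Hr; rewrite Hb; auto. now left.
  - revert HD2; apply ray_ext; intros r Hr; rewrite Hb; auto. now right.
  - revert HP0; apply ray_ext; intros r Hr; rewrite HT; auto. apply real_im; auto.
  - revert HP1; apply ray_ext; intros r Hr; rewrite HT; auto. apply real_im; auto.
  - revert HQ1; apply ray_ext; intros r Hr; unfold rot. destruct (gam_im (PI / 3) r); auto. { now left. } rewrite !HT; auto.
  - revert HQ2; apply ray_ext; intros r Hr; unfold rot. destruct (gam_im (2 * PI / 3) r); auto. { now right. } rewrite !HT; auto.
Qed.

Lemma utm_plus x t uh uh' b b' T T' v v' :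
  utm x t uh b T v -> utm x t uh' b' T' v' ->
  utm x t (fun l => uh l + uh' l)%C (fun l => b l + b' l)%C (fun l => T l + T' l)%C (v + v')%C.
Proof.
  intros (A0 & A1 & B1 & B2 & D1 & D2 & P0 & P1 & Q1 & Q2 & [HA0 HA1] & [HB1 HB2] & [HD1 HD2] & [HP0 HP1] & [HQ1 HQ2] & HE)
    (A0' & A1' & B1' & B2' & D1' & D2' & P0' & P1' & Q1' & Q2' & [HA0' HA1'] & [HB1' HB2'] & [HD1' HD2'] & [HP0' HP1'] & [HQ1' HQ2'] & HE').
  exists (A0 + A0')%C, (A1 + A1')%C, (B1 + B1')%C, (B2 + B2')%C, (D1 + D1')%C, (D2 + D2')%C, (P0 + P0')%C, (P1 + P1')%C, (Q1 + Q1')%C, (Q2 + Q2')%C.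
  repeat split.
  - pose proof (ray_plus _ _ _ _ _ HA0 HA0') as H; revert H; apply ray_ext; intros; ringC.
  - pose proof (ray_plus _ _ _ _ _ HA1 HA1') as H; revert H; apply ray_ext; intros; ringC.
  - pose proof (ray_plus _ _ _ _ _ HB1 HB1') as H; revert H; apply ray_ext; intros; unfold rot; ringC.
  - pose proof (ray_plus _ _ _ _ _ HB2 HB2') as H; revert H; apply ray_ext; intros; unfold rot; ringC.
  - pose proof (ray_plus _ _ _ _ _ HD1 HD1') as H; revert H; apply ray_ext; intros; ringC.
  - pose proof (ray_plus _ _ _ _ _ HD2 HD2') as H; revert H; apply ray_ext; intros; ringC.
  - pose proof (ray_plus _ _ _ _ _ HP0 HP0') as H; revert H; apply ray_ext; intros; ringC.
  - pose proof (ray_plus _ _ _ _ _ HP1 HP1') as H; revert H; apply ray_ext; intros; ringC.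
  - pose proof (ray_plus _ _ _ _ _ HQ1 HQ1') as H; revert H; apply ray_ext; intros; unfold rot; ringC.
  - pose proof (ray_plus _ _ _ _ _ HQ2 HQ2') as H; revert H; apply ray_ext; intros; unfold rot; ringC.
  - replace (RtoC (2 * PI) * (v + v'))%C with (RtoC (2 * PI) * v + RtoC (2 * PI) * v')%C by ringC.
    rewrite HE, HE'; ringC.
Qed.

(** This is e^(-k t) times [tilde], with the two exponentials merged: for Re k >= 0 the product
    stays bounded, whereas [tilde] alone grows. *)
Definition bt (a : R -> C) (k : C) (t : R) : C := CInt (fun s => Cexp (- (k * RtoC (t - s))) * a s)%C 0 t.

Lemma bt_ibp a a' k t :
  0 <= t -> (forall s, continuous a s) -> (forall s, continuous a' s) -> (forall s, 0 < s -> is_derive a s (a' s)) ->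
  (k * bt a k t = a t - Cexp (- (k * RtoC t)) * a 0%R - bt a' k t)%C.
Proof.
  intros Ht Ha Ha' Hd.
  assert (H : CInt (fun s => k * (Cexp (- (k * RtoC (t - s))) * a s) + Cexp (- (k * RtoC (t - s))) * a' s)%C 0 t =
     (a t - Cexp (- (k * RtoC t)) * a 0%R)%C).
  { rewrite (CInt_derive_open (fun s => Cexp (- (k * RtoC (t - s))) * a s)%C); auto.
    - replace (t - t) with 0 by ring. replace (- (k * RtoC 0))%C with (RtoC 0) by ringC.
      replace (t - 0) with t by ring. rewrite Cexp_0; ringC.
    - intros s Hs; pose proof (Hd s (proj1 Hs)). dr.
      replace (0 - 1) with (-1) by ring. rewrite RtoC_m1. ringC.
    - intros s; ct.
    - intros s; ct. }
  rewrite CInt_plus in H by (intros; ct). rewrite CInt_scal in H by (intros; ct).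
  unfold bt. rewrite <- H; ringC.
Qed.

Lemma exp_Re_le1 k s : 0 <= Re k -> 0 <= s -> Cmod (Cexp (- (k * RtoC s))) <= 1.
Proof.
  intros Hk Hs; rewrite Cmod_Cexp, <- exp_0; apply exp_le.
  unfold Re in *; simpl. nra.
Qed.

Lemma bt_bound a k t A :
  0 <= t -> 0 <= Re k -> (forall s, continuous a s) -> (forall s, 0 <= s <= t -> Cmod (a s) <= A) ->
  Cmod (bt a k t) <= A * t.
Proof.
  intros Ht Hk Ha HA; unfold bt. replace (A * t) with (A * (t - 0)) by ring.
  apply CInt_norm_const; auto.
  - intros; ct.
  - intros s Hs; rewrite Cmod_mult. pose proof (exp_Re_le1 k (t - s) Hk ltac:(lra)).
    pose proof (Cmod_ge_0 (a s)). pose proof (Cmod_ge_0 (Cexp (- (k * RtoC (t - s))))). specialize (HA s Hs). nra.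
Qed.

Lemma cont_bounded (a : R -> C) t : 0 <= t -> (forall s, continuous a s) -> exists A, 0 <= A /\ forall s, 0 <= s <= t -> Cmod (a s) <= A.
Proof.
  intros Ht Ha; destruct (cont0_bounded a t (cont0_ct a Ha) Ht) as [A HA]; exists A; split; auto.
  eapply Rle_trans; [apply Cmod_ge_0|apply (HA 0); lra].
Qed.

Lemma bt_decay a a' t :
  0 <= t -> (forall s, continuous a s) -> (forall s, continuous a' s) -> (forall s, 0 < s -> is_derive a s (a' s)) ->
  exists B, 0 <= B /\ forall k, 0 <= Re k -> Cmod k * Cmod (bt a k t) <= B.
Proof.
  intros Ht Ha Ha' Hd.
  destruct (cont_bounded a t Ht Ha) as [A [HA0 HA]].
  destruct (cont_bounded a' t Ht Ha') as [A' [HA0' HA']].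
  exists (2 * A + A' * t); split; [nra|].
  intros k Hk; rewrite <- Cmod_mult, (bt_ibp a a') by auto.
  unfold Cminus; eapply Rle_trans; [apply Cmod_triangle|]; eapply Rle_trans; [apply Rplus_le_compat_r, Cmod_triangle|].
  rewrite !Cmod_opp, Cmod_mult.
  pose proof (bt_bound a' k t A' Ht Hk Ha' HA'). pose proof (exp_Re_le1 k t Hk Ht).
  pose proof (HA t ltac:(lra)). pose proof (HA 0 ltac:(lra)).
  pose proof (Cmod_ge_0 (a 0)). pose proof (Cmod_ge_0 (Cexp (- (k * RtoC t)))). nra.
Qed.

Lemma bt_ct a t {U : UniformSpace} (f : U -> C) p :
  0 <= t -> (forall s, continuous a s) -> continuous f p -> continuous (fun x => bt a (f x) t) p.
Proof.
  intros Ht Ha Hf; unfold bt.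
  apply (ct_comp (fun k => CInt (fun s => Cexp (- (k * RtoC (t - s))) * a s)%C 0 t) f); auto.
  intros k; apply (CInt_ct (fun k s => Cexp (- (k * RtoC (t - s))) * a s)%C); auto.
  intros k' s _; unfold jct; ct.
Qed.

(** The boundary terms in the transform of phi''' form a quadratic polynomial of this kind. *)
Definition qpoly (c2 c1 c0 l : C) : C := (c2 * (l * l) + c1 * l + c0)%C.

Lemma qpoly_bound c2 c1 c0 r th : 0 <= r ->
  Cmod (qpoly c2 c1 c0 (pol r th)) <= (Cmod c2 + Cmod c1 + Cmod c0) * (1 + r) ^ 2.
Proof.
  intros Hr; unfold qpoly.
  eapply Rle_trans; [apply Cmod_triangle|]; eapply Rle_trans; [apply Rplus_le_compat_r, Cmod_triangle|].
  rewrite !Cmod_mult, Cmod_pol by auto.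
  pose proof (Cmod_ge_0 c2); pose proof (Cmod_ge_0 c1); pose proof (Cmod_ge_0 c0).
  assert (r * r <= (1 + r) ^ 2) by nra. assert (r <= (1 + r) ^ 2) by nra. assert (1 <= (1 + r) ^ 2) by nra. nra.
Qed.

Lemma Cmod_omega_pol r th : 0 <= r -> Cmod (omega (pol r th)) = r ^ 3.
Proof. intros; unfold omega; rewrite Cmod_mult, Cmod_opp, Cmod_Ci, Cmod_pow, Cmod_pol by auto; ring. Qed.

Lemma Re_omega_pol r th : 0 <= r -> 0 <= sin (3 * th) -> 0 <= Re (omega (pol r th)).
Proof. intros; rewrite omega_pol; unfold Re; simpl. repeat apply Rmult_le_pos; lra. Qed.

(* Since [bt a (omega l) t] is [O(1/|l|^3)] where [Re omega >= 0], Jordan's lemma applies even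
   after multiplication by a quadratic polynomial. *)
Lemma bt_rot a a' t x c2 c1 c0 t1 t2 I :
  0 <= t -> 0 < x -> (forall s, continuous a s) -> (forall s, continuous a' s) -> (forall s, 0 < s -> is_derive a s (a' s)) ->
  sector_ok t1 t2 ->
  ray (fun l => Kx x l * (qpoly c2 c1 c0 l * bt a (omega l) t))%C t2 I <->
  ray (fun l => Kx x l * (qpoly c2 c1 c0 l * bt a (omega l) t))%C t1 I.
Proof.
  intros Ht Hx Ha Ha' Hd Hs; pose proof (sector_ok_range _ _ Hs) as Hr.
  destruct (bt_decay a a' t Ht Ha Ha' Hd) as [B [HB HBk]].
  assert (CG : forall z, continuous (fun l => Kx x l * (qpoly c2 c1 c0 l * bt a (omega l) t))%C z).
  { intros z; apply ct_mult; [ctx|apply ct_mult; [unfold qpoly; ctx|apply bt_ct; auto; ctx]]. }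
  set (P := Cmod c2 + Cmod c1 + Cmod c0).
  assert (HP : 0 <= P) by (unfold P; pose proof (Cmod_ge_0 c2); pose proof (Cmod_ge_0 c1); pose proof (Cmod_ge_0 c0); lra).
  apply (ray_rot _ t1 t2 x (4 * P * B)); try lra; auto.
  - apply (CI_ext (fun z => CInt (fun s => Kx x z * (qpoly c2 c1 c0 z * (Cexp (- (omega z * RtoC (t - s))) * a s)))%C 0 t)); [lra| |].
    { intros r th _ _; unfold bt. rewrite CInt_scal by (intros; ct). rewrite CInt_scal by (intros; ct). reflexivity. }
    apply (CI_CInt (fun z s => Kx x z * (qpoly c2 c1 c0 z * (Cexp (- (omega z * RtoC (t - s))) * a s)))%C); auto; try lra.
    + intros z s; unfold jct, qpoly; ctx.
    + intros s Hst. eapply (sector_identity _ _ (t1 - 1) (t2 + 1)); try lra.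
      intros r th _ _; split; [|split].
      * unfold qpoly; holx.
      * unfold qpoly; ctx.
      * unfold qpoly; ctx.
  - pose proof (Rmult_le_pos _ _ HP HB). lra.
  - intros r th Hr1 Hth; rewrite !Cmod_mult, Kx_mod.
    pose proof (qpoly_bound c2 c1 c0 r th ltac:(lra)) as Q; fold P in Q.
    specialize (HBk (omega (pol r th)) (Re_omega_pol r th ltac:(lra) (sin3_pos _ _ _ Hs Hth))).
    rewrite Cmod_omega_pol in HBk by lra.
    rewrite Rmult_comm; apply Rmult_le_compat_r; [left; apply exp_pos|].
    assert (Hb : Cmod (bt a (omega (pol r th)) t) <= B / r ^ 3).
    { assert (0 < r ^ 3) by (apply pow_lt; lra).
      apply (Rmult_le_reg_l (r ^ 3)); auto. replace (r ^ 3 * (B / r ^ 3)) with B by (field; lra). exact HBk. }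
    replace (4 * P * B / r) with (P * (2 * r) ^ 2 * (B / r ^ 3)) by (field; lra).
    apply Rmult_le_compat; try apply Cmod_ge_0; auto.
    eapply Rle_trans; [exact Q|]. apply Rmult_le_compat_l; auto. nra.
Qed.

Lemma gam_sin3 th : gam th -> sin (3 * th) = 0.
Proof.
  intros [-> | ->].
  - replace (3 * (PI / 3)) with PI by field; apply sin_PI.
  - replace (3 * (2 * PI / 3)) with (2 * PI) by field; apply sin_2PI.
Qed.

(** The exponential decay of e^(izx) on Gamma absorbs any polynomial growth. *)
Lemma ray_gamma_ex x th (G : C -> C) B m :
  0 < x -> gam th -> (forall r, 0 <= r -> continuous G (pol r th)) ->
  (forall r, 0 <= r -> Cmod (G (pol r th)) <= B * (1 + r) ^ m) ->
  exists I, ray (fun l => Kx x l * G l)%C th I.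
Proof.
  intros Hx Hth HG HB; destruct (gam_cos th Hth) as [_ Hs].
  destruct (ray_dom x th (fun r => G (pol r th) * ex th)%C B m Hx Hs) as [M HM].
  { intros r Hr; rewrite Cmod_mult, Cmod_ex, Rmult_1_r; auto. }
  exists (J (fun r => Kx x (pol r th) * (G (pol r th) * ex th))%C).
  apply (is_J_ext (fun r => Kx x (pol r th) * (G (pol r th) * ex th))%C).
  - intros r _; unfold pol; ringC.
  - apply (J_is M); [|apply HM; lra].
    apply (cont0_mult (fun r => Kx x (pol r th))); [apply cont0_ct; intros; ctx|].
    intros r; apply (ct_mult (fun r => G (pol (Rmax 0 r) th)) (fun _ => ex th)); [|apply continuous_const].
    apply (continuous_comp (fun r => pol (Rmax 0 r) th) G); [ctx|apply HG, Rmax_l].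
Qed.

Lemma HH_ctc phi M {U : UniformSpace} (f : U -> C) p :
  cont0 phi -> dom M phi -> continuous f p -> continuous (fun x => HH phi (f x)) p.
Proof. intros; apply (ct_comp (HH phi) f); auto. intros; now apply (HH_ct phi M). Qed.

Lemma rot_bound u B l : (forall l, Cmod (u l) <= B) -> Cmod (rot u l) <= 2 * B.
Proof.
  intros H; unfold rot; eapply Rle_trans; [apply Cmod_triangle|].
  rewrite !Cmod_mult, alpha2_ex, alpha_ex, !Cmod_ex. pose proof (H (ex (2 * PI / 3) * l)%C).
  pose proof (H (ex (4 * PI / 3) * l)%C). lra.
Qed.

(** Two jets expand the transform into phi(0) rho plus a remainder of order |l|^-2. The first term
    converges only conditionally and is brought over from Gamma by rotation; the remainder converges
    absolutely. *)
Lemma initial_rays phi n M x t :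
  jets n phi M -> (2 <= n)%nat -> 0 < x -> 0 <= t ->
  (exists A0, ray (fun l => Kx x l * Ew t l * HH (phi O) l)%C 0 A0) /\
  (exists A1, ray (fun l => Kx x l * Ew t l * HH (phi O) l)%C PI A1).
Proof.
  intros HJ Hn Hx Ht; pose proof PI_RGT_0.
  pose proof (proj1 HJ 2%nat ltac:(lia)) as [C2 D2].
  assert (E : forall l, Im l <= 0 -> HH (phi O) l = (phi O 0%R * rho l + rho l * rho l * (phi 1%nat 0%R + HH (phi 2%nat) l))%C).
  { intros l Hl; rewrite (HH_jet n phi M 0), (HH_jet n phi M 1) by (auto; lia). ringC. }
  assert (Q0 : forall th, gam th -> exists I, ray (fun l => Kx x l * Ew t l * rho l)%C th I).
  { intros th Hth. destruct (ray_gamma_ex x th (fun l => Ew t l * rho l)%C 6 0 Hx Hth) as [I HI].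
    - intros r Hr; unfold Ew; apply ct_mult; [ctx|]. apply rho_ct, rho_pol_nz. now apply gam_cos.
    - intros r Hr; rewrite Cmod_mult.
      pose proof (omega_decay r th t Hr Ht ltac:(rewrite gam_sin3; auto; lra)) as W; fold (Ew t (pol r th)) in W.
      pose proof (rho_gamma_bound th r Hth Hr) as B. rewrite Cmod_mult, Cmod_ex in B.
      pose proof (Cmod_ge_0 (rho (pol r th))). pose proof (Cmod_ge_0 (Ew t (pol r th))). nra.
    - exists I. revert HI; apply ray_ext; intros; ringC. }
  assert (R : forall th t1 t2, th = 0 \/ th = PI -> (th = 0 -> t1 = 0 /\ t2 = PI / 3) -> (th = PI -> t1 = 2 * PI / 3 /\ t2 = PI) ->
     exists I, ray (fun l => Kx x l * Ew t l * HH (phi O) l)%C th I).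
  { intros th t1 t2 Hth H1 H2.
    assert (Hs : sector_ok t1 t2) by (destruct Hth as [Hth|Hth]; [left; destruct (H1 Hth); lra|right; destruct (H2 Hth); lra]).
    assert (Q1 : exists I1, ray (fun l => Kx x l * Ew t l * rho l)%C th I1).
    { destruct Hth as [Hth|Hth]; [destruct (H1 Hth) as [E1 E2]|destruct (H2 Hth) as [E1 E2]]; subst.
      - destruct (Q0 (PI / 3) ltac:(now left)) as [I HI]. exists I. exact (proj1 (rho_rot x t 0 (PI / 3) I Hx Ht Hs) HI).
      - destruct (Q0 (2 * PI / 3) ltac:(now right)) as [I HI]. exists I. exact (proj2 (rho_rot x t (2 * PI / 3) PI I Hx Ht Hs) HI). }
    destruct Q1 as [I1 HI1].
    set (g := fun r => (Kx x (pol r th) * Ew t (pol r th) * (rho (pol r th) * rho (pol r th) * (phi 1%nat 0%R + HH (phi 2%nat) (pol r th))) * ex th)%C).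
    assert (Im0 : forall r, Im (pol r th) <= 0) by (intros; apply real_im; auto).
    assert (Q2 : is_J g (J g)).
    { set (B := Cmod (phi 1%nat 0%R) + M).
      apply (J_is (4 * B)).
      - apply cont0_ct; intros r; unfold g, Ew.
        assert (Cr : continuous (fun r => rho (pol r th)) r).
        { apply (continuous_comp (fun r => pol r th) rho); [ctx|apply rho_ct, rho_nz, Im0]. }
        apply ct_mult; [|ctx]. apply ct_mult; [ctx|]. apply ct_mult; [now apply ct_mult|].
        apply ct_plus; [ctx|]. apply (HH_ctc _ M); auto. ctx.
      - intros r Hr; unfold g; rewrite !Cmod_mult, Cmod_ex, Kx_mod.
        assert (Hsin : sin th = 0) by (destruct Hth as [-> | ->]; [apply sin_0|apply sin_PI]).
        assert (Hsin3 : sin (3 * th) = 0).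
        { destruct Hth as [-> | ->]; [rewrite Rmult_0_r; apply sin_0|].
          replace (3 * PI) with (PI + 2 * PI) by ring. rewrite sin_2PI_neg || (rewrite sin_plus, sin_2PI, sin_PI; ring). }
        rewrite Hsin, !Rmult_0_r, Ropp_0, exp_0.
        pose proof (omega_decay r th t Hr Ht ltac:(lra)) as W; fold (Ew t (pol r th)) in W.
        pose proof (rho_bound (pol r th) (Im0 r)) as Rb. rewrite Cmod_pol in Rb by auto.
        assert (HB : Cmod (phi 1%nat 0%R + HH (phi 2%nat) (pol r th)) <= B).
        { eapply Rle_trans; [apply Cmod_triangle|]. pose proof (HH_bound M (phi 2%nat) (pol r th) C2 D2). unfold B; lra. }
        pose proof (Cmod_ge_0 (rho (pol r th))). pose proof (Cmod_ge_0 (Ew t (pol r th))).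
        pose proof (Cmod_ge_0 (phi 1%nat 0%R + HH (phi 2%nat) (pol r th))).
        replace (4 * B / (1 + r) ^ 2) with (1 * 1 * (2 / (1 + r) * (2 / (1 + r)) * B) * 1) by (field; lra).
        apply Rmult_le_compat_r; [lra|]. apply Rmult_le_compat; try lra.
        + repeat apply Rmult_le_pos; auto.
        + apply Rmult_le_compat; auto. * now apply Rmult_le_pos. * apply Rmult_le_compat; auto. }
    exists (phi O 0%R * I1 + J g)%C.
    pose proof (is_J_plus _ _ _ _ (ray_scal (phi O 0%R) _ _ _ HI1) Q2) as T; revert T; apply is_J_ext; intros r Hr.
    fold (pol r th). rewrite E by apply Im0. unfold g; ringC. }
  split.
  - apply (R 0 0 (PI / 3)); auto. intros; lra.
  - apply (R PI (2 * PI / 3) PI); auto. intros; lra.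
Qed.

(** The left side is the distance from x to the line spanned by e^(i be). *)
Lemma im_dist x y be : 0 < x -> 0 <= y -> Cmod (ex be) = 1 -> sin be <> 0 ->
  x * Rabs (sin be) <= Cmod (RtoC x - ex be * RtoC y).
Proof.
  intros Hx Hy _ Hs; rewrite ex_eq; set (s := sin be); set (c := cos be).
  apply Rsqr_incr_0_var; [|apply Cmod_ge_0].
  rewrite !Rsqr_pow2, Cmod2_alt. unfold Re, Im; simpl.
  pose proof (sin2_cos2 be) as S; unfold Rsqr in S; fold s c in S.
  replace (x * Rabs s * (x * Rabs s * 1)) with (x * x * (Rabs s * Rabs s)) by ring.
  rewrite <- Rabs_mult, Rabs_pos_eq by apply Rle_0_sqr.
  replace ((x + - (c * y - s * 0)) * ((x + - (c * y - s * 0)) * 1) + (0 + - (c * 0 + s * y)) * ((0 + - (c * 0 + s * y)) * 1))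
    with (x * x - 2 * (c * x * y) + y * y * (s * s + c * c)) by ring.
  rewrite S. replace (s * s) with (1 - c * c) by lra.
  pose proof (Rle_0_sqr (y - c * x)) as Q; unfold Rsqr in Q. nra.
Qed.

(* The oscillating exponential integrates along the ray to [i / (x - beta y)], whatever the ray. *)
Lemma gam_zero phi M x th be :
  0 < x -> cont0 phi -> dom M phi -> sin be <> 0 -> 0 < sin th ->
  (forall r, 0 <= r -> Im (ex be * pol r th) <= 0) ->
  ray (fun l => Kx x l * (ex be * HH phi (ex be * l)))%C th
      (Ci * ex be * J (fun y => phi y * / (RtoC x - ex be * RtoC y)))%C.
Proof.
  intros Hx Hc Hd Hbe Hs Him; pose proof (dom_pos _ _ Hd) as HM.
  set (dl := x * Rabs (sin be)).
  assert (Hdl : 0 < dl) by (unfold dl; apply Rmult_lt_0_compat; auto; now apply Rabs_pos_lt).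
  assert (Hden : forall y, 0 <= y -> dl <= Cmod (RtoC x - ex be * RtoC y)).
  { intros y Hy; apply im_dist; auto. apply Cmod_ex. }
  assert (Hnz : forall y, 0 <= y -> (RtoC x - ex be * RtoC y)%C <> 0%C).
  { intros y Hy E; specialize (Hden y Hy); rewrite E, Cmod_0 in Hden; lra. }
  pose proof Ci2 as Ii.
  set (psi := fun y => (phi y * / (RtoC x - ex be * RtoC y))%C).
  assert (Cpsi : cont0 psi).
  { intros r; unfold cl, psi; apply ct_mult; [apply Hc|]. apply ct_inv; [ctx|]. apply Hnz, Rmax_l. }
  assert (Dpsi : forall y, 0 <= y -> Cmod (psi y) <= M / dl / (1 + y) ^ 2).
  { intros y Hy; unfold psi; rewrite Cmod_mult, Cmod_inv by auto.
    replace (M / dl / (1 + y) ^ 2) with (M / (1 + y) ^ 2 * / dl) by (field; split; lra).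
    apply Rmult_le_compat; [apply Cmod_ge_0| |now apply Hd|].
    - left; apply Rinv_0_lt_compat; specialize (Hden y Hy); lra.
    - apply Rinv_le_contravar; auto. }
  unfold ray. set (F := fun r => (Kx x (RtoC r * ex th) * (ex be * HH phi (ex be * (RtoC r * ex th))) * ex th)%C).
  assert (CF : cont0 F).
  { apply cont0_ct; intros r; unfold F. apply ct_mult; [|ctx]. apply ct_mult; [ctx|].
    apply ct_mult; [ctx|]. apply (HH_ctc _ M); auto. ctx. }
  assert (Key : forall N, 0 <= N -> CInt F 0 N = (- Ci * ex be * (J (fun y => psi y * (Kx x (pol N th) * ek (ex be * pol N th) y)) - J psi))%C).
  { intros N HN.
    set (f := fun r y => (Kx x (pol (clab 0 N r) th) * (ex be * (ek (ex be * pol (clab 0 N r) th) y * phi y)) * ex th)%C).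
    assert (Ccl : forall r, continuous (clab 0 N) r) by (intros; unfold clab; ct).
    assert (Kb : forall r, 0 <= r -> Cmod (Kx x (pol r th)) <= 1).
    { intros r Hr; rewrite Kx_mod, <- exp_0; apply exp_le. assert (0 <= r * sin th) by nra. nra. }
    assert (Fub : is_J (fun y => CInt (fun r => f r y) 0 N) (CInt (fun r => J (f r)) 0 N)).
    { apply (J_Fubini_loc f 0 N M HN).
      - intros p y; unfold jct, cl, f.
        apply ct_mult; [|ctx]. apply ct_mult; [ctx|].
        apply ct_mult; [ctx|]. apply ct_mult; [ctx|].
        apply (ct_comp (cl phi) (fun q : R * R => snd q)); [exact Hc|ct].
      - intros p _ y Hy; unfold f; rewrite !Cmod_mult, !Cmod_ex.
        pose proof (Kb (clab 0 N p) (proj1 (clab_in 0 N p HN))). pose proof (ek_bound (ex be * pol (clab 0 N p) th) y Hy).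
        pose proof (Cmod_ge_0 (Kx x (pol (clab 0 N p) th))). pose proof (Cmod_ge_0 (ek (ex be * pol (clab 0 N p) th) y)).
        pose proof (Hd y Hy). pose proof (Cmod_ge_0 (phi y)).
        rewrite Rmult_1_r, Rmult_1_l.
        apply (Rle_trans _ (1 * (1 * Cmod (phi y)))); [|lra].
        apply Rmult_le_compat; auto. + now apply Rmult_le_pos. + now apply Rmult_le_compat_r. }
    transitivity (CInt (fun r => J (f r)) 0 N).
    { apply CInt_ext; intros r Hr; rewrite Rmin_left, Rmax_right in Hr by lra.
      unfold f, F. rewrite clab_id by lra. fold (pol r th). symmetry.
      rewrite (J_scalr (Cmod (Kx x (pol r th) * ex be) * M) (ex th) (fun y => Kx x (pol r th) * (ex be * (ek (ex be * pol r th) y * phi y)))%C).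
      - f_equal. rewrite (J_ext _ (fun y => (Kx x (pol r th) * ex be) * (ek (ex be * pol r th) y * phi y))%C) by (intros; ringC).
        unfold HH; rewrite (J_scal M); [ringC|now apply ek_cont0|now apply ek_dom].
      - apply (cont0_scal (Kx x (pol r th)) (fun y => ex be * (ek (ex be * pol r th) y * phi y))%C).
        apply (cont0_scal (ex be) (fun y => ek (ex be * pol r th) y * phi y)%C). now apply ek_cont0.
      - intros y Hy. replace (Kx x (pol r th) * (ex be * (ek (ex be * pol r th) y * phi y)))%C with
          ((Kx x (pol r th) * ex be) * (ek (ex be * pol r th) y * phi y))%C by ringC.
        rewrite Cmod_mult. pose proof (ek_dom M (ex be * pol r th) phi Hd y Hy).
        unfold Rdiv; rewrite Rmult_assoc. apply Rmult_le_compat_l; [apply Cmod_ge_0|exact H]. }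
    rewrite <- (is_J_unique _ _ Fub).
    assert (Cps2 : cont0 (fun y => psi y * (Kx x (pol N th) * ek (ex be * pol N th) y))%C).
    { apply (cont0_mult psi); auto. apply (cont0_scal (Kx x (pol N th)) (fun y => ek (ex be * pol N th) y)).
      apply cont0_ct; intros; ctx. }
    assert (Dps2 : dom (M / dl) (fun y => psi y * (Kx x (pol N th) * ek (ex be * pol N th) y))%C).
    { intros y Hy; rewrite !Cmod_mult. specialize (Dpsi y Hy). pose proof (Kb N HN). pose proof (ek_bound (ex be * pol N th) y Hy).
      pose proof (Cmod_ge_0 (psi y)). pose proof (Cmod_ge_0 (Kx x (pol N th))). pose proof (Cmod_ge_0 (ek (ex be * pol N th) y)).
      assert (Cmod (Kx x (pol N th)) * Cmod (ek (ex be * pol N th) y) <= 1 * 1) by (apply Rmult_le_compat; auto).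
      nra. }
    assert (DP : dom (M / dl) psi) by (intros y Hy; apply Dpsi; auto).
    rewrite <- (J_minus (M / dl)), <- (J_scal (M / dl + M / dl)); auto.
    - apply J_ext; intros y Hy.
      set (w := (RtoC x - ex be * RtoC y)%C).
      rewrite (CInt_ext _ (fun r => ex be * phi y * (Cexp (Ci * w * pol r th) * ex th))%C).
      2: { intros r Hr; rewrite Rmin_left, Rmax_right in Hr by lra. unfold f; rewrite clab_id by lra.
           unfold ek; rewrite dn_id by (apply Him; lra). unfold Kx, w.
           replace (Ci * (RtoC x - ex be * RtoC y) * pol r th)%C with (Ci * pol r th * RtoC x + - (Ci * (ex be * pol r th) * RtoC y))%C by ringC.
           rewrite Cexp_plus; ringC. }
      rewrite CInt_scal by (intros; ctx).
      rewrite (CInt_derive (fun r => - Ci * / w * Cexp (Ci * w * pol r th))%C).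
      + unfold psi; fold w. unfold pol at 2. replace (Ci * w * (0 * ex th))%C with (RtoC 0) by ringC. rewrite Cexp_0.
        unfold Kx, ek; rewrite dn_id by (apply Him; lra).
        replace (Cexp (Ci * w * pol N th)) with (Cexp (Ci * pol N th * RtoC x) * Cexp (- (Ci * (ex be * pol N th) * RtoC y)))%C; [ringC|].
        rewrite <- Cexp_plus; f_equal; unfold w; ringC.
      + intros r _; unfold pol; dr.
        transitivity (- (Ci * Ci) * (w * / w) * (Cexp (Ci * w * (RtoC r * ex th)) * ex th))%C; [ringC|].
        rewrite Ii. replace (w * / w)%C with (RtoC 1) by (field; apply Hnz; auto). ringC.
      + intros; ctx.
    - apply (cont0_minus (fun y => psi y * (Kx x (pol N th) * ek (ex be * pol N th) y))%C psi); auto.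
    - intros y Hy; unfold Cminus; eapply Rle_trans; [apply Cmod_triangle|]; rewrite Cmod_opp.
      specialize (Dps2 y Hy); specialize (DP y Hy).
      replace ((M / dl + M / dl) / (1 + y) ^ 2) with (M / dl / (1 + y) ^ 2 + M / dl / (1 + y) ^ 2) by (field; split; lra).
      lra. }
  apply is_J_char; auto; apply lim_Cmod; [apply Rbar_locally_filter|]; intros e He.
  set (k := x * sin th). assert (Hk : 0 < k) by (unfold k; nra).
  set (Q := M / dl). assert (HQ : 0 <= Q) by (unfold Q; apply Rmult_le_pos; auto; left; now apply Rinv_0_lt_compat).
  exists (Q / e / k); intros N HN.
  assert (HQe : 0 <= Q / e / k).
  { repeat apply Rmult_le_pos; auto; left; now apply Rinv_0_lt_compat. }
  rewrite CInt_cl, Key by lra.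
  replace (- Ci * ex be * (J (fun y => psi y * (Kx x (pol N th) * ek (ex be * pol N th) y)) - J psi) - Ci * ex be * J psi)%C
    with (- Ci * ex be * J (fun y => psi y * (Kx x (pol N th) * ek (ex be * pol N th) y)))%C by ringC.
  rewrite !Cmod_mult, Cmod_opp, Cmod_Ci, Cmod_ex, !Rmult_1_l.
  assert (HKN : exp (- (x * (N * sin th))) * Q < e).
  { replace (x * (N * sin th)) with (k * N) by (unfold k; ring).
    assert (HkN : 0 <= k * N) by nra.
    assert (Q < e * (k * N) + e).
    { assert (E1 : Q / e / k * (e * k) = Q) by (field; split; lra).
      assert (E2 : Q / e / k * (e * k) <= N * (e * k)) by (apply Rmult_le_compat_r; [left; now apply Rmult_lt_0_compat|lra]).
      replace (e * (k * N)) with (N * (e * k)) by ring. lra. }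
    pose proof (exp_ineq1_le (k * N)). rewrite exp_Ropp.
    apply (Rmult_lt_reg_l (exp (k * N))); [apply exp_pos|]. rewrite <- Rmult_assoc, Rinv_r by (pose proof (exp_pos (k * N)); lra). nra. }
  eapply Rle_lt_trans; [apply (J_bound (exp (- (x * (N * sin th))) * Q))|exact HKN].
  - apply (cont0_mult psi); auto. apply (cont0_scal (Kx x (pol N th)) (fun y => ek (ex be * pol N th) y)).
    apply cont0_ct; intros; ctx.
  - intros y Hy; rewrite !Cmod_mult, Kx_mod. specialize (Dpsi y Hy). pose proof (ek_bound (ex be * pol N th) y Hy).
    pose proof (Cmod_ge_0 (psi y)). pose proof (Cmod_ge_0 (ek (ex be * pol N th) y)).
    pose proof (exp_pos (- (x * (N * sin th)))).
    fold Q in Dpsi. unfold Rdiv in *. 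
    assert (exp (- (x * (N * sin th))) * Cmod (ek (ex be * pol N th) y) <= exp (- (x * (N * sin th))) * 1) by (apply Rmult_le_compat_l; lra).
    rewrite Rmult_assoc. rewrite (Rmult_comm (exp _) (Q * _)). apply Rmult_le_compat; auto.
    + apply Rmult_le_pos; lra.
    + lra.
Qed.

Lemma sin_alpha : sin (2 * PI / 3) <> 0 /\ sin (4 * PI / 3) <> 0.
Proof.
  pose proof sin_PI3_pos; split.
  - rewrite sin_2PI3_eq; lra.
  - replace (4 * PI / 3) with (PI / 3 + PI) by field. rewrite neg_sin; lra.
Qed.

(** The same [Z] serves both rays of Gamma, so that the rotated transforms contribute nothing to the
    difference and Fourier inversion alone remains. *)
Lemma gam_zero_rot phi M x :
  0 < x -> cont0 phi -> dom M phi ->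
  exists Z, forall th, gam th -> ray (fun l => Kx x l * rot (HH phi) l)%C th Z.
Proof.
  intros Hx Hc Hd; destruct sin_alpha as [S1 S2].
  exists (Ci * ex (2 * PI / 3) * J (fun y => phi y * / (RtoC x - ex (2 * PI / 3) * RtoC y)) +
     Ci * ex (4 * PI / 3) * J (fun y => phi y * / (RtoC x - ex (4 * PI / 3) * RtoC y)))%C.
  intros th Hth; destruct (gam_cos th Hth) as [_ Hs].
  pose proof (gam_zero phi M x th (2 * PI / 3) Hx Hc Hd S1 Hs ltac:(intros r Hr; rewrite <- alpha_ex; now apply gam_im)) as H1.
  pose proof (gam_zero phi M x th (4 * PI / 3) Hx Hc Hd S2 Hs ltac:(intros r Hr; rewrite <- alpha2_ex; now apply gam_im)) as H2.
  pose proof (ray_plus _ _ _ _ _ H1 H2) as H; revert H; apply ray_ext; intros r Hr; unfold rot.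
  rewrite <- alpha2_ex, <- alpha_ex; ringC.
Qed.

(* [W(x,t) = a(t) phi(x)] is represented by the formula with its own data. *)
Lemma utm_sep a a' phi M x t :
  0 < x -> 0 < t -> (forall s, continuous a s) -> (forall s, continuous a' s) -> (forall s, 0 < s -> is_derive a s (a' s)) ->
  jets 2 phi M ->
  let c2 := phi 0%nat 0%R in
  let c1 := (- Ci * (phi 1%nat 0%R - phi 0%nat 0%R))%C in
  let c0 := (- (phi 2%nat 0%R - 2 * phi 1%nat 0%R + phi 0%nat 0%R))%C in
  utm x t (fun l => a 0%R * HH (phi O) l)%C (fun l => phi O 0%R * bt a (omega l) t)%C
      (fun l => (a t - Ew t l * a 0%R) * HH (phi O) l + qpoly c2 c1 c0 l * bt a (omega l) t)%C
      (a t * phi O x)%C.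
Proof.
  intros Hx Ht Ha Ha' Hd HJ c2 c1 c0; pose proof PI_RGT_0.
  destruct (initial_rays phi 2 M x t HJ ltac:(lia) Hx ltac:(lra)) as [[E0 HE0] [E1 HE1]].
  destruct (proj1 HJ O ltac:(lia)) as [C0 D0].
  assert (Dx : is_derive (phi O) x (phi 1%nat x - phi O x)%C) by (apply (proj2 HJ O ltac:(lia)); auto).
  destruct (inversion (phi O) M x _ C0 D0 Hx Dx) as [I0 [I1 [HI0 [HI1 HI]]]].
  destruct (gam_zero_rot (phi O) M x Hx C0 D0) as [Z HZ].
  assert (W1 : forall th r, gam th -> 0 <= r -> Cmod (Ew t (pol r th)) <= 1).
  { intros th r Hth Hr; apply omega_decay; auto; try lra. rewrite gam_sin3; auto; lra. }
  assert (G2 : forall th, gam th -> exists D, ray (fun l => Kx x l * Ew t l * rot (HH (phi O)) l)%C th D).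
  { intros th Hth; destruct (ray_gamma_ex x th (fun l => Ew t l * rot (HH (phi O)) l)%C (2 * M) 0 Hx Hth) as [D HD].
    - intros r Hr; unfold Ew, rot. apply ct_mult; [ctx|].
      apply ct_plus; (apply ct_mult; [ctx|]); apply (HH_ctc _ M); auto; ctx.
    - intros r Hr; rewrite Cmod_mult. specialize (W1 th r Hth Hr).
      pose proof (rot_bound (HH (phi O)) M (pol r th) (fun l => HH_bound M (phi O) l C0 D0)).
      pose proof (Cmod_ge_0 (rot (HH (phi O)) (pol r th))). pose proof (Cmod_ge_0 (Ew t (pol r th))). simpl. nra.
    - exists D; revert HD; apply ray_ext; intros; ringC. }
  destruct (G2 _ ltac:(now left)) as [F1 HF1]. destruct (G2 _ ltac:(now right)) as [F2 HF2].
  destruct (cont_bounded a t ltac:(lra) Ha) as [A [HA0 HA]].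
  assert (G3 : forall q2 q1 q0 th, gam th -> exists D, ray (fun l => Kx x l * (qpoly q2 q1 q0 l * bt a (omega l) t))%C th D).
  { intros q2 q1 q0 th Hth.
    apply (ray_gamma_ex x th (fun l => qpoly q2 q1 q0 l * bt a (omega l) t)%C ((Cmod q2 + Cmod q1 + Cmod q0) * (A * t)) 2 Hx Hth).
    - intros r Hr; unfold qpoly; apply ct_mult; [ctx|apply bt_ct; auto; try lra; ctx].
    - intros r Hr; rewrite Cmod_mult.
      pose proof (qpoly_bound q2 q1 q0 r th Hr).
      assert (Hb : Cmod (bt a (omega (pol r th)) t) <= A * t).
      { apply bt_bound; auto; try lra. apply Re_omega_pol; auto. rewrite gam_sin3; auto; lra. }
      replace ((Cmod q2 + Cmod q1 + Cmod q0) * (A * t) * (1 + r) ^ 2) with ((Cmod q2 + Cmod q1 + Cmod q0) * (1 + r) ^ 2 * (A * t)) by ring.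
      apply Rmult_le_compat; try apply Cmod_ge_0; auto. }
  destruct (G3 c2 c1 c0 _ ltac:(now left)) as [P1 HP1]. destruct (G3 c2 c1 c0 _ ltac:(now right)) as [P2 HP2].
  destruct (G3 (3 * c2)%C 0%C 0%C _ ltac:(now left)) as [S1 HS1]. destruct (G3 (3 * c2)%C 0%C 0%C _ ltac:(now right)) as [S2 HS2].
  pose proof (proj1 (bt_rot a a' t x c2 c1 c0 0 (PI / 3) P1 ltac:(lra) Hx Ha Ha' Hd ltac:(left; lra)) HP1) as HR0.
  pose proof (proj2 (bt_rot a a' t x c2 c1 c0 (2 * PI / 3) PI P2 ltac:(lra) Hx Ha Ha' Hd ltac:(right; lra)) HP2) as HR1.
  (* The algebra behind the combination with alpha and alpha^2: since 1 + alpha + alpha^2 = 0 and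
     alpha^3 = 1, rotating the quadratic q gives 3 c2 l^2 - q. The first part is the boundary datum
     with its factor 3 l^2; the second is undone by the integral over the line. *)
  assert (Er : forall l, rot (fun l => (a t - Ew t l * a 0%R) * HH (phi O) l + qpoly c2 c1 c0 l * bt a (omega l) t)%C l =
     ((a t - Ew t l * a 0%R) * rot (HH (phi O)) l + qpoly (3 * c2) 0 0 l * bt a (omega l) t - qpoly c2 c1 c0 l * bt a (omega l) t)%C).
  { intros l; unfold rot, Ew. rewrite omega_alpha, omega_alpha2.
    transitivity ((a t - Cexp (- (omega l * RtoC t)) * a 0%R) * (alpha * HH (phi O) (alpha * l) + alpha ^ 2 * HH (phi O) (alpha ^ 2 * l))
      + (alpha * qpoly c2 c1 c0 (alpha * l) + alpha ^ 2 * qpoly c2 c1 c0 (alpha ^ 2 * l)) * bt a (omega l) t)%C; [ringC|].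
    replace (alpha * qpoly c2 c1 c0 (alpha * l) + alpha ^ 2 * qpoly c2 c1 c0 (alpha ^ 2 * l))%C
      with (qpoly (3 * c2) 0 0 l - qpoly c2 c1 c0 l)%C; [ringC|].
    unfold qpoly.
    transitivity (2 * c2 * (l * l) - c1 * l - c0 + (c2 * (l * l) * ((alpha ^ 3 - 1) + (alpha ^ 3 * alpha ^ 3 - 1))
       + c1 * l * ((1 + alpha + alpha ^ 2) + alpha * (alpha ^ 3 - 1)) + c0 * (1 + alpha + alpha ^ 2)))%C.
    - rewrite alpha3, alpha_sum.
      replace (RtoC 3) with (RtoC 1 + RtoC 1 + RtoC 1)%C by (rewrite <- !RtoC_plus; f_equal; ring).
      replace (RtoC 2) with (RtoC 1 + RtoC 1)%C by (rewrite <- !RtoC_plus; f_equal; ring). ringC.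
    - replace (RtoC 2) with (RtoC 1 + RtoC 1)%C by (rewrite <- !RtoC_plus; f_equal; ring). simpl. ringC. }
  (* In the sum the terms E and F of the initial datum cancel against the forcing, P1 and P2 between
     the last two contours, S1 and S2 between the boundary integral and the last one, and Z with
     itself; a(t) (I0 - I1) is left. *)
  exists (a 0%R * E0)%C, (a 0%R * E1)%C, (a 0%R * F1)%C, (a 0%R * F2)%C, S1, S2,
    (a t * I0 - a 0%R * E0 + P1)%C, (a t * I1 - a 0%R * E1 + P2)%C,
    (a t * Z - a 0%R * F1 + S1 - P1)%C, (a t * Z - a 0%R * F2 + S2 - P2)%C.
  repeat split.
  - pose proof (ray_scal (a 0%R) _ _ _ HE0) as T; revert T; apply ray_ext; intros; ringC.
  - pose proof (ray_scal (a 0%R) _ _ _ HE1) as T; revert T; apply ray_ext; intros; ringC.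
  - pose proof (ray_scal (a 0%R) _ _ _ HF1) as T; revert T; apply ray_ext; intros; unfold rot; ringC.
  - pose proof (ray_scal (a 0%R) _ _ _ HF2) as T; revert T; apply ray_ext; intros; unfold rot; ringC.
  - revert HS1; apply ray_ext; intros; unfold qpoly, c2; ringC.
  - revert HS2; apply ray_ext; intros; unfold qpoly, c2; ringC.
  - pose proof (ray_plus _ _ _ _ _ (ray_minus _ _ _ _ _ (ray_scal (a t) _ _ _ HI0) (ray_scal (a 0%R) _ _ _ HE0)) HR0) as T.
    revert T; apply ray_ext; intros; ringC.
  - pose proof (ray_plus _ _ _ _ _ (ray_minus _ _ _ _ _ (ray_scal (a t) _ _ _ HI1) (ray_scal (a 0%R) _ _ _ HE1)) HR1) as T.
    revert T; apply ray_ext; intros; ringC.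
  - pose proof (ray_minus _ _ _ _ _ (ray_plus _ _ _ _ _ (ray_minus _ _ _ _ _ (ray_scal (a t) _ _ _ (HZ _ ltac:(now left))) (ray_scal (a 0%R) _ _ _ HF1)) HS1) HP1) as T.
    revert T; apply ray_ext; intros; rewrite Er; ringC.
  - pose proof (ray_minus _ _ _ _ _ (ray_plus _ _ _ _ _ (ray_minus _ _ _ _ _ (ray_scal (a t) _ _ _ (HZ _ ltac:(now right))) (ray_scal (a 0%R) _ _ _ HF2)) HS2) HP2) as T.
    revert T; apply ray_ext; intros; rewrite Er; ringC.
  - transitivity (a t * (RtoC (2 * PI) * phi O x))%C; [ringC|]. rewrite <- HI; ringC.
Qed.

(** * The contribution of the boundary datum *)

Definition th1 : R := PI / 6.
Definition th2 : R := 5 * PI / 6.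
Definition isth (th : R) : Prop := th = th1 \/ th = th2.

Lemma isth_sin th : isth th -> sin th = 1 / 2.
Proof.
  intros [-> | ->]; unfold th1, th2; [apply sin_PI6|].
  replace (5 * PI / 6) with (PI - PI / 6) by field. rewrite sin_PI_x; apply sin_PI6.
Qed.
Lemma isth_ex3 th : isth th -> (ex th ^ 3)%C = Ci.
Proof.
  intros H; rewrite ex_pow3, ex_eq; unfold Ci. destruct H as [-> | ->]; unfold th1, th2.
  - replace (3 * (PI / 6)) with (PI / 2) by field. rewrite cos_PI2, sin_PI2; reflexivity.
  - replace (3 * (5 * PI / 6)) with (PI / 2 + 2 * PI) by field. rewrite cos_plus, sin_plus, cos_2PI, sin_2PI, cos_PI2, sin_PI2. f_equal; ring.
Qed.
Lemma isth_omega th r : isth th -> omega (pol r th) = RtoC (r ^ 3).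
Proof.
  intros H; unfold omega, pol.
  replace (- Ci * (RtoC r * ex th) ^ 3)%C with (- Ci * (RtoC (r ^ 3) * ex th ^ 3))%C by (rewrite RtoC_pow; simpl; ring).
  rewrite isth_ex3 by auto.
  pose proof Ci2 as Ii.
  transitivity (- (Ci * Ci) * RtoC (r ^ 3))%C; [ring|rewrite Ii; ring].
Qed.

(** The factor brought down by an x-derivative. Its cube is omega, which on these two rays is the
    real number r^3. *)
Definition ipol (th r : R) : C := (Ci * pol r th)%C.
Lemma ipol3 th r : isth th -> (ipol th r ^ 3)%C = RtoC (r ^ 3).
Proof. intros H; unfold ipol; rewrite <- omega_eq; now apply isth_omega. Qed.

Definition polyb (B : R) (m : nat) (H : R -> C) : Prop := forall r, 0 <= r -> Cmod (H r) <= B * (1 + r) ^ m.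

Lemma polyb_pos B m H : polyb B m H -> 0 <= B.
Proof. intros P; specialize (P 0 (Rle_refl 0)); rewrite Rplus_0_r, pow1 in P; pose proof (Cmod_ge_0 (H 0)); lra. Qed.

Lemma ipol_polyb th j B m H : polyb B m H -> polyb B (j + m) (fun r => ipol th r ^ j * H r)%C.
Proof.
  intros P r Hr; unfold ipol; rewrite Cmod_mult, Cmod_pow, Cmod_mult, Cmod_Ci, Cmod_pol, Rmult_1_l by auto.
  rewrite pow_add. pose proof (P r Hr). pose proof (pow_incr r (1 + r) j ltac:(lra)).
  replace (B * ((1 + r) ^ j * (1 + r) ^ m)) with ((1 + r) ^ j * (B * (1 + r) ^ m)) by ring.
  apply Rmult_le_compat; auto; [now apply pow_le|apply Cmod_ge_0].
Qed.

Lemma ipol_cont0 th j H : cont0 H -> cont0 (fun r => ipol th r ^ j * H r)%C.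
Proof. intros; apply (cont0_mult (fun r => ipol th r ^ j)%C H); auto. apply cont0_ct; intros; unfold ipol; ctx. Qed.

Definition Vj (j : nat) (th : R) (H : R -> C) (x : R) : C := J (fun r => Kx x (pol r th) * (ipol th r ^ j * H r))%C.
(** The j-th x-derivative of -1/(2 pi) times a Gamma integral moved to the two rays; the factor e^(i
    th) of the line element is part of [H]. *)
Definition LG (j : nat) (H : R -> C) (x : R) : C := (RtoC (- / (2 * PI)) * (Vj j th1 H x - Vj j th2 H x))%C.

Lemma Vj_dom B m j H x : polyb B m H -> 0 < x ->
  exists M, forall th x', isth th -> x <= x' -> dom M (fun r => Kx x' (pol r th) * (ipol th r ^ j * H r))%C.
Proof.
  intros P Hx.
  destruct (ray_dom x th1 _ B (j + m) Hx ltac:(rewrite isth_sin; [lra|now left]) (ipol_polyb th1 j B m H P)) as [M1 HM1].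
  destruct (ray_dom x th2 _ B (j + m) Hx ltac:(rewrite isth_sin; [lra|now right]) (ipol_polyb th2 j B m H P)) as [M2 HM2].
  exists (Rmax M1 M2); intros th x' [-> | ->] Hx'.
  - apply (dom_le M1); [now apply HM1|apply Rmax_l].
  - apply (dom_le M2); [now apply HM2|apply Rmax_r].
Qed.

Lemma Vj_cont0 j th H x : cont0 H -> cont0 (fun r => Kx x (pol r th) * (ipol th r ^ j * H r))%C.
Proof.
  intros; apply (cont0_mult (fun r => Kx x (pol r th))); [apply cont0_ct; intros; ctx|now apply ipol_cont0].
Qed.

Lemma Vj_is B m j th H x : cont0 H -> polyb B m H -> 0 < x -> isth th ->
  is_J (fun r => Kx x (pol r th) * (ipol th r ^ j * H r))%C (Vj j th H x).
Proof.
  intros Hc P Hx Hth; destruct (Vj_dom B m j H x P Hx) as [M HM].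
  apply (J_is M); [now apply Vj_cont0|apply HM; auto; lra].
Qed.

Lemma Vj_dx B m j th H x : cont0 H -> polyb B m H -> 0 < x -> isth th -> is_derive (Vj j th H) x (Vj (S j) th H x).
Proof.
  intros Hc P Hx Hth.
  eapply dr_eq; [apply (ray_dx x th (fun r => ipol th r ^ j * H r)%C B (j + m)); auto|].
  - rewrite isth_sin; auto; lra.
  - now apply ipol_cont0.
  - now apply ipol_polyb.
  - apply J_ext; intros r Hr; unfold ipol; simpl; ringC.
Qed.

Lemma LG_dx B m j H x : cont0 H -> polyb B m H -> 0 < x -> is_derive (LG j H) x (LG (S j) H x).
Proof.
  intros Hc P Hx; unfold LG; apply dr_scal, dr_minus; apply (Vj_dx B m); auto; [now left|now right].
Qed.

Lemma LG_plus B m j H1 H2 x : cont0 H1 -> polyb B m H1 -> cont0 H2 -> polyb B m H2 -> 0 < x ->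
  LG j (fun r => H1 r + H2 r)%C x = (LG j H1 x + LG j H2 x)%C.
Proof.
  intros C1 P1 C2 P2 Hx.
  assert (E : forall th, isth th -> Vj j th (fun r => H1 r + H2 r)%C x = (Vj j th H1 x + Vj j th H2 x)%C).
  { intros th Hth; apply is_J_unique.
    pose proof (is_J_plus _ _ _ _ (Vj_is B m j th H1 x C1 P1 Hx Hth) (Vj_is B m j th H2 x C2 P2 Hx Hth)) as T.
    revert T; apply is_J_ext; intros; ringC. }
  unfold LG; rewrite !E; [ringC|now right|now left].
Qed.
Lemma LG_scal B m j c H x : cont0 H -> polyb B m H -> 0 < x -> LG j (fun r => c * H r)%C x = (c * LG j H x)%C.
Proof.
  intros C1 P1 Hx.
  assert (E : forall th, isth th -> Vj j th (fun r => c * H r)%C x = (c * Vj j th H x)%C).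
  { intros th Hth; apply is_J_unique.
    pose proof (is_J_scal c _ _ (Vj_is B m j th H x C1 P1 Hx Hth)) as T.
    revert T; apply is_J_ext; intros; ringC. }
  unfold LG; rewrite !E; [ringC|now right|now left].
Qed.
Lemma LG_ext j H1 H2 x : (forall r, 0 <= r -> H1 r = H2 r) -> LG j H1 x = LG j H2 x.
Proof. intros E; unfold LG, Vj; f_equal; f_equal; apply J_ext; intros r Hr; now rewrite E. Qed.

Lemma LG_3 H x : LG 3 H x = LG 0 (fun r => RtoC (r ^ 3) * H r)%C x.
Proof.
  unfold LG, Vj; f_equal; f_equal; apply J_ext; intros r Hr; rewrite ipol3; try (now left); try (now right); simpl; ringC.
Qed.

Lemma dr_unique (f : R -> C) x a b : is_derive f x a -> is_derive f x b -> a = b.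
Proof.
  intros Ha Hb; apply is_derive_C in Ha; apply is_derive_C in Hb.
  destruct Ha as [A1 A2], Hb as [B1 B2]. apply injective_projections.
  - transitivity (Derive (fun x => fst (f x)) x); [symmetry|]; now apply is_derive_unique.
  - transitivity (Derive (fun x => snd (f x)) x); [symmetry|]; now apply is_derive_unique.
Qed.

(** On these rays r^2 dr is a constant multiple of (iz)^2 dz, so the integral is a second derivative
    of the angle-independent i/x. This removes the term with g(t) from the time derivative in
    [Ug_dt]. *)
Lemma LG_r2 x : 0 < x -> LG 0 (fun r => RtoC (r ^ 2)) x = RtoC 0.
Proof.
  intros Hx.
  assert (Cex : forall th : R, cont0 (fun _ : R => ex th)) by (intros; apply cont0_ct; intros; ct).
  assert (Pex : forall th, polyb 1 0 (fun _ : R => ex th)) by (intros th r Hr; rewrite Cmod_ex; simpl; lra).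
  assert (Z : forall y, 0 < y -> (Vj 0 th1 (fun _ => ex th1) y - Vj 0 th2 (fun _ => ex th2) y = 0)%C).
  { intros y Hy.
    assert (E : forall th, isth th -> Vj 0 th (fun _ => ex th) y = (Ci / RtoC y)%C).
    { intros th Hth; apply is_J_unique. pose proof (ray_Kx y th Hy ltac:(rewrite isth_sin; auto; lra)) as T.
      revert T; apply is_J_ext; intros; unfold pol; simpl; ringC. }
    rewrite !E by (unfold isth; auto); ringC. }
  assert (D : forall j y, 0 < y -> is_derive (fun y => Vj j th1 (fun _ => ex th1) y - Vj j th2 (fun _ => ex th2) y)%C y
     (Vj (S j) th1 (fun _ => ex th1) y - Vj (S j) th2 (fun _ => ex th2) y)%C).
  { intros j y Hy; apply dr_minus; apply (Vj_dx 1 0); auto; [now left|now right]. }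
  (* The difference vanishes for all y > 0, hence so do its derivatives, which are the cases of
     higher j. *)
  assert (N : forall j y, 0 < y -> (Vj j th1 (fun _ => ex th1) y - Vj j th2 (fun _ => ex th2) y = 0)%C).
  { induction j; intros y Hy; [auto|].
    apply (dr_unique (fun y => Vj j th1 (fun _ => ex th1) y - Vj j th2 (fun _ => ex th2) y)%C y); [now apply D|].
    apply (is_derive_ext_loc (fun _ : R => RtoC 0)); [|apply dr_const].
    apply locally_pos; [lra|]. intros z Hz; symmetry; auto. }
  pose proof Ci2 as Ii.
  assert (E : forall th, isth th -> Vj 0 th (fun r => RtoC (r ^ 2)) x = (Ci * Vj 2 th (fun _ => ex th) x)%C).
  { intros th Hth; apply is_J_unique.
    pose proof (is_J_scal Ci _ _ (Vj_is 1 0 2 th (fun _ => ex th) x (Cex th) (Pex th) Hx Hth)) as T.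
    revert T; apply is_J_ext; intros r Hr. unfold ipol, pol.
    transitivity (Kx x (RtoC r * ex th) * (Ci * Ci * Ci * (RtoC r ^ 2 * ex th ^ 3)))%C; [simpl; ringC|].
    rewrite isth_ex3, Ii, RtoC_pow by auto.
    transitivity (- (Ci * Ci) * (Kx x (RtoC r * ex th) * RtoC r ^ 2))%C; [ringC|]. rewrite Ii. simpl; ringC. }
  unfold LG; rewrite !E by (unfold isth; auto).
  transitivity (RtoC (- / (2 * PI)) * Ci * (Vj 2 th1 (fun _ => ex th1) x - Vj 2 th2 (fun _ => ex th2) x))%C; [ringC|].
  rewrite N by auto; ringC.
Qed.

Lemma LG_ct j (H : R -> R -> C) B m x0 t0 :
  (forall t, jct0 H t) -> locally t0 (fun t => polyb B m (H t)) -> 0 < x0 ->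
  continuous (fun q : R * R => LG j (H (snd q)) (fst q)) (x0, t0).
Proof.
  intros Hj HB Hx; unfold LG, Vj.
  assert (K : forall th, isth th -> continuous (fun q : R * R => J (fun r => Kx (fst q) (pol r th) * (ipol th r ^ j * H (snd q) r))%C) (x0, t0)).
  { intros th Hth.
    assert (L : locally (x0, t0) (fun q : R * R => x0 / 2 < fst q /\ polyb B m (H (snd q)))).
    { apply filter_and.
      - refine (continuous_fst x0 t0 (fun x => x0 / 2 < x) _). apply (open_gt (x0 / 2)); simpl; lra.
      - exact (continuous_snd x0 t0 (fun t => polyb B m (H t)) HB). }
    assert (M' : exists M, forall q : R * R, x0 / 2 < fst q /\ polyb B m (H (snd q)) ->
        dom M (fun r => Kx (fst q) (pol r th) * (ipol th r ^ j * H (snd q) r))%C).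
    { destruct (expdom (x0 / 2 * sin th) (j + m)) as [M [HM HE]].
      { rewrite isth_sin by auto. lra. }
      exists (B * M); intros [x t] [Hx' P] r Hr; simpl in *.
      rewrite Cmod_mult, Kx_mod. pose proof (ipol_polyb th j B m _ P r Hr) as Q.
      assert (Hs : sin th = 1 / 2) by (now apply isth_sin).
      specialize (HE (x * sin th) r ltac:(rewrite Hs; lra) Hr).
      replace (x * (r * sin th)) with (x * sin th * r) by ring.
      pose proof (exp_pos (- (x * sin th * r))). pose proof (polyb_pos _ _ _ P).
      apply (Rle_trans _ (exp (- (x * sin th * r)) * (B * (1 + r) ^ (j + m)))); [apply Rmult_le_compat_l; lra|].
      unfold Rdiv in *; rewrite (Rmult_assoc B).
      replace (exp (- (x * sin th * r)) * (B * (1 + r) ^ (j + m))) with (B * ((1 + r) ^ (j + m) * exp (- (x * sin th * r)))) by ring.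
      now apply Rmult_le_compat_l. }
    destruct M' as [M HM].
    apply (J_ct (fun (q : R * R) r => Kx (fst q) (pol r th) * (ipol th r ^ j * H (snd q) r))%C (x0, t0) M).
    revert L; apply filter_imp; intros q Hq; split; [|now apply HM].
    intros r; unfold jct, cl, ipol. apply ct_mult; [ctx|]. apply ct_mult; [ctx|].
    apply (ct_comp2 (fun t r => cl (H t) r)); [intros [? ?]; apply Hj| |]; ct. }
  apply ct_mult; [ct|]. apply ct_minus; apply K; [now left|now right].
Qed.

Lemma ct_1 {V : UniformSpace} (f : R -> R -> V) x t : continuous (fun q : R * R => f (fst q) (snd q)) (x, t) -> continuous (fun t => f x t) t.
Proof.
  intros H; apply (continuous_comp (fun t => (x, t)) (fun q : R * R => f (fst q) (snd q))); [|exact H].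
  apply filterlim_locally; intros e; exists e; intros y Hy; split; [apply ball_center|exact Hy].
Qed.

(** On the rotated rays 3 z^2 dz = 3 i r^2 dr and omega = r^3, so that the integrand apart from
    e^(izx) is the same on both. *)
Definition Gt (g : R -> C) (t r : R) : C := (3 * Ci * RtoC (r ^ 2) * bt g (RtoC (r ^ 3)) t)%C.
Definition Ug (g : R -> C) (x t : R) : C := LG 0 (Gt g t) x.

(* Rescaled to a fixed interval, [bt] is seen to be jointly continuous. *)
Lemma bt_scaled a k t : (forall s, continuous a s) ->
  bt a k t = (RtoC t * CInt (fun s => Cexp (- (k * RtoC (t - t * s))) * a (t * s)%R) 0 1)%C.
Proof.
  intros Ha; unfold bt.
  rewrite <- CInt_scal by (intros x _; apply ct_mult; [ct|apply (ct_comp a (fun s => t * s)); [auto|ct]]).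
  pose proof (RInt_comp_lin (V := C_R_CompleteNormedModule) (fun s => Cexp (- (k * RtoC (t - s))) * a s)%C t 0 0 1) as E.
  replace (t * 0 + 0) with 0 in E by ring; replace (t * 1 + 0) with t in E by ring.
  rewrite <- E by (apply CInt_ex; intros; ct).
  apply CInt_ext; intros s _. rewrite scalC. replace (t * s + 0) with (t * s) by ring. reflexivity.
Qed.

Lemma bt_ct2 a {U : UniformSpace} (f : U -> C) (g : U -> R) p :
  (forall s, continuous a s) -> continuous f p -> continuous g p -> continuous (fun x => bt a (f x) (g x)) p.
Proof.
  intros Ha Hf Hg.
  apply (ct_comp2 (fun k t => bt a k t)); auto.
  intros q; apply (continuous_ext (fun q : C * R => RtoC (snd q) * CInt (fun s => Cexp (- (fst q * RtoC (snd q - snd q * s))) * a (snd q * s)%R) 0 1)%C).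
  - intros q'; symmetry; now apply bt_scaled.
  - apply ct_mult; [ct|].
    apply (CInt_ct (fun (q : C * R) s => Cexp (- (fst q * RtoC (snd q - snd q * s))) * a (snd q * s)%R)%C); [lra|].
    intros p' s _; unfold jct. apply ct_mult; [ct|].
    apply (ct_comp a (fun x : C * R * R => snd (fst x) * snd x)); [auto|ct].
Qed.

Lemma Gt_jct0 g t : (forall s, continuous g s) -> jct0 (Gt g) t.
Proof. intros Hg r; unfold jct, cl, Gt. apply ct_mult; [ct|]. apply bt_ct2; auto; ct. Qed.

Lemma RtoC_Re_nonneg r : 0 <= r -> 0 <= Re (RtoC (r ^ 3)).
Proof. intros; simpl. repeat apply Rmult_le_pos; lra. Qed.

Lemma bt_real_bound g A r t : 0 <= t -> (forall s, continuous g s) -> (forall s, 0 <= s <= t -> Cmod (g s) <= A) -> 0 <= r ->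
  Cmod (bt g (RtoC (r ^ 3)) t) <= A * t.
Proof. intros; apply bt_bound; auto. now apply RtoC_Re_nonneg. Qed.

Lemma Gt_mod g t r : 0 <= r -> Cmod (Gt g t r) = 3 * r ^ 2 * Cmod (bt g (RtoC (r ^ 3)) t).
Proof.
  intros Hr; unfold Gt; rewrite !Cmod_mult, Cmod_Ci, !Cmod_R, (Rabs_pos_eq 3), (Rabs_pos_eq (r ^ 2)) by (try nra; lra). ring.
Qed.

Lemma Gt_polyb g A T t : 0 <= t <= T -> (forall s, continuous g s) -> (forall s, 0 <= s <= T -> Cmod (g s) <= A) ->
  polyb (3 * (A * t)) 2 (Gt g t).
Proof.
  intros Ht Hg HA r Hr; rewrite Gt_mod by auto.
  pose proof (bt_real_bound g A r t ltac:(lra) Hg ltac:(intros; apply HA; lra) Hr).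
  pose proof (Cmod_ge_0 (bt g (RtoC (r ^ 3)) t)). assert (r ^ 2 <= (1 + r) ^ 2) by nra. assert (0 <= r ^ 2) by nra.
  replace (3 * (A * t) * (1 + r) ^ 2) with (3 * (1 + r) ^ 2 * (A * t)) by ring.
  apply Rmult_le_compat; nra.
Qed.

Lemma bt_dt g k t : (forall s, continuous g s) -> is_derive (fun t => bt g k t) t (g t - k * bt g k t)%C.
Proof.
  intros Hg.
  assert (E : forall t, bt g k t = (Cexp (- (k * RtoC t)) * CInt (fun s => Cexp (k * RtoC s) * g s) 0 t)%C).
  { intros u; unfold bt; rewrite <- CInt_scal by (intros; ct). apply CInt_ext; intros s _.
    replace (- (k * RtoC (u - s)))%C with (- (k * RtoC u) + k * RtoC s)%C by (rewrite RtoC_minus; ringC).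
    rewrite Cexp_plus; ringC. }
  apply (is_derive_ext (fun t => Cexp (- (k * RtoC t)) * CInt (fun s => Cexp (k * RtoC s) * g s) 0 t)%C); [intros; now rewrite E|].
  rewrite E.
  pose proof (dr_CInt (fun s => Cexp (k * RtoC s) * g s)%C 0 t ltac:(intros; ct)) as D.
  eapply dr_eq; [apply dr_mult; [apply dr_exp; repeat dr1|exact D]|].
  cbv beta. transitivity (- (k * (Cexp (- (k * RtoC t)) * CInt (fun s => Cexp (k * RtoC s) * g s) 0 t)) + (Cexp (k * RtoC t) * Cexp (- (k * RtoC t))) * g t)%C; [ringC|].
  rewrite Cexp_opp; ringC.
Qed.

(** The time derivative of [Gt], with the term g(t) kept inside the bracket. *)
Definition Ht (g : R -> C) (t r : R) : C := (3 * Ci * RtoC (r ^ 2) * (g t - RtoC (r ^ 3) * bt g (RtoC (r ^ 3)) t))%C.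

Lemma Ht_polyb g A T t : 0 <= t <= T -> (forall s, continuous g s) -> (forall s, 0 <= s <= T -> Cmod (g s) <= A) -> 0 <= A ->
  polyb (3 * (A + A * T)) 5 (Ht g t).
Proof.
  intros Ht' Hg HA HA0 r Hr; unfold Ht.
  rewrite !Cmod_mult, Cmod_Ci, !Cmod_R, (Rabs_pos_eq 3), (Rabs_pos_eq (r ^ 2)) by (try nra; lra).
  pose proof (bt_real_bound g A r t ltac:(lra) Hg ltac:(intros; apply HA; lra) Hr) as Hb.
  assert (Hd : Cmod (g t - RtoC (r ^ 3) * bt g (RtoC (r ^ 3)) t) <= (A + A * T) * (1 + r) ^ 3).
  { unfold Cminus; eapply Rle_trans; [apply Cmod_triangle|]; rewrite Cmod_opp, Cmod_mult, Cmod_R, Rabs_pos_eq by (apply pow_le; auto).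
    pose proof (HA t ltac:(lra)). pose proof (pow_incr r (1 + r) 3 ltac:(lra)). pose proof (pow_R1_Rle (1 + r) 3 ltac:(lra)).
    pose proof (pow_le r 3 Hr).
    assert (A * t <= A * T) by nra.
    assert (r ^ 3 * Cmod (bt g (RtoC (r ^ 3)) t) <= (1 + r) ^ 3 * (A * T)).
    { apply Rmult_le_compat; auto; [apply Cmod_ge_0|lra]. }
    nra. }
  replace (3 * (A + A * T) * (1 + r) ^ 5) with (3 * (1 + r) ^ 2 * ((A + A * T) * (1 + r) ^ 3)) by ring.
  pose proof (Cmod_ge_0 (g t - RtoC (r ^ 3) * bt g (RtoC (r ^ 3)) t)).
  assert (r ^ 2 <= (1 + r) ^ 2) by nra. assert (0 <= r ^ 2) by nra.
  apply Rmult_le_compat; auto; nra.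
Qed.

Lemma Ht_jct0 g t : (forall s, continuous g s) -> jct0 (Ht g) t.
Proof. intros Hg r; unfold jct, cl, Ht. apply ct_mult; [ct|]. apply ct_minus; [ct|]. apply ct_mult; [ct|]. apply bt_ct2; auto; ct. Qed.

Lemma Ug_dt_aux g x t : (forall s, continuous g s) -> 0 < x -> 0 < t -> is_derive (fun t => Ug g x t) t (LG 0 (Ht g t) x).
Proof.
  intros Hg Hx Ht0; unfold Ug, LG; apply dr_scal.
  (* A bound up to t + 1 gives a domination valid for all times near t. *)
  destruct (cont_bounded g (t + 1) ltac:(lra) Hg) as [A [HA0 HA]].
  assert (L : locally t (fun u => 0 < u < t + 1)).
  { apply locally_interval; lra. }
  assert (K : forall th, isth th -> is_derive (fun t => Vj 0 th (Gt g t) x) t (Vj 0 th (Ht g t) x)).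
  { intros th Hth.
    assert (P1 : forall u, 0 < u < t + 1 -> polyb (3 * (A + A * (t + 1))) 5 (Gt g u)).
    { intros u Hu r Hr; eapply Rle_trans; [apply (Gt_polyb g A (t + 1) u); auto; lra|].
      pose proof (pow_R1_Rle (1 + r) 3 ltac:(lra)). 
      replace ((1 + r) ^ 5) with ((1 + r) ^ 2 * (1 + r) ^ 3) by ring.
      assert (0 <= (1 + r) ^ 2) by nra. assert (A * u <= A + A * (t + 1)) by nra.
      assert (0 <= A * u) by nra.
      apply (Rle_trans _ (3 * (A + A * (t + 1)) * (1 + r) ^ 2)); [apply Rmult_le_compat_r; lra|].
      apply Rmult_le_compat_l; nra. }
    assert (P2 : forall u, 0 < u < t + 1 -> polyb (3 * (A + A * (t + 1))) 5 (Ht g u)).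
    { intros u Hu; apply (Ht_polyb g A (t + 1) u); auto; lra. }
    assert (Hs : 0 < sin th) by (rewrite isth_sin; auto; lra).
    set (B := 3 * (A + A * (t + 1))).
    destruct (expdom (x * sin th) 5) as [M [HM HE]]; [nra|].
    assert (DD : forall H, polyb B 5 H -> dom (B * M) (fun r => Kx x (pol r th) * (ipol th r ^ 0 * H r))%C).
    { intros H P r Hr; rewrite Cmod_mult, Kx_mod. pose proof (ipol_polyb th 0 B 5 H P r Hr) as Q.
      specialize (HE (x * sin th) r (Rle_refl _) Hr). replace (x * (r * sin th)) with (x * sin th * r) by ring.
      pose proof (exp_pos (- (x * sin th * r))). pose proof (polyb_pos _ _ _ P).
      apply (Rle_trans _ (exp (- (x * sin th * r)) * (B * (1 + r) ^ 5))); [apply Rmult_le_compat_l; simpl in *; lra|].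
      unfold Rdiv in *; rewrite (Rmult_assoc B).
      replace (exp (- (x * sin th * r)) * (B * (1 + r) ^ 5)) with (B * ((1 + r) ^ 5 * exp (- (x * sin th * r)))) by ring.
      now apply Rmult_le_compat_l. }
    assert (JJ : forall F : R -> R -> C, (forall u, jct0 F u) -> forall u, jct0 (fun u r => Kx x (pol r th) * (ipol th r ^ 0 * F u r))%C u).
    { intros F HF u r; unfold jct, cl, ipol. apply ct_mult; [ctx|]. apply ct_mult; [ctx|].
      apply (ct_comp2 (fun t r => cl (F t) r)); [intros [? ?]; apply HF| |]; ct. }
    unfold Vj.
    apply (J_dr (fun t r => Kx x (pol r th) * (ipol th r ^ 0 * Gt g t r))%C (fun t r => Kx x (pol r th) * (ipol th r ^ 0 * Ht g t r))%C t (B * M)).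
    revert L; apply filter_imp; intros u Hu; split; [|split].
    - split; [apply (JJ (Gt g)); intros; now apply Gt_jct0|apply DD, P1, Hu].
    - split; [apply (JJ (Ht g)); intros; now apply Ht_jct0|apply DD, P2, Hu].
    - intros r Hr; apply dr_scal, dr_scal. unfold Gt, Ht. apply dr_scal. now apply bt_dt. }
  apply dr_minus; apply K; [now left|now right].
Qed.

Lemma Ug_dt g x t : (forall s, continuous g s) -> 0 < x -> 0 < t -> is_derive (fun t => Ug g x t) t (- LG 3 (Gt g t) x)%C.
Proof.
  intros Hg Hx Ht0; eapply dr_eq; [now apply Ug_dt_aux|].
  destruct (cont_bounded g t ltac:(lra) Hg) as [A [HA0 HA]].
  pose proof (Gt_polyb g A t t ltac:(lra) Hg HA) as P.
  assert (C2 : cont0 (fun r => RtoC (r ^ 2))) by (apply cont0_ct; intros; ct).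
  assert (P2 : polyb 1 2 (fun r => RtoC (r ^ 2))).
  { intros r Hr; rewrite Cmod_R, Rabs_pos_eq by nra. nra. }
  assert (CG : cont0 (Gt g t)) by (apply (jct0_cont0 (Gt g)), Gt_jct0, Hg).
  rewrite LG_3.
  rewrite (LG_ext 0 (Ht g t) (fun r => (3 * Ci * g t) * RtoC (r ^ 2) + (-1) * (RtoC (r ^ 3) * Gt g t r))%C).
  2: { intros r Hr; unfold Ht, Gt. rewrite RtoC_m1. ringC. }
  assert (C3 : cont0 (fun r => RtoC (r ^ 3) * Gt g t r)%C).
  { apply (cont0_mult (fun r => RtoC (r ^ 3))); auto. apply cont0_ct; intros; ct. }
  assert (P3 : polyb (3 * (A * t)) 5 (fun r => RtoC (r ^ 3) * Gt g t r)%C).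
  { intros r Hr; rewrite Cmod_mult, Cmod_R, Rabs_pos_eq by (now apply pow_le).
    replace (3 * (A * t) * (1 + r) ^ 5) with ((1 + r) ^ 3 * (3 * (A * t) * (1 + r) ^ 2)) by ring.
    apply Rmult_le_compat; [now apply pow_le|apply Cmod_ge_0|apply pow_incr; lra|now apply P]. }
  rewrite (LG_plus (3 * Cmod (g t) + 3 * (A * t)) 5); auto.
  - rewrite (LG_scal 1 2), LG_r2, (LG_scal (3 * (A * t)) 5) by auto. 
    rewrite RtoC_m1. ringC.
  - now apply (cont0_scal (3 * Ci * g t)%C (fun r => RtoC (r ^ 2))).
  - intros r Hr; rewrite !Cmod_mult, Cmod_Ci, !Cmod_R, (Rabs_pos_eq 3), (Rabs_pos_eq (r ^ 2)) by (try nra; lra).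
    pose proof (Cmod_ge_0 (g t)). pose proof (pow_R1_Rle (1 + r) 3 ltac:(lra)).
    assert (0 <= A * t) by nra.
    assert (r ^ 2 <= (1 + r) ^ 5) by (replace ((1 + r) ^ 5) with ((1 + r) ^ 2 * (1 + r) ^ 3) by ring; nra).
    assert (0 <= r ^ 2) by nra.
    replace (3 * 1 * Cmod (g t) * r ^ 2) with (3 * Cmod (g t) * r ^ 2) by ring.
    apply Rmult_le_compat; lra.
  - now apply (cont0_scal (-1)%C).
  - intros r Hr; rewrite Cmod_mult, Cmod_R, Rabs_left1 by lra. pose proof (P3 r Hr). pose proof (Cmod_ge_0 (g t)).
    pose proof (pow_le (1 + r) 5 ltac:(lra)). nra.
Qed.

Lemma ray_zero th : ray (fun _ => RtoC 0) th (RtoC 0).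
Proof.
  destruct expm_dom as [M HM].
  pose proof (is_J_scal 0%C _ _ (J_is M expm expm_cont0 HM)) as T.
  replace (RtoC 0) with (0 * J expm)%C by ringC. revert T; apply is_J_ext; intros; ringC.
Qed.

Lemma sector_r : sector_ok (PI / 6) (PI / 3).
Proof. pose proof PI_RGT_0; left; lra. Qed.
Lemma sector_l : sector_ok (2 * PI / 3) (5 * PI / 6).
Proof. pose proof PI_RGT_0; right; lra. Qed.

Lemma isth_ray g x t th B m : isth th -> (forall s, continuous g s) -> 0 < x -> polyb B m (Gt g t) ->
  ray (fun l => Kx x l * (qpoly 3 0 0 l * bt g (omega l) t))%C th (Vj 0 th (Gt g t) x).
Proof.
  intros Hth Hg Hx P.
  pose proof (Vj_is B m 0 th (Gt g t) x (jct0_cont0 (Gt g) t (Gt_jct0 g t Hg)) P Hx Hth) as T.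
  revert T; apply is_J_ext; intros r Hr. fold (pol r th). rewrite isth_omega by auto.
  unfold Gt, qpoly. simpl Cpow.
  transitivity (Kx x (pol r th) * (3 * (RtoC r ^ 2 * ex th ^ 3) * bt g (RtoC (r ^ 3)) t))%C; [|unfold pol; simpl; ringC].
  rewrite isth_ex3, RtoC_pow by auto. simpl; ringC.
Qed.

Lemma utm_Ug g g' x t :
  0 < x -> 0 < t -> (forall s, continuous g s) -> (forall s, continuous g' s) -> (forall s, 0 < s -> is_derive g s (g' s)) ->
  utm x t (fun _ => RtoC 0) (fun l => bt g (omega l) t) (fun _ => RtoC 0) (Ug g x t).
Proof.
  intros Hx Ht Hg Hg' Hd; pose proof PI_RGT_0.
  destruct (cont_bounded g t ltac:(lra) Hg) as [A [HA0 HA]].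
  pose proof (Gt_polyb g A t t ltac:(lra) Hg HA) as P.
  pose proof (proj2 (bt_rot g g' t x 3 0 0 (PI / 6) (PI / 3) _ ltac:(lra) Hx Hg Hg' Hd sector_r)
     (isth_ray g x t th1 _ _ ltac:(now left) Hg Hx P)) as R1.
  pose proof (proj1 (bt_rot g g' t x 3 0 0 (2 * PI / 3) (5 * PI / 6) _ ltac:(lra) Hx Hg Hg' Hd sector_l)
     (isth_ray g x t th2 _ _ ltac:(now right) Hg Hx P)) as R2.
  exists 0%C, 0%C, 0%C, 0%C, (Vj 0 th1 (Gt g t) x), (Vj 0 th2 (Gt g t) x), 0%C, 0%C, 0%C, 0%C.
  repeat split.
  1-4: eapply ray_ext; [|apply ray_zero]; intros; unfold rot; cbv beta; ringC.
  - revert R1; apply ray_ext; intros; unfold qpoly; ringC.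
  - revert R2; apply ray_ext; intros; unfold qpoly; ringC.
  - eapply ray_ext; [|apply ray_zero]; intros; unfold rot; cbv beta; ringC.
  - eapply ray_ext; [|apply ray_zero]; intros; unfold rot; cbv beta; ringC.
  - eapply ray_ext; [|apply ray_zero]; intros; unfold rot; cbv beta; ringC.
  - eapply ray_ext; [|apply ray_zero]; intros; unfold rot; cbv beta; ringC.
  - unfold Ug, LG. rewrite Cmult_assoc, <- RtoC_mult.
    replace (2 * PI * - / (2 * PI)) with (-1) by (field; lra).
    rewrite RtoC_m1. ringC.
Qed.

(** * An exact exponential solution *)

(** With z = i l this is the logarithmic derivative of 1 + z^3 = (1 + z)(1 + alpha z)(1 + alpha^2
    z). *)
Lemma rho_sum l : (1 + Ci * l)%C <> 0%C -> Im (alpha * l) <= 0 -> Im (alpha ^ 2 * l) <= 0 ->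
  (3 * (l * l) * / (1 + omega l) = - (rho l + rot rho l))%C.
Proof.
  intros Ha Hb0 Hc0.
  assert (Hb : (1 + Ci * (alpha * l))%C <> 0%C) by now apply rho_nz.
  assert (Hc : (1 + Ci * (alpha ^ 2 * l))%C <> 0%C) by now apply rho_nz.
  pose proof Ci2 as Ii.
  unfold rot, rho. rewrite omega_eq.
  set (z := (Ci * l)%C) in *.
  assert (E1 : (alpha * alpha ^ 2 = 1)%C) by (rewrite <- alpha3; simpl; ring).
  assert (E2 : (alpha + alpha ^ 2 = - 1)%C) by (rewrite <- (Cplus_0_l (- 1)), <- alpha_sum; ring).
  set (be := (alpha ^ 2)%C) in *.
  assert (Eb : (Ci * (alpha * l) = alpha * z)%C) by (unfold z; ring).
  assert (Ec : (Ci * (be * l) = be * z)%C) by (unfold z; ring).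
  rewrite Eb in *; rewrite Ec in *.
  set (b := (1 + alpha * z)%C) in *. set (c := (1 + be * z)%C) in *.
  assert (Hbc : (b * c = 1 - z + z * z)%C).
  { unfold b, c. transitivity (1 + (alpha + be) * z + (alpha * be) * (z * z))%C; [ring|]. rewrite E1, E2; ring. }
  assert (Hs : (alpha * c + be * b = - 1 + 2 * z)%C).
  { unfold b, c. transitivity ((alpha + be) + 2 * (alpha * be) * z)%C.
    - replace (RtoC 2) with (RtoC 1 + RtoC 1)%C by (rewrite <- RtoC_plus; f_equal; ring). ring.
    - rewrite E1, E2; ring. }
  transitivity (- ((b * c + (1 + z) * (alpha * c + be * b)) * / ((1 + z) * (b * c))))%C.
  - rewrite Hbc, Hs.
    replace ((1 + z) * (1 - z + z * z))%C with (1 + z ^ 3)%C by (simpl; ring).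
    replace (1 - z + z * z + (1 + z) * (- 1 + 2 * z))%C with (3 * (z * z))%C.
    + replace (z * z)%C with (- (l * l))%C; [ring|]. unfold z.
      transitivity ((Ci * Ci) * (l * l))%C; [rewrite Ii; ring|ring].
    + replace (RtoC 2) with (RtoC 1 + RtoC 1)%C by (rewrite <- RtoC_plus; f_equal; ring).
      replace (RtoC 3) with (RtoC 1 + RtoC 1 + RtoC 1)%C by (rewrite <- !RtoC_plus; f_equal; ring). ring.
  - field. repeat split; auto.
Qed.

(** A zero of 1 + omega requires 3 th = 3 pi/2 modulo 2 pi. The shifted sine singles out an open
    half-turn of 3 th that avoids this value and leaves room around the closed sector. *)
Lemma omega1_nz r th a : 0 <= r -> 0 < sin (3 * th - a) -> (a = PI / 4 \/ a = 7 * PI / 4) -> (1 + omega (pol r th))%C <> 0%C.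
Proof.
  intros Hr Hs Ha E; rewrite omega_pol in E; unfold Cplus, RtoC in E; simpl in E. injection E; intros E2 E1.
  rewrite sin_minus in Hs.
  assert (Hr3 : 0 <= r * (r * (r * 1))) by (repeat apply Rmult_le_pos; lra).
  assert (Hc : cos (3 * th) = 0).
  { destruct (Rle_lt_or_eq_dec _ _ Hr3) as [Hp|Hz].
    - assert (r * (r * (r * 1)) * cos (3 * th) = 0) by lra. destruct (Rmult_integral _ _ H); lra.
    - rewrite <- Hz in E1; lra. }
  assert (Hsn : sin (3 * th) < 0).
  { apply Rnot_le_lt; intros Hn. assert (0 <= r * (r * (r * 1)) * sin (3 * th)) by now apply Rmult_le_pos. lra. }
  rewrite Hc in Hs.
  assert (Hca : 0 < cos a).
  { destruct Ha as [-> | ->].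
    - apply cos_gt_0; pose proof PI_RGT_0; lra.
    - replace (7 * PI / 4) with (2 * PI - PI / 4) by field. rewrite cos_minus, cos_2PI, sin_2PI.
      assert (0 < cos (PI / 4)) by (apply cos_gt_0; pose proof PI_RGT_0; lra). lra. }
  nra.
Qed.

Lemma omega1_rot x t1 t2 I : 0 < x -> (t1 = PI / 6 /\ t2 = PI / 3) \/ (t1 = 2 * PI / 3 /\ t2 = 5 * PI / 6) ->
  ray (fun l => Kx x l * (3 * (l * l) * / (1 + omega l)))%C t2 I <-> ray (fun l => Kx x l * (3 * (l * l) * / (1 + omega l)))%C t1 I.
Proof.
  intros Hx Ht; pose proof PI_RGT_0.
  assert (Hs : sector_ok t1 t2) by (destruct Ht as [[-> ->]|[-> ->]]; [apply sector_r|apply sector_l]).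
  pose proof (sector_ok_range _ _ Hs) as Hr.
  assert (N : exists a b, a < t1 /\ t2 < b /\ forall r th, 0 <= r -> a < th < b -> (1 + omega (pol r th))%C <> 0%C).
  { destruct Ht as [[-> ->]|[-> ->]].
    - exists (PI / 12), (5 * PI / 12); repeat split; try lra. intros r th Hr0 Hth.
      apply (omega1_nz r th (PI / 4)); auto. apply sin_gt_0; lra.
    - exists (7 * PI / 12), (11 * PI / 12); repeat split; try lra. intros r th Hr0 Hth.
      apply (omega1_nz r th (7 * PI / 4)); auto. apply sin_gt_0; lra. }
  destruct N as [a [b [Ha [Hb N]]]].
  assert (CG : forall z, (1 + omega z)%C <> 0%C -> continuous (fun l => Kx x l * (3 * (l * l) * / (1 + omega l)))%C z).
  { intros z Hz; ctx; exact Hz. }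
  apply (ray_rot _ t1 t2 x 3); try lra.
  - eapply (sector_identity _ _ a b); try lra.
    intros r th Hr0 Hth; pose proof (N r th Hr0 Hth) as Hz; split; [|split].
    + holx; exact Hz.
    + now apply CG.
    + ctx; exact Hz.
  - intros r th Hr0 Hth; apply CG, N; lra.
  - intros r th Hr1 Hth; rewrite !Cmod_mult, Kx_mod, Cmod_pol, Cmod_R, (Rabs_pos_eq 3) by lra.
    rewrite Rmult_comm; apply Rmult_le_compat_r; [left; apply exp_pos|].
    assert (Hz : (1 + omega (pol r th))%C <> 0%C) by (apply N; lra).
    rewrite Cmod_inv by auto.
    assert (H1 : r ^ 3 <= Cmod (1 + omega (pol r th))).
    { pose proof (sin3_pos _ _ _ Hs Hth) as S3.
      apply Rsqr_incr_0_var; [|apply Cmod_ge_0].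
      rewrite !Rsqr_pow2, Cmod2_alt, omega_pol; unfold Re, Im; simpl Re; cbn [fst snd Cplus RtoC].
      pose proof (sin2_cos2 (3 * th)) as S; unfold Rsqr in S.
      assert (0 <= r ^ 3) by (apply pow_le; lra).
      set (k := r ^ 3) in *. set (s := sin (3 * th)) in *. set (c := cos (3 * th)) in *.
      replace (k ^ 2) with (k * k * (s * s + c * c)) by (rewrite S; ring).
      assert (0 <= k * s) by nra. nra. }
    assert (0 < r ^ 3) by (apply pow_lt; lra).
    replace (3 / r) with (3 * (r * r) * / r ^ 3) by (field; lra).
    apply Rmult_le_compat_l; [nra|]. now apply Rinv_le_contravar.
Qed.

(** The counterpart of [Gt] for the exact solution e^(t - x): its boundary datum e^s, integrated
    against e^(-k (t - s)) from minus infinity, gives e^t/(1 + k), and the factor e^t is divided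
    out. *)
Definition Gexp (r : R) : C := (3 * Ci * RtoC (r ^ 2 / (1 + r ^ 3)))%C.

Lemma r3_pos r : 0 <= r -> 0 < 1 + r ^ 3.
Proof. intros; pose proof (pow_le r 3 H); lra. Qed.

Lemma Gexp_cont0 : cont0 Gexp.
Proof.
  intros r; unfold cl, Gexp; ct. pose proof (r3_pos (Rmax 0 r) (Rmax_l 0 r)). lra.
Qed.
Lemma Gexp_polyb : polyb 3 2 Gexp.
Proof.
  intros r Hr; unfold Gexp; rewrite !Cmod_mult, Cmod_Ci, !Cmod_R, (Rabs_pos_eq 3) by lra.
  pose proof (pow_le r 3 Hr). assert (0 < / (1 + r ^ 3) <= 1).
  { split; [apply Rinv_0_lt_compat; lra|]. rewrite <- Rinv_1; apply Rinv_le_contravar; lra. }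
  unfold Rdiv; rewrite Rabs_pos_eq by (apply Rmult_le_pos; nra).
  assert (0 <= r ^ 2) by nra. assert (r ^ 2 * / (1 + r ^ 3) <= r ^ 2 * 1) by (apply Rmult_le_compat_l; lra).
  assert (r ^ 2 <= (1 + r) ^ 2) by nra. lra.
Qed.

(** By [rho_sum] the integrand splits into the transform of e^(-y) and its rotations. The rotations
    give the same [Z] on both rays, and what is left is the integral [Acos]. *)
Lemma LG_Gexp x : 0 < x -> LG 0 Gexp x = RtoC (exp (- x)).
Proof.
  intros Hx; pose proof PI_RGT_0.
  destruct expm_dom as [M HM].
  destruct (gam_zero_rot expm M x Hx expm_cont0 HM) as [Z HZ].
  assert (G : forall th, gam th -> ray (fun l => Kx x l * (3 * (l * l) * / (1 + omega l)))%C th (- (Egam th x + Z))%C).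
  { intros th Hth.
    pose proof (ray_scal (- (1))%C _ _ _ (ray_plus _ _ _ _ _ (Egam_ray th x Hth Hx) (HZ th Hth))) as T.
    replace (- (Egam th x + Z))%C with (- (1) * (Egam th x + Z))%C by ringC.
    revert T; apply ray_ext; intros r Hr.
    destruct (gam_im th r Hth Hr) as [I1 I2].
    rewrite rho_sum; auto; [|apply rho_pol_nz; now apply (gam_cos th)].
    unfold rot; rewrite !HH_expm by auto. ringC. }
  assert (K : forall th t0, isth th -> gam t0 -> (forall I, ray (fun l => Kx x l * (3 * (l * l) * / (1 + omega l)))%C t0 I -> ray (fun l => Kx x l * (3 * (l * l) * / (1 + omega l)))%C th I) ->
     Vj 0 th Gexp x = (- (Egam t0 x + Z))%C).
  { intros th t0 Hth Ht0 HR; pose proof (HR _ (G t0 Ht0)) as T.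
    apply is_J_unique; revert T; apply is_J_ext; intros r Hr. fold (pol r th). rewrite isth_omega by auto.
    unfold Gexp, Rdiv. simpl Cpow. rewrite RtoC_mult, RtoC_inv by (pose proof (r3_pos r Hr); lra).
    rewrite (RtoC_plus 1 (r ^ 3)).
    set (w := (/ (1 + RtoC (r ^ 3)))%C).
    assert (E2 : RtoC (r ^ 2) = (RtoC r * RtoC r)%C) by (rewrite <- RtoC_mult; f_equal; ring).
    rewrite E2. pose proof (isth_ex3 th Hth) as E3. simpl in E3. rewrite <- E3. unfold pol. ringC. }
  unfold LG. rewrite (K th1 (PI / 3)), (K th2 (2 * PI / 3)); try (unfold isth, gam; tauto).
  - replace (- (Egam (PI / 3) x + Z) - - (Egam (2 * PI / 3) x + Z))%C with (- (Egam (PI / 3) x - Egam (2 * PI / 3) x))%C by ringC.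
    rewrite <- Acos_gamma, Acos_eq by lra. rewrite <- RtoC_opp, <- RtoC_mult. f_equal; field; lra.
  - intros I; apply (omega1_rot x (2 * PI / 3) (5 * PI / 6)); auto.
  - intros I; apply (omega1_rot x (PI / 6) (PI / 3)); auto.
Qed.

(** * Bounds near the boundary and at infinity *)

(** The kernel k e^(-k (t - s)) has mass at most 1, which gains a factor k without differentiating
    the datum. *)
Lemma bt_kbound h A k t : 0 <= t -> 0 <= k -> (forall s, continuous h s) -> (forall s, 0 <= s <= t -> Cmod (h s) <= A) ->
  k * Cmod (bt h (RtoC k) t) <= A.
Proof.
  intros Ht Hk Hh HA.
  assert (HA0 : 0 <= A) by (eapply Rle_trans; [apply Cmod_ge_0|apply (HA 0); lra]).
  assert (HI : is_RInt (fun s => A * (k * exp (- (k * (t - s))))) 0 t (minus (A * exp (- (k * (t - t)))) (A * exp (- (k * (t - 0)))))).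
  { apply (is_RInt_derive (V := R_CompleteNormedModule) (fun s => A * exp (- (k * (t - s))))).
    - intros s _; rdr. ring.
    - intros; ct. }
  replace (k * Cmod (bt h (RtoC k) t)) with (Cmod (RtoC k * bt h (RtoC k) t)) by (rewrite Cmod_mult, Cmod_R, Rabs_pos_eq; auto).
  unfold bt; rewrite <- CInt_scal by (intros; ct).
  eapply Rle_trans; [apply (CInt_norm _ (fun s => A * (k * exp (- (k * (t - s))))))|]; auto.
  - intros; ct.
  - intros s Hs; rewrite !Cmod_mult, Cmod_R, Cmod_Cexp, Rabs_pos_eq by auto.
    replace (Re (- (RtoC k * RtoC (t - s)))%C) with (- (k * (t - s))) by (simpl; ring).
    pose proof (exp_pos (- (k * (t - s)))). specialize (HA s Hs). pose proof (Cmod_ge_0 (h s)).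
    assert (0 <= k * exp (- (k * (t - s)))) by nra. nra.
  - eexists; exact HI.
  - rewrite (is_RInt_unique _ _ _ _ HI); unfold minus, plus, opp; simpl.
    replace (- (k * (t - t))) with 0 by ring. rewrite exp_0. pose proof (exp_pos (- (k * (t - 0)))). nra.
Qed.

(** What remains after comparison with g(t) times the exponential solution. It is of order r^-4,
    hence absolutely integrable down to x = 0 together with two x-derivatives, whereas [Gt] is only
    of order 1/r. *)
Definition Qt (g : R -> C) (t r : R) : C := (Gt g t r - g t * Gexp r)%C.

(* The rate [D]: the second alternative is what makes the estimate uniform as [t -> 0] when [g 0 = 0]. *)
Lemma Qt_bound g g' A T t D :
  0 < t <= T -> (forall s, continuous g s) -> (forall s, continuous g' s) -> (forall s, 0 < s -> is_derive g s (g' s)) ->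
  (forall s, 0 <= s <= T -> Cmod (g s - g' s) <= A) ->
  (g 0 = RtoC 0 \/ Cmod (g 0) * (1 + / t) <= D) -> 0 <= D ->
  forall r, 0 <= r -> Cmod (Qt g t r) <= 3 * (A * (1 + T) + D) * (r ^ 2 / (1 + r ^ 3) ^ 2).
Proof.
  intros Ht Hg Hg' Hd HA H0 HD r Hr.
  set (k := r ^ 3). assert (Hk : 0 <= k) by (apply pow_le; auto).
  assert (Chg : forall s, continuous (fun s => g s - g' s)%C s) by (intros; ct).
  (* Multiplication by 1 + k and integration by parts replace [g] by g - g', its defect from being
     an exponential. *)
  assert (E : ((1 + RtoC k) * (bt g (RtoC k) t - g t / (1 + RtoC k)) = bt (fun s => g s - g' s)%C (RtoC k) t - Cexp (- (RtoC k * RtoC t)) * g 0%R)%C).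
  { assert (Hkn : (1 + RtoC k)%C <> 0%C) by (rewrite <- RtoC_plus; intros E; injection E; lra).
    transitivity (bt g (RtoC k) t + RtoC k * bt g (RtoC k) t - g t)%C; [field; auto|].
    rewrite (bt_ibp g g') by (auto; lra).
    replace (bt (fun s => g s - g' s)%C (RtoC k) t) with (bt g (RtoC k) t - bt g' (RtoC k) t)%C; [ringC|].
    unfold bt. rewrite <- CInt_minus by (intros; ct). apply CInt_ext; intros; ringC. }
  assert (HA0 : 0 <= A) by (eapply Rle_trans; [apply Cmod_ge_0|apply (HA 0); lra]).
  assert (HAt : forall s, 0 <= s <= t -> Cmod (g s - g' s) <= A) by (intros; apply HA; lra).
  pose proof (bt_kbound _ A k t ltac:(lra) Hk Chg HAt) as B1.
  pose proof (bt_bound _ (RtoC k) t A ltac:(lra) Hk Chg HAt) as B2.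
  assert (B3 : (1 + k) * Cmod (Cexp (- (RtoC k * RtoC t)) * g 0%R) <= D).
  { rewrite Cmod_mult, Cmod_Cexp. replace (Re (- (RtoC k * RtoC t))%C) with (- (k * t)) by (simpl; ring).
    destruct H0 as [H0|H0]; [rewrite H0, Cmod_0; lra|].
    pose proof (Cmod_ge_0 (g 0)). pose proof (exp_pos (- (k * t))).
    assert (exp (- (k * t)) <= 1) by (rewrite <- exp_0; apply exp_le; nra).
    assert (k * exp (- (k * t)) <= / t).
    { rewrite exp_Ropp. pose proof (exp_ineq1_le (k * t)).
      apply (Rmult_le_reg_r (t * exp (k * t))); [apply Rmult_lt_0_compat; [lra|apply exp_pos]|].
      pose proof (exp_pos (k * t)).
      replace (k * / exp (k * t) * (t * exp (k * t))) with (k * t) by (field; lra).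
      replace (/ t * (t * exp (k * t))) with (exp (k * t)) by (field; lra). lra. }
    nra. }
  unfold Qt, Gt, Gexp. fold k.
  assert (Hk1 : RtoC (1 + k) <> 0%C) by (intros E'; injection E'; lra).
  replace (3 * Ci * RtoC (r ^ 2) * bt g (RtoC k) t - g t * (3 * Ci * RtoC (r ^ 2 / (1 + k))))%C
    with (3 * Ci * RtoC (r ^ 2) * (/ RtoC (1 + k)) * ((1 + RtoC k) * (bt g (RtoC k) t - g t / (1 + RtoC k))))%C.
  2: { unfold Rdiv; rewrite RtoC_mult, RtoC_inv by lra. rewrite RtoC_plus in *. field. exact Hk1. }
  rewrite E, !Cmod_mult, Cmod_inv, Cmod_Ci, !Cmod_R, (Rabs_pos_eq 3), (Rabs_pos_eq (r ^ 2)), (Rabs_pos_eq (1 + k)) by (try nra; lra || auto).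
  replace (3 * (A * (1 + T) + D) * (r ^ 2 / (1 + k) ^ 2)) with (3 * 1 * r ^ 2 * / (1 + k) * ((A * (1 + T) + D) / (1 + k))) by (field; lra).
  assert (0 <= / (1 + k)) by (left; apply Rinv_0_lt_compat; lra).
  apply Rmult_le_compat_l.
  { apply Rmult_le_pos; auto. nra. }
  apply (Rmult_le_reg_l (1 + k)); [lra|]. replace ((1 + k) * ((A * (1 + T) + D) / (1 + k))) with (A * (1 + T) + D) by (field; lra).
  unfold Cminus at 1; eapply Rle_trans; [apply Rmult_le_compat_l; [lra|apply Cmod_triangle]|].
  rewrite Cmod_opp. pose proof (Cmod_ge_0 (bt (fun s => g s - g' s)%C (RtoC k) t)).
  assert (A * t <= A * T) by (apply Rmult_le_compat_l; lra). set (m := Cmod (bt (fun s : R => g s - g' s)%C (RtoC k) t)) in *. change (k * m <= A) in B1. change (m <= A * t) in B2. lra.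
Qed.

(** The square of (1 + r)^3 <= 4 (1 + r^3) gives the constant 16 and six powers of 1 + r, of which
    r^(j+2) uses at most four. *)
Lemma r2_decay r j : 0 <= r -> (j <= 2)%nat -> r ^ j * (r ^ 2 / (1 + r ^ 3) ^ 2) <= 16 / (1 + r) ^ 2.
Proof.
  intros Hr Hj; pose proof (r3_pos r Hr).
  assert (H1 : r ^ j * r ^ 2 <= (1 + r) ^ 4).
  { rewrite <- pow_add. apply (Rle_trans _ ((1 + r) ^ (j + 2))); [apply pow_incr; lra|].
    apply Rle_pow; [lra|lia]. }
  assert (H2 : (1 + r) ^ 3 <= 4 * (1 + r ^ 3)).
  { pose proof (Rle_0_sqr (r - 1)) as Q; unfold Rsqr in Q.
    assert (0 <= (r - 1) * (r - 1) * (1 + r)) by nra. nra. }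
  assert (H3 : (1 + r) ^ 6 <= 16 * (1 + r ^ 3) ^ 2).
  { replace ((1 + r) ^ 6) with ((1 + r) ^ 3 * (1 + r) ^ 3) by ring.
    replace (16 * (1 + r ^ 3) ^ 2) with (4 * (1 + r ^ 3) * (4 * (1 + r ^ 3))) by ring.
    assert (0 <= (1 + r) ^ 3) by (apply pow_le; lra). apply Rmult_le_compat; auto. }
  assert (0 < (1 + r) ^ 2) by nra. assert (0 < (1 + r ^ 3) ^ 2) by (apply pow_lt; auto).
  apply (Rmult_le_reg_r ((1 + r) ^ 2 * (1 + r ^ 3) ^ 2)); [now apply Rmult_lt_0_compat|].
  replace (r ^ j * (r ^ 2 / (1 + r ^ 3) ^ 2) * ((1 + r) ^ 2 * (1 + r ^ 3) ^ 2)) with (r ^ j * r ^ 2 * (1 + r) ^ 2) by (field; lra).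
  replace (16 / (1 + r) ^ 2 * ((1 + r) ^ 2 * (1 + r ^ 3) ^ 2)) with (16 * (1 + r ^ 3) ^ 2) by (field; lra).
  eapply Rle_trans; [|exact H3]. replace ((1 + r) ^ 6) with ((1 + r) ^ 4 * (1 + r) ^ 2) by ring.
  apply Rmult_le_compat_r; lra.
Qed.

Lemma K_le1 x r th : 0 <= x -> 0 <= r -> 0 <= sin th -> Cmod (Kx x (pol r th)) <= 1.
Proof. intros; rewrite Kx_mod, <- exp_0; apply exp_le. assert (0 <= r * sin th) by nra. nra. Qed.

Lemma Q_dom D Q j x th : (forall r, 0 <= r -> Cmod (Q r) <= D * (r ^ 2 / (1 + r ^ 3) ^ 2)) -> (j <= 2)%nat -> 0 <= x -> isth th -> 0 <= D ->
  dom (16 * D) (fun r => Kx x (pol r th) * (ipol th r ^ j * Q r))%C.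
Proof.
  intros HQ Hj Hx Hth HD r Hr.
  pose proof (K_le1 x r th Hx Hr ltac:(rewrite isth_sin; auto; lra)) as K.
  unfold ipol; rewrite !Cmod_mult, Cmod_pow, Cmod_mult, Cmod_Ci, Cmod_pol, Rmult_1_l by auto.
  specialize (HQ r Hr). pose proof (r2_decay r j Hr Hj). pose proof (pow_le r j Hr).
  pose proof (Cmod_ge_0 (Kx x (pol r th))). pose proof (Cmod_ge_0 (Q r)).
  apply (Rle_trans _ (1 * (r ^ j * Cmod (Q r)))); [apply Rmult_le_compat_r; auto; now apply Rmult_le_pos|].
  rewrite Rmult_1_l. apply (Rle_trans _ (r ^ j * (D * (r ^ 2 / (1 + r ^ 3) ^ 2)))); [now apply Rmult_le_compat_l|].
  replace (r ^ j * (D * (r ^ 2 / (1 + r ^ 3) ^ 2))) with (D * (r ^ j * (r ^ 2 / (1 + r ^ 3) ^ 2))) by ring.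
  replace (16 * D / (1 + r) ^ 2) with (D * (16 / (1 + r) ^ 2)) by (field; lra).
  now apply Rmult_le_compat_l.
Qed.

Lemma LG_bound j H x M : (forall th, isth th -> cont0 (fun r => Kx x (pol r th) * (ipol th r ^ j * H r))%C) ->
  (forall th, isth th -> dom M (fun r => Kx x (pol r th) * (ipol th r ^ j * H r))%C) -> Cmod (LG j H x) <= M.
Proof.
  intros Hc Hd; unfold LG; rewrite Cmod_mult, Cmod_R.
  pose proof PI2_3_2.
  rewrite Rabs_left1 by (assert (0 < / (2 * PI)) by (apply Rinv_0_lt_compat; lra); lra).
  pose proof (J_bound M _ (Hc th1 ltac:(now left)) (Hd th1 ltac:(now left))) as B1.
  pose proof (J_bound M _ (Hc th2 ltac:(now right)) (Hd th2 ltac:(now right))) as B2.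
  fold (Vj j th1 H x) in B1. fold (Vj j th2 H x) in B2.
  assert (B3 : Cmod (Vj j th1 H x - Vj j th2 H x) <= 2 * M).
  { unfold Cminus; eapply Rle_trans; [apply Cmod_triangle|]; rewrite Cmod_opp; lra. }
  assert (/ (2 * PI) <= / 2) by (apply Rinv_le_contravar; lra).
  assert (0 < / (2 * PI)) by (apply Rinv_0_lt_compat; lra).
  pose proof (Cmod_ge_0 (Vj j th1 H x - Vj j th2 H x)). rewrite Ropp_involutive. nra.
Qed.

Lemma Qt_cont0 g t : (forall s, continuous g s) -> cont0 (Qt g t).
Proof.
  intros Hg; apply (cont0_minus (Gt g t) (fun r => g t * Gexp r)%C).
  - apply (jct0_cont0 (Gt g)), Gt_jct0, Hg.
  - apply (cont0_scal (g t) Gexp), Gexp_cont0.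
Qed.

Lemma LG_split g A T t j x : 0 <= t <= T -> (forall s, continuous g s) -> (forall s, 0 <= s <= T -> Cmod (g s) <= A) -> 0 < x ->
  LG j (Gt g t) x = (LG j (Qt g t) x + g t * LG j Gexp x)%C.
Proof.
  intros Ht Hg HA Hx.
  pose proof (Gt_polyb g A T t Ht Hg HA) as P.
  set (B := 3 * (A * t) + 3 * Cmod (g t) + 3).
  assert (HA0 : 0 <= A) by (eapply Rle_trans; [apply Cmod_ge_0|apply (HA 0); lra]).
  assert (HAt : 0 <= A * t) by (apply Rmult_le_pos; lra).
  pose proof (Cmod_ge_0 (g t)) as Hgt.
  assert (P1 : polyb B 2 (Qt g t)).
  { intros r Hr; unfold Qt, Cminus; eapply Rle_trans; [apply Cmod_triangle|]; rewrite Cmod_opp, Cmod_mult.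
    specialize (P r Hr). pose proof (Gexp_polyb r Hr). assert (0 <= (1 + r) ^ 2) by nra. unfold B.
    assert (Cmod (g t) * Cmod (Gexp r) <= Cmod (g t) * (3 * (1 + r) ^ 2)) by (now apply Rmult_le_compat_l). nra. }
  assert (P2 : polyb B 2 (fun r => g t * Gexp r)%C).
  { intros r Hr; rewrite Cmod_mult. pose proof (Gexp_polyb r Hr). assert (0 <= (1 + r) ^ 2) by nra. unfold B.
    assert (Cmod (g t) * Cmod (Gexp r) <= Cmod (g t) * (3 * (1 + r) ^ 2)) by (now apply Rmult_le_compat_l). nra. }
  rewrite <- (LG_scal 3 2 j (g t) Gexp) by (try apply Gexp_cont0; try apply Gexp_polyb; auto).
  rewrite <- (LG_plus B 2 j (Qt g t) (fun r => g t * Gexp r)%C x); [|now apply Qt_cont0|exact P1|apply (cont0_scal (g t) Gexp), Gexp_cont0|exact P2|exact Hx].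
  apply LG_ext; intros r Hr; unfold Qt; ringC.
Qed.

Lemma LG_Gexp_j j x : 0 < x -> LG j Gexp x = (RtoC ((-1) ^ j) * RtoC (exp (- x)))%C.
Proof.
  revert x; induction j; intros x Hx.
  - rewrite LG_Gexp by auto. simpl; ringC.
  - apply (dr_unique (LG j Gexp) x); [apply (LG_dx 3 2); auto; [apply Gexp_cont0|apply Gexp_polyb]|].
    apply (is_derive_ext_loc (fun x => RtoC ((-1) ^ j) * RtoC (exp (- x)))%C).
    + apply locally_pos; [lra|]. intros y Hy; symmetry; auto.
    + dr. simpl pow. rewrite <- !RtoC_mult. f_equal; ring.
Qed.

Lemma LG_Gexp_bound j x : 0 < x -> Cmod (LG j Gexp x) <= 1.
Proof.
  intros Hx; rewrite LG_Gexp_j, <- RtoC_mult, Cmod_R, Rabs_mult, <- RPow_abs by auto.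
  rewrite (Rabs_left1 (-1)) by lra. replace (- -1) with 1 by ring. rewrite pow1, Rmult_1_l, Rabs_pos_eq by (left; apply exp_pos).
  rewrite <- exp_0; apply exp_le; lra.
Qed.

(** At x = 0 the integral of [Qt] is the same on both rays and cancels, so that g(t) e^(-x) alone
    gives the limit. *)
Lemma Ug_lim0 g g' t :
  0 < t -> (forall s, continuous g s) -> (forall s, continuous g' s) -> (forall s, 0 < s -> is_derive g s (g' s)) ->
  filterlim (fun x => Ug g x t) (at_right 0) (locally (g t)).
Proof.
  intros Ht Hg Hg' Hd.
  destruct (cont_bounded (fun s => g s - g' s)%C t ltac:(lra) ltac:(intros; ct)) as [A [HA0 HA]].
  destruct (cont_bounded g t ltac:(lra) Hg) as [Ag [_ HAg]].
  set (D := Cmod (g 0) * (1 + / t)).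
  assert (HD : 0 <= D).
  { unfold D; apply Rmult_le_pos; [apply Cmod_ge_0|]. assert (0 < / t) by now apply Rinv_0_lt_compat. lra. }
  pose proof (Qt_bound g g' A t t D ltac:(lra) Hg Hg' Hd HA ltac:(right; unfold D; lra) HD) as HQ.
  set (DD := 3 * (A * (1 + t) + D)) in *.
  assert (HDD : 0 <= DD) by (unfold DD; nra).
  (* Clamping x keeps the exponential bounded on both sides of 0, and the one-sided limit becomes
     continuity at 0. *)
  assert (Cx : continuous (fun x => LG 0 (Qt g t) (Rmax 0 x)) 0).
  { unfold LG; apply ct_mult; [ct|].
    assert (K : forall th, isth th -> continuous (fun x => Vj 0 th (Qt g t) (Rmax 0 x)) 0).
    { intros th Hth; unfold Vj.
      apply (J_ct (fun x r => Kx (Rmax 0 x) (pol r th) * (ipol th r ^ 0 * Qt g t r))%C 0 (16 * DD)).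
      apply filter_forall; intros x; split.
      - intros r; unfold jct, cl, ipol. apply ct_mult; [ctx|]. apply ct_mult; [ctx|].
        apply (ct_comp (cl (Qt g t)) (fun q : R * R => snd q)); [now apply Qt_cont0|ct].
      - apply Q_dom; auto. apply Rmax_l. }
    apply ct_minus; apply K; unfold isth; auto. }
  assert (Z0 : LG 0 (Qt g t) (Rmax 0 0) = RtoC 0).
  { rewrite Rmax_left by lra. unfold LG, Vj.
    rewrite (J_ext (fun r => Kx 0 (pol r th1) * (ipol th1 r ^ 0 * Qt g t r))%C (fun r => Kx 0 (pol r th2) * (ipol th2 r ^ 0 * Qt g t r))%C); [ringC|].
    intros r _; unfold Kx. replace (Ci * pol r th1 * RtoC 0)%C with (Ci * pol r th2 * RtoC 0)%C by ringC. simpl; reflexivity. }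
  assert (C2 : continuous (fun x => LG 0 (Qt g t) (Rmax 0 x) + g t * RtoC (exp (- x)))%C 0).
  { apply ct_plus; [exact Cx|ct]. }
  unfold continuous in C2. rewrite Z0, Ropp_0, exp_0 in C2. replace (0 + g t * 1)%C with (g t) in C2 by ringC.
  apply (filterlim_ext_loc (fun x => LG 0 (Qt g t) (Rmax 0 x) + g t * RtoC (exp (- x)))%C).
  - exists (mkposreal 1 Rlt_0_1); intros x _ Hx. rewrite Rmax_right by lra.
    unfold Ug. rewrite (LG_split g Ag t t) by (auto; lra). rewrite LG_Gexp by auto. reflexivity.
  - intros P HP; specialize (C2 P HP). unfold filtermap, at_right, within in *. revert C2; apply filter_imp; auto.
Qed.

(** For x >= 1 half of the exponential absorbs the powers of r, and the other half trades one factor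
    r of the kernel for 4/x. *)
Lemma Ug_decay A T : 0 <= A -> exists C, 0 <= C /\ forall g t j x,
  (forall s, continuous g s) -> (forall s, 0 <= s <= T -> Cmod (g s) <= A) -> 0 <= t <= T -> (j <= 2)%nat -> 1 <= x ->
  Cmod (LG j (Gt g t) x) <= C / x.
Proof.
  intros HA0.
  destruct (expdom (1 / 4) 4 ltac:(lra)) as [M [HM HE]].
  destruct (Rle_dec 0 T) as [HT|HT].
  2: { exists 0; split; [lra|]. intros g t j x _ _ Ht. lra. }
  assert (HAT : 0 <= A * T) by (apply Rmult_le_pos; auto).
  exists (12 * (A * T) * M); split; [apply Rmult_le_pos; lra|].
  intros g t j x Hg HA Ht Hj Hx.
  apply LG_bound.
  - intros th _; apply Vj_cont0. apply (jct0_cont0 (Gt g)), Gt_jct0, Hg.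
  - intros th Hth r Hr. unfold ipol; rewrite !Cmod_mult, Cmod_pow, Cmod_mult, Cmod_Ci, Cmod_pol, Rmult_1_l, Kx_mod, isth_sin by auto.
    rewrite Gt_mod by auto.
    pose proof (bt_real_bound g A r t ltac:(lra) Hg ltac:(intros; apply HA; lra) Hr) as Hb.
    assert (Hb' : Cmod (bt g (RtoC (r ^ 3)) t) <= A * T) by (eapply Rle_trans; [exact Hb|apply Rmult_le_compat_l; lra]).
    specialize (HE (1 / 4) r (Rle_refl _) Hr).
    assert (E1 : exp (- (x * (r * (1 / 2)))) <= exp (- (1 / 4 * r)) * exp (- (x * r / 4))).
    { rewrite <- exp_plus; apply exp_le. nra. }
    assert (E2 : r * exp (- (x * r / 4)) <= 4 / x).
    { rewrite exp_Ropp. pose proof (exp_ineq1_le (x * r / 4)). assert (0 <= x * r) by nra.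
      pose proof (exp_pos (x * r / 4)).
      apply (Rmult_le_reg_r (x * exp (x * r / 4))); [apply Rmult_lt_0_compat; lra|].
      replace (r * / exp (x * r / 4) * (x * exp (x * r / 4))) with (x * r) by (field; lra).
      replace (4 / x * (x * exp (x * r / 4))) with (4 * exp (x * r / 4)) by (field; lra). lra. }
    assert (E3 : r ^ j * r <= (1 + r) ^ 4).
    { replace (r ^ j * r) with (r ^ (S j)) by (simpl; ring).
      apply (Rle_trans _ ((1 + r) ^ S j)); [apply pow_incr; lra|apply Rle_pow; [lra|lia]]. }
    pose proof (exp_pos (- (1 / 4 * r))). pose proof (exp_pos (- (x * r / 4))). pose proof (pow_le r j Hr).
    pose proof (Cmod_ge_0 (bt g (RtoC (r ^ 3)) t)).
    assert (0 <= r ^ 2) by nra.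
    apply (Rle_trans _ (exp (- (1 / 4 * r)) * exp (- (x * r / 4)) * (r ^ j * (3 * r ^ 2 * (A * T))))).
    { apply Rmult_le_compat; auto.
      - left; apply exp_pos.
      - repeat apply Rmult_le_pos; auto; lra.
      - apply Rmult_le_compat_l; auto. apply Rmult_le_compat_l; nra. }
    replace (exp (- (1 / 4 * r)) * exp (- (x * r / 4)) * (r ^ j * (3 * r ^ 2 * (A * T)))) with
      (3 * (A * T) * ((r ^ j * r * exp (- (1 / 4 * r))) * (r * exp (- (x * r / 4))))) by ring.
    replace (12 * (A * T) * M / x / (1 + r) ^ 2) with (3 * (A * T) * (M / (1 + r) ^ 2 * (4 / x))) by (field; split; lra).
    apply Rmult_le_compat_l; [lra|]. apply Rmult_le_compat; auto.
    + repeat apply Rmult_le_pos; auto; lra.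
    + apply Rmult_le_pos; lra.
    + eapply Rle_trans; [|exact HE]. apply Rmult_le_compat_r; lra.
Qed.

Lemma LG_Q_bound D Q j x : cont0 Q -> (forall r, 0 <= r -> Cmod (Q r) <= D * (r ^ 2 / (1 + r ^ 3) ^ 2)) -> (j <= 2)%nat -> 0 <= x -> 0 <= D ->
  Cmod (LG j Q x) <= 16 * D.
Proof.
  intros Hc HQ Hj Hx HD; apply LG_bound.
  - intros th _; now apply Vj_cont0.
  - intros th Hth; now apply Q_dom.
Qed.

(** Supplies the bound on U_xx up to the edge that makes the boundary term of the energy identity
    vanish. *)
Lemma Ug_near g g' t :
  0 < t -> (forall s, continuous g s) -> (forall s, continuous g' s) -> (forall s, 0 < s -> is_derive g s (g' s)) ->
  exists C, forall x, 0 < x -> Cmod (LG 2 (Gt g t) x) <= C.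
Proof.
  intros Ht Hg Hg' Hd.
  destruct (cont_bounded (fun s => g s - g' s)%C t ltac:(lra) ltac:(intros; ct)) as [A [HA0 HA]].
  destruct (cont_bounded g t ltac:(lra) Hg) as [Ag [_ HAg]].
  set (D := Cmod (g 0) * (1 + / t)).
  assert (HD : 0 <= D).
  { unfold D; apply Rmult_le_pos; [apply Cmod_ge_0|]. assert (0 < / t) by now apply Rinv_0_lt_compat. lra. }
  pose proof (Qt_bound g g' A t t D ltac:(lra) Hg Hg' Hd HA ltac:(right; unfold D; lra) HD) as HQ.
  set (DD := 3 * (A * (1 + t) + D)) in *.
  assert (HDD : 0 <= DD) by (unfold DD; nra).
  exists (16 * DD + Cmod (g t)); intros x Hx.
  rewrite (LG_split g Ag t t) by (auto; lra). eapply Rle_trans; [apply Cmod_triangle|]; rewrite Cmod_mult.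
  pose proof (LG_Q_bound DD (Qt g t) 2 x (Qt_cont0 g t Hg) HQ ltac:(lia) ltac:(lra) HDD).
  pose proof (LG_Gexp_bound 2 x Hx). pose proof (Cmod_ge_0 (g t)). pose proof (Cmod_ge_0 (LG 2 Gexp x)). nra.
Qed.

Lemma Ug_unif g g' T :
  0 < T -> (forall s, continuous g s) -> (forall s, continuous g' s) -> (forall s, 0 < s -> is_derive g s (g' s)) -> g 0 = RtoC 0 ->
  exists C, forall x t, 0 < x -> 0 < t <= T -> Cmod (Ug g x t) <= C / (1 + x).
Proof.
  intros HT Hg Hg' Hd H0.
  destruct (cont_bounded (fun s => g s - g' s)%C T ltac:(lra) ltac:(intros; ct)) as [A [HA0 HA]].
  destruct (cont_bounded g T ltac:(lra) Hg) as [Ag [HAg0 HAg]].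
  destruct (Ug_decay Ag T HAg0) as [C1 [HC1 HC]].
  set (DD := 3 * (A * (1 + T) + 0)).
  assert (HDD : 0 <= DD) by (unfold DD; nra).
  exists (2 * (16 * DD + Ag) + 2 * C1); intros x t Hx Ht.
  destruct (Rle_dec 1 x) as [Hx1|Hx1].
  - pose proof (HC g t 0%nat x Hg HAg ltac:(lra) ltac:(lia) Hx1) as B.
    eapply Rle_trans; [exact B|].
    apply (Rle_trans _ (2 * C1 / (1 + x))).
    + apply (Rmult_le_reg_r (x * (1 + x))); [nra|].
      replace (C1 / x * (x * (1 + x))) with (C1 * (1 + x)) by (field; lra).
      replace (2 * C1 / (1 + x) * (x * (1 + x))) with (2 * C1 * x) by (field; lra). nra.
    + apply Rmult_le_compat_r; [left; apply Rinv_0_lt_compat; lra|lra].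
  (* Since [g] vanishes at 0, the rate may be taken to be 0 and the bound no longer depends on t. *)
  - pose proof (Qt_bound g g' A T t 0 Ht Hg Hg' Hd HA ltac:(now left) (Rle_refl 0)) as HQ. fold DD in HQ.
    unfold Ug; rewrite (LG_split g Ag T t) by (auto; lra).
    pose proof (LG_Q_bound DD (Qt g t) 0 x (Qt_cont0 g t Hg) HQ ltac:(lia) ltac:(lra) HDD).
    pose proof (LG_Gexp_bound 0 x Hx). pose proof (Cmod_ge_0 (g t)). pose proof (Cmod_ge_0 (LG 0 Gexp x)).
    pose proof (HAg t ltac:(lra)).
    apply (Rle_trans _ (16 * DD + Ag)).
    + eapply Rle_trans; [apply Cmod_triangle|]; rewrite Cmod_mult. nra.
    + apply (Rmult_le_reg_r (1 + x)); [lra|]. unfold Rdiv; rewrite Rmult_assoc, Rinv_l, Rmult_1_r by lra. nra.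
Qed.

(** When g(0) = 0 the time derivative passes onto the datum, so that the uniform bound of [Ug_unif],
    applied to g', controls it. *)
Lemma Ug_dt_compat g g' x t :
  0 < x -> 0 < t -> (forall s, continuous g s) -> (forall s, continuous g' s) -> (forall s, 0 < s -> is_derive g s (g' s)) -> g 0 = RtoC 0 ->
  (- LG 3 (Gt g t) x)%C = Ug g' x t.
Proof.
  intros Hx Ht0 Hg Hg' Hd H0.
  apply (dr_unique (fun t => Ug g x t) t); [now apply Ug_dt|].
  eapply dr_eq; [now apply Ug_dt_aux|]. unfold Ug; apply LG_ext; intros r Hr; unfold Ht, Gt.
  rewrite (bt_ibp g g') by (auto; lra). rewrite H0; ringC.
Qed.

Lemma Ug_t0 g x : 0 < x -> (forall s, continuous g s) -> filterlim (fun t => Ug g x t) (at_right 0) (locally (RtoC 0)).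
Proof.
  intros Hx Hg.
  destruct (cont_bounded g 1 ltac:(lra) Hg) as [A [HA0 HA]].
  assert (C1 : continuous (fun q : R * R => LG 0 (Gt g (Rmax 0 (snd q))) (fst q)) (x, 0)).
  { apply (LG_ct 0 (fun t => Gt g (Rmax 0 t)) (3 * A) 2 x 0); auto.
    - intros t r; unfold jct, cl, Gt. apply ct_mult; [ct|]. apply bt_ct2; auto; ct.
    - apply (filter_imp (fun t => t < 1)); [|apply (open_lt 1); lra].
      intros t Ht r Hr.
      assert (Hm : 0 <= Rmax 0 t <= 1) by (split; [apply Rmax_l|apply Rmax_lub; lra]).
      eapply Rle_trans; [apply (Gt_polyb g A 1 (Rmax 0 t)); auto|].
      assert (0 <= (1 + r) ^ 2) by nra. assert (A * Rmax 0 t <= A * 1) by (apply Rmult_le_compat_l; lra). nra. }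
  pose proof (ct_1 (fun x t => LG 0 (Gt g (Rmax 0 t)) x) x 0 C1) as C2.
  unfold continuous in C2. rewrite Rmax_left in C2 by lra.
  replace (LG 0 (Gt g 0) x) with (RtoC 0) in C2.
  - apply (filterlim_ext_loc (fun t => LG 0 (Gt g (Rmax 0 t)) x)).
    + exists (mkposreal 1 Rlt_0_1); intros t _ Ht. rewrite Rmax_right by lra. reflexivity.
    + intros P HP; specialize (C2 P HP). unfold filtermap, at_right, within in *. revert C2; apply filter_imp; auto.
  - rewrite (LG_ext 0 (Gt g 0) (fun r => 0 * Gexp r)%C).
    + rewrite (LG_scal 3 2) by (try apply Gexp_cont0; try apply Gexp_polyb; auto). ringC.
    + intros r _; unfold Gt, bt. rewrite CInt_point. ringC.
Qed.

(** * The contribution of the forcing *)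

(* Seven vanishing jets at the boundary make the transform [O(|l|^-7)]: enough for three
   derivatives in [x] and one integration by parts in [l], which costs another [l^2]. *)
Definition forcing (F : nat -> R -> R -> C) (M : R) : Prop :=
  (forall k t, (k <= 7)%nat -> jct0 (F k) t) /\
  (forall k t y, (k <= 7)%nat -> 0 <= y -> Cmod (F k t y) <= M / (1 + y) ^ 3) /\
  (forall k t y, (k < 7)%nat -> 0 < y -> is_derive (F k t) y (F (S k) t y - F k t y)%C) /\
  (forall k t, (k < 7)%nat -> F k t 0 = RtoC 0).

Lemma inv_pow_anti M y m n : 0 <= M -> 0 <= y -> (m <= n)%nat -> M / (1 + y) ^ n <= M / (1 + y) ^ m.
Proof.
  intros HM Hy Hn; apply Rmult_le_compat_l; auto. apply Rinv_le_contravar; [apply pow_lt; lra|apply Rle_pow; [lra|auto]].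
Qed.

Lemma pow_inv_decay M r j m n : 0 <= M -> 0 <= r -> (j + m <= n)%nat -> r ^ j * (M / (1 + r) ^ n) <= M / (1 + r) ^ m.
Proof.
  intros HM Hr Hn; assert (0 < (1 + r) ^ j) by (apply pow_lt; lra). assert (0 < (1 + r) ^ m) by (apply pow_lt; lra).
  apply (Rle_trans _ ((1 + r) ^ j * (M / (1 + r) ^ (j + m)))).
  - apply Rmult_le_compat; [now apply pow_le| |apply pow_incr; lra|now apply inv_pow_anti].
    apply Rmult_le_pos; auto. left; apply Rinv_0_lt_compat, pow_lt; lra.
  - right; rewrite pow_add; field; lra.
Qed.

Lemma forcing_pos F M : forcing F M -> 0 <= M.
Proof. intros (_ & H & _); specialize (H O 0 0 ltac:(lia) ltac:(lra)). pose proof (Cmod_ge_0 (F O 0 0)). rewrite Rplus_0_r, pow1 in H. lra. Qed.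

Lemma forcing_dom F M k t : forcing F M -> (k <= 7)%nat -> dom M (F k t).
Proof.
  intros HF Hk y Hy; pose proof (forcing_pos F M HF). eapply Rle_trans; [apply HF; auto|]. apply inv_pow_anti; auto.
Qed.

Lemma forcing_cont0 F M k t : forcing F M -> (k <= 7)%nat -> cont0 (F k t).
Proof. intros HF Hk; apply (jct0_cont0 (F k)), HF, Hk. Qed.

Lemma forcing_HH_ct F M k {U : UniformSpace} (f : U -> C) (g : U -> R) p : forcing F M -> (k <= 7)%nat ->
  continuous f p -> continuous g p -> continuous (fun x => HH (F k (g x)) (f x)) p.
Proof.
  intros HF Hk Hf Hg; apply (ct_comp2 (fun z t => HH (F k t) z)); auto.
  intros q; apply (HH_ct2 (F k) M q); intros u; [now apply HF|now apply (forcing_dom F)].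
Qed.

Lemma forcing_HH0 F M t mu : forcing F M -> Im mu <= 0 -> HH (F O t) mu = (rho mu ^ 7 * HH (F 7%nat t) mu)%C.
Proof.
  intros HF Hmu; apply (HH_jets_van 7 (fun k => F k t) M); auto.
  - split; [intros k Hk; split; [now apply (forcing_cont0 F M)|now apply (forcing_dom F)]|intros; now apply HF].
  - intros; now apply HF.
Qed.

(** The forcing term with e^(-omega t) absorbed and the seven vanishing jets already extracted as
    the seventh power of [rho]; [dn] makes it continuous on all of [C]. *)
Definition TF (F : nat -> R -> R -> C) (t : R) (mu : C) : C :=
  (rho (dn mu) ^ 7 * bt (fun s => HH (F 7%nat s) mu) (omega mu) t)%C.

Lemma dn_im mu : Im (dn mu) <= 0.
Proof. unfold dn, Im; simpl; apply Rmin_l. Qed.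

Lemma ct_rhod {U : UniformSpace} (f : U -> C) p : continuous f p -> continuous (fun x => rho (dn (f x))) p.
Proof.
  intros Hf; apply (continuous_comp (fun x => dn (f x)) rho); [ctx|apply rho_ct, rho_nz, dn_im].
Qed.

Lemma ct_TF F M {U : UniformSpace} (f : U -> C) (g : U -> R) p : forcing F M ->
  continuous f p -> continuous g p -> continuous (fun x => TF F (g x) (f x)) p.
Proof.
  intros HF Hf Hg; apply (ct_comp2 (fun z t => TF F t z)); auto. clear f g p Hf Hg.
  intros q; unfold TF; apply ct_mult; [apply ct_pow, ct_rhod; ct|].
  apply (continuous_ext (fun q : C * R => RtoC (snd q) * CInt (fun s => Cexp (- (omega (fst q) * RtoC (snd q - snd q * s))) * HH (F 7%nat (snd q * s)%R) (fst q)) 0 1)%C).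
  - intros q'; symmetry; apply bt_scaled. intros s; apply (forcing_HH_ct F M); auto; ct.
  - apply ct_mult; [ct|].
    apply (CInt_ct (fun (q : C * R) s => Cexp (- (omega (fst q) * RtoC (snd q - snd q * s))) * HH (F 7%nat (snd q * s)%R) (fst q))%C); [lra|].
    intros p' s _; unfold jct. apply ct_mult; [ctx|]. apply (forcing_HH_ct F M); auto; ct.
Qed.

Lemma rhod_pol r ph : 0 <= r -> sin ph <= 0 -> dn (pol r ph) = pol r ph /\ Cmod (rho (pol r ph)) <= 2 / (1 + r).
Proof.
  intros Hr Hs; assert (Hi : Im (pol r ph) <= 0) by (rewrite pol_eq; unfold Im; simpl; nra).
  split; [now apply dn_id|]. pose proof (rho_bound _ Hi) as B; rewrite Cmod_pol in B; auto.
Qed.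

Lemma rho7_bound r ph : 0 <= r -> sin ph <= 0 -> Cmod (rho (dn (pol r ph)) ^ 7) <= 128 / (1 + r) ^ 7.
Proof.
  intros Hr Hs; destruct (rhod_pol r ph Hr Hs) as [E B]; rewrite E, Cmod_pow.
  replace (128 / (1 + r) ^ 7) with ((2 / (1 + r)) ^ 7) by (field; lra).
  apply pow_incr; split; [apply Cmod_ge_0|auto].
Qed.

Lemma bt_HH_bound F M t mu : forcing F M -> 0 <= t -> 0 <= Re (omega mu) -> Cmod (bt (fun s => HH (F 7%nat s) mu) (omega mu) t) <= M * t.
Proof.
  intros HF Ht Hw; apply bt_bound; auto.
  - intros s; apply (forcing_HH_ct F M); auto; ct.
  - intros s _; apply HH_bound; [now apply (forcing_cont0 F M)|now apply (forcing_dom F)].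
Qed.

(** Here [th] is the argument of the integration variable in e^(izx) and [ph] that of the rotated
    variable in the transform. The first lies in the upper, the second in the lower half-plane, and
    their cubes have the same direction, so omega takes the same value with nonnegative real
    part. *)
Definition adm (th ph : R) : Prop := 0 <= sin th /\ sin ph <= 0 /\ 0 <= sin (3 * ph) /\ ex (3 * th) = ex (3 * ph).

Lemma adm_omega th ph r : adm th ph -> omega (pol r ph) = (ipol th r ^ 3)%C.
Proof.
  intros (_ & _ & _ & E); unfold ipol; rewrite <- omega_eq, !omega_pol. rewrite !ex_eq in E. injection E as E1 E2. rewrite E1, E2; reflexivity.
Qed.
Lemma adm_Re th ph r : adm th ph -> 0 <= r -> 0 <= Re (omega (pol r ph)).
Proof. intros (_ & _ & H & _) Hr; now apply Re_omega_pol. Qed.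

Lemma TF_bound F M t th ph r : forcing F M -> adm th ph -> 0 <= t -> 0 <= r -> Cmod (TF F t (pol r ph)) <= 128 * M * t / (1 + r) ^ 7.
Proof.
  intros HF Ha Ht Hr; unfold TF; rewrite Cmod_mult.
  replace (128 * M * t / (1 + r) ^ 7) with (128 / (1 + r) ^ 7 * (M * t)) by (field; lra).
  apply Rmult_le_compat; try apply Cmod_ge_0; [apply rho7_bound; auto; apply Ha|].
  apply bt_HH_bound; auto. now apply (adm_Re th).
Qed.

Lemma Cmod_ipol th r : 0 <= r -> Cmod (ipol th r) = r.
Proof. intros; unfold ipol; rewrite Cmod_mult, Cmod_Ci, Cmod_pol; auto; ring. Qed.

Lemma PF_dom x th j A S : 0 <= x -> 0 <= sin th -> 0 <= A -> (j <= 5)%nat -> (forall r, 0 <= r -> Cmod (S r) <= A / (1 + r) ^ 7) ->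
  dom A (fun r => Kx x (pol r th) * (ipol th r ^ j * S r))%C.
Proof.
  intros Hx Hs HA Hj HS r Hr; rewrite !Cmod_mult, Cmod_pow, Cmod_ipol by auto.
  pose proof (K_le1 x r th Hx Hr Hs). pose proof (pow_le r j Hr). pose proof (Cmod_ge_0 (S r)).
  apply (Rle_trans _ (1 * (r ^ j * Cmod (S r)))); [apply Rmult_le_compat_r; auto; now apply Rmult_le_pos|].
  rewrite Rmult_1_l. eapply Rle_trans; [apply Rmult_le_compat_l; [auto|apply HS; auto]|].
  apply pow_inv_decay; auto; lia.
Qed.

(** The factor e^(i ph) unites the direction e^(i th) of the ray with the power of alpha in front of
    the transform. *)
Definition PF (F : nat -> R -> R -> C) (th ph : R) (j : nat) (x t : R) : C :=
  (J (fun r => Kx x (pol r th) * (ipol th r ^ j * TF F t (pol r ph))) * ex ph)%C.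

Lemma PF_integrand F M th ph j x t : forcing F M -> adm th ph -> 0 <= x -> 0 <= t -> (j <= 5)%nat ->
  dom (128 * M * t) (fun r => Kx x (pol r th) * (ipol th r ^ j * TF F t (pol r ph)))%C.
Proof.
  intros HF Ha Hx Ht Hj; pose proof (forcing_pos F M HF). apply PF_dom; auto; [apply Ha| |].
  - apply Rmult_le_pos; lra.
  - intros; now apply (TF_bound F M t th).
Qed.

Lemma PF_cont {U : UniformSpace} F M th ph j (f g : U -> R) (h : U -> R) p : forcing F M -> continuous f p -> continuous g p -> continuous h p ->
  continuous (fun q => Kx (f q) (pol (h q) th) * (ipol th (h q) ^ j * TF F (g q) (pol (h q) ph)))%C p.
Proof.
  intros HF Hf Hg Hh; apply ct_mult; [ctx|]. apply ct_mult; [unfold ipol; ctx|]. apply (ct_TF F M); auto. ctx.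
Qed.

Lemma PF_cont0 F M th ph j x t : forcing F M -> cont0 (fun r => Kx x (pol r th) * (ipol th r ^ j * TF F t (pol r ph)))%C.
Proof. intros HF; apply cont0_ct; intros r; apply (PF_cont F M); auto; ct. Qed.

Lemma PF_ray F M th ph x t : forcing F M -> adm th ph -> 0 <= x -> 0 <= t ->
  is_J (fun r => Kx x (pol r th) * TF F t (pol r ph) * ex ph)%C (PF F th ph 0 x t).
Proof.
  intros HF Ha Hx Ht; pose proof (J_is _ _ (PF_cont0 F M th ph 0 x t HF) (PF_integrand F M th ph 0 x t HF Ha Hx Ht ltac:(lia))) as T.
  pose proof (is_J_scal (ex ph) _ _ T) as T2. unfold PF. replace (ex ph * J (fun r => Kx x (pol r th) * (ipol th r ^ 0 * TF F t (pol r ph))))%C with (J (fun r => Kx x (pol r th) * (ipol th r ^ 0 * TF F t (pol r ph))) * ex ph)%C in T2 by ringC.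
  revert T2; apply is_J_ext; intros r _; simpl; ringC.
Qed.

Lemma PF_dx F M th ph j x t : forcing F M -> adm th ph -> 0 < x -> 0 <= t -> (j <= 4)%nat ->
  is_derive (fun x => PF F th ph j x t) x (PF F th ph (S j) x t).
Proof.
  intros HF Ha Hx Ht Hj; unfold PF; apply dr_scalr.
  apply (J_dr (fun x r => Kx x (pol r th) * (ipol th r ^ j * TF F t (pol r ph)))%C (fun x r => Kx x (pol r th) * (ipol th r ^ (S j) * TF F t (pol r ph)))%C x (128 * M * t)).
  apply locally_pos; [lra|].
  intros y Hy; split; [|split].
  - split; [|apply PF_integrand; auto; lra || lia]. intros r; unfold jct, cl. apply (PF_cont F M); auto; ct.
  - split; [|apply PF_integrand; auto; lra || lia]. intros r; unfold jct, cl. apply (PF_cont F M); auto; ct.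
  - intros r Hr; unfold Kx. dr. unfold ipol; simpl; ringC.
Qed.

Definition DTF (F : nat -> R -> R -> C) (t : R) (mu : C) : C :=
  (rho (dn mu) ^ 7 * HH (F 7%nat t) mu - omega mu * TF F t mu)%C.

Lemma TF_dt F M t mu : forcing F M -> is_derive (fun t => TF F t mu) t (DTF F t mu).
Proof.
  intros HF; unfold TF, DTF. eapply dr_eq; [apply dr_scal, bt_dt; intros s; apply (forcing_HH_ct F M); auto; ct|].
  unfold TF; ringC.
Qed.

Lemma H7_bound F M t ph r : forcing F M -> 0 <= r -> sin ph <= 0 ->
  Cmod (rho (dn (pol r ph)) ^ 7 * HH (F 7%nat t) (pol r ph)) <= 128 * M / (1 + r) ^ 7.
Proof.
  intros HF Hr Hs; rewrite Cmod_mult. replace (128 * M / (1 + r) ^ 7) with (128 / (1 + r) ^ 7 * M) by (field; lra).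
  apply Rmult_le_compat; try apply Cmod_ge_0; [now apply rho7_bound|].
  apply HH_bound; [now apply (forcing_cont0 F M)|now apply (forcing_dom F)].
Qed.

(** The source part stays a separate integral of the transform at time t; the six of them are summed
    by Fourier inversion in [UF_dt]. *)
Lemma PF_dt F M th ph x t : forcing F M -> adm th ph -> 0 <= x -> 0 < t ->
  is_derive (fun t => PF F th ph 0 x t) t (J (fun r => Kx x (pol r th) * HH (F O t) (pol r ph)) * ex ph - PF F th ph 3 x t)%C.
Proof.
  intros HF Ha Hx Ht; pose proof (forcing_pos F M HF) as HM.
  assert (C0 : forall t, cont0 (fun r => Kx x (pol r th) * (rho (dn (pol r ph)) ^ 7 * HH (F 7%nat t) (pol r ph)))%C).
  { intros u; apply cont0_ct; intros r; apply ct_mult; [ctx|]. apply ct_mult; [apply ct_pow, ct_rhod; ctx|]. apply (forcing_HH_ct F M); auto; ctx. }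
  assert (D0 : forall t, dom (128 * M) (fun r => Kx x (pol r th) * (rho (dn (pol r ph)) ^ 7 * HH (F 7%nat t) (pol r ph)))%C).
  { intros u. pose proof (PF_dom x th 0 (128 * M) (fun r => rho (dn (pol r ph)) ^ 7 * HH (F 7%nat u) (pol r ph))%C Hx ltac:(apply Ha) ltac:(lra) ltac:(lia)) as D.
    assert (B : forall r, 0 <= r -> Cmod (rho (dn (pol r ph)) ^ 7 * HH (F 7%nat u) (pol r ph)) <= 128 * M / (1 + r) ^ 7).
    { intros r Hr; apply H7_bound; auto; apply Ha. }
    intros r Hr; pose proof (D B r Hr) as D'. cbv beta in D'. change (ipol th r ^ 0)%C with (RtoC 1) in D'. rewrite Cmult_1_l in D'. exact D'. }
  assert (E : forall u r, 0 <= r -> (Kx x (pol r th) * (ipol th r ^ 0 * DTF F u (pol r ph)) =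
     Kx x (pol r th) * (rho (dn (pol r ph)) ^ 7 * HH (F 7%nat u) (pol r ph)) - Kx x (pol r th) * (ipol th r ^ 3 * TF F u (pol r ph)))%C).
  { intros u r Hr; unfold DTF; rewrite (adm_omega th ph) by auto. simpl; ringC. }
  eapply dr_eq.
  - unfold PF at 1; apply dr_scalr.
    apply (J_dr (fun t r => Kx x (pol r th) * (ipol th r ^ 0 * TF F t (pol r ph)))%C (fun t r => Kx x (pol r th) * (ipol th r ^ 0 * DTF F t (pol r ph)))%C t (128 * M * (t + 1) + 128 * M)).
    assert (L : locally t (fun u => 0 < u < t + 1)).
    { apply locally_interval; lra. }
    revert L; apply filter_imp; intros u Hu; split; [|split].
    + split; [intros r; unfold jct, cl; apply (PF_cont F M); auto; ct|].
      apply (dom_le (128 * M * u)); [apply PF_integrand; auto; lra || lia|]. assert (128 * M * u <= 128 * M * (t + 1)) by (apply Rmult_le_compat_l; lra). lra.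
    + split.
      * intros r; unfold jct, cl, DTF. apply ct_mult; [ctx|]. apply ct_mult; [unfold ipol; ctx|]. apply ct_minus.
        -- apply ct_mult; [apply ct_pow, ct_rhod; ctx|]. apply (forcing_HH_ct F M); auto; ctx.
        -- apply ct_mult; [ctx|]. apply (ct_TF F M); auto; ctx.
      * intros r Hr. rewrite E by auto. unfold Cminus; eapply Rle_trans; [apply Cmod_triangle|]; rewrite Cmod_opp.
        pose proof (D0 u r Hr). pose proof (PF_integrand F M th ph 3 x u HF Ha Hx ltac:(lra) ltac:(lia) r Hr).
        assert (128 * M * u / (1 + r) ^ 2 <= 128 * M * (t + 1) / (1 + r) ^ 2).
        { apply Rmult_le_compat_r; [left; apply Rinv_0_lt_compat, pow_lt; lra|]. apply Rmult_le_compat_l; lra. }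
        replace ((128 * M * (t + 1) + 128 * M) / (1 + r) ^ 2) with (128 * M / (1 + r) ^ 2 + 128 * M * (t + 1) / (1 + r) ^ 2) by (field; lra). lra.
    + intros r Hr; apply dr_scal, dr_scal. now apply (TF_dt F M).
  - rewrite (J_ext _ _ (E t)).
    assert (HMt : 0 <= 128 * M * t) by (apply Rmult_le_pos; lra).
    rewrite (J_minus (128 * M + 128 * M * t)); auto.
    + unfold PF. rewrite (J_ext (fun r => Kx x (pol r th) * HH (F O t) (pol r ph))%C (fun r => Kx x (pol r th) * (rho (dn (pol r ph)) ^ 7 * HH (F 7%nat t) (pol r ph)))%C); [ringC|].
      intros r Hr; destruct (rhod_pol r ph Hr ltac:(apply Ha)) as [-> _]. rewrite (forcing_HH0 F M); auto.
      destruct Ha as (_ & Hs & _). rewrite pol_eq; unfold Im; simpl; nra.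
    + apply (dom_le (128 * M)); [auto|lra].
    + apply (PF_cont0 F M); auto.
    + apply (dom_le (128 * M * t)); [apply PF_integrand; auto; lra || lia|lra].
Qed.

Lemma PF_ct F M th ph j x t : forcing F M -> adm th ph -> 0 < x -> 0 < t -> (j <= 5)%nat ->
  continuous (fun q : R * R => PF F th ph j (fst q) (snd q)) (x, t).
Proof.
  intros HF Ha Hx Ht Hj; unfold PF; apply ct_mult; [|ct].
  pose proof (forcing_pos F M HF).
  apply (J_ct (fun (q : R * R) r => Kx (fst q) (pol r th) * (ipol th r ^ j * TF F (snd q) (pol r ph)))%C (x, t) (128 * M * (t + 1))).
  assert (L : locally (x, t) (fun q : R * R => 0 < fst q /\ 0 < snd q < t + 1)).
  { apply filter_and.
    - refine (continuous_fst x t (fun x => 0 < x) _). apply (open_gt 0); simpl; lra.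
    - refine (continuous_snd x t (fun u => 0 < u < t + 1) _). apply locally_interval; simpl; lra. }
  revert L; apply filter_imp; intros [y u] [Hy Hu]; simpl in *; split.
  - intros r; unfold jct, cl; apply (PF_cont F M); auto; ct.
  - apply (dom_le (128 * M * u)); [apply PF_integrand; auto; lra || lia|]. apply Rmult_le_compat_l; lra.
Qed.

Lemma PF_lim0 F M th ph t : forcing F M -> adm th ph -> 0 < t ->
  filterlim (fun x => PF F th ph 0 x t) (at_right 0) (locally (PF F th ph 0 0 t)).
Proof.
  intros HF Ha Ht; pose proof (forcing_pos F M HF).
  assert (C1 : continuous (fun x => PF F th ph 0 (Rmax 0 x) t) 0).
  { unfold PF; apply ct_mult; [|ct].
    apply (J_ct (fun x r => Kx (Rmax 0 x) (pol r th) * (ipol th r ^ 0 * TF F t (pol r ph)))%C 0 (128 * M * t)).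
    apply filter_forall; intros x; split.
    - intros r; unfold jct, cl; apply (PF_cont F M); auto; ct.
    - apply PF_integrand; auto; try lra; try lia. apply Rmax_l. }
  unfold continuous in C1; rewrite Rmax_left in C1 by lra.
  apply (filterlim_ext_loc (fun x => PF F th ph 0 (Rmax 0 x) t)).
  - exists (mkposreal 1 Rlt_0_1); intros x _ Hx. rewrite Rmax_right by lra. reflexivity.
  - intros P HP; specialize (C1 P HP). unfold filtermap, at_right, within in *. revert C1; apply filter_imp; auto.
Qed.

Lemma PF_bound0 F M th ph j x t : forcing F M -> adm th ph -> 0 <= x -> 0 <= t -> (j <= 5)%nat -> Cmod (PF F th ph j x t) <= 128 * M * t.
Proof.
  intros; unfold PF; rewrite Cmod_mult, Cmod_ex, Rmult_1_r. apply J_bound; [now apply (PF_cont0 F M)|now apply PF_integrand].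
Qed.

(** * Decay in [x] *)

(** Integration by parts against e^(izx) gains 1/x; the boundary term and the remaining integral
    cost at most [M] each. *)
Lemma ray_ibp x th G G' M : 0 < x -> 0 <= sin th -> cont0 G -> cont0 G' -> dom M G -> dom M G' ->
  (forall r, 0 < r -> is_derive G r (G' r)) -> Cmod (J (fun r => Kx x (pol r th) * G r)%C) <= 2 * M / x.
Proof.
  intros Hx Hs C0 C1 D0 D1 HD.
  assert (DK : forall H, dom M H -> dom M (fun r => Kx x (pol r th) * H r)%C).
  { intros H D r Hr; rewrite Cmod_mult. pose proof (K_le1 x r th ltac:(lra) Hr Hs). pose proof (Cmod_ge_0 (H r)).
    eapply Rle_trans; [|apply D; auto]. rewrite <- (Rmult_1_l (Cmod (H r))) at 2. now apply Rmult_le_compat_r. }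
  assert (CK : forall H, cont0 H -> cont0 (fun r => Kx x (pol r th) * H r)%C).
  { intros H CH; apply (cont0_mult (fun r => Kx x (pol r th))); auto. apply cont0_ct; intros; ctx. }
  set (c := (Ci * ex th * RtoC x)%C).
  assert (A : is_J (fun r => c * (Kx x (pol r th) * G r) + Kx x (pol r th) * G' r)%C (- (Kx x (pol 0 th) * G 0%R))%C).
  { apply (J_FTC (fun r => Kx x (pol r th) * G r)%C).
    - auto.
    - apply (cont0_plus (fun r => c * (Kx x (pol r th) * G r))%C); auto. apply (cont0_scal c (fun r => Kx x (pol r th) * G r)%C); auto.
    - intros r Hr; pose proof (HD r Hr). unfold Kx, pol. dr. unfold c; ringC.
    - apply (dom_lim M); auto. }
  pose proof (is_J_scal c _ _ (J_is M _ (CK G C0) (DK G D0))) as B1.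
  pose proof (J_is M _ (CK G' C1) (DK G' D1)) as B2.
  pose proof (is_J_unique _ _ (is_J_plus _ _ _ _ B1 B2)) as E. cbv beta in E. rewrite (is_J_unique _ _ A) in E.
  assert (Ec : Cmod (c * J (fun r => Kx x (pol r th) * G r)%C) <= 2 * M).
  { replace (c * J (fun r => Kx x (pol r th) * G r))%C with (- (Kx x (pol 0 th) * G 0%R) - J (fun r => Kx x (pol r th) * G' r))%C by (rewrite E; ringC).
    unfold Cminus; eapply Rle_trans; [apply Cmod_triangle|]. rewrite !Cmod_opp.
    pose proof (J_bound M _ (CK G' C1) (DK G' D1)). pose proof (DK G D0 0 ltac:(lra)) as D. cbv beta in D. rewrite Rplus_0_r, pow1 in D. lra. }
  rewrite Cmod_mult in Ec. unfold c in Ec. rewrite !Cmod_mult, Cmod_Ci, Cmod_ex, Cmod_R, Rabs_pos_eq in Ec by lra.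
  apply (Rmult_le_reg_l x); auto. replace (x * (2 * M / x)) with (2 * M) by (field; lra). lra.
Qed.

(** The ray stays in the closed lower half-plane, where [dn] is the identity, and the factor y uses
    one power of the cubic decay. *)
Lemma HH_dr h M ph r : cont0 h -> (forall y, 0 <= y -> Cmod (h y) <= M / (1 + y) ^ 3) -> sin ph <= 0 -> 0 < r ->
  is_derive (fun r => HH h (pol r ph)) r (HH (fun y => - Ci * ex ph * RtoC y * h y)%C (pol r ph)).
Proof.
  intros Ch Bh Hs Hr; unfold HH.
  assert (HM : 0 <= M) by (specialize (Bh 0 ltac:(lra)); pose proof (Cmod_ge_0 (h 0)); rewrite Rplus_0_r, pow1 in Bh; lra).
  assert (D1 : dom M h) by (intros y Hy; eapply Rle_trans; [apply Bh; auto|apply inv_pow_anti; auto]).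
  assert (D2 : dom M (fun y => - Ci * ex ph * RtoC y * h y)%C).
  { intros y Hy; rewrite !Cmod_mult, Cmod_opp, Cmod_Ci, Cmod_ex, Cmod_R, Rabs_pos_eq by auto.
    replace (1 * 1 * y * Cmod (h y)) with (y ^ 1 * Cmod (h y)) by ring.
    eapply Rle_trans; [apply Rmult_le_compat_l; [simpl; lra|apply Bh; auto]|]. apply pow_inv_decay; auto. }
  assert (JJ : forall H, cont0 H -> forall p : R, jct0 (fun r y => ek (pol r ph) y * H y)%C p).
  { intros H CH p y; unfold jct, cl. apply ct_mult; [ctx|]. apply (ct_comp (cl H) (fun q : R * R => snd q)); [exact CH|ct]. }
  apply (J_dr (fun r y => ek (pol r ph) y * h y)%C (fun r y => ek (pol r ph) y * (- Ci * ex ph * RtoC y * h y))%C r M).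
  apply locally_pos; [lra|].
  intros p Hp; split; [|split].
  - split; [now apply JJ|now apply ek_dom].
  - split; [apply JJ|now apply ek_dom]. apply (cont0_mult (fun y => - Ci * ex ph * RtoC y)%C); auto. apply cont0_ct; intros; ct.
  - intros y Hy. apply (is_derive_ext_loc (fun r => Cexp (- (Ci * pol r ph * RtoC y)) * h y)%C).
    + apply locally_pos; [lra|]. intros q Hq; unfold ek.
      rewrite dn_id; auto. rewrite pol_eq; unfold Im; simpl; nra.
    + unfold ek; rewrite dn_id by (rewrite pol_eq; unfold Im; simpl; nra). unfold pol; dr. ringC.
Qed.

Definition Fy (F : nat -> R -> R -> C) (ph s y : R) : C := (- Ci * ex ph * RtoC y * F 7%nat s y)%C.

Definition DRi (F : nat -> R -> R -> C) (ph t r s : R) : C :=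
  (Cexp (- (omega (pol r ph) * RtoC (t - s))) *
   (HH (Fy F ph s) (pol r ph) - 3 * (Ci * ex ph) * (Ci * pol r ph) ^ 2 * RtoC (t - s) * HH (F 7%nat s) (pol r ph)))%C.

(** The radial derivative of [TF]: the first summand comes from the power of [rho], the integral
    from the exponential and the transform inside [bt]. *)
Definition DRF (F : nat -> R -> R -> C) (ph t r : R) : C :=
  (rho (dn (pol r ph)) ^ 7 * (- (7 * Ci * ex ph * rho (dn (pol r ph))) * bt (fun s => HH (F 7%nat s) (pol r ph)) (omega (pol r ph)) t
   + CInt (fun s => DRi F ph t r s) 0 t))%C.

Lemma Fy_dom F M ph s : forcing F M -> dom M (Fy F ph s).
Proof.
  intros HF y Hy; unfold Fy; rewrite !Cmod_mult, Cmod_opp, Cmod_Ci, Cmod_ex, Cmod_R, Rabs_pos_eq by auto.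
  replace (1 * 1 * y * Cmod (F 7%nat s y)) with (y ^ 1 * Cmod (F 7%nat s y)) by ring.
  eapply Rle_trans; [apply Rmult_le_compat_l; [simpl; lra|apply HF; auto]|]. apply pow_inv_decay; auto. now apply (forcing_pos F).
Qed.

Lemma Fy_jct0 F M ph s : forcing F M -> jct0 (Fy F ph) s.
Proof.
  intros HF y; unfold jct, cl, Fy. apply ct_mult; [ct|]. apply (ct_comp2 (fun t r => cl (F 7%nat t) r)); [intros [? ?]; apply HF; auto| |]; ct.
Qed.

Lemma Fy_HH_ct F M ph {U : UniformSpace} (f : U -> C) (g : U -> R) p : forcing F M ->
  continuous f p -> continuous g p -> continuous (fun x => HH (Fy F ph (g x)) (f x)) p.
Proof.
  intros HF Hf Hg; apply (ct_comp2 (fun z t => HH (Fy F ph t) z)); auto.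
  intros q; apply (HH_ct2 (Fy F ph) M q); intros u; [now apply (Fy_jct0 F M)|now apply Fy_dom].
Qed.

Lemma DRi_ct F M ph t {U : UniformSpace} (f g : U -> R) p : forcing F M -> continuous f p -> continuous g p ->
  continuous (fun q => DRi F ph t (f q) (g q)) p.
Proof.
  intros HF Hf Hg; unfold DRi; apply ct_mult; [ctx|]. apply ct_minus; [apply (Fy_HH_ct F M); auto; ctx|].
  apply ct_mult; [ctx|]. apply (forcing_HH_ct F M); auto; ctx.
Qed.

Lemma DRF_ct F M ph t r : forcing F M -> 0 <= t -> continuous (DRF F ph t) r.
Proof.
  intros HF Ht; unfold DRF; apply ct_mult; [apply ct_pow, ct_rhod; ctx|]. apply ct_plus.
  - apply ct_mult; [apply ct_opp, ct_mult; [ctx|apply ct_rhod; ctx]|].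
    unfold bt. apply (CInt_ct (fun r s => Cexp (- (omega (pol r ph) * RtoC (t - s))) * HH (F 7%nat s) (pol r ph))%C); auto.
    intros p s _; unfold jct; apply ct_mult; [ctx|]. apply (forcing_HH_ct F M); auto; ctx.
  - apply (CInt_ct (fun r s => DRi F ph t r s)%C); auto.
    intros p s _; unfold jct; apply (DRi_ct F M); auto; ct.
Qed.

Lemma TF_dr F M ph t r : forcing F M -> 0 <= t -> sin ph <= 0 -> 0 < r -> is_derive (fun r => TF F t (pol r ph)) r (DRF F ph t r).
Proof.
  intros HF Ht Hs Hr.
  assert (Hi : forall q, 0 < q -> dn (pol q ph) = pol q ph) by (intros; apply rhod_pol; auto; lra).
  apply (is_derive_ext_loc (fun r => rho (pol r ph) ^ 7 * bt (fun s => HH (F 7%nat s) (pol r ph)) (omega (pol r ph)) t)%C).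
  { apply locally_pos; [lra|]. intros q Hq; unfold TF; now rewrite Hi. }
  assert (Db : is_derive (fun r => bt (fun s => HH (F 7%nat s) (pol r ph)) (omega (pol r ph)) t) r
    (CInt (DRi F ph t r) 0 t)).
  { unfold bt. apply (CInt_dr (fun r s => Cexp (- (omega (pol r ph) * RtoC (t - s))) * HH (F 7%nat s) (pol r ph))%C
      (fun r s => DRi F ph t r s)%C); auto.
    apply locally_pos; [lra|]. intros q Hq s Hst; split; [|split].
    - unfold jct; apply ct_mult; [ctx|]. apply (forcing_HH_ct F M); auto; ctx.
    - unfold jct; apply (DRi_ct F M); auto; ct.
    - pose proof (HH_dr (F 7%nat s) M ph q (forcing_cont0 F M 7 s HF ltac:(lia)) ltac:(intros; apply HF; auto) Hs Hq) as D.
      assert (De : is_derive (fun r => Cexp (- (omega (pol r ph) * RtoC (t - s)))) q (- (3 * (Ci * ex ph) * (Ci * pol q ph) ^ 2 * RtoC (t - s)) * Cexp (- (omega (pol q ph) * RtoC (t - s))))%C).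
      { unfold omega, pol. dr. replace (INR 3) with (1 + 1 + 1) by (simpl; ring). rewrite !RtoC_plus. simpl.
        pose proof Ci2 as Ii.
        set (E := Cexp _). set (e := ex ph). set (ts := RtoC (t - s)). set (rr := RtoC q).
        transitivity ((3 * Ci * (e * e * e * rr * rr) * ts) * E)%C; [ringC|].
        transitivity (- (Ci * Ci) * (3 * Ci * (e * e * e * rr * rr) * ts) * E)%C; [rewrite Ii; ringC|ringC]. }
      eapply dr_eq; [apply dr_mult; [exact De|exact D]|]. unfold DRi, Fy. ringC. }
  assert (Dr : is_derive (fun r => rho (pol r ph)) r (- Ci * ex ph * (rho (pol r ph) * rho (pol r ph)))%C).
  { unfold rho, pol. eapply dr_eq; [apply (dr_inv (fun r => 1 + Ci * (RtoC r * ex ph))%C); [repeat dr1|]|cbv beta; ringC].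
    fold (pol r ph). apply rho_nz. rewrite <- Hi by auto. apply dn_im. }
  eapply dr_eq; [apply dr_mult; [apply (dr_pow _ 7 _ _ Dr)|exact Db]|].
  unfold DRF; rewrite Hi by auto. replace (INR 7) with (1 + 1 + 1 + 1 + 1 + 1 + 1) by (simpl; ring). rewrite !RtoC_plus. simpl.
  set (b := bt _ _ _). set (c := CInt _ _ _). set (q := rho _). ringC.
Qed.

(** Differentiating e^(-omega (t - s)) costs r^2, which lowers the exponent 7 to 5. The number 15 is
    7 times the bound 2 of [rho], plus 1 for the derivative of the transform. *)
Lemma DRF_bound F M th ph t r : forcing F M -> adm th ph -> 0 <= t -> 0 <= r -> Cmod (DRF F ph t r) <= 128 * M * t * (15 + 3 * t) / (1 + r) ^ 5.
Proof.
  intros HF Ha Ht Hr; pose proof (forcing_pos F M HF) as HM.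
  pose proof (rho7_bound r ph Hr ltac:(apply Ha)) as B7. destruct (rhod_pol r ph Hr ltac:(apply Ha)) as [Hd B1].
  pose proof (bt_HH_bound F M t (pol r ph) HF Ht (adm_Re th ph r Ha Hr)) as Bb.
  set (CC := CInt (fun s => DRi F ph t r s)%C 0 t).
  assert (Bc : Cmod CC <= (M + 3 * r ^ 2 * t * M) * (t - 0)).
  { apply CInt_norm_const; auto.
    - intros s _; apply (DRi_ct F M ph t (fun _ : R => r) (fun s : R => s)); auto; ct.
    - intros s Hst; unfold DRi; rewrite Cmod_mult. pose proof (exp_Re_le1 _ (t - s) (adm_Re th ph r Ha Hr) ltac:(lra)) as Be.
      set (X := (HH (Fy F ph s) (pol r ph) - 3 * (Ci * ex ph) * (Ci * pol r ph) ^ 2 * RtoC (t - s) * HH (F 7%nat s) (pol r ph))%C).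
      assert (BX : Cmod X <= M + 3 * r ^ 2 * t * M).
      { unfold X, Cminus; eapply Rle_trans; [apply Cmod_triangle|]; rewrite Cmod_opp, !Cmod_mult, Cmod_pow, Cmod_mult, Cmod_Ci, Cmod_ex, Cmod_pol, !Cmod_R, (Rabs_pos_eq 3), (Rabs_pos_eq (t - s)) by lra.
        pose proof (HH_bound M (Fy F ph s) (pol r ph) (jct0_cont0 _ _ (Fy_jct0 F M ph s HF)) (Fy_dom F M ph s HF)).
        pose proof (HH_bound M (F 7%nat s) (pol r ph) (forcing_cont0 F M 7 s HF ltac:(lia)) (forcing_dom F M 7 s HF ltac:(lia))).
        pose proof (Cmod_ge_0 (HH (F 7%nat s) (pol r ph))).
        assert (3 * (1 * 1) * (1 * r) ^ 2 * (t - s) * Cmod (HH (F 7%nat s) (pol r ph)) <= 3 * r ^ 2 * t * M); [|lra].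
        assert (0 <= r ^ 2) by nra.
        apply Rmult_le_compat; auto; [apply Rmult_le_pos; nra|]. rewrite !Rmult_1_l. replace (3 * 1 * r ^ 2) with (3 * r ^ 2) by ring. apply Rmult_le_compat_l; lra. }
      pose proof (Cmod_ge_0 X). pose proof (Cmod_ge_0 (Cexp (- (omega (pol r ph) * RtoC (t - s))))). nra. }
  unfold DRF; fold CC. rewrite Cmod_mult.
  assert (HMt : 0 <= M * t) by (now apply Rmult_le_pos).
  assert (Bi : Cmod (- (7 * Ci * ex ph * rho (dn (pol r ph))) * bt (fun s => HH (F 7%nat s) (pol r ph)) (omega (pol r ph)) t + CC) <= M * t * (15 + 3 * t) * (1 + r) ^ 2).
  { eapply Rle_trans; [apply Cmod_triangle|]. rewrite Hd, Cmod_mult, Cmod_opp, !Cmod_mult, Cmod_Ci, Cmod_ex, Cmod_R, (Rabs_pos_eq 7) by lra.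
    assert (2 / (1 + r) <= 2). { apply (Rmult_le_reg_r (1 + r)); [lra|]. unfold Rdiv; rewrite Rmult_assoc, Rinv_l by lra. lra. }
    pose proof (Cmod_ge_0 (rho (pol r ph))). pose proof (Cmod_ge_0 (bt (fun s => HH (F 7%nat s) (pol r ph)) (omega (pol r ph)) t)).
    assert (7 * 1 * 1 * Cmod (rho (pol r ph)) * Cmod (bt (fun s => HH (F 7%nat s) (pol r ph)) (omega (pol r ph)) t) <= 14 * (M * t)).
    { apply Rmult_le_compat; lra. }
    apply (Rle_trans _ (14 * (M * t) + (M + 3 * r ^ 2 * t * M) * (t - 0))); [lra|].
    replace (14 * (M * t) + (M + 3 * r ^ 2 * t * M) * (t - 0)) with (M * t * (15 + 3 * r ^ 2 * t)) by ring.
    rewrite (Rmult_assoc (M * t)). apply Rmult_le_compat_l; auto.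
    assert (0 <= r * t) by nra. assert (0 <= r ^ 2) by nra. assert (0 <= r ^ 2 * t) by nra. nra. }
  apply (Rle_trans _ (128 / (1 + r) ^ 7 * (M * t * (15 + 3 * t) * (1 + r) ^ 2))).
  - apply Rmult_le_compat; auto; apply Cmod_ge_0.
  - right; field; lra.
Qed.

(** With three x-derivatives the integration by parts leaves r^3 (1 + r)^-5, which the domination (1
    + r)^-2 just admits: this uses up the seven jets. *)
Lemma PF_decay F M th ph T : forcing F M -> adm th ph -> exists K, 0 <= K /\ forall j x t, (j <= 3)%nat -> 0 < x -> 0 < t <= T -> Cmod (PF F th ph j x t) <= K / (1 + x).
Proof.
  intros HF Ha; pose proof (forcing_pos F M HF) as HM.
  destruct (Rle_dec T 0) as [HT|HT]; [exists 0; split; [lra|intros; lra]|].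
  (* The coefficient 384 = 3 * 128 pays for the derivative of the j-th power with j <= 3. *)
  set (A := 384 * M * T + 128 * M * T * (15 + 3 * T)).
  assert (HMT : 0 <= M * T) by (apply Rmult_le_pos; lra).
  assert (HMT2 : 0 <= M * T * (15 + 3 * T)) by (apply Rmult_le_pos; lra).
  exists (128 * M * T + 2 * A); split; [unfold A; lra|].
  intros j x t Hj Hx Ht.
  assert (HMt : M * t <= M * T) by (apply Rmult_le_compat_l; lra).
  assert (HMt0 : 0 <= M * t) by (apply Rmult_le_pos; lra).
  assert (HMt2 : M * t * (15 + 3 * t) <= M * T * (15 + 3 * T)) by (apply Rmult_le_compat; lra).
  pose proof (PF_bound0 F M th ph j x t HF Ha ltac:(lra) ltac:(lra) ltac:(lia)) as B0.
  assert (B1 : Cmod (PF F th ph j x t) <= 2 * A / x).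
  { unfold PF; rewrite Cmod_mult, Cmod_ex, Rmult_1_r.
    assert (BT : forall r, 0 <= r -> Cmod (TF F t (pol r ph)) <= 128 * M * T / (1 + r) ^ 7).
    { intros r Hr; eapply Rle_trans; [apply (TF_bound F M t th); auto; lra|]. apply Rmult_le_compat_r; [left; apply Rinv_0_lt_compat, pow_lt; lra|lra]. }
    assert (BD : forall r, 0 <= r -> Cmod (DRF F ph t r) <= 128 * M * T * (15 + 3 * T) / (1 + r) ^ 5).
    { intros r Hr; eapply Rle_trans; [apply (DRF_bound F M th); auto; lra|]. apply Rmult_le_compat_r; [left; apply Rinv_0_lt_compat, pow_lt; lra|lra]. }
    apply (ray_ibp x th (fun r => ipol th r ^ j * TF F t (pol r ph))%C
      (fun r => INR j * (Ci * ex th) * ipol th r ^ (pred j) * TF F t (pol r ph) + ipol th r ^ j * DRF F ph t r)%C).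
    - auto.
    - apply Ha.
    - apply cont0_ct; intros r; apply ct_mult; [unfold ipol; ctx|]. apply (ct_TF F M); auto; ctx.
    - apply cont0_ct; intros r; apply ct_plus; apply ct_mult; [unfold ipol; ctx|apply (ct_TF F M); auto; ctx|unfold ipol; ctx|]. apply (DRF_ct F M); auto; lra.
    - intros r Hr; rewrite Cmod_mult, Cmod_pow, Cmod_ipol by auto.
      eapply Rle_trans; [apply Rmult_le_compat_l; [now apply pow_le|apply BT; auto]|].
      eapply Rle_trans; [apply (pow_inv_decay (128 * M * T) r j 2); auto; lra || lia|].
      apply Rmult_le_compat_r; [left; apply Rinv_0_lt_compat, pow_lt; lra|unfold A; lra].
    - intros r Hr; eapply Rle_trans; [apply Cmod_triangle|].
      rewrite !Cmod_mult, !Cmod_pow, !Cmod_ipol, Cmod_Ci, Cmod_ex, Cmod_R, Rabs_pos_eq by (auto; apply pos_INR).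
      assert (INR j <= 3) by (replace 3 with (INR 3) by (simpl; ring); now apply le_INR). pose proof (pos_INR j).
      replace (A / (1 + r) ^ 2) with (3 * (128 * M * T / (1 + r) ^ 2) + 128 * M * T * (15 + 3 * T) / (1 + r) ^ 2) by (unfold A; field; lra).
      apply Rplus_le_compat.
      + replace (INR j * (1 * 1) * r ^ (pred j) * Cmod (TF F t (pol r ph))) with (INR j * (r ^ (pred j) * Cmod (TF F t (pol r ph)))) by ring.
        apply Rmult_le_compat; auto.
        * apply Rmult_le_pos; [now apply pow_le|apply Cmod_ge_0].
        * eapply Rle_trans; [apply Rmult_le_compat_l; [now apply pow_le|apply BT; auto]|]. apply pow_inv_decay; auto; lra || lia.
      + eapply Rle_trans; [apply Rmult_le_compat_l; [now apply pow_le|apply BD; auto]|]. apply pow_inv_decay; auto; lra || lia.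
    - intros r Hr. pose proof (TF_dr F M ph t r HF ltac:(lra) ltac:(apply Ha) Hr) as D.
      assert (Di : is_derive (fun r => ipol th r) r (Ci * ex th)%C) by (unfold ipol, pol; dr; ringC).
      eapply dr_eq; [apply dr_mult; [apply (dr_pow _ j _ _ Di)|exact D]|]. ringC. }
  apply (Rmult_le_reg_l (1 + x)); [lra|]. replace ((1 + x) * ((128 * M * T + 2 * A) / (1 + x))) with (128 * M * T + 2 * A) by (field; lra).
  assert (x * Cmod (PF F th ph j x t) <= 2 * A).
  { apply (Rmult_le_compat_l x) in B1; [|lra]. replace (x * (2 * A / x)) with (2 * A) in B1 by (field; lra). exact B1. }
  lra.
Qed.

(** * The six rays of the forcing term *)

Lemma ex_2PI x : ex (x + 2 * PI) = ex x.
Proof. rewrite !ex_eq, cos_plus, sin_plus, cos_2PI, sin_2PI. f_equal; ring. Qed.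

Lemma adm_intro th ph : 0 <= th <= PI -> (PI <= ph <= 2 * PI \/ ph = 0) -> sin (3 * th) = 0 -> ex (3 * th) = ex (3 * ph) -> adm th ph.
Proof.
  intros H1 H2 H3 E; split; [|split; [|split]]; auto.
  - apply sin_ge_0; lra.
  - destruct H2 as [H2| ->]; [apply sin_le_0; lra|rewrite sin_0; lra].
  - rewrite !ex_eq in E; injection E as _ E. lra.
Qed.

Lemma adm_1 : adm 0 0.
Proof. pose proof PI_RGT_0; apply adm_intro; try lra; auto. rewrite Rmult_0_r; apply sin_0. Qed.
Lemma adm_2 : adm PI PI.
Proof. pose proof PI_RGT_0; apply adm_intro; try lra; auto. replace (3 * PI) with (PI + 2 * PI) by ring. rewrite sin_plus, sin_2PI, sin_PI; ring. Qed.
Lemma adm_3 : adm (PI / 3) PI.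
Proof. pose proof PI_RGT_0; apply adm_intro; try lra; auto; [apply gam_sin3; now left|]. replace (3 * PI) with (3 * (PI / 3) + 2 * PI) by field. now rewrite ex_2PI. Qed.
Lemma adm_4 : adm (PI / 3) (5 * PI / 3).
Proof. pose proof PI_RGT_0; apply adm_intro; try lra; auto; [apply gam_sin3; now left|]. replace (3 * (5 * PI / 3)) with (3 * (PI / 3) + 2 * PI + 2 * PI) by field. now rewrite !ex_2PI. Qed.
Lemma adm_5 : adm (2 * PI / 3) (4 * PI / 3).
Proof. pose proof PI_RGT_0; apply adm_intro; try lra; auto; [apply gam_sin3; now right|]. replace (3 * (4 * PI / 3)) with (3 * (2 * PI / 3) + 2 * PI) by field. now rewrite ex_2PI. Qed.
Lemma adm_6 : adm (2 * PI / 3) (2 * PI).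
Proof. pose proof PI_RGT_0; apply adm_intro; try lra; auto; [apply gam_sin3; now right|]. replace (3 * (2 * PI)) with (3 * (2 * PI / 3) + 2 * PI + 2 * PI) by field. now rewrite !ex_2PI. Qed.

Lemma rot_ray1 u r : (rot u (pol r (PI / 3)) * ex (PI / 3) = u (pol r PI) * ex PI + u (pol r (5 * PI / 3)) * ex (5 * PI / 3))%C.
Proof.
  unfold rot. rewrite alpha_pol, alpha2_pol, alpha2_ex, alpha_ex.
  replace (PI / 3 + 2 * PI / 3) with PI by field. replace (PI / 3 + 4 * PI / 3) with (5 * PI / 3) by field.
  replace (ex PI) with (ex (2 * PI / 3) * ex (PI / 3))%C by (rewrite <- ex_plus; f_equal; field).
  replace (ex (5 * PI / 3)) with (ex (4 * PI / 3) * ex (PI / 3))%C by (rewrite <- ex_plus; f_equal; field). ringC.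
Qed.
Lemma rot_ray2 u r : (rot u (pol r (2 * PI / 3)) * ex (2 * PI / 3) = u (pol r (4 * PI / 3)) * ex (4 * PI / 3) + u (pol r (2 * PI)) * ex (2 * PI))%C.
Proof.
  unfold rot. rewrite alpha_pol, alpha2_pol, alpha2_ex, alpha_ex.
  replace (2 * PI / 3 + 2 * PI / 3) with (4 * PI / 3) by field. replace (2 * PI / 3 + 4 * PI / 3) with (2 * PI) by field.
  replace (ex (2 * PI)) with (ex (4 * PI / 3) * ex (2 * PI / 3))%C by (rewrite <- ex_plus; f_equal; field).
  replace (ex (4 * PI / 3)) with (ex (2 * PI / 3) * ex (2 * PI / 3))%C by (rewrite <- ex_plus; f_equal; field). ringC.
Qed.

Definition UF (F : nat -> R -> R -> C) (j : nat) (x t : R) : C :=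
  (RtoC (/ (2 * PI)) * (PF F 0 0 j x t - PF F PI PI j x t + PF F (PI / 3) PI j x t + PF F (PI / 3) (5 * PI / 3) j x t
    - PF F (2 * PI / 3) (4 * PI / 3) j x t - PF F (2 * PI / 3) (2 * PI) j x t))%C.

Lemma UF_dx F M j x t : forcing F M -> 0 < x -> 0 <= t -> (j <= 4)%nat -> is_derive (fun x => UF F j x t) x (UF F (S j) x t).
Proof.
  intros HF Hx Ht Hj; unfold UF; apply dr_scal.
  (apply dr_minus; [apply dr_minus; [apply dr_plus; [apply dr_plus; [apply dr_minus|]|]|]|]); apply (PF_dx F M); auto; [apply adm_1|apply adm_2|apply adm_3|apply adm_4|apply adm_5|apply adm_6].
Qed.

Lemma UF_ct F M j x t : forcing F M -> 0 < x -> 0 < t -> (j <= 5)%nat -> continuous (fun q : R * R => UF F j (fst q) (snd q)) (x, t).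
Proof.
  intros HF Hx Ht Hj; unfold UF; apply ct_mult; [ct|].
  (apply ct_minus; [apply ct_minus; [apply ct_plus; [apply ct_plus; [apply ct_minus|]|]|]|]); apply (PF_ct F M); auto; [apply adm_1|apply adm_2|apply adm_3|apply adm_4|apply adm_5|apply adm_6].
Qed.

Lemma Cmod_sum6 a b c d e f (K1 K2 K3 K4 K5 K6 : R) : Cmod a <= K1 -> Cmod b <= K2 -> Cmod c <= K3 -> Cmod d <= K4 -> Cmod e <= K5 -> Cmod f <= K6 ->
  Cmod (RtoC (/ (2 * PI)) * (a - b + c + d - e - f)) <= K1 + K2 + K3 + K4 + K5 + K6.
Proof.
  intros; rewrite Cmod_mult, Cmod_R. pose proof PI2_3_2.
  assert (0 < / (2 * PI) <= 1).
  { split; [apply Rinv_0_lt_compat; lra|]. rewrite <- Rinv_1. apply Rinv_le_contravar; lra. }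
  rewrite Rabs_pos_eq by lra.
  assert (Cmod (a - b + c + d - e - f) <= K1 + K2 + K3 + K4 + K5 + K6).
  { unfold Cminus. repeat (eapply Rle_trans; [apply Cmod_triangle|]; apply Rplus_le_compat); rewrite ?Cmod_opp; auto. }
  pose proof (Cmod_ge_0 (a - b + c + d - e - f)). nra.
Qed.

Lemma UF_bound0 F M j x t : forcing F M -> 0 <= x -> 0 <= t -> (j <= 5)%nat -> Cmod (UF F j x t) <= 768 * M * t.
Proof.
  intros HF Hx Ht Hj. replace (768 * M * t) with (128 * M * t + 128 * M * t + 128 * M * t + 128 * M * t + 128 * M * t + 128 * M * t) by ring.
  unfold UF; apply Cmod_sum6; apply PF_bound0; auto; [apply adm_1|apply adm_2|apply adm_3|apply adm_4|apply adm_5|apply adm_6].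
Qed.

Lemma UF_decay F M T : forcing F M -> exists K, 0 <= K /\ forall j x t, (j <= 3)%nat -> 0 < x -> 0 < t <= T -> Cmod (UF F j x t) <= K / (1 + x).
Proof.
  intros HF.
  destruct (PF_decay F M _ _ T HF adm_1) as [K1 [P1 H1]]. destruct (PF_decay F M _ _ T HF adm_2) as [K2 [P2 H2]].
  destruct (PF_decay F M _ _ T HF adm_3) as [K3 [P3 H3]]. destruct (PF_decay F M _ _ T HF adm_4) as [K4 [P4 H4]].
  destruct (PF_decay F M _ _ T HF adm_5) as [K5 [P5 H5]]. destruct (PF_decay F M _ _ T HF adm_6) as [K6 [P6 H6]].
  exists (K1 + K2 + K3 + K4 + K5 + K6); split; [lra|]. intros j x t Hj Hx Ht.
  replace ((K1 + K2 + K3 + K4 + K5 + K6) / (1 + x)) with (K1 / (1 + x) + K2 / (1 + x) + K3 / (1 + x) + K4 / (1 + x) + K5 / (1 + x) + K6 / (1 + x)) by (field; lra).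
  unfold UF; apply Cmod_sum6; auto.
Qed.

Lemma UF_utm F M x t : forcing F M -> 0 < x -> 0 < t -> utm x t (fun _ => RtoC 0) (fun _ => RtoC 0) (TF F t) (UF F 0 x t).
Proof.
  intros HF Hx Ht; pose proof PI_RGT_0.
  exists (RtoC 0), (RtoC 0), (RtoC 0), (RtoC 0), (RtoC 0), (RtoC 0), (PF F 0 0 0 x t), (PF F PI PI 0 x t),
    (PF F (PI / 3) PI 0 x t + PF F (PI / 3) (5 * PI / 3) 0 x t)%C, (PF F (2 * PI / 3) (4 * PI / 3) 0 x t + PF F (2 * PI / 3) (2 * PI) 0 x t)%C.
  assert (Z : forall th (G : C -> C), (forall l, G l = RtoC 0) -> ray G th (RtoC 0)).
  { intros th G HG; apply (ray_ext (fun _ => RtoC 0)); [intros; now rewrite HG|apply ray_zero]. }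
  split; [split; apply Z; intros; ringC|].
  split; [split; apply Z; intros; unfold rot; ringC|].
  split; [split; apply Z; intros; ringC|].
  split; [split|split; [split|]].
  - pose proof (PF_ray F M 0 0 x t HF adm_1 ltac:(lra) ltac:(lra)) as T; exact T.
  - pose proof (PF_ray F M PI PI x t HF adm_2 ltac:(lra) ltac:(lra)) as T; exact T.
  - pose proof (is_J_plus _ _ _ _ (PF_ray F M _ _ x t HF adm_3 ltac:(lra) ltac:(lra)) (PF_ray F M _ _ x t HF adm_4 ltac:(lra) ltac:(lra))) as T.
    revert T; apply is_J_ext; intros r Hr. pose proof (rot_ray1 (TF F t) r) as E'. fold (pol r (PI / 3)) in *. transitivity (Kx x (pol r (PI / 3)) * (rot (TF F t) (pol r (PI / 3)) * ex (PI / 3)))%C; [rewrite E'; ringC|ringC].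
  - pose proof (is_J_plus _ _ _ _ (PF_ray F M _ _ x t HF adm_5 ltac:(lra) ltac:(lra)) (PF_ray F M _ _ x t HF adm_6 ltac:(lra) ltac:(lra))) as T.
    revert T; apply is_J_ext; intros r Hr. pose proof (rot_ray2 (TF F t) r) as E'. fold (pol r (2 * PI / 3)) in *. transitivity (Kx x (pol r (2 * PI / 3)) * (rot (TF F t) (pol r (2 * PI / 3)) * ex (2 * PI / 3)))%C; [rewrite E'; ringC|ringC].
  - unfold UF. rewrite RtoC_inv by lra. field. intros E; injection E; lra.
Qed.

Lemma ray_unique F th I : ray F th I -> J (fun r => F (pol r th) * ex th)%C = I.
Proof. exact (is_J_unique _ I). Qed.

(** The source integrals of the six rays add up to the forcing: the pair on the real line by Fourier
    inversion, while the pairs on the two rays of Gamma have the same sum [Z]. *)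
Lemma UF_dt F M x t l : forcing F M -> 0 < x -> 0 < t -> is_derive (F O t) x l ->
  is_derive (fun t => UF F 0 x t) t (F O t x - UF F 3 x t)%C.
Proof.
  intros HF Hx Ht Hl; pose proof PI_RGT_0.
  destruct (inversion (F O t) M x l (forcing_cont0 F M 0 t HF ltac:(lia)) (forcing_dom F M 0 t HF ltac:(lia)) Hx Hl) as [A [B [HA [HB E]]]].
  destruct (gam_zero_rot (F O t) M x Hx (forcing_cont0 F M 0 t HF ltac:(lia)) (forcing_dom F M 0 t HF ltac:(lia))) as [Z HZ].
  assert (C0 : forall th ph, cont0 (fun r => Kx x (pol r th) * HH (F O t) (pol r ph))%C).
  { intros th ph; apply cont0_ct; intros r; apply ct_mult; [ctx|]. apply (forcing_HH_ct F M); auto; [lia| |]; ctx. }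
  assert (D0 : forall th ph, adm th ph -> dom (128 * M) (fun r => Kx x (pol r th) * HH (F O t) (pol r ph))%C).
  { intros th ph Ha r Hr.
    pose proof (PF_dom x th 0 (128 * M) (fun r => rho (dn (pol r ph)) ^ 7 * HH (F 7%nat t) (pol r ph))%C ltac:(lra) ltac:(apply Ha) ltac:(pose proof (forcing_pos F M HF); lra) ltac:(lia)) as D.
    assert (Bd : forall r, 0 <= r -> Cmod (rho (dn (pol r ph)) ^ 7 * HH (F 7%nat t) (pol r ph)) <= 128 * M / (1 + r) ^ 7).
    { intros q Hq; apply H7_bound; auto; apply Ha. }
    pose proof (D Bd r Hr) as D'. cbv beta in D'. change (ipol th r ^ 0)%C with (RtoC 1) in D'. rewrite Cmult_1_l in D'.
    destruct (rhod_pol r ph Hr ltac:(apply Ha)) as [Hd _]. rewrite Hd in D'.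
    rewrite (forcing_HH0 F M t (pol r ph) HF) by (rewrite <- Hd; apply dn_im). exact D'. }
  set (N := fun th ph => (J (fun r => Kx x (pol r th) * HH (F O t) (pol r ph)) * ex ph)%C).
  assert (HN : forall th ph, adm th ph -> is_J (fun r => Kx x (pol r th) * HH (F O t) (pol r ph) * ex ph)%C (N th ph)).
  { intros th ph Ha. pose proof (is_J_scal (ex ph) _ _ (J_is _ _ (C0 th ph) (D0 th ph Ha))) as T. unfold N.
    replace (J (fun r => Kx x (pol r th) * HH (F O t) (pol r ph)) * ex ph)%C with (ex ph * J (fun r => Kx x (pol r th) * HH (F O t) (pol r ph)))%C by ringC.
    revert T; apply is_J_ext; intros; ringC. }
  assert (E1 : N 0 0 = A). { pose proof (is_J_unique _ _ (HN 0 0 adm_1)) as X. apply ray_unique in HA. rewrite <- X, <- HA. apply J_ext; intros r Hr; unfold pol; ringC. }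
  assert (E2 : N PI PI = B). { pose proof (is_J_unique _ _ (HN PI PI adm_2)) as X. apply ray_unique in HB. rewrite <- X, <- HB. apply J_ext; intros r Hr; unfold pol; ringC. }
  assert (E3 : Cplus (N (PI / 3) PI) (N (PI / 3) (5 * PI / 3)) = Z).
  { pose proof (is_J_plus _ _ _ _ (HN _ _ adm_3) (HN _ _ adm_4)) as X. rewrite <- (is_J_unique _ _ X).
    pose proof (HZ (PI / 3) ltac:(now left)) as Y. apply ray_unique in Y. rewrite <- Y. apply J_ext; intros r Hr.
    pose proof (rot_ray1 (HH (F O t)) r) as E'. fold (pol r (PI / 3)) in *. transitivity (Kx x (pol r (PI / 3)) * (rot (HH (F O t)) (pol r (PI / 3)) * ex (PI / 3)))%C; [rewrite E'; ringC|ringC]. }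
  assert (E4 : Cplus (N (2 * PI / 3) (4 * PI / 3)) (N (2 * PI / 3) (2 * PI)) = Z).
  { pose proof (is_J_plus _ _ _ _ (HN _ _ adm_5) (HN _ _ adm_6)) as X. rewrite <- (is_J_unique _ _ X).
    pose proof (HZ (2 * PI / 3) ltac:(now right)) as Y. apply ray_unique in Y. rewrite <- Y. apply J_ext; intros r Hr.
    pose proof (rot_ray2 (HH (F O t)) r) as E'. fold (pol r (2 * PI / 3)) in *. transitivity (Kx x (pol r (2 * PI / 3)) * (rot (HH (F O t)) (pol r (2 * PI / 3)) * ex (2 * PI / 3)))%C; [rewrite E'; ringC|ringC]. }
  eapply dr_eq.
  - unfold UF; apply dr_scal. (apply dr_minus; [apply dr_minus; [apply dr_plus; [apply dr_plus; [apply dr_minus|]|]|]|]); apply (PF_dt F M); auto; try lra; [apply adm_1|apply adm_2|apply adm_3|apply adm_4|apply adm_5|apply adm_6].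
  - fold (N 0 0) (N PI PI) (N (PI / 3) PI) (N (PI / 3) (5 * PI / 3)) (N (2 * PI / 3) (4 * PI / 3)) (N (2 * PI / 3) (2 * PI)).
    replace (F O t x) with (RtoC (/ (2 * PI)) * (RtoC (2 * PI) * F O t x))%C.
    2: { rewrite RtoC_inv by lra. field. intros E'; injection E'; lra. }
    rewrite <- E, <- E1, <- E2. unfold UF.
    transitivity (RtoC (/ (2 * PI)) * (N 0%R 0%R - N PI PI + (N (PI / 3)%R PI + N (PI / 3)%R (5 * PI / 3)%R) - (N (2 * PI / 3)%R (4 * PI / 3)%R + N (2 * PI / 3)%R (2 * PI)%R)
      - (PF F 0 0 3 x t - PF F PI PI 3 x t + PF F (PI / 3) PI 3 x t + PF F (PI / 3) (5 * PI / 3) 3 x t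
    - PF F (2 * PI / 3) (4 * PI / 3) 3 x t - PF F (2 * PI / 3) (2 * PI) 3 x t)))%C; [ringC|]. rewrite E3, E4. ringC.
Qed.

(** The sector between the two rotated rays lies in the lower half-plane with Re omega >= 0.
    Exchanging integrals twice reduces Cauchy's theorem to explicit exponentials times a power of
    [rho]. *)
Lemma TF_CI F M t : forcing F M -> 0 <= t -> CI (TF F t) (4 * PI / 3) (5 * PI / 3).
Proof.
  intros HF Ht; pose proof PI_RGT_0; pose proof (forcing_pos F M HF) as HM.
  assert (Hd : forall r th, 0 <= r -> 4 * PI / 3 <= th <= 5 * PI / 3 -> dn (pol r th) = pol r th).
  { intros r th Hr Hth; apply rhod_pol; auto. apply sin_le_0; lra. }
  apply (CI_ext (fun z => CInt (fun s => J (fun y => rho (dn z) ^ 7 * Cexp (- (omega z * RtoC (t - s))) * (ek z y * F 7%nat s y))%C) 0 t)); [lra| |].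
  { intros r th Hr Hth; unfold TF, bt. rewrite <- CInt_scal.
    2: { intros s _; apply ct_mult; [ctx|]. apply (forcing_HH_ct F M); auto; ct. }
    apply CInt_ext; intros s _. rewrite (J_scal M _ (fun y => ek (pol r th) y * F 7%nat s y)%C); [unfold HH; ringC| |].
    - apply ek_cont0; now apply (forcing_cont0 F M).
    - apply ek_dom; now apply (forcing_dom F). }
  assert (DD : forall R0, exists M', forall (z : C) s, Cmod z <= R0 -> 0 <= s <= t -> dom M' (fun y => rho (dn z) ^ 7 * Cexp (- (omega z * RtoC (t - s))) * (ek z y * F 7%nat s y))%C).
  { intros R0; exists (128 * exp (R0 ^ 3 * t) * M); intros z s Hz Hs y Hy.
    rewrite !Cmod_mult, Cmod_pow, Cmod_Cexp.
    pose proof (rho_bound (dn z) (dn_im z)) as Br. pose proof (Cmod_ge_0 (dn z)). pose proof (Cmod_ge_0 (rho (dn z))).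
    assert (Br2 : Cmod (rho (dn z)) <= 2).
    { eapply Rle_trans; [exact Br|]. apply (Rmult_le_reg_r (1 + Cmod (dn z))); [lra|]. unfold Rdiv; rewrite Rmult_assoc, Rinv_l by lra. lra. }
    pose proof (pow_incr _ _ 7 (conj H1 Br2)) as P7. replace (2 ^ 7) with 128 in P7 by ring.
    assert (Be : exp (Re (- (omega z * RtoC (t - s)))) <= exp (R0 ^ 3 * t)).
    { apply exp_le. eapply Rle_trans; [apply Rle_abs|]. eapply Rle_trans; [apply re_le_Cmod|].
      rewrite Cmod_opp, Cmod_mult, Cmod_R, Rabs_pos_eq by lra. unfold omega; rewrite Cmod_mult, Cmod_opp, Cmod_Ci, Cmod_pow, Rmult_1_l.
      pose proof (Cmod_ge_0 z). apply Rmult_le_compat; try lra; [now apply pow_le|apply pow_incr; lra]. }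
    pose proof (forcing_dom F M 7 s HF ltac:(lia) y Hy). pose proof (ek_bound z y Hy). pose proof (Cmod_ge_0 (F 7%nat s y)). pose proof (Cmod_ge_0 (ek z y)).
    pose proof (exp_pos (Re (- (omega z * RtoC (t - s))))). pose proof (pow_le (Cmod (rho (dn z))) 7 H1).
    replace (128 * exp (R0 ^ 3 * t) * M / (1 + y) ^ 2) with (128 * exp (R0 ^ 3 * t) * (1 * (M / (1 + y) ^ 2))) by (field; lra).
    apply Rmult_le_compat.
    - apply Rmult_le_pos; lra.
    - now apply Rmult_le_pos.
    - apply Rmult_le_compat; lra.
    - apply Rmult_le_compat; lra. }
  assert (Hcl : forall s, 0 <= clab 0 t s <= t) by (intros; apply clab_in; auto).
  (* Clamping the time variable makes the bounds [DD] available for every real s. *)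
  apply (CI_ext (fun z => CInt (fun s => J (fun y => rho (dn z) ^ 7 * Cexp (- (omega z * RtoC (t - clab 0 t s))) * (ek z y * F 7%nat (clab 0 t s) y))%C) 0 t)); [lra| |].
  { intros r th _ _; apply CInt_ext; intros s Hs. rewrite Rmin_left, Rmax_right in Hs by lra. rewrite clab_id by lra. reflexivity. }
  assert (JJ : forall (q : C * R), jct0 (fun (q : C * R) y => rho (dn (fst q)) ^ 7 * Cexp (- (omega (fst q) * RtoC (t - clab 0 t (snd q)))) * (ek (fst q) y * F 7%nat (clab 0 t (snd q)) y))%C q).
  { intros q y; unfold jct, cl, clab. apply ct_mult; [apply ct_mult; [apply ct_pow, ct_rhod; ct|ctx]|]. apply ct_mult; [ctx|].
    apply (ct_comp2 (fun t r => cl (F 7%nat t) r)); [intros [? ?]; apply HF; auto| |]; ct. }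
  apply (CI_CInt (fun z s => J (fun y => rho (dn z) ^ 7 * Cexp (- (omega z * RtoC (t - clab 0 t s))) * (ek z y * F 7%nat (clab 0 t s) y))%C)); try lra.
  - intros z s; unfold jct.
    destruct (DD (Cmod z + 1)) as [M' HM'].
    apply (J_ct (fun (q : C * R) y => rho (dn (fst q)) ^ 7 * Cexp (- (omega (fst q) * RtoC (t - clab 0 t (snd q)))) * (ek (fst q) y * F 7%nat (clab 0 t (snd q)) y))%C (z, s) M').
    assert (L : locally (z, s) (fun q : C * R => Cmod (fst q) < Cmod z + 1)).
    { pose proof (rct_Cmod (fun q : C * R => fst q) (z, s) ltac:(ct)) as Cc.
      refine (Cc (fun r => r < Cmod z + 1) _). apply (open_lt (Cmod z + 1)); simpl; lra. }
    revert L; apply filter_imp; intros q Hq; split; [apply JJ|]. apply HM'; [lra|auto].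
  - intros s Hs. apply (CI_J (fun z y => rho (dn z) ^ 7 * Cexp (- (omega z * RtoC (t - clab 0 t s))) * (ek z y * F 7%nat (clab 0 t s) y))%C); try lra.
    + intros z y. pose proof (JJ (z, s) y) as Q. unfold jct in *.
      apply (continuous_comp (fun q : C * R => ((fst q, s), snd q)) (fun q : C * R * R => cl (fun y => rho (dn (fst (fst q))) ^ 7 * Cexp (- (omega (fst (fst q)) * RtoC (t - clab 0 t (snd (fst q))))) * (ek (fst (fst q)) y * F 7%nat (clab 0 t (snd (fst q))) y))%C (snd q))); [|exact Q].
      apply filterlim_locally; intros e; exists e; intros [y1 y2] [By1 By2]; split; [split|]; auto. apply ball_center.
    + intros R0; destruct (DD R0) as [M' HM']; exists M'; intros z Hz; apply HM'; auto.
    + intros y Hy.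
      apply (CI_ext (fun z => rho z ^ 7 * Cexp (- (omega z * RtoC (t - clab 0 t s))) * (Cexp (- (Ci * z * RtoC y)) * F 7%nat (clab 0 t s) y))%C); [lra| |].
      { intros r th Hr Hth; unfold ek; rewrite Hd by auto; reflexivity. }
      eapply (sector_identity _ _ PI (2 * PI)); try lra.
      intros r th Hr Hth.
      assert (Hz : (1 + Ci * pol r th)%C <> 0%C).
      { apply rho_nz. rewrite pol_eq; unfold Im; simpl. pose proof (sin_le_0 th ltac:(lra) ltac:(lra)). nra. }
      assert (Cr : forall z, (1 + Ci * z)%C <> 0%C -> continuous (fun z => rho z) z) by (intros; now apply rho_ct).
      split; [|split].
      * holx; exact Hz.
      * apply ct_mult; [apply ct_mult; [apply ct_pow; auto|ctx]|ctx].
      * ctx; auto.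
Qed.

(** At x = 0 the decay of e^(izx) is lost, but the factor O(r^-7) alone makes the arc between the
    angles 4 pi/3 and 5 pi/3 disappear. *)
Lemma PF_corner F M t : forcing F M -> 0 < t ->
  PF F (PI / 3) (5 * PI / 3) 0 0 t = PF F (2 * PI / 3) (4 * PI / 3) 0 0 t.
Proof.
  intros HF Ht; pose proof PI_RGT_0; pose proof (forcing_pos F M HF) as HM.
  assert (K0 : forall l, Kx 0 l = RtoC 1).
  { intros l; unfold Kx. replace (Ci * l * RtoC 0)%C with (RtoC 0) by ringC. apply Cexp_0. }
  assert (R0 : forall th ph, adm th ph -> ray (TF F t) ph (PF F th ph 0 0 t)).
  { intros th ph Ha; pose proof (PF_ray F M th ph 0 t HF Ha ltac:(lra) ltac:(lra)) as T; revert T; apply is_J_ext; intros r Hr. rewrite K0. fold (pol r ph). ringC. }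
  assert (E : ray (TF F t) (5 * PI / 3) (PF F (PI / 3) (5 * PI / 3) 0 0 t) <-> ray (TF F t) (4 * PI / 3) (PF F (PI / 3) (5 * PI / 3) 0 0 t)).
  { assert (CT : forall z, continuous (TF F t) z) by (intros z; apply (ct_TF F M (fun z : C => z) (fun _ => t)); auto; ct).
    apply ray_rot_gen.
    - apply (TF_CI F M); auto; lra.
    - intros r _; apply CT.
    - intros r _; apply CT.
    - apply (arc_small _ _ _ (128 * M * t)); auto; try lra.
      + apply Rmult_le_pos; lra.
      + intros r th Hr Hth. unfold TF; rewrite Cmod_mult.
        assert (S1 : sin th <= 0) by (apply sin_le_0; lra).
        assert (S3 : 0 <= sin (3 * th)).
        { assert (E : ex (3 * th) = ex (3 * th - 4 * PI)).
          { replace (3 * th) with (3 * th - 4 * PI + 2 * PI + 2 * PI) at 1 by ring. now rewrite !ex_2PI. }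
          rewrite !ex_eq in E; injection E as _ ->. apply sin_ge_0; lra. }
        pose proof (rho7_bound r th ltac:(lra) S1). pose proof (bt_HH_bound F M t (pol r th) HF ltac:(lra) (Re_omega_pol r th ltac:(lra) S3)).
        apply (Rle_trans _ (128 / (1 + r) ^ 7 * (M * t))); [apply Rmult_le_compat; auto; apply Cmod_ge_0|].
        assert (r ^ 2 <= (1 + r) ^ 7). { apply (Rle_trans _ ((1 + r) ^ 2)); [apply pow_incr; lra|apply Rle_pow; [lra|lia]]. }
        replace (128 * M * t / r ^ 2) with (128 * (M * t) * / r ^ 2) by (field; lra).
        replace (128 / (1 + r) ^ 7 * (M * t)) with (128 * (M * t) * / (1 + r) ^ 7) by (field; lra).
        assert (0 <= M * t) by (apply Rmult_le_pos; lra). apply Rmult_le_compat_l; [lra|]. apply Rinv_le_contravar; auto. apply pow_lt; lra. }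
  pose proof (is_J_unique _ _ (proj1 E (R0 _ _ adm_4))) as E1. pose proof (is_J_unique _ _ (R0 _ _ adm_5)) as E2. congruence.
Qed.

Lemma lim_plus {T} (F : (T -> Prop) -> Prop) {FF : Filter F} (f g : T -> C) a b :
  filterlim f F (locally a) -> filterlim g F (locally b) -> filterlim (fun x => f x + g x)%C F (locally (a + b)%C).
Proof.
  intros Hf Hg; eapply filterlim_comp_2; [exact Hf|exact Hg|exact (filterlim_plus (V := C_R_NormedModule) a b)].
Qed.
Lemma lim_scal {T} (F : (T -> Prop) -> Prop) {FF : Filter F} c (f : T -> C) a :
  filterlim f F (locally a) -> filterlim (fun x => c * f x)%C F (locally (c * a)%C).
Proof.
  intros Hf; apply (filterlim_comp _ _ _ f (fun z : C => c * z)%C _ (locally a) _ Hf). apply (ct_mult (fun _ : C => c) (fun z => z)); ct.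
Qed.
Lemma lim_minus {T} (F : (T -> Prop) -> Prop) {FF : Filter F} (f g : T -> C) a b :
  filterlim f F (locally a) -> filterlim g F (locally b) -> filterlim (fun x => f x - g x)%C F (locally (a - b)%C).
Proof.
  intros Hf Hg; replace (a - b)%C with (a + (- (1)) * b)%C by ringC.
  apply (filterlim_ext (fun x => f x + (- (1)) * g x)%C); [intros; ringC|]. apply lim_plus; auto. now apply lim_scal.
Qed.

(** At x = 0 only the second angle matters: 0 and 2 pi agree by periodicity, the two terms with
    angle pi cancel, and the last pair is [PF_corner]. *)
Lemma UF_lim0 F M t : forcing F M -> 0 < t -> filterlim (fun x => UF F 0 x t) (at_right 0) (locally (RtoC 0)).
Proof.
  intros HF Ht.
  assert (E0 : forall th1 th2 ph, PF F th1 ph 0 0 t = PF F th2 ph 0 0 t).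
  { intros t1 t2 ph; unfold PF; f_equal; apply J_ext; intros r _; unfold Kx.
    replace (Ci * pol r t1 * RtoC 0)%C with (Ci * pol r t2 * RtoC 0)%C by ringC. reflexivity. }
  assert (E6 : PF F (2 * PI / 3) (2 * PI) 0 0 t = PF F 0 0 0 0 t).
  { rewrite (E0 _ 0). unfold PF.
    assert (X : ex (2 * PI) = ex 0) by (replace (2 * PI) with (0 + 2 * PI) by ring; apply ex_2PI).
    unfold pol; rewrite X; reflexivity. }
  set (L := (RtoC (/ (2 * PI)) * (PF F 0 0 0 0 t - PF F PI PI 0 0 t + PF F (PI / 3) PI 0 0 t + PF F (PI / 3) (5 * PI / 3) 0 0 t
    - PF F (2 * PI / 3) (4 * PI / 3) 0 0 t - PF F (2 * PI / 3) (2 * PI) 0 0 t))%C).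
  replace (RtoC 0) with L.
  2: { unfold L; rewrite E6, (PF_corner F M) by auto. rewrite (E0 (PI / 3) PI PI). ringC. }
  unfold UF, L. apply (lim_scal (at_right 0)). (apply (lim_minus (at_right 0)); [apply (lim_minus (at_right 0)); [apply (lim_plus (at_right 0)); [apply (lim_plus (at_right 0)); [apply (lim_minus (at_right 0))|]|]|]|]); apply (PF_lim0 F M); auto; [apply adm_1|apply adm_2|apply adm_3|apply adm_4|apply adm_5|apply adm_6].
Qed.

(** * The representation formula for general data *)

Definition Tf (f : R -> R -> C) (t : R) (mu : C) : C :=
  CInt (fun s => Cexp (- (omega mu * RtoC (t - s))) * HH (f s) mu)%C 0 t.

(** Domination is uniform only on bounded time intervals, as products a(t) phi(y) with unbounded [a]
    require. *)
Definition regf (f : R -> R -> C) : Prop :=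
  (forall t, jct0 f t) /\ forall T, exists M, forall t, Rabs t < T -> dom M (f t).
Definition regu (u : R -> C) : Prop := cont0 u /\ exists M, dom M u.

Definition utmf (x t : R) (u g : R -> C) (f : R -> R -> C) (v : C) : Prop :=
  utm x t (HH u) (fun l => bt g (omega l) t) (Tf f t) v.

Lemma regf_HH_ct f mu s : regf f -> continuous (fun s => HH (f s) mu) s.
Proof.
  intros [Hj Hd]; destruct (Hd (Rabs s + 1)) as [M HM]. unfold HH.
  apply (J_ct (fun s y => ek mu y * f s y)%C s M).
  assert (L : locally s (fun u => Rabs u < Rabs s + 1)).
  { pose proof (rct_abs (fun x : R => x) s ltac:(ct)) as Cc. refine (Cc (fun r => r < Rabs s + 1) _). apply (open_lt (Rabs s + 1)); simpl; lra. }
  revert L; apply filter_imp; intros u Hu; split; [|apply ek_dom; auto].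
  intros y; unfold jct, cl. apply ct_mult; [ctx|]. apply (ct_comp2 (fun t r => cl (f t) r)); [intros [? ?]; apply Hj| |]; ct.
Qed.

Lemma dom_max M M' h : dom M h -> dom (Rmax M M') h.
Proof. intros D; apply (dom_le M); auto. apply Rmax_l. Qed.
Lemma dom_max' M M' h : dom M' h -> dom (Rmax M M') h.
Proof. intros D; apply (dom_le M'); auto. apply Rmax_r. Qed.

Lemma dom_plus M1 M2 h k : dom M1 h -> dom M2 k -> dom (M1 + M2) (fun y => h y + k y)%C.
Proof.
  intros D1 D2 y Hy; eapply Rle_trans; [apply Cmod_triangle|]. specialize (D1 y Hy). specialize (D2 y Hy). unfold Rdiv in *; lra.
Qed.
Lemma dom_scal M c h : dom M h -> dom (Cmod c * M) (fun y => c * h y)%C.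
Proof.
  intros D y Hy; rewrite Cmod_mult. unfold Rdiv; rewrite Rmult_assoc. apply Rmult_le_compat_l; [apply Cmod_ge_0|now apply D].
Qed.

Lemma regu_plus u v : regu u -> regu v -> regu (fun y => u y + v y)%C.
Proof.
  intros [C1 [M1 D1]] [C2 [M2 D2]]; split; [now apply (cont0_plus u v)|]. exists (M1 + M2); now apply dom_plus.
Qed.
Lemma regu_scal c u : regu u -> regu (fun y => c * u y)%C.
Proof. intros [C1 [M1 D1]]; split; [now apply (cont0_scal c u)|]. eexists; apply dom_scal; eauto. Qed.
Lemma regu_zero : regu (fun _ => RtoC 0).
Proof. split; [apply cont0_ct; intros; ct|]. exists 0; intros y Hy; rewrite Cmod_0; unfold Rdiv; lra. Qed.

Lemma regf_plus f f' : regf f -> regf f' -> regf (fun t y => f t y + f' t y)%C.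
Proof.
  intros [J1 D1] [J2 D2]; split.
  - intros t y; unfold jct, cl; apply ct_plus; [apply (J1 t y)|apply (J2 t y)].
  - intros T; destruct (D1 T) as [M1 H1]; destruct (D2 T) as [M2 H2]; exists (M1 + M2); intros t Ht. apply dom_plus; auto.
Qed.

Lemma regf_sep a u : (forall s, continuous a s) -> regu u -> regf (fun t y => a t * u y)%C.
Proof.
  intros Ha [Cu [M Du]]; split.
  - intros t y; unfold jct, cl; apply ct_mult; [apply (ct_comp a (fun q : R * R => fst q)); auto; ct|].
    apply (ct_comp (cl u) (fun q : R * R => snd q)); [exact Cu|ct].
  - intros T.
    assert (Ha2 : forall s, continuous (fun s => a (- s)) s) by (intros; apply (ct_comp a (fun s => - s)); auto; ct).
    destruct (Rle_dec 0 T) as [HT|HT].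
    + destruct (cont_bounded a T HT Ha) as [A1 [P1 B1]]. destruct (cont_bounded _ T HT Ha2) as [A2 [P2 B2]].
      exists ((A1 + A2) * M); intros t Ht y Hy. rewrite Cmod_mult. unfold Rdiv; rewrite Rmult_assoc.
      pose proof (dom_pos M u Du). apply Rmult_le_compat; try apply Cmod_ge_0; [|now apply Du].
      apply Rabs_def2 in Ht. destruct (Rle_dec 0 t) as [H0|H0].
      * specialize (B1 t ltac:(lra)); lra.
      * specialize (B2 (- t) ltac:(lra)). rewrite Ropp_involutive in B2; lra.
    + exists 0; intros t Ht. pose proof (Rabs_pos t); lra.
Qed.

Lemma HH_plus u v mu : regu u -> regu v -> HH (fun y => u y + v y)%C mu = (HH u mu + HH v mu)%C.
Proof.
  intros [C1 [M1 D1]] [C2 [M2 D2]].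
  transitivity (HH (fun y => u y + 1 * v y)%C mu); [unfold HH; apply J_ext; intros; ringC|].
  rewrite (HH_lin (Rmax M1 M2)); auto; [ringC|now apply dom_max|now apply dom_max'].
Qed.
Lemma HH_scal c u mu : regu u -> HH (fun y => c * u y)%C mu = (c * HH u mu)%C.
Proof.
  intros [C1 [M1 D1]]; unfold HH.
  rewrite <- (J_scal M1 c (fun y => ek mu y * u y)%C); [apply J_ext; intros; ringC|now apply ek_cont0|now apply ek_dom].
Qed.
Lemma HH_ext u v mu : (forall y, 0 <= y -> u y = v y) -> HH u mu = HH v mu.
Proof. intros E; unfold HH; apply J_ext; intros y Hy; now rewrite E. Qed.
Lemma HH_zero mu : HH (fun _ => RtoC 0) mu = RtoC 0.
Proof.
  pose proof (HH_scal 0 (fun _ => RtoC 0) mu regu_zero) as E. rewrite (HH_ext _ (fun _ => RtoC 0)) in E by (intros; ringC). rewrite E; ringC.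
Qed.

Lemma regf_slice f t : regf f -> regu (f t).
Proof.
  intros [H1 H2]; split; [now apply (jct0_cont0 f)|]. destruct (H2 (Rabs t + 1)) as [M HM]; exists M; apply HM; lra.
Qed.

Lemma Tf_plus f f' t mu : regf f -> regf f' -> Tf (fun t y => f t y + f' t y)%C t mu = (Tf f t mu + Tf f' t mu)%C.
Proof.
  intros R1 R2; unfold Tf. rewrite <- CInt_plus.
  - apply CInt_ext; intros s _. rewrite (HH_plus (f s) (f' s)) by (now apply regf_slice). ringC.
  - intros s _; apply ct_mult; [ctx|now apply regf_HH_ct].
  - intros s _; apply ct_mult; [ctx|now apply regf_HH_ct].
Qed.

Lemma bt_plus a b k t : (forall s, continuous a s) -> (forall s, continuous b s) -> bt (fun s => a s + b s)%C k t = (bt a k t + bt b k t)%C.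
Proof. intros Ha Hb; unfold bt; rewrite <- CInt_plus by (intros; ct). apply CInt_ext; intros; ringC. Qed.
Lemma bt_scal c a k t : (forall s, continuous a s) -> bt (fun s => c * a s)%C k t = (c * bt a k t)%C.
Proof. intros Ha; unfold bt; rewrite <- CInt_scal by (intros; ct). apply CInt_ext; intros; ringC. Qed.

Lemma bt_ext a b k t : 0 <= t -> (forall s, 0 <= s -> a s = b s) -> bt a k t = bt b k t.
Proof. intros Ht E; unfold bt; apply CInt_ext; intros s Hs; rewrite Rmin_left in Hs by auto; rewrite E by lra; reflexivity. Qed.
Lemma Tf_ext f f' t mu : 0 <= t -> (forall s y, 0 <= s -> 0 <= y -> f s y = f' s y) -> Tf f t mu = Tf f' t mu.
Proof.
  intros Ht E; unfold Tf; apply CInt_ext; intros s Hs; rewrite Rmin_left in Hs by auto. rewrite (HH_ext (f s) (f' s)); auto. intros; apply E; lra.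
Qed.

Lemma utmf_ext x t u u' g g' f f' v v' : 0 <= t -> (forall y, 0 <= y -> u y = u' y) -> (forall s, 0 <= s -> g s = g' s) ->
  (forall s y, 0 <= s -> 0 <= y -> f s y = f' s y) -> v = v' -> utmf x t u g f v -> utmf x t u' g' f' v'.
Proof.
  intros Ht Hu Hg Hf <-; apply utm_ext.
  - intros; now apply HH_ext.
  - intros; now apply bt_ext.
  - intros; now apply Tf_ext.
Qed.

Lemma utmf_plus x t u u' g g' f f' v v' :
  regu u -> regu u' -> (forall s, continuous g s) -> (forall s, continuous g' s) -> regf f -> regf f' ->
  utmf x t u g f v -> utmf x t u' g' f' v' -> utmf x t (fun y => u y + u' y)%C (fun s => g s + g' s)%C (fun s y => f s y + f' s y)%C (v + v')%C.
Proof.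
  intros Ru Ru' Cg Cg' Rf Rf' H H'. pose proof (utm_plus _ _ _ _ _ _ _ _ _ _ H H') as P. revert P; apply utm_ext.
  - intros l _; symmetry; now apply HH_plus.
  - intros th r _ _; symmetry; now apply bt_plus.
  - intros l _; symmetry; now apply Tf_plus.
Qed.

(** The third derivative written with the iterates of D = d/dy + 1, as the expansion of (D -
    1)^3. *)
Definition third (phi : nat -> R -> C) (y : R) : C := (phi 3%nat y - 3 * phi 2%nat y + 3 * phi 1%nat y - phi O y)%C.

Lemma jets_regu n phi M k : jets n phi M -> (k <= n)%nat -> regu (phi k).
Proof. intros [H _] Hk; destruct (H k Hk); split; eauto. Qed.

Lemma third_regu phi M : jets 3 phi M -> regu (third phi).
Proof.
  intros HJ; pose proof (jets_regu 3 phi M 0 HJ ltac:(lia)). pose proof (jets_regu 3 phi M 1 HJ ltac:(lia)).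
  pose proof (jets_regu 3 phi M 2 HJ ltac:(lia)). pose proof (jets_regu 3 phi M 3 HJ ltac:(lia)).
  assert (E : third phi = (fun y => phi 3%nat y + (- (3) * phi 2%nat y + (3 * phi 1%nat y + - (1) * phi O y)))%C).
  { apply functional_extensionality; intros y; unfold third; ringC. }
  rewrite E. apply regu_plus; auto. apply (regu_plus (fun y => - (3) * phi 2%nat y)%C); [now apply regu_scal|].
  apply (regu_plus (fun y => 3 * phi 1%nat y)%C); now apply regu_scal.
Qed.

(** Three integrations by parts: since D - 1 becomes i mu, its cube becomes omega, and the boundary
    terms collect into [qpoly]. *)
Lemma HH_third phi M mu : jets 3 phi M -> Im mu <= 0 ->
  HH (third phi) mu = (omega mu * HH (phi O) mu + qpoly (phi O 0%R) (- Ci * (phi 1%nat 0%R - phi O 0%R)) (- (phi 2%nat 0%R - 2 * phi 1%nat 0%R + phi O 0%R)) mu)%C.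
Proof.
  intros HJ Hmu; pose proof (jets_regu 3 phi M 0 HJ ltac:(lia)) as R0. pose proof (jets_regu 3 phi M 1 HJ ltac:(lia)) as R1.
  pose proof (jets_regu 3 phi M 2 HJ ltac:(lia)) as R2. pose proof (jets_regu 3 phi M 3 HJ ltac:(lia)) as R3.
  rewrite (HH_ext _ (fun y => phi 3%nat y + (- (3) * phi 2%nat y + (3 * phi 1%nat y + - (1) * phi O y)))%C) by (intros; unfold third; ringC).
  rewrite (HH_plus (phi 3%nat)); [|auto|apply (regu_plus (fun y => - (3) * phi 2%nat y)%C); [now apply regu_scal|apply (regu_plus (fun y => 3 * phi 1%nat y)%C); now apply regu_scal]].
  rewrite (HH_plus (fun y => - (3) * phi 2%nat y)%C); [|now apply regu_scal|apply (regu_plus (fun y => 3 * phi 1%nat y)%C); now apply regu_scal].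
  rewrite (HH_plus (fun y => 3 * phi 1%nat y)%C) by (now apply regu_scal).
  rewrite !HH_scal by auto.
  destruct HJ as [HJ1 HJ2].
  pose proof (HH_ibp M (phi O) (phi 1%nat) mu ltac:(apply HJ1; lia) ltac:(apply HJ1; lia) ltac:(apply HJ1; lia) ltac:(apply HJ1; lia) ltac:(apply HJ2; lia) Hmu) as E1.
  pose proof (HH_ibp M (phi 1%nat) (phi 2%nat) mu ltac:(apply HJ1; lia) ltac:(apply HJ1; lia) ltac:(apply HJ1; lia) ltac:(apply HJ1; lia) ltac:(apply HJ2; lia) Hmu) as E2.
  pose proof (HH_ibp M (phi 2%nat) (phi 3%nat) mu ltac:(apply HJ1; lia) ltac:(apply HJ1; lia) ltac:(apply HJ1; lia) ltac:(apply HJ1; lia) ltac:(apply HJ2; lia) Hmu) as E3.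
  set (p0 := phi O 0%R) in *. set (p1 := phi 1%nat 0%R) in *. set (p2 := phi 2%nat 0%R) in *.
  set (h0 := HH (phi O) mu) in *. set (h1 := HH (phi 1%nat) mu) in *. set (h2 := HH (phi 2%nat) mu) in *. set (h3 := HH (phi 3%nat) mu) in *.
  assert (X1 : h1 = ((1 + Ci * mu) * h0 - p0)%C) by (rewrite E1; ringC).
  assert (X2 : h2 = ((1 + Ci * mu) * h1 - p1)%C) by (rewrite E2; ringC).
  assert (X3 : h3 = ((1 + Ci * mu) * h2 - p2)%C) by (rewrite E3; ringC).
  rewrite X3, X2, X1, omega_eq. unfold qpoly.
  pose proof Ci2 as Ii.
  replace (p0 * (mu * mu))%C with (- (Ci * Ci) * p0 * (mu * mu))%C by (rewrite Ii; ringC).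
  rewrite RtoC_3. rewrite RtoC_2.
  simpl. ringC.
Qed.

(** The forcing is W_t + W_xxx for W = a(t) phi(x); [bt_ibp] turns the transform of a' back into the
    terms of [utm_sep]. *)
Lemma utmf_sep a a' phi M x t :
  0 < x -> 0 < t -> (forall s, continuous a s) -> (forall s, continuous a' s) -> (forall s, 0 < s -> is_derive a s (a' s)) -> jets 3 phi M ->
  utmf x t (fun y => a 0%R * phi O y)%C (fun s => phi O 0%R * a s)%C (fun s y => a' s * phi O y + a s * third phi y)%C (a t * phi O x)%C.
Proof.
  intros Hx Ht Ca Ca' Hd HJ.
  assert (HJ2 : jets 2 phi M) by (destruct HJ; split; [intros; auto with arith|intros; auto with arith]).
  pose proof (utm_sep a a' phi M x t Hx Ht Ca Ca' Hd HJ2) as P. cbv zeta in P. revert P; apply utm_ext.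
  - intros l _; symmetry; apply HH_scal. apply (jets_regu 3 phi M); auto; lia.
  - intros; symmetry; now apply bt_scal.
  - intros l Hl. pose proof (jets_regu 3 phi M 0 HJ ltac:(lia)) as R0. pose proof (third_regu phi M HJ) as R3.
    rewrite (Tf_plus (fun s y => a' s * phi O y)%C (fun s y => a s * third phi y)%C) by (now apply regf_sep).
    assert (E : forall b u, (forall s, continuous b s) -> regu u -> Tf (fun s y => b s * u y)%C t l = (bt b (omega l) t * HH u l)%C).
    { intros b u Cb Ru; unfold Tf, bt. rewrite <- CInt_scalr by (intros; ct). apply CInt_ext; intros s _. rewrite (HH_scal (b s) u) by auto. ringC. }
    rewrite !E by auto. rewrite (HH_third phi M) by auto.
    pose proof (bt_ibp a a' (omega l) t ltac:(lra) Ca Ca' Hd) as B. fold (Ew t l) in B.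
    set (q := qpoly _ _ _ _). set (h := HH (phi O) l).
    transitivity ((a t - Ew t l * a 0%R - bt a' (omega l) t) * h + bt a' (omega l) t * h + q * bt a (omega l) t)%C; [ringC|].
    rewrite <- B. ringC.
Qed.

Lemma utmf_Ug g g' x t : 0 < x -> 0 < t -> (forall s, continuous g s) -> (forall s, continuous g' s) -> (forall s, 0 < s -> is_derive g s (g' s)) ->
  utmf x t (fun _ => RtoC 0) g (fun _ _ => RtoC 0) (Ug g x t).
Proof.
  intros Hx Ht Cg Cg' Hd. pose proof (utm_Ug g g' x t Hx Ht Cg Cg' Hd) as P; revert P; apply utm_ext.
  - intros; symmetry; apply HH_zero.
  - reflexivity.
  - intros l _; unfold Tf. rewrite (CInt_ext _ (fun _ => RtoC 0)) by (intros; rewrite HH_zero; ringC). rewrite CInt_const; ringC.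
Qed.

Lemma utmf_UF F M x t : forcing F M -> 0 < x -> 0 < t -> utmf x t (fun _ => RtoC 0) (fun _ => RtoC 0) (F O) (UF F 0 x t).
Proof.
  intros HF Hx Ht; pose proof (UF_utm F M x t HF Hx Ht) as P; revert P; apply utm_ext.
  - intros; symmetry; apply HH_zero.
  - intros; unfold bt. rewrite (CInt_ext _ (fun _ => RtoC 0)) by (intros; ringC). rewrite CInt_const; ringC.
  - intros l Hl; unfold Tf, TF, bt. rewrite dn_id by auto. rewrite <- CInt_scal by (intros; apply ct_mult; [ctx|apply (forcing_HH_ct F M); auto; ct]).
    apply CInt_ext; intros s _. rewrite (forcing_HH0 F M) by auto. ringC.
Qed.

(** * From rays to the contours of the formula *)

(** The negative half-axis is the ray of angle pi traversed inwards, whence the minus sign. *)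
Lemma is_int_line_rays F A0 A1 : ray F 0 A0 -> ray F PI A1 -> is_int_line F (A0 - A1)%C.
Proof.
  intros H0 H1; unfold is_int_line.
  assert (E0 : is_J (fun r => F (RtoC r)) A0).
  { revert H0; apply is_J_ext; intros r _. fold (pol r 0). rewrite pol_0, ex_eq, cos_0, sin_0. change ((1, 0) : C) with (RtoC 1). ringC. }
  assert (E1 : is_J (fun r => - F (RtoC (- r)))%C A1).
  { revert H1; apply is_J_ext; intros r _. fold (pol r PI). rewrite pol_PI, ex_eq, cos_PI, sin_PI. change ((-1, 0) : C) with (RtoC (-1)).
    rewrite RtoC_m1. ringC. }
  assert (E2 : is_RInt_gen (V := C_R_NormedModule) (fun l : R => F (RtoC l)) (Rbar_locally m_infty) (at_point 0) (- A1)%C).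
  { intros P HP. specialize (E1 (fun z => P (- z)%C)).
    assert (HP' : locally A1 (fun z => P (- z)%C)).
    { exact (ct_opp (fun z : C => z) A1 (continuous_id A1) P HP). }
    specialize (E1 HP'). unfold filtermapi in *. destruct E1 as [Q1 Q2 HQ1 [b Hb] HQ].
    exists (fun a => a < - b /\ True) (fun z => z = 0); [exists (- b); intros a Ha; split; auto|reflexivity|].
    intros a z [Ha _] ->. destruct (HQ 0 (- a) HQ1 (Hb (- a) ltac:(simpl; lra))) as [y [Hy Py]]. simpl in *.
    exists (- y)%C; split; auto.
    assert (Y : is_RInt (V := C_R_NormedModule) (fun r : R => (- F (RtoC (- r)))%C) (- 0) (- a) y) by (rewrite Ropp_0; exact Hy).
    apply (is_RInt_comp_opp (V := C_R_NormedModule)) in Y. apply (is_RInt_swap (V := C_R_NormedModule)) in Y.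
    revert Y; apply (is_RInt_ext (V := C_R_NormedModule)). intros r _. change (@eq C (- - F (RtoC (- - r)))%C (F (RtoC r))). rewrite Ropp_involutive; ringC. }
  pose proof (is_RInt_gen_Chasles (V := C_R_NormedModule) _ 0 _ _ E2 E0) as E3.
  replace (A0 - A1)%C with (- A1 + A0)%C by ringC. exact E3.
Qed.

Lemma is_int_Gamma_rays F B1 B2 : ray F (PI / 3) B1 -> ray F (2 * PI / 3) B2 -> is_int_Gamma F (B1 - B2)%C.
Proof.
  intros H1 H2; exists (- B2)%C, B1; split; [|split].
  - exact (is_RInt_gen_swap (V := C_R_NormedModule) _ _ H2).
  - exact H1.
  - ringC.
Qed.

(** The data are clamped to nonnegative arguments, where only their values on the closed quadrant
    enter, and e^(-omega t) is moved into the time integrals. *)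
Lemma utm_final u0 g0 (f : R -> R -> C) x t v : 0 < t ->
  (forall s, continuous (fun s => g0 (Rmax 0 s)) s) -> regf (fun s y => f (Rmax 0 y) (Rmax 0 s)) ->
  utmf x t u0 (fun s => g0 (Rmax 0 s)) (fun s y => f (Rmax 0 y) (Rmax 0 s)) v -> is_UTM_value u0 g0 f x t v.
Proof.
  intros Ht Cg Rf (A0 & A1 & B1 & B2 & D1 & D2 & P0 & P1 & Q1 & Q2 & [HA0 HA1] & [HB1 HB2] & [HD1 HD2] & [HP0 HP1] & [HQ1 HQ2] & E).
  assert (Kker : forall l, (Cexp (Ci * l * RtoC x - omega l * RtoC t) = Kx x l * Ew t l)%C).
  { intros l; unfold Kx, Ew; rewrite <- Cexp_plus; f_equal; ringC. }
  assert (Eti : forall (h : R -> C) k, (forall s, continuous (fun s => h (Rmax 0 s)) s) -> (Cexp (- (k * RtoC t)) * tilde h k t)%C = bt (fun s => h (Rmax 0 s)) k t).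
  { intros h k Ch; unfold tilde.
    rewrite (CInt_ext (fun tau => Cexp (k * RtoC tau) * h tau)%C (fun tau => Cexp (k * RtoC tau) * h (Rmax 0 tau))%C).
    2: { intros s Hs; rewrite Rmin_left in Hs by lra. rewrite Rmax_right by lra. reflexivity. }
    unfold bt; rewrite <- CInt_scal by (intros; apply ct_mult; [ct|apply Ch]). apply CInt_ext; intros s _.
    replace (- (k * RtoC (t - s)))%C with (- (k * RtoC t) + k * RtoC s)%C by (rewrite RtoC_minus; ringC). rewrite Cexp_plus; ringC. }
  assert (Eth : forall l k, Im l <= 0 -> omega l = k -> (Cexp (- (k * RtoC t)) * tilde_hat f l k t)%C = Tf (fun s y => f (Rmax 0 y) (Rmax 0 s)) t l).
  { intros l k Hl <-; unfold tilde_hat.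
    assert (Eh : forall s, 0 <= s -> hat (fun y => f y s) l = HH (fun y => f (Rmax 0 y) (Rmax 0 s)) l).
    { intros s Hs. rewrite hat_HH by auto. apply HH_ext; intros y Hy; rewrite !Rmax_right by lra; reflexivity. }
    unfold tilde, Tf.
    rewrite (CInt_ext _ (fun tau => Cexp (omega l * RtoC tau) * HH (fun y => f (Rmax 0 y) (Rmax 0 tau)) l)%C).
    2: { intros s Hs; rewrite Rmin_left in Hs by lra. rewrite Eh by lra. reflexivity. }
    pose proof (fun s => regf_HH_ct _ l s Rf) as Ch. cbv beta in Ch.
    rewrite <- CInt_scal by (intros; apply ct_mult; [ctx|apply Ch]). apply CInt_ext; intros s _.
    replace (- (omega l * RtoC (t - s)))%C with (- (omega l * RtoC t) + omega l * RtoC s)%C by (rewrite RtoC_minus; ringC). rewrite Cexp_plus; ringC. }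
  exists (A0 - A1)%C, (B1 - B2)%C, (D1 - D2)%C, (P0 - P1)%C, (Q1 - Q2)%C.
  split; [|split; [|split; [|split; [|split]]]]; [apply is_int_line_rays|apply is_int_Gamma_rays|apply is_int_Gamma_rays|apply is_int_line_rays|apply is_int_Gamma_rays|exact E].
  - revert HA0; apply ray_ext; intros r Hr; rewrite Kker, hat_HH; [reflexivity|apply real_im; auto].
  - revert HA1; apply ray_ext; intros r Hr; rewrite Kker, hat_HH; [reflexivity|apply real_im; auto].
  - revert HB1; apply ray_ext; intros r Hr. destruct (gam_im (PI / 3) r ltac:(now left) Hr). rewrite Kker, !hat_HH by auto. reflexivity.
  - revert HB2; apply ray_ext; intros r Hr. destruct (gam_im (2 * PI / 3) r ltac:(now right) Hr). rewrite Kker, !hat_HH by auto. reflexivity.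
  - revert HD1; apply ray_ext; intros r Hr. rewrite Kker, <- (Eti g0) by auto. unfold Ew. simpl; ringC.
  - revert HD2; apply ray_ext; intros r Hr. rewrite Kker, <- (Eti g0) by auto. unfold Ew. simpl; ringC.
  - revert HP0; apply ray_ext; intros r Hr. rewrite Kker, <- (Eth (pol r 0) (omega (pol r 0))) by (auto; apply real_im; auto). unfold Ew; ringC.
  - revert HP1; apply ray_ext; intros r Hr. rewrite Kker, <- (Eth (pol r PI) (omega (pol r PI))) by (auto; apply real_im; auto). unfold Ew; ringC.
  - revert HQ1; apply ray_ext; intros r Hr. destruct (gam_im (PI / 3) r ltac:(now left) Hr). unfold rot.
    rewrite Kker, <- (Eth (alpha * pol r (PI / 3))%C (omega (pol r (PI / 3)))), <- (Eth (alpha ^ 2 * pol r (PI / 3))%C (omega (pol r (PI / 3)))) by (auto; apply omega_alpha || apply omega_alpha2).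
    unfold Ew; ringC.
  - revert HQ2; apply ray_ext; intros r Hr. destruct (gam_im (2 * PI / 3) r ltac:(now right) Hr). unfold rot.
    rewrite Kker, <- (Eth (alpha * pol r (2 * PI / 3))%C (omega (pol r (2 * PI / 3)))), <- (Eth (alpha ^ 2 * pol r (2 * PI / 3))%C (omega (pol r (2 * PI / 3)))) by (auto; apply omega_alpha || apply omega_alpha2).
    unfold Ew; ringC.
Qed.

(** * Derivatives relative to a domain *)

Lemma on_char D h x l : is_derive_on D h x l <->
  forall e, 0 < e -> locally x (fun y => y <> x -> D y -> Cmod (h y - h x - RtoC (y - x) * l) <= e * Rabs (y - x)).
Proof.
  assert (Q : forall y, y <> x -> Cmod (h y - h x - RtoC (y - x) * l) = Cmod ((h y - h x) / RtoC (y - x) - l) * Rabs (y - x)).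
  { intros y Hy; rewrite <- Cmod_R, <- Cmod_mult. f_equal.
    assert (RtoC (y - x) <> 0%C) by (intros E; injection E; lra). field; auto. }
  unfold is_derive_on, locally'. split.
  - intros H e He. pose proof (proj1 (lim_Cmod _ _ _) H e He) as L. unfold within in L. revert L; apply filter_imp.
    intros y Hy Hn HD; rewrite Q by auto. apply Rmult_le_compat_r; [apply Rabs_pos|]. left; auto.
  - intros H. apply (lim_Cmod (within D (within (fun y => y <> x) (locally x)))). intros e He.
    unfold within. generalize (H (e / 2) ltac:(lra)); apply filter_imp. intros y Hy Hn HD.
    specialize (Hy Hn HD). rewrite Q in Hy by auto. assert (0 < Rabs (y - x)) by (apply Rabs_pos_lt; lra).
    apply Rmult_le_reg_r in Hy; lra.
Qed.

Lemma on_dr D h x l : locally x D -> is_derive_on D h x l -> is_derive h x l.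
Proof.
  intros HD H; apply dr_char; intros e He.
  pose proof (filter_and _ _ HD (proj1 (on_char D h x l) H e He)) as [d Hd]. exists d; intros k Hk.
  destruct (Req_dec k 0) as [-> |Hk0].
  - rewrite Rplus_0_r, Rabs_R0, Rmult_0_r. replace (h x - h x - 0 * l)%C with (RtoC 0) by ringC. rewrite Cmod_0; lra.
  - destruct (Hd (x + k)) as [H1 H2].
    { unfold ball; simpl; unfold AbsRing_ball, abs, minus, plus, opp; simpl. replace (x + k + - x) with k by ring. exact Hk. }
    specialize (H2 ltac:(lra) H1). replace (x + k - x) with k in H2 by ring. exact H2.
Qed.

Lemma dr_on D h x l : is_derive h x l -> is_derive_on D h x l.
Proof.
  intros H; apply on_char; intros e He. generalize (dr_char_conv h x l H e He); apply filter_imp. auto.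
Qed.

(** Points of the domain accumulate from the right, which makes relative derivatives unique. *)
Definition rightD (D : R -> Prop) (x : R) : Prop := forall y, x < y -> D y.

Lemma on_unique D h x a b : rightD D x -> is_derive_on D h x a -> is_derive_on D h x b -> a = b.
Proof.
  intros HD Ha Hb.
  destruct (Req_dec (Cmod (a - b)) 0) as [E|E].
  - apply Cmod_eq_0 in E. replace a with (a - b + b)%C by ringC. rewrite E; ringC.
  - exfalso. assert (P : 0 < Cmod (a - b)) by (pose proof (Cmod_ge_0 (a - b)); lra).
    (* Two linear approximations tested at one point to the right of x would force |a - b| <= 2
       e. *)
    set (e := Cmod (a - b) / 3).
    assert (He : 0 < e) by (unfold e; apply Rdiv_lt_0_compat; [exact P|lra]).
    destruct (filter_and _ _ (proj1 (on_char D h x a) Ha e He) (proj1 (on_char D h x b) Hb e He)) as [d Hd].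
    set (y := x + d / 2). pose proof (cond_pos d).
    destruct (Hd y) as [H1 H2].
    { apply ball_right; unfold y; lra. }
    specialize (H1 ltac:(unfold y; lra) ltac:(apply HD; unfold y; lra)). specialize (H2 ltac:(unfold y; lra) ltac:(apply HD; unfold y; lra)).
    replace (y - x) with (d / 2) in * by (unfold y; ring). rewrite (Rabs_pos_eq (d / 2)) in * by lra.
    assert (T : Cmod (RtoC (d / 2) * (a - b)) <= e * (d / 2) + e * (d / 2)).
    { replace (RtoC (d / 2) * (a - b))%C with ((h y - h x - RtoC (d / 2) * b) - (h y - h x - RtoC (d / 2) * a))%C by ringC.
      unfold Cminus at 1; eapply Rle_trans; [apply Cmod_triangle|]; rewrite Cmod_opp; lra. }
    rewrite Cmod_mult, Cmod_R, Rabs_pos_eq in T by lra. unfold e in T. nra.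
Qed.

Lemma Derive_on_eq D h x l : rightD D x -> is_derive_on D h x l -> Derive_on D h x = l.
Proof.
  intros HD H. unfold Derive_on. apply (iota_unique (V := C_R_CompleteNormedModule)); [|exact H].
  intros y Hy; apply (on_unique D h x); auto.
Qed.

Lemma Derive_on_is D h x : rightD D x -> ex_derive_on D h x -> is_derive_on D h x (Derive_on D h x).
Proof. intros HD [l Hl]. now rewrite (Derive_on_eq D h x l). Qed.

Lemma on_ext D h k x l : (forall y, D y -> h y = k y) -> D x -> is_derive_on D h x l -> is_derive_on D k x l.
Proof.
  intros E Dx H; apply on_char; intros e He. generalize (proj1 (on_char D h x l) H e He); apply filter_imp.
  intros y Hy Hn HD; rewrite <- !E by auto. auto.
Qed.

Lemma on_ct D h x l : is_derive_on D h x l -> filterlim h (within D (locally x)) (locally (h x)).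
Proof.
  intros H; apply (lim_Cmod (within D (locally x))). intros e He. unfold within.
  pose proof (proj1 (on_char D h x l) H 1 ltac:(lra)) as L.
  pose proof (Cmod_ge_0 l).
  assert (L2 : locally x (fun y => Rabs (y - x) < e / (2 + Cmod l))).
  { assert (0 < e / (2 + Cmod l)) by (apply Rdiv_lt_0_compat; lra). exists (mkposreal _ H1). intros y Hy; exact Hy. }
  generalize (filter_and _ _ L L2); apply filter_imp; intros y [H1 H2] HD.
  destruct (Req_dec y x) as [-> |Hn].
  - replace (h x - h x)%C with (RtoC 0) by ringC. rewrite Cmod_0; auto.
  - specialize (H1 Hn HD). replace (h y - h x)%C with ((h y - h x - RtoC (y - x) * l) + RtoC (y - x) * l)%C by ringC.
    eapply Rle_lt_trans; [apply Cmod_triangle|]. rewrite Cmod_mult, Cmod_R.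
    assert (Rabs (y - x) * (2 + Cmod l) < e).
    { apply (Rmult_lt_compat_r (2 + Cmod l)) in H2; [|lra]. replace (e / (2 + Cmod l) * (2 + Cmod l)) with e in H2 by (field; lra). exact H2. }
    pose proof (Rabs_pos_lt (y - x) ltac:(lra)). nra.
Qed.

Lemma clamp_lim p : filterlim (fun x => Rmax 0 x) (locally p) (within halfline (locally (Rmax 0 p))).
Proof.
  intros P HP. unfold filtermap, within in *.
  pose proof (rct_max (fun _ : R => 0) (fun x : R => x) p ltac:(ct) ltac:(ct) _ HP) as H. unfold filtermap in H.
  revert H; apply filter_imp; intros x Hx; apply Hx. apply Rmax_l.
Qed.

Lemma cont0_on h h' : (forall x, 0 <= x -> is_derive_on halfline h x (h' x)) -> cont0 h.
Proof.
  intros H p; unfold continuous, cl.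
  eapply filterlim_comp; [apply clamp_lim|]. apply (on_ct _ _ _ (h' (Rmax 0 p))), H, Rmax_l.
Qed.

(** Clamping both coordinates is the nearest-point retraction onto the closed quadrant, so relative
    continuity becomes continuity on the plane. *)
Lemma cont_in_clamp W q : continuous_in Qbar W -> continuous (fun q : R * R => W (Rmax 0 (fst q)) (Rmax 0 (snd q))) q.
Proof.
  intros H; destruct q as [x t]; unfold continuous; simpl.
  apply (filterlim_comp _ _ _ (fun q : R * R => (Rmax 0 (fst q), Rmax 0 (snd q))) (fun p => W (fst p) (snd p)) _
     (within (fun p : R * R => Qbar (fst p) (snd p)) (locally (Rmax 0 x, Rmax 0 t)))).
  - intros P HP; unfold filtermap, within in *.
    assert (Cp : continuous (fun q : R * R => (Rmax 0 (fst q), Rmax 0 (snd q))) (x, t)).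
    { apply filterlim_locally; intros e.
      pose proof (rct_max (fun _ : R * R => 0) (fun q : R * R => fst q) (x, t) ltac:(ct) ltac:(ct)) as C1.
      pose proof (rct_max (fun _ : R * R => 0) (fun q : R * R => snd q) (x, t) ltac:(ct) ltac:(ct)) as C2.
      pose proof (proj1 (filterlim_locally _ _) C1 e) as L1. pose proof (proj1 (filterlim_locally _ _) C2 e) as L2.
      generalize (filter_and _ _ L1 L2); apply filter_imp; intros q [Q1 Q2]; split; auto. }
    specialize (Cp _ HP). unfold filtermap in Cp. revert Cp; apply filter_imp; intros q Hq; apply Hq.
    split; apply Rmax_l.
  - apply (H (Rmax 0 x) (Rmax 0 t)). split; apply Rmax_l.
Qed.

Lemma cube_le x : 0 <= x -> (1 + x) ^ 3 <= 4 * (1 + x ^ 3).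
Proof.
  intros; pose proof (Rle_0_sqr (x - 1)) as Q; unfold Rsqr in Q. assert (0 <= (x - 1) * (x - 1) * (1 + x)) by nra. nra.
Qed.

Lemma decay_of_moments m x A B : 0 <= x -> 0 <= m -> x ^ 0 * m <= A -> x ^ 3 * m <= B -> m <= 4 * (A + B) / (1 + x) ^ 3.
Proof.
  intros Hx Hm H0 H3; pose proof (cube_le x Hx). assert (0 < (1 + x) ^ 3) by (apply pow_lt; lra).
  apply (Rmult_le_reg_r ((1 + x) ^ 3)); auto. replace (4 * (A + B) / (1 + x) ^ 3 * (1 + x) ^ 3) with (4 * (A + B)) by (field; lra).
  apply (Rle_trans _ (m * (4 * (1 + x ^ 3)))); [now apply Rmult_le_compat_l|]. simpl in H0. nra.
Qed.

Definition dseq (G : nat -> R -> C) : Prop :=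
  (forall n, cont0 (G n)) /\ (forall n x, 0 < x -> is_derive (G n) x (G (S n) x)).
Definition decays (G : nat -> R -> C) : Prop := forall n, exists M, forall x, 0 <= x -> Cmod (G n x) <= M / (1 + x) ^ 3.

Lemma halfline_right x : 0 <= x -> rightD halfline x.
Proof. intros Hx y Hy; unfold halfline; lra. Qed.
Lemma halfline_int x : 0 < x -> locally x halfline.
Proof. intros Hx; apply locally_pos; auto. intros y Hy; unfold halfline; lra. Qed.

Lemma Cinfty_dseq u : Cinfty_halfline u ->
  dseq (fun n => Nat.iter n (Derive_on halfline) u) /\
  forall n x, 0 <= x -> is_derive_on halfline (Nat.iter n (Derive_on halfline) u) x (Nat.iter (S n) (Derive_on halfline) u x).
Proof.
  intros H.
  assert (D : forall n x, 0 <= x -> is_derive_on halfline (Nat.iter n (Derive_on halfline) u) x (Nat.iter (S n) (Derive_on halfline) u x)).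
  { intros n x Hx; apply Derive_on_is; [now apply halfline_right|now apply H]. }
  split; [split|]; auto.
  - intros n; apply (cont0_on _ (Nat.iter (S n) (Derive_on halfline) u)); auto.
  - intros n x Hx; apply (on_dr halfline); [now apply halfline_int|apply D; lra].
Qed.

Lemma Schwartz_decays u : Schwartz_halfline u -> decays (fun n => Nat.iter n (Derive_on halfline) u).
Proof.
  intros [_ H] n; destruct (H 0%nat n) as [A HA]; destruct (H 3%nat n) as [B HB]. exists (4 * (A + B)); intros x Hx.
  apply decay_of_moments; auto. apply Cmod_ge_0.
Qed.

Definition CK (W : R -> R -> C) : Prop := forall k, Ck Qbar k W.

Lemma CK_cont W : CK W -> continuous_in Qbar W.
Proof. intros H; apply (H O). Qed.
Lemma CK_px W : CK W -> CK (pdx Qbar W).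
Proof. intros H k; apply (H (S k)). Qed.
Lemma CK_pt W : CK W -> CK (pdt Qbar W).
Proof. intros H k; apply (H (S k)). Qed.
Lemma CK_dx W x t : CK W -> 0 < x -> 0 <= t -> is_derive (fun x => W x t) x (pdx Qbar W x t).
Proof.
  intros H Hx Ht. destruct (proj1 (proj2 (H 1%nat)) x t ltac:(split; lra)) as [E _].
  apply (on_dr (fun y => Qbar y t)).
  - apply locally_pos; auto. intros y Hy; split; lra.
  - apply Derive_on_is; auto. intros y Hy; split; lra.
Qed.
Lemma CK_dt W x t : CK W -> 0 <= x -> 0 < t -> is_derive (fun t => W x t) t (pdt Qbar W x t).
Proof.
  intros H Hx Ht. destruct (proj1 (proj2 (H 1%nat)) x t ltac:(split; lra)) as [_ E].
  apply (on_dr (fun y => Qbar x y)).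
  - apply locally_pos; auto. intros y Hy; split; lra.
  - apply Derive_on_is; auto. intros y Hy; split; lra.
Qed.

Lemma SQ_iter f n : Schwartz_Qbar f -> CK (Nat.iter n (pdx Qbar) f).
Proof. intros [H _]; induction n; [exact H|]. simpl. now apply CK_px. Qed.

Lemma SQ_decay f n : Schwartz_Qbar f -> exists M, forall x t, 0 <= x -> 0 <= t -> Cmod (Nat.iter n (pdx Qbar) f x t) <= M / (1 + x) ^ 3.
Proof.
  intros [_ H]; destruct (H 0%nat 0%nat n 0%nat) as [A HA]; destruct (H 3%nat 0%nat n 0%nat) as [B HB]. change (Nat.iter 0 (pdt Qbar) f) with f in HA, HB.
  exists (4 * (A + B)); intros x t Hx Ht. specialize (HA x t ltac:(split; auto)). specialize (HB x t ltac:(split; auto)).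
  simpl (t ^ 0) in *. rewrite Rmult_1_r in *. apply decay_of_moments; auto. apply Cmod_ge_0.
Qed.

(** * Iterates of [d/dx + 1] *)

(** With G n standing for the n-th derivative, this is (d/dx + 1)^k applied to the i-th derivative;
    carrying the index i avoids binomial sums. *)
Fixpoint Dj (G : nat -> R -> C) (k i : nat) (y : R) : C :=
  match k with O => G i y | S k' => (Dj G k' i y + Dj G k' (S i) y)%C end.

Lemma Dj_dr G k i y : (forall n, is_derive (G n) y (G (S n) y)) -> is_derive (Dj G k i) y (Dj G k (S i) y).
Proof. intros H; revert i; induction k; intros i; simpl; [apply H|apply dr_plus; auto]. Qed.

Lemma Dj_jet G k y : (forall n, is_derive (G n) y (G (S n) y)) -> is_derive (Dj G k 0) y (Dj G (S k) 0 y - Dj G k 0 y)%C.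
Proof. intros H; eapply dr_eq; [now apply Dj_dr|]. simpl; ringC. Qed.

Lemma Dj_cont0 G k i : (forall n, cont0 (G n)) -> cont0 (Dj G k i).
Proof. intros H; revert i; induction k; intros i; simpl; [apply H|]. apply (cont0_plus (Dj G k i) (Dj G k (S i))); auto. Qed.

Lemma Dj_jct0 (G : R -> nat -> R -> C) k i t : (forall n t, jct0 (fun t => G t n) t) -> jct0 (fun t => Dj (G t) k i) t.
Proof. intros H; revert i; induction k; intros i y; simpl; [apply H|]. apply (ct_plus (fun q : R * R => cl (Dj (G (fst q)) k i) (snd q)) (fun q => cl (Dj (G (fst q)) k (S i)) (snd q))); [apply IHk|apply IHk]. Qed.

Lemma Dj_decay {T : Type} (G : T -> nat -> R -> C) k i : (forall n, exists M, forall t x, 0 <= x -> Cmod (G t n x) <= M / (1 + x) ^ 3) ->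
  exists M, forall t x, 0 <= x -> Cmod (Dj (G t) k i x) <= M / (1 + x) ^ 3.
Proof.
  intros H; revert i; induction k; intros i; cbn [Dj]; [apply H|].
  destruct (IHk i) as [M1 H1]; destruct (IHk (S i)) as [M2 H2]. exists (M1 + M2); intros t x Hx.
  eapply Rle_trans; [apply Cmod_triangle|]. specialize (H1 t x Hx). specialize (H2 t x Hx). unfold Rdiv in *; lra.
Qed.

Lemma bound_upto (P : nat -> R -> Prop) n : (forall k, exists M, P k M) -> (forall k M M', P k M -> M <= M' -> P k M') ->
  exists M, forall k, (k <= n)%nat -> P k M.
Proof.
  intros H Hm; induction n.
  - destruct (H O) as [M HM]; exists M; intros k Hk. replace k with O by lia; auto.
  - destruct IHn as [M1 H1]; destruct (H (S n)) as [M2 H2]; exists (Rmax M1 M2); intros k Hk.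
    destruct (Nat.eq_dec k (S n)) as [-> |Hn].
    + apply (Hm _ M2); auto. apply Rmax_r.
    + apply (Hm _ M1); [apply H1; lia|apply Rmax_l].
Qed.

Lemma inv3_mono M M' x : 0 <= x -> M <= M' -> M / (1 + x) ^ 3 <= M' / (1 + x) ^ 3.
Proof. intros; apply Rmult_le_compat_r; auto. left; apply Rinv_0_lt_compat, pow_lt; lra. Qed.
Lemma inv32 M x : 0 <= x -> 0 <= M -> M / (1 + x) ^ 3 <= M / (1 + x) ^ 2.
Proof. intros; apply inv_pow_anti; auto. Qed.

Lemma jets_of_dseq G n : dseq G -> decays G -> exists M, jets n (fun k => Dj G k 0) M.
Proof.
  intros [H1 H2] H3.
  assert (B : forall k, exists M, forall (t : unit) x, 0 <= x -> Cmod (Dj G k 0 x) <= M / (1 + x) ^ 3) by (intros k; apply (Dj_decay (fun _ : unit => G)); intros m; destruct (H3 m) as [M HM]; exists M; auto).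
  destruct (bound_upto (fun k M => forall (t : unit) x, 0 <= x -> Cmod (Dj G k 0 x) <= M / (1 + x) ^ 3) n B) as [M HM].
  { intros k M M' H HM t x Hx; eapply Rle_trans; [apply H; auto|now apply inv3_mono]. }
  exists M; split.
  - intros k Hk; split; [apply Dj_cont0; auto|]. intros x Hx; eapply Rle_trans; [apply (HM k Hk tt); auto|]. apply inv32; auto.
    specialize (HM k Hk tt 0 ltac:(lra)). pose proof (Cmod_ge_0 (Dj G k 0 0)). rewrite Rplus_0_r, pow1 in HM. lra.
  - intros k Hk y Hy; apply Dj_jet; auto.
Qed.

(** Under d/dy + 1 the index drops by one and index 0 is annihilated, so the jets at 0 form the
    identity matrix ([phj_0]). *)
Definition phik (k : nat) (y : R) : C := RtoC (y ^ k / INR (fact k) * exp (- y)).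
Definition phj (k j : nat) : R -> C := if Nat.leb j k then phik (k - j) else fun _ => RtoC 0.

Lemma phik_dr k y : is_derive (phik (S k)) y (phik k y - phik (S k) y)%C /\ is_derive (phik 0) y (- phik 0 y)%C.
Proof.
  assert (Hf : forall n, INR (fact n) <> 0) by apply INR_fact_neq_0. split.
  - unfold phik; rewrite <- RtoC_minus. apply dr_RtoC. rdr; [apply Hf|].
    change (fact (S k)) with ((S k) * fact k)%nat. rewrite mult_INR. simpl pred. assert (INR (S k) <> 0) by (apply not_0_INR; lia).
    eqR. set (E := exp (- y)). replace (y ^ S k) with (y * y ^ k) by reflexivity. set (p := y ^ k). set (n := INR (S k)) in *. field; auto.
  - unfold phik; rewrite <- RtoC_opp. apply dr_RtoC. rdr; [apply Hf|]. simpl. field.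
Qed.

Lemma phik_decay k : exists M, forall y, 0 <= y -> Cmod (phik k y) <= M / (1 + y) ^ 3.
Proof.
  destruct (expdom 1 (k + 1) ltac:(lra)) as [M [HM H]]. exists M; intros y Hy. unfold phik; rewrite Cmod_R.
  pose proof (exp_pos (- y)). assert (F1 : 1 <= INR (fact k)) by (replace 1 with (INR 1) by reflexivity; apply le_INR, lt_O_fact).
  assert (0 <= y ^ k) by (now apply pow_le).
  rewrite Rabs_pos_eq.
  2: { apply Rmult_le_pos; [|lra]. apply Rmult_le_pos; auto. left; apply Rinv_0_lt_compat; lra. }
  specialize (H 1 y ltac:(lra) Hy). rewrite Rmult_1_l in H.
  assert (E : y ^ k / INR (fact k) <= (1 + y) ^ k).
  { apply (Rle_trans _ (y ^ k * 1)); [apply Rmult_le_compat_l; auto; rewrite <- Rinv_1; apply Rinv_le_contravar; lra|]. rewrite Rmult_1_r; apply pow_incr; lra. }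
  apply (Rmult_le_reg_l (1 + y)); [lra|]. replace ((1 + y) * (M / (1 + y) ^ 3)) with (M / (1 + y) ^ 2) by (field; lra).
  eapply Rle_trans; [|exact H]. rewrite pow_add, pow_1.
  replace ((1 + y) ^ k * (1 + y) * exp (- y)) with ((1 + y) * ((1 + y) ^ k * exp (- y))) by ring.
  apply Rmult_le_compat_l; [lra|]. apply Rmult_le_compat_r; lra.
Qed.

Lemma phj_dr k j y : is_derive (phj k j) y (phj k (S j) y - phj k j y)%C.
Proof.
  unfold phj. destruct (Nat.leb_spec j k) as [H|H].
  - destruct (Nat.leb_spec (S j) k) as [H'|H'].
    + replace (k - j)%nat with (S (k - S j)) by lia. apply phik_dr.
    + replace (k - j)%nat with O by lia. eapply dr_eq; [apply (phik_dr O)|ringC].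
  - destruct (Nat.leb_spec (S j) k); [lia|]. eapply dr_eq; [apply dr_const|ringC].
Qed.

Lemma phj_decay k j : exists M, forall y, 0 <= y -> Cmod (phj k j y) <= M / (1 + y) ^ 3.
Proof.
  unfold phj; destruct (Nat.leb j k); [apply phik_decay|]. exists 0; intros; rewrite Cmod_0; unfold Rdiv; lra.
Qed.

Lemma phj_ct k j y : continuous (phj k j) y.
Proof. apply (dr_ct _ _ (phj k (S j) y - phj k j y)%C), phj_dr. Qed.

Lemma phj_0 k j : phj k j 0 = if Nat.eqb j k then RtoC 1 else RtoC 0.
Proof.
  unfold phj. destruct (Nat.leb_spec j k) as [H|H].
  - unfold phik. destruct (Nat.eqb_spec j k) as [-> |Hn].
    + rewrite Nat.sub_diag. simpl. rewrite Ropp_0, exp_0. f_equal; field.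
    + rewrite pow_i by lia. f_equal. unfold Rdiv; ring.
  - destruct (Nat.eqb_spec j k); [lia|reflexivity].
Qed.

Lemma phj_jets k n : exists M, jets n (phj k) M.
Proof.
  destruct (bound_upto (fun j M => forall x, 0 <= x -> Cmod (phj k j x) <= M / (1 + x) ^ 3) n (phj_decay k)) as [M HM].
  { intros j M M' H HM x Hx; eapply Rle_trans; [apply H; auto|now apply inv3_mono]. }
  exists M; split.
  - intros j Hj; split; [apply cont0_ct, phj_ct|]. intros x Hx; eapply Rle_trans; [apply (HM j Hj); auto|]. apply inv32; auto.
    specialize (HM j Hj 0 ltac:(lra)). pose proof (Cmod_ge_0 (phj k j 0)). rewrite Rplus_0_r, pow1 in HM. lra.
  - intros; apply phj_dr.
Qed.

(* Makes [sum a_k phj k 0] match the boundary jets of the forcing; the system is triangular, hence solved by successive integrations. *)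
Lemma triangular n (c : nat -> R -> C) : (forall k s, continuous (c k) s) ->
  exists a : nat -> R -> C, (forall k, (n <= k)%nat -> forall t, a k t = RtoC 0) /\ (forall k, a k 0 = RtoC 0) /\
    forall k t, (k < n)%nat -> is_derive (a k) t (a k t - 3 * a (S k) t + 3 * a (S (S k)) t - a (S (S (S k))) t + c k t)%C.
Proof.
  revert c; induction n; intros c Hc.
  - exists (fun _ _ => RtoC 0); repeat split; auto; lia.
  - destruct (IHn (fun k => c (S k)) (fun k => Hc (S k))) as [a' [Z [A0 D]]].
    assert (Ca : forall k s, continuous (a' k) s).
    { intros k s; destruct (Nat.lt_ge_cases k n) as [H|H]; [apply (dr_ct _ _ _ (D k s H))|].
      apply (continuous_ext (fun _ => RtoC 0)); [intros; symmetry; auto|ct]. }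
    set (h := fun s => (- (3) * a' 0%nat s + 3 * a' 1%nat s - a' 2%nat s + c 0%nat s)%C).
    assert (Ch : forall s, continuous h s).
    { intros s; unfold h. pose proof (Ca 0%nat s). pose proof (Ca 1%nat s). pose proof (Ca 2%nat s). pose proof (Hc 0%nat s). ct. }
    (* The equation for index 0 is a' = a + h once the higher coefficients are known; variation of
       constants gives [bt] with rate -1. *)
    exists (fun k => match k with O => bt h (- (1))%C | S k' => a' k' end); split; [|split].
    + intros [|k] Hk t; [lia|apply Z; lia].
    + intros [|k]; [apply CInt_point|apply A0].
    + intros [|k] t Hk; [|apply D; lia]. eapply dr_eq; [now apply bt_dt|]. unfold h; ringC.
Qed.

(** * Reduction to vanishing boundary jets *)

Fixpoint csum (n : nat) (h : nat -> C) : C := match n with O => RtoC 0 | S m => (csum m h + h m)%C end.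

Lemma csum_ext n h k : (forall i, (i < n)%nat -> h i = k i) -> csum n h = csum n k.
Proof. intros E; induction n; cbn [csum]; auto. rewrite IHn, E; auto. Qed.
Lemma csum_plus n h k : csum n (fun i => h i + k i)%C = (csum n h + csum n k)%C.
Proof. induction n; cbn [csum]; [ringC|rewrite IHn; ringC]. Qed.
Lemma csum_dr n (h : nat -> R -> C) h' x : (forall i, (i < n)%nat -> is_derive (h i) x (h' i)) ->
  is_derive (fun x => csum n (fun i => h i x)) x (csum n h').
Proof. intros H; induction n; cbn [csum]; [apply dr_const|]. apply (dr_plus (fun x => csum n (fun i => h i x)) (h n)); auto. Qed.
Lemma csum_ct n {U : UniformSpace} (h : nat -> U -> C) p : (forall i, (i < n)%nat -> continuous (h i) p) -> continuous (fun x => csum n (fun i => h i x)) p.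
Proof. intros H; induction n; cbn [csum]; [ct|]. apply (ct_plus (fun x => csum n (fun i => h i x)) (h n)); auto. Qed.
Lemma csum_decay n (h : nat -> R -> R -> C) (P : R -> R -> Prop) : (forall x t, P x t -> 0 <= x) ->
  (forall i, (i < n)%nat -> exists K, 0 <= K /\ forall x t, P x t -> Cmod (h i x t) <= K / (1 + x)) ->
  exists K, 0 <= K /\ forall x t, P x t -> Cmod (csum n (fun i => h i x t)) <= K / (1 + x).
Proof.
  intros HP H; induction n; cbn [csum].
  - exists 0; split; [lra|]. intros; rewrite Cmod_0; unfold Rdiv; lra.
  - destruct (IHn ltac:(auto)) as [K1 [P1 H1]]. destruct (H n ltac:(lia)) as [K2 [P2 H2]]. exists (K1 + K2); split; [lra|].
    intros x t Hx; eapply Rle_trans; [apply Cmod_triangle|]. specialize (H1 x t Hx). specialize (H2 x t Hx). unfold Rdiv in *; lra.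
Qed.

(** The ordinary j-th derivative in terms of the iterates of D = d/dy + 1, as the expansion of (D -
    1)^j. *)
Definition djet (phi : nat -> R -> C) (j : nat) (y : R) : C :=
  match j with
  | O => phi O y
  | 1%nat => (phi 1%nat y - phi O y)%C
  | 2%nat => (phi 2%nat y - 2 * phi 1%nat y + phi O y)%C
  | _ => third phi y
  end.

Lemma djet_dr phi M j y : jets 3 phi M -> (j < 3)%nat -> 0 < y -> is_derive (djet phi j) y (djet phi (S j) y).
Proof.
  intros [_ H] Hj Hy. pose proof (H 0%nat ltac:(lia) y Hy). pose proof (H 1%nat ltac:(lia) y Hy). pose proof (H 2%nat ltac:(lia) y Hy).
  destruct j as [|[|[|j]]]; [| | |lia]; unfold djet, third; dr; try ringC.
Qed.

(** The constant 8 = 1 + 3 + 3 + 1 is the sum of the absolute coefficients of (D - 1)^3. *)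
Lemma djet_bound phi M j y : jets 3 phi M -> 0 <= y -> Cmod (djet phi j y) <= 8 * M / (1 + y).
Proof.
  intros [H _] Hy. destruct (H 0%nat ltac:(lia)) as [_ D0]; destruct (H 1%nat ltac:(lia)) as [_ D1]; destruct (H 2%nat ltac:(lia)) as [_ D2]; destruct (H 3%nat ltac:(lia)) as [_ D3].
  pose proof (dom_pos _ _ D0) as HM.
  assert (E : M / (1 + y) ^ 2 <= M / (1 + y)) by (pose proof (inv_pow_anti M y 1 2 HM Hy ltac:(lia)) as I; rewrite pow_1 in I; exact I).
  specialize (D0 y Hy); specialize (D1 y Hy); specialize (D2 y Hy); specialize (D3 y Hy).
  replace (8 * M / (1 + y)) with (8 * (M / (1 + y))) by (field; lra). set (m := M / (1 + y)) in *.
  pose proof (Cmod_ge_0 (phi O y)). pose proof (Cmod_ge_0 (phi 1%nat y)). pose proof (Cmod_ge_0 (phi 2%nat y)). pose proof (Cmod_ge_0 (phi 3%nat y)).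
  assert (T : forall a b, Cmod (a - b) <= Cmod a + Cmod b) by (intros a b; unfold Cminus; eapply Rle_trans; [apply Cmod_triangle|rewrite Cmod_opp; lra]).
  assert (S2 : forall a, Cmod (2 * a) = 2 * Cmod a) by (intros; rewrite Cmod_mult, Cmod_R, Rabs_pos_eq; lra).
  assert (S3 : forall a, Cmod (3 * a) = 3 * Cmod a) by (intros; rewrite Cmod_mult, Cmod_R, Rabs_pos_eq; lra).
  destruct j as [|[|[|j]]]; unfold djet, third.
  - lra.
  - eapply Rle_trans; [apply T|lra].
  - eapply Rle_trans; [apply Cmod_triangle|]. pose proof (T (phi 2%nat y) (2 * phi 1%nat y)%C). rewrite S2 in *; lra.
  - eapply Rle_trans; [apply T|]. pose proof (Cmod_triangle (phi 3%nat y - 3 * phi 2%nat y) (3 * phi 1%nat y)).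
    pose proof (T (phi 3%nat y) (3 * phi 2%nat y)%C). rewrite !S3 in *; lra.
Qed.

Definition pieces (n : nat) (a a1 : nat -> R -> C) (phi : nat -> nat -> R -> C) : Prop :=
  forall k, (k < n)%nat -> (forall t, is_derive (a k) t (a1 k t)) /\ (forall t, continuous (a1 k) t) /\ exists M, jets 3 (phi k) M.

Lemma pieces_a n a a1 phi k t : pieces n a a1 phi -> (k < n)%nat -> continuous (a k) t.
Proof. intros H Hk; apply (dr_ct _ _ (a1 k t)), H, Hk. Qed.

Lemma pieces_decay n a (b : nat -> R -> C) a1 phi j T : pieces n a a1 phi -> 0 <= T -> (forall k t, (k < n)%nat -> continuous (b k) t) ->
  exists K, 0 <= K /\ forall x t, 0 <= x /\ 0 <= t <= T -> Cmod (csum n (fun k => b k t * djet (phi k) j x)%C) <= K / (1 + x).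
Proof.
  intros H HT Hb; apply (csum_decay n (fun k x t => b k t * djet (phi k) j x)%C); [tauto|]. intros k Hk.
  destruct (H k Hk) as (_ & _ & M & HJ). destruct (cont_bounded (b k) T HT ltac:(auto)) as [A [HA0 HA]].
  pose proof (dom_pos M (phi k O) ltac:(apply HJ; lia)). exists (A * (8 * M)); split; [apply Rmult_le_pos; lra|].
  intros x t [Hx Ht]. rewrite Cmod_mult. replace (A * (8 * M) / (1 + x)) with (A * (8 * M / (1 + x))) by (field; lra).
  apply Rmult_le_compat; try apply Cmod_ge_0; auto. now apply djet_bound.
Qed.

Lemma regf_csum n (h : nat -> R -> R -> C) : (forall k, (k < n)%nat -> regf (h k)) -> regf (fun s y => csum n (fun k => h k s y)).
Proof.
  intros H; induction n; cbn [csum].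
  - split; [intros t y; unfold jct, cl; ct|]. intros T; exists 0; intros t Ht y Hy; rewrite Cmod_0; unfold Rdiv; lra.
  - apply (regf_plus (fun s y => csum n (fun k => h k s y)) (h n)); auto.
Qed.
Lemma regu_csum n (h : nat -> R -> C) : (forall k, (k < n)%nat -> regu (h k)) -> regu (fun y => csum n (fun k => h k y)).
Proof.
  intros H; induction n; cbn [csum]; [apply regu_zero|]. apply (regu_plus (fun y => csum n (fun k => h k y)) (h n)); auto.
Qed.

Lemma pieces_regf n a a1 phi k : pieces n a a1 phi -> (k < n)%nat -> regf (fun s y => a1 k s * phi k O y + a k s * third (phi k) y)%C.
Proof.
  intros H Hk; pose proof (fun t => pieces_a n a a1 phi k t H Hk). destruct (H k Hk) as (_ & C1 & M & HJ).
  apply (regf_plus (fun s y => a1 k s * phi k O y)%C (fun s y => a k s * third (phi k) y)%C); apply regf_sep; auto.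
  - apply (jets_regu 3 _ M); auto; lia.
  - apply (third_regu _ M); auto.
Qed.

Lemma utmf_zero x t : utmf x t (fun _ => RtoC 0) (fun _ => RtoC 0) (fun _ _ => RtoC 0) (RtoC 0).
Proof.
  assert (Z : forall th (G : C -> C), (forall l, G l = RtoC 0) -> ray G th (RtoC 0)).
  { intros th G HG; apply (ray_ext (fun _ => RtoC 0)); [intros; now rewrite HG|apply ray_zero]. }
  assert (B : forall l, bt (fun _ => RtoC 0) l t = RtoC 0).
  { intros; unfold bt. rewrite (CInt_ext _ (fun _ => RtoC 0)) by (intros; ringC). rewrite CInt_const; ringC. }
  assert (T : forall l, Tf (fun _ _ => RtoC 0) t l = RtoC 0).
  { intros; unfold Tf. rewrite (CInt_ext _ (fun _ => RtoC 0)) by (intros; rewrite HH_zero; ringC). rewrite CInt_const; ringC. }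
  exists (RtoC 0), (RtoC 0), (RtoC 0), (RtoC 0), (RtoC 0), (RtoC 0), (RtoC 0), (RtoC 0), (RtoC 0), (RtoC 0).
  repeat split; try (apply Z; intros l; unfold rot; rewrite ?HH_zero, ?B, ?T; ringC). ringC.
Qed.

Lemma utmf_pieces n a a1 phi x t : pieces n a a1 phi -> 0 < x -> 0 < t ->
  utmf x t (fun y => csum n (fun k => a k 0%R * phi k O y)%C) (fun s => csum n (fun k => phi k O 0%R * a k s)%C)
    (fun s y => csum n (fun k => a1 k s * phi k O y + a k s * third (phi k) y)%C) (csum n (fun k => a k t * phi k O x)%C).
Proof.
  intros H Hx Ht; induction n; cbn [csum]; [apply utmf_zero|].
  assert (H' : pieces n a a1 phi) by (intros k Hk; apply H; lia).
  assert (Ra : forall k, (k < S n)%nat -> regu (fun y => a k 0%R * phi k O y)%C).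
  { intros k Hk; destruct (H k Hk) as (_ & _ & M & HJ). apply regu_scal, (jets_regu 3 _ M); auto; lia. }
  assert (Ca : forall k s, (k < S n)%nat -> continuous (fun s => phi k O 0%R * a k s)%C s).
  { intros k s Hk; pose proof (pieces_a _ _ _ _ k s H Hk). ct. }
  apply (utmf_plus x t (fun y => csum n (fun k => a k 0%R * phi k O y)%C) (fun y => a n 0%R * phi n O y)%C
    (fun s => csum n (fun k => phi k O 0%R * a k s)%C) (fun s => phi n O 0%R * a n s)%C
    (fun s y => csum n (fun k => a1 k s * phi k O y + a k s * third (phi k) y)%C) (fun s y => a1 n s * phi n O y + a n s * third (phi n) y)%C).
  - apply (regu_csum n (fun k y => a k 0%R * phi k O y)%C); auto.
  - apply Ra; lia.
  - intros s; apply (csum_ct n (fun k s => phi k O 0%R * a k s)%C); auto.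
  - intros s; apply Ca; lia.
  - apply (regf_csum n (fun k s y => a1 k s * phi k O y + a k s * third (phi k) y)%C). intros k Hk; apply (pieces_regf (S n)); auto; lia.
  - apply (pieces_regf (S n)); auto; lia.
  - auto.
  - destruct (H n ltac:(lia)) as (D & C1 & M & HJ). apply (utmf_sep _ _ _ M); auto. intros s; apply (pieces_a (S n) a a1 phi n s H); lia.
Qed.

Lemma forcing_regf F M : forcing F M -> regf (F O).
Proof.
  intros HF; split; [intros; apply HF; lia|]. intros T; exists M; intros; apply (forcing_dom F); auto; lia.
Qed.

(** Seven pieces cancel the boundary jets of the forcing f - u0''' left by the initial datum, and an
    eighth carries the datum itself. The boundary datum that remains is g0 - u0(0) - a_0, and the
    two compatibility conditions say exactly that it vanishes at 0 together with its first
    derivative. *)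
Lemma decomposition u0 g0 f : Schwartz_halfline u0 -> Cinfty_halfline g0 -> Schwartz_Qbar f ->
  exists (n : nat) (a a1 : nat -> R -> C) (phi : nat -> nat -> R -> C) (F : nat -> R -> R -> C) (MF : R) (g g1 : R -> C),
    pieces n a a1 phi /\ forcing F MF /\ (forall s, continuous g s) /\ (forall s, continuous g1 s) /\ (forall s, 0 < s -> is_derive g s (g1 s)) /\
    (forall y, 0 <= y -> csum n (fun k => a k 0%R * phi k O y)%C = u0 y) /\
    (forall s, 0 <= s -> (csum n (fun k => phi k O 0%R * a k s) + g s)%C = g0 s) /\
    (forall s y, 0 <= s -> 0 <= y -> (csum n (fun k => a1 k s * phi k O y + a k s * third (phi k) y) + F O s y)%C = f y s) /\
    (forall t y, 0 < y -> exists l : C, is_derive (F O t) y l) /\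
    (compatible u0 g0 f -> g 0 = RtoC 0 /\ g1 0 = RtoC 0 /\ exists g2 : R -> C, (forall s, continuous g2 s) /\ forall s, 0 < s -> is_derive g1 s (g2 s)).
Proof.
  intros Hu Hg Hf.
  destruct (Cinfty_dseq u0 (proj1 Hu)) as [Du _]. pose proof (Schwartz_decays u0 Hu) as Eu.
  destruct (Cinfty_dseq g0 Hg) as [[Cg Dg] Dg0].
  set (Gu := fun n => Nat.iter n (Derive_on halfline) u0) in *.
  set (Gg := fun n => Nat.iter n (Derive_on halfline) g0) in *.
  (* The x-derivatives of f - u0''', with the time clamped to be nonnegative. *)
  set (G1 := fun s n y => (Nat.iter n (pdx Qbar) f y (Rmax 0 s) - Gu (3 + n)%nat y)%C).
  assert (G1d : forall s n y, 0 < y -> is_derive (G1 s n) y (G1 s (S n) y)).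
  { intros s n y Hy; unfold G1; apply dr_minus; [apply (CK_dx (Nat.iter n (pdx Qbar) f)); auto; [now apply SQ_iter|apply Rmax_l]|apply Du; auto]. }
  assert (G1j : forall n t, jct0 (fun t => G1 t n) t).
  { intros n t y; unfold jct, cl, G1. apply ct_minus.
    - pose proof (fun q => cont_in_clamp _ q (CK_cont _ (SQ_iter f n Hf))) as Cq.
      apply (ct_comp2 (fun a b => Nat.iter n (pdx Qbar) f (Rmax 0 a) (Rmax 0 b)) (fun q : R * R => snd q) (fun q => fst q)); [exact Cq|ct|ct].
    - apply (ct_comp (cl (Gu (3 + n)%nat)) (fun q : R * R => snd q)); [apply Du|ct]. }
  assert (G1b : forall n, exists M, forall t x, 0 <= x -> Cmod (G1 t n x) <= M / (1 + x) ^ 3).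
  { intros n; destruct (SQ_decay f n Hf) as [M1 H1]; destruct (Eu (3 + n)%nat) as [M2 H2]. exists (M1 + M2); intros t x Hx.
    unfold G1, Cminus; eapply Rle_trans; [apply Cmod_triangle|]; rewrite Cmod_opp. specialize (H1 x (Rmax 0 t) Hx (Rmax_l _ _)). specialize (H2 x Hx). unfold Rdiv in *; lra. }
  set (c := fun k s => Dj (G1 s) k 0 0).
  assert (Cc : forall k s, continuous (c k) s).
  { intros k s. pose proof (jct_p _ s 0 (Dj_jct0 G1 k 0 s G1j 0)) as P. unfold c, cl in *. revert P; apply continuous_ext; intros s'. rewrite Rmax_left by lra. reflexivity. }
  assert (Bc : forall k, exists M, forall s, Cmod (c k s) <= M).
  { intros k; destruct (Dj_decay G1 k 0 G1b) as [M HM]. exists M; intros s. specialize (HM s 0 ltac:(lra)). rewrite Rplus_0_r, pow1 in HM. unfold c; lra. }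
  destruct (triangular 7 c Cc) as [a [Za [A0 Da]]].
  set (ad := fun k t => (a k t - 3 * a (S k) t + 3 * a (S (S k)) t - a (S (S (S k))) t + c k t)%C).
  assert (Ca : forall k s, continuous (a k) s).
  { intros k s; destruct (Nat.lt_ge_cases k 7) as [H|H]; [apply (dr_ct _ _ _ (Da k s H))|].
    apply (continuous_ext (fun _ => RtoC 0)); [intros; symmetry; auto|ct]. }
  assert (Cad : forall k s, continuous (ad k) s).
  { intros k s; unfold ad. pose proof (Ca k s). pose proof (Ca (S k) s). pose proof (Ca (S (S k)) s). pose proof (Ca (S (S (S k))) s). pose proof (Cc k s). ct. }
  set (F := fun k s y => (Dj (G1 s) k 0 y - csum 7 (fun i => c i s * phj i k y))%C).
  assert (FM : exists MF, forcing F MF).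
  { assert (FB : forall k, exists M, forall s y, 0 <= y -> Cmod (F k s y) <= M / (1 + y) ^ 3).
    { intros k; destruct (Dj_decay G1 k 0 G1b) as [M1 H1].
      assert (B2 : forall n, exists M, forall s y, 0 <= y -> Cmod (csum n (fun i => c i s * phj i k y)%C) <= M / (1 + y) ^ 3).
      { induction n; cbn [csum]; [exists 0; intros; rewrite Cmod_0; unfold Rdiv; lra|].
        destruct IHn as [M2 H2]; destruct (Bc n) as [M3 H3]; destruct (phj_decay n k) as [M4 H4]. exists (M2 + M3 * M4); intros s y Hy.
        eapply Rle_trans; [apply Cmod_triangle|]. rewrite Cmod_mult. specialize (H2 s y Hy). specialize (H3 s). specialize (H4 y Hy).
        assert (Cmod (c n s) * Cmod (phj n k y) <= M3 * (M4 / (1 + y) ^ 3)) by (apply Rmult_le_compat; auto; apply Cmod_ge_0).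
        unfold Rdiv in *; lra. }
      destruct (B2 7%nat) as [M2 H2]. exists (M1 + M2); intros s y Hy. unfold F, Cminus; eapply Rle_trans; [apply Cmod_triangle|]; rewrite Cmod_opp.
      specialize (H1 s y Hy). specialize (H2 s y Hy). unfold Rdiv in *; lra. }
    destruct (bound_upto (fun k M => forall s y, 0 <= y -> Cmod (F k s y) <= M / (1 + y) ^ 3) 7 FB) as [MF HMF].
    { intros k M M' H HM s y Hy; eapply Rle_trans; [apply H; auto|now apply inv3_mono]. }
    exists MF; split; [|split; [|split]].
    - intros k t _ y; unfold jct, cl, F. apply ct_minus; [apply (Dj_jct0 G1 k 0 t G1j y)|].
      apply (csum_ct 7 (fun i (q : R * R) => c i (fst q) * phj i k (Rmax 0 (snd q)))%C). intros i _. apply ct_mult.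
      + apply (ct_comp (c i) (fun q : R * R => fst q)); [auto|ct].
      + apply (ct_comp (phj i k) (fun q : R * R => Rmax 0 (snd q))); [apply phj_ct|ct].
    - intros k t y Hk Hy; now apply HMF.
    - intros k t y Hk Hy; unfold F. eapply dr_eq.
      + apply dr_minus; [apply Dj_jet; auto|]. apply (csum_dr 7 (fun i y => c i t * phj i k y)%C). intros i _. apply dr_scal, phj_dr.
      + cbn [csum]. ringC.
    - intros k t Hk; unfold F. assert (E : csum 7 (fun i => c i t * phj i k 0)%C = c k t).
      { cbn [csum]. rewrite !phj_0. do 7 (destruct k as [|k]; [cbn [Nat.eqb]; ringC|]). lia. }
      rewrite E; unfold c; ringC. }
  destruct FM as [MF HF].
  (* The eighth piece is [u0] with the constant coefficient 1. *)
  exists 8%nat, (fun k => if Nat.ltb k 7 then a k else fun _ => RtoC 1), (fun k => if Nat.ltb k 7 then ad k else fun _ => RtoC 0),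
    (fun k => if Nat.ltb k 7 then phj k else fun j => Dj Gu j 0), F, MF,
    (fun s => cl (Gg 0%nat) s - u0 0%R - a 0%nat s)%C, (fun s => cl (Gg 1%nat) s - ad 0%nat s)%C.
  assert (Dcl : forall n s, 0 < s -> is_derive (cl (Gg n)) s (cl (Gg (S n)) s)).
  { intros n s Hs. rewrite cl_pos by lra. apply (is_derive_ext_loc (Gg n)); [|apply Dg; auto].
    apply locally_pos; [lra|]. intros y Hy; symmetry; apply cl_pos; lra. }
  split; [|split; [exact HF|split; [|split; [|split; [|split; [|split; [|split; [|split]]]]]]]].
  - intros k Hk. destruct (Nat.ltb_spec k 7) as [H|H].
    + split; [intros t; apply Da; auto|split; [auto|]]. destruct (phj_jets k 3) as [M HM]; exists M; exact HM.
    + split; [intros; apply dr_const|split; [intros; ct|]]. destruct (jets_of_dseq Gu 3 Du Eu) as [M HM]; exists M; exact HM.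
  - intros s; pose proof (Cg 0%nat s) as C0; pose proof (Ca 0%nat s). apply ct_minus; auto. apply ct_minus; [exact C0|ct].
  - intros s; apply ct_minus; [apply Cg|apply Cad].
  - intros s Hs. eapply dr_eq; [apply dr_minus; [apply dr_minus; [now apply Dcl|apply dr_const]|apply Da; lia]|]. unfold ad; ringC.
  - intros y Hy. cbn [csum Nat.ltb Nat.leb]. rewrite !A0. unfold Gu; cbn [Dj Nat.iter nat_rect]. ringC.
  - intros s Hs. cbn [csum Nat.ltb Nat.leb]. rewrite !phj_0, cl_pos by auto. unfold Gg, Gu. cbn [Dj Nat.iter nat_rect Nat.eqb]. ringC.
  (* The coefficient of each [phik] vanishes by the equations defining [a]; the coefficients 7, 8
     and 9, beyond the system, are zero. *)
  - intros s y Hs Hy. cbn [csum Nat.ltb Nat.leb]. unfold F, third, ad. cbn [csum].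
    change (phj 0 0) with (phik 0). change (phj 1 0) with (phik 1). change (phj 2 0) with (phik 2). change (phj 3 0) with (phik 3).
    change (phj 4 0) with (phik 4). change (phj 5 0) with (phik 5). change (phj 6 0) with (phik 6).
    change (phj 1 1) with (phik 0). change (phj 2 1) with (phik 1). change (phj 3 1) with (phik 2).
    change (phj 4 1) with (phik 3). change (phj 5 1) with (phik 4). change (phj 6 1) with (phik 5).
    change (phj 2 2) with (phik 0). change (phj 3 2) with (phik 1). change (phj 4 2) with (phik 2). change (phj 5 2) with (phik 3). change (phj 6 2) with (phik 4).
    change (phj 3 3) with (phik 0). change (phj 4 3) with (phik 1). change (phj 5 3) with (phik 2). change (phj 6 3) with (phik 3).
    change (phj 0 1 y) with (RtoC 0). change (phj 0 2 y) with (RtoC 0). change (phj 0 3 y) with (RtoC 0).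
    change (phj 1 2 y) with (RtoC 0). change (phj 1 3 y) with (RtoC 0). change (phj 2 3 y) with (RtoC 0).
    rewrite (Za 7%nat), (Za 8%nat), (Za 9%nat) by lia. cbn [Dj].
    unfold G1. cbn [Nat.iter nat_rect Nat.add]. rewrite (Rmax_right 0 s) by auto.
    rewrite RtoC_3.
    ringC.
  - intros t y Hy. eexists; apply HF; auto; lia.
  - intros [K1 K2]. fold (Gu 3%nat) in K2. change (Derive_on halfline g0 0) with (Gg 1%nat 0%R) in K2.
    unfold cl; rewrite Rmax_left by lra. split; [|split].
    + rewrite A0. unfold Gg; cbn [Nat.iter nat_rect]. rewrite K1; ringC.
    + rewrite K2. unfold ad; rewrite !A0. unfold c, G1; cbn [Dj Nat.iter nat_rect Nat.add]. rewrite Rmax_left by lra. ringC.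
    (* The derivative of c_0(s) = f(0, s) - u0'''(0) brings in the time derivative of [f] on the
       edge x = 0. *)
    + exists (fun s => cl (Gg 2%nat) s - (ad 0%nat s - 3 * ad 1%nat s + 3 * ad 2%nat s - ad 3%nat s + pdt Qbar f (Rmax 0 0) (Rmax 0 s)))%C.
      assert (HCK : CK f) by (apply (SQ_iter f 0), Hf).
      split.
      * intros s; apply ct_minus; [apply Cg|]. pose proof (Cad 0%nat s); pose proof (Cad 1%nat s); pose proof (Cad 2%nat s); pose proof (Cad 3%nat s).
        assert (continuous (fun s => pdt Qbar f (Rmax 0 0) (Rmax 0 s)) s).
        { pose proof (fun q => cont_in_clamp _ q (CK_cont _ (CK_pt _ HCK))) as Cq.
          apply (ct_comp2 (fun a b => pdt Qbar f (Rmax 0 a) (Rmax 0 b)) (fun _ : R => 0) (fun s => s)); [exact Cq|ct|ct]. }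
        ct.
      * intros s Hs. apply dr_minus; [now apply Dcl|]. unfold ad at 1.
        apply dr_plus; [apply dr_minus; [apply dr_plus; [apply dr_minus; [|apply dr_scal]|apply dr_scal]|]|]; try (apply Da; lia).
        rewrite Rmax_left, (Rmax_right 0 s) by lra. unfold c. cbn [Dj]. unfold G1.
        apply (dr_eq _ s (pdt Qbar f 0 s - 0)%C); [apply dr_minus; [|apply dr_const]|ringC].
        apply (is_derive_ext_loc (fun s => f 0 s)); [|apply CK_dt; auto; lra].
        apply locally_pos; [lra|]. intros y Hy; cbn [Nat.iter nat_rect]. rewrite Rmax_right by lra; reflexivity.
Qed.

(** * Existence *)

Lemma ct_at_right {V : UniformSpace} (f : R -> V) p : continuous f p -> filterlim f (at_right p) (locally (f p)).
Proof.
  intros H P HP; specialize (H P HP). unfold filtermap, at_right, within in *. revert H; apply filter_imp; auto.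
Qed.

Lemma at_right_pos (p : R) (P : R -> Prop) : (forall y, p < y -> P y) -> at_right p P.
Proof. intros H; exists (mkposreal 1 Rlt_0_1); intros y _ Hy; auto. Qed.

Lemma LG_Gt_ct g j x t : (forall s, continuous g s) -> 0 < x -> 0 < t -> continuous (fun q : R * R => LG j (Gt g (snd q)) (fst q)) (x, t).
Proof.
  intros Hg Hx Ht. destruct (cont_bounded g (t + 1) ltac:(lra) Hg) as [A [HA0 HA]].
  apply (LG_ct j (Gt g) (3 * (A * (t + 1))) 2); auto; [intros; now apply Gt_jct0|].
  assert (L : locally t (fun u => 0 < u < t + 1)).
  { apply locally_interval; lra. }
  revert L; apply filter_imp; intros u Hu r Hr.
  eapply Rle_trans; [apply (Gt_polyb g A (t + 1) u); auto; lra|]. apply Rmult_le_compat_r; [apply pow_le; lra|].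
  assert (A * u <= A * (t + 1)) by (apply Rmult_le_compat_l; lra). lra.
Qed.

Lemma decay_weaken K x : 0 <= K -> 0 < x -> K / (1 + x) <= K / x /\ K / (1 + x) <= K.
Proof.
  intros HK Hx; split; [apply Rmult_le_compat_l; auto; apply Rinv_le_contravar; lra|].
  apply (Rmult_le_reg_r (1 + x)); [lra|]. unfold Rdiv; rewrite Rmult_assoc, Rinv_l by lra. nra.
Qed.

Lemma Cmod_add3 a b c A B D : Cmod a <= A -> Cmod b <= B -> Cmod c <= D -> Cmod (a + b + c) <= A + B + D.
Proof. intros; eapply Rle_trans; [apply Cmod_triangle|]. pose proof (Cmod_triangle a b). lra. Qed.

(** The derivatives are given as functions because the energy argument needs their decay at
    infinity, their behaviour at the edge and, under compatibility, a bound K/(1 + x), whose square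
    is integrable. *)
Theorem existence u0 g0 f : Schwartz_halfline u0 -> Cinfty_halfline g0 -> Schwartz_Qbar f ->
  exists U U1 U2 U3 Ut : R -> R -> C,
    (forall x t, 0 < x -> 0 < t -> is_UTM_value u0 g0 f x t (U x t)) /\
    (forall x t, 0 < x -> 0 < t ->
       is_derive (fun x => U x t) x (U1 x t) /\ is_derive (fun x => U1 x t) x (U2 x t) /\ is_derive (fun x => U2 x t) x (U3 x t) /\
       is_derive (fun t => U x t) t (Ut x t) /\ (Ut x t + U3 x t)%C = f x t) /\
    (forall x, 0 < x -> filterlim (fun t => U x t) (at_right 0) (locally (u0 x))) /\
    (forall t, 0 < t -> filterlim (fun x => U x t) (at_right 0) (locally (g0 t))) /\
    (forall x t, 0 < x -> 0 < t -> continuous (fun q : R * R => U (fst q) (snd q)) (x, t) /\ continuous (fun q : R * R => Ut (fst q) (snd q)) (x, t)) /\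
    (forall t, 0 < t -> exists K, (forall x, 1 <= x -> Cmod (U x t) <= K / x /\ Cmod (U1 x t) <= K / x) /\ forall x, 0 < x -> Cmod (U2 x t) <= K) /\
    (compatible u0 g0 f -> forall T, 0 < T -> exists K, forall x t, 0 < x -> 0 < t <= T -> Cmod (U x t) <= K / (1 + x) /\ Cmod (Ut x t) <= K / (1 + x)).
Proof.
  intros Hu Hg Hf.
  destruct (decomposition u0 g0 f Hu Hg Hf) as (n & a & a1 & phi & F & MF & g & g1 & HP & HF & Cg & Cg1 & Dg & Eu & Eg & Ef & DF & Hcomp).
  set (S := fun j x t => csum n (fun k => a k t * djet (phi k) j x)%C).
  set (St := fun x t => csum n (fun k => a1 k t * djet (phi k) 0 x)%C).
  set (Uj := fun j x t => (S j x t + LG j (Gt g t) x + UF F j x t)%C).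
  set (Ut := fun x t => (St x t + - LG 3 (Gt g t) x + (F O t x - UF F 3 x t))%C).
  assert (Ca1 : forall k t, (k < n)%nat -> continuous (a1 k) t) by (intros; apply HP; auto).
  assert (Ca : forall k t, (k < n)%nat -> continuous (a k) t) by (intros k t Hk; apply (pieces_a n a a1 phi); auto).
  assert (Sdx : forall j x t, (j < 3)%nat -> 0 < x -> is_derive (fun x => S j x t) x (S (Datatypes.S j) x t)).
  { intros j x t Hj Hx; unfold S. apply (csum_dr n (fun k x => a k t * djet (phi k) j x)%C). intros k Hk. apply dr_scal.
    destruct (HP k Hk) as (_ & _ & M & HJ). now apply (djet_dr _ M). }
  assert (Cphi : forall k x t, (k < n)%nat -> 0 < x -> continuous (fun q : R * R => djet (phi k) 0 (fst q)) (x, t)).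
  { intros k x t Hk Hx; destruct (HP k Hk) as (_ & _ & M & HJ).
    apply (continuous_comp (fun q : R * R => fst q) (djet (phi k) 0)); [ct|]. apply (dr_ct _ _ _ (djet_dr _ M 0 x HJ ltac:(lia) Hx)). }
  assert (Udx : forall j x t, (j < 3)%nat -> 0 < x -> 0 < t -> is_derive (fun x => Uj j x t) x (Uj (Datatypes.S j) x t)).
  { intros j x t Hj Hx Ht; unfold Uj; apply dr_plus; [apply dr_plus; [now apply Sdx|]|].
    - destruct (cont_bounded g t ltac:(lra) Cg) as [A [HA0 HA]].
      apply (LG_dx (3 * (A * t)) 2); auto; [apply (jct0_cont0 (Gt g)), Gt_jct0, Cg|apply (Gt_polyb g A t t); auto; lra].
    - apply (UF_dx F MF); auto; lra || lia. }
  exists (Uj 0%nat), (Uj 1%nat), (Uj 2%nat), (Uj 3%nat), Ut.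
  split; [|split; [|split; [|split; [|split; [|split]]]]].
  - intros x t Hx Ht.
    assert (Cg0 : forall s, continuous (fun s => g0 (Rmax 0 s)) s).
    { destruct (Cinfty_dseq g0 Hg) as [[C _] _]. apply (C 0%nat). }
    pose proof (SQ_iter f 0 Hf) as HCK. change (Nat.iter 0 (pdx Qbar) f) with f in HCK.
    apply utm_final; auto.
    { split.
      - intros s y; unfold jct, cl. pose proof (fun q => cont_in_clamp _ q (CK_cont _ HCK)) as Cq.
        apply (ct_comp2 (fun a b => f (Rmax 0 a) (Rmax 0 b)) (fun q : R * R => Rmax 0 (snd q)) (fun q => fst q)); [exact Cq|ct|ct].
      - intros T; destruct (SQ_decay f 0 Hf) as [M HM]. exists M; intros s _ y Hy. change (Nat.iter 0 (pdx Qbar) f) with f in HM.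
        pose proof (HM 0 0 ltac:(lra) ltac:(lra)) as H0. rewrite Rplus_0_r, pow1 in H0. pose proof (Cmod_ge_0 (f 0 0)).
        rewrite (Rmax_right 0 y) by auto. eapply Rle_trans; [apply HM; auto; apply Rmax_l|]. apply inv32; lra. }
    pose proof (utmf_pieces n a a1 phi x t HP Hx Ht) as P1.
    pose proof (utmf_Ug g g1 x t Hx Ht Cg Cg1 Dg) as P2.
    pose proof (utmf_UF F MF x t HF Hx Ht) as P3.
    assert (R1 : regu (fun y => csum n (fun k => a k 0%R * phi k O y)%C)).
    { apply (regu_csum n (fun k y => a k 0%R * phi k O y)%C). intros k Hk; destruct (HP k Hk) as (_ & _ & M & HJ). apply regu_scal, (jets_regu 3 _ M); auto; lia. }
    assert (C1 : forall s, continuous (fun s => csum n (fun k => phi k O 0%R * a k s)%C) s).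
    { intros s; apply (csum_ct n (fun k s => phi k O 0%R * a k s)%C). intros k Hk; pose proof (Ca k s Hk). ct. }
    assert (R2 : regf (fun s y => csum n (fun k => a1 k s * phi k O y + a k s * third (phi k) y)%C)).
    { apply (regf_csum n (fun k s y => a1 k s * phi k O y + a k s * third (phi k) y)%C). intros k Hk; now apply (pieces_regf n). }
    assert (Z : regf (fun _ _ => RtoC 0)) by (apply (regf_csum 0 (fun _ _ _ => RtoC 0)); intros; lia).
    pose proof (utmf_plus x t _ _ _ _ _ _ _ _ R1 regu_zero C1 Cg R2 Z P1 P2) as P4.
    assert (P5 := utmf_plus x t _ _ _ _ _ _ _ _ (regu_plus _ _ R1 regu_zero) regu_zero
      (fun s => ct_plus (fun s => csum n (fun k => phi k O 0%R * a k s)%C) g s (C1 s) (Cg s)) (fun s => continuous_const (RtoC 0) s)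
      (regf_plus _ _ R2 Z) (forcing_regf F MF HF) P4 P3).
    revert P5; apply utmf_ext; try lra.
    + intros y Hy; rewrite <- Eu by auto. ringC.
    + intros s Hs; rewrite Rmax_right, <- Eg by auto. ringC.
    + intros s y Hs Hy; rewrite !Rmax_right, <- Ef by auto. ringC.
    + unfold Uj, S, Ug. reflexivity.
  - intros x t Hx Ht. split; [apply Udx; auto|split; [apply Udx; auto|split; [apply Udx; auto|split]]].
    + unfold Uj, Ut; apply dr_plus; [apply dr_plus|].
      * unfold S, St. apply (csum_dr n (fun k t => a k t * djet (phi k) 0 x)%C). intros k Hk. apply dr_scalr, HP, Hk.
      * apply (Ug_dt g x t); auto.
      * destruct (DF t x Hx) as [l Hl]. now apply (UF_dt F MF x t l).
    + unfold Ut, Uj. rewrite <- (Ef t x) by lra.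
      rewrite (csum_plus n (fun k => a1 k t * phi k O x)%C (fun k => a k t * third (phi k) x)%C).
      unfold St, S. unfold djet. ringC.
  - intros x Hx. rewrite <- Eu by lra.
    replace (csum n (fun k => (a k 0%R * phi k O x)%C)) with (S 0%nat x 0 + 0 + 0)%C by (unfold S, djet; ringC).
    unfold Uj; apply (lim_plus (at_right 0)); [apply (lim_plus (at_right 0))|].
    + apply (ct_at_right (fun t => S 0%nat x t)). unfold S. apply (csum_ct n (fun k t => a k t * djet (phi k) 0 x)%C). intros k Hk; pose proof (Ca k 0 Hk). ct.
    + apply (Ug_t0 g x Hx Cg).
    + apply (lim_Cmod (at_right 0)). intros e He. pose proof (forcing_pos F MF HF) as HM.
      assert (0 < e / (768 * MF + 1)) by (apply Rdiv_lt_0_compat; lra).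
      exists (mkposreal _ H); intros t Bt Ht. replace (UF F 0 x t - 0)%C with (UF F 0 x t) by ringC.
      eapply Rle_lt_trans; [apply (UF_bound0 F MF); auto; lra || lia|].
      unfold ball in Bt; simpl in Bt; unfold AbsRing_ball, abs, minus, plus, opp in Bt; simpl in Bt. rewrite Rabs_pos_eq in Bt by lra.
      apply (Rmult_lt_compat_l (768 * MF + 1)) in Bt; [|lra]. replace ((768 * MF + 1) * (e / (768 * MF + 1))) with e in Bt by (field; lra). nra.
  - intros t Ht. rewrite <- Eg by lra.
    replace (csum n (fun k => phi k O 0%R * a k t) + g t)%C with (S 0%nat 0 t + g t + 0)%C.
    2: { unfold S, djet. rewrite (csum_ext n (fun k => a k t * phi k O 0%R)%C (fun k => phi k O 0%R * a k t)%C) by (intros; ringC). ringC. }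
    unfold Uj; apply (lim_plus (at_right 0)); [apply (lim_plus (at_right 0))|].
    + assert (C1 : continuous (fun x => csum n (fun k => a k t * cl (phi k O) x)%C) 0).
      { apply (csum_ct n (fun k x => a k t * cl (phi k O) x)%C). intros k Hk; destruct (HP k Hk) as (_ & _ & M & HJ).
        apply ct_mult; [ct|]. apply HJ; lia. }
      apply ct_at_right in C1. replace (csum n (fun k => a k t * cl (phi k O) 0)%C) with (S 0%nat 0 t) in C1.
      2: { unfold S, djet, cl. rewrite Rmax_left by lra. reflexivity. }
      revert C1; apply filterlim_ext_loc. apply at_right_pos; intros x Hx. unfold S, djet, cl. rewrite Rmax_right by lra. reflexivity.
    + apply (Ug_lim0 g g1 t); auto.
    + apply (UF_lim0 F MF t); auto.
  - intros x t Hx Ht; split.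
    + unfold Uj; apply ct_plus; [apply ct_plus|].
      * unfold S. apply (csum_ct n (fun k (q : R * R) => a k (snd q) * djet (phi k) 0 (fst q))%C). intros k Hk. apply ct_mult; [|now apply Cphi].
        apply (continuous_comp (fun q : R * R => snd q) (a k)); [ct|apply Ca, Hk].
      * now apply LG_Gt_ct.
      * apply (UF_ct F MF); auto; lia.
    + unfold Ut; apply ct_plus; [apply ct_plus|apply ct_minus].
      * unfold St. apply (csum_ct n (fun k (q : R * R) => a1 k (snd q) * djet (phi k) 0 (fst q))%C). intros k Hk. apply ct_mult; [|now apply Cphi].
        apply (continuous_comp (fun q : R * R => snd q) (a1 k)); [ct|apply Ca1, Hk].
      * apply ct_opp. now apply LG_Gt_ct.
      * apply (continuous_ext_loc _ (fun q : R * R => cl (F O (snd q)) (fst q))).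
        -- assert (L : locally (x, t) (fun q : R * R => 0 < fst q)) by (refine (continuous_fst x t (fun x => 0 < x) _); apply (open_gt 0); simpl; lra).
           revert L; apply filter_imp; intros q Hq. apply cl_pos; lra.
        -- apply (ct_comp2 (fun t r => cl (F O t) r) (fun q : R * R => snd q) (fun q => fst q)); [intros [? ?]; apply HF; lia|ct|ct].
      * apply (UF_ct F MF); auto; lia.
  - intros t Ht.
    destruct (cont_bounded g t ltac:(lra) Cg) as [A [HA0 HA]].
    destruct (Ug_decay A t HA0) as [K1 [P1 H1]]. destruct (UF_decay F MF t HF) as [K2 [P2 H2]].
    assert (HS : forall j, exists K, 0 <= K /\ forall x, 0 < x -> Cmod (S j x t) <= K / (1 + x)).
    { intros j; destruct (pieces_decay n a a a1 phi j t HP ltac:(lra) Ca) as [K [PK HK]]. exists K; split; auto. intros x Hx; apply HK; lra. }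
    destruct (HS 0%nat) as [S0 [PS0 HS0]]. destruct (HS 1%nat) as [S1 [PS1 HS1]]. destruct (HS 2%nat) as [S2 [PS2 HS2]].
    destruct (Ug_near g g1 t Ht Cg Cg1 Dg) as [K3 H3].
    exists (S0 + S1 + S2 + K1 + K2 + Rabs K3). pose proof (Rabs_pos K3). pose proof (Rle_abs K3). split.
    + assert (X : forall j Sj, (j <= 1)%nat -> 0 <= Sj -> Sj <= S0 + S1 + S2 + Rabs K3 -> (forall x, 0 < x -> Cmod (S j x t) <= Sj / (1 + x)) -> forall x, 1 <= x -> Cmod (Uj j x t) <= (S0 + S1 + S2 + K1 + K2 + Rabs K3) / x).
      { intros j Sj Hj PSj Le HSj x Hx. apply (Rle_trans _ (Sj / x + K1 / x + K2 / x)).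
        - unfold Uj; apply Cmod_add3.
          + eapply Rle_trans; [apply HSj; lra|]. apply decay_weaken; lra.
          + apply H1; auto; lra || lia.
          + eapply Rle_trans; [apply H2; auto; lra || lia|]. apply decay_weaken; lra.
        - replace (Sj / x + K1 / x + K2 / x) with ((Sj + K1 + K2) / x) by (field; lra).
          apply Rmult_le_compat_r; [left; apply Rinv_0_lt_compat; lra|lra]. }
      intros x Hx; split; [apply (X 0%nat S0)|apply (X 1%nat S1)]; auto; lra.
    + intros x Hx. apply (Rle_trans _ (S2 + K3 + K2)); [|lra]. unfold Uj; apply Cmod_add3.
      * eapply Rle_trans; [apply HS2; lra|]. apply decay_weaken; lra.
      * now apply H3.
      * eapply Rle_trans; [apply H2; auto; lra || lia|]. apply decay_weaken; lra.
  - intros Hc T HT. destruct (Hcomp Hc) as (Z0 & Z1 & g2 & Cg2 & Dg2).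
    destruct (Ug_unif g g1 T HT Cg Cg1 Dg Z0) as [K1 H1]. destruct (Ug_unif g1 g2 T HT Cg1 Cg2 Dg2 Z1) as [K2 H2].
    destruct (UF_decay F MF T HF) as [K3 [P3 H3]].
    destruct (pieces_decay n a a a1 phi 0 T HP ltac:(lra) Ca) as [K4 [P4 H4]].
    destruct (pieces_decay n a a1 a1 phi 0 T HP ltac:(lra) Ca1) as [K5 [P5 H5]].
    pose proof (forcing_pos F MF HF) as HM.
    exists (Rabs K1 + Rabs K2 + K3 + K4 + K5 + MF). intros x t Hx Ht.
    pose proof (Rabs_pos K1). pose proof (Rle_abs K1). pose proof (Rabs_pos K2). pose proof (Rle_abs K2).
    assert (Hi : 0 < / (1 + x)) by (apply Rinv_0_lt_compat; lra).
    split.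
    + apply (Rle_trans _ (K4 / (1 + x) + K1 / (1 + x) + K3 / (1 + x))).
      * unfold Uj; apply Cmod_add3; [apply H4; lra|apply H1; auto|apply H3; auto].
      * replace (K4 / (1 + x) + K1 / (1 + x) + K3 / (1 + x)) with ((K4 + K1 + K3) / (1 + x)) by (field; lra). apply Rmult_le_compat_r; lra.
    + apply (Rle_trans _ (K5 / (1 + x) + K2 / (1 + x) + (MF / (1 + x) + K3 / (1 + x)))).
      * unfold Ut; apply Cmod_add3; [apply H5; lra| |].
        (* Both conditions enter here: g(0) = 0 turns the time derivative into [Ug] of g', and g'(0)
           = 0 makes that bound uniform. *)
        -- rewrite (Ug_dt_compat g g1) by (auto; lra). apply H2; auto.
        -- unfold Cminus; eapply Rle_trans; [apply Cmod_triangle|]; rewrite Cmod_opp. apply Rplus_le_compat; [|apply H3; auto; lra || lia].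
           eapply Rle_trans; [apply HF; lra || lia|]. pose proof (inv_pow_anti MF x 1 3 HM ltac:(lra) ltac:(lia)) as I. rewrite pow_1 in I; exact I.
      * replace (K5 / (1 + x) + K2 / (1 + x) + (MF / (1 + x) + K3 / (1 + x))) with ((K5 + K2 + MF + K3) / (1 + x)) by (field; lra). apply Rmult_le_compat_r; lra.
Qed.

(** * Uniqueness by the energy method *)

(** The real part of z times the conjugate of w. *)
Definition dot (z w : C) : R := fst z * fst w + snd z * snd w.

Lemma dot_le z w : Rabs (dot z w) <= Cmod z * Cmod w.
Proof.
  assert (E : Cmod (fst w, - snd w) = Cmod w) by (unfold Cmod; f_equal; simpl; ring).
  rewrite <- E, <- Cmod_mult. eapply Rle_trans; [|apply re_le_Cmod]. unfold dot, Re; simpl. right; f_equal; ring.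
Qed.
Lemma dot_self z : dot z z = Cmod z ^ 2.
Proof. rewrite Cmod2_alt; unfold dot, Re, Im; ring. Qed.
Lemma dot_half z w : Rabs (2 * dot z w) <= Cmod z ^ 2 + Cmod w ^ 2.
Proof.
  rewrite Rabs_mult, (Rabs_pos_eq 2) by lra. pose proof (dot_le z w). pose proof (Rle_0_sqr (Cmod z - Cmod w)). unfold Rsqr in *. nra.
Qed.
Lemma dot_dr (f g : R -> C) x a b : is_derive f x a -> is_derive g x b -> is_derive (fun x => dot (f x) (g x)) x (dot a (g x) + dot (f x) b).
Proof.
  intros Hf Hg; apply is_derive_C in Hf; apply is_derive_C in Hg. destruct Hf as [F1 F2], Hg as [G1 G2]. unfold dot. rdr. ring.
Qed.
Lemma dot_ct {U : UniformSpace} (f g : U -> C) p : continuous f p -> continuous g p -> continuous (fun x => dot (f x) (g x)) p.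
Proof.
  intros; unfold dot; apply rct_plus; apply rct_mult; [apply (ct_fst f)|apply (ct_fst g)|apply (ct_snd f)|apply (ct_snd g)]; assumption.
Qed.

Lemma CInt_RtoC (w : R -> R) a b : (forall x, Rmin a b <= x <= Rmax a b -> continuous w x) -> CInt (fun x => RtoC (w x)) a b = RtoC (RInt w a b).
Proof.
  intros Hw. apply (is_RInt_unique (V := C_R_CompleteNormedModule)). apply is_CInt_C; simpl; split.
  - apply (RInt_correct w). apply (ex_RInt_continuous (V := R_CompleteNormedModule)); auto.
  - pose proof (is_RInt_const (V := R_NormedModule) a b 0) as H. change (is_RInt (fun _ : R => 0) a b ((b - a) * 0)) in H. rewrite Rmult_0_r in H. exact H.
Qed.

(** Two truncated integrals, each within e/2 of the limit, differ by at most e: this makes the tails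
    at 0 and at infinity small together. *)
Lemma integrable_facts B : (forall x, 0 < x -> 0 <= B x) -> ex_RInt_gen B (at_right 0) (Rbar_locally p_infty) ->
  (forall a b, 0 < a <= b -> ex_RInt B a b) /\
  forall e, 0 < e -> exists a0 b0, 0 < a0 < b0 /\ forall a' a b b', 0 < a' <= a -> a <= a0 -> b0 <= b <= b' -> RInt B a' a + RInt B b b' <= e.
Proof.
  intros HB [l Hl].
  assert (EV : forall e, 0 < e -> exists a0 b0, 0 < a0 < b0 /\ forall a b, 0 < a <= a0 -> b0 <= b -> exists y, is_RInt B a b y /\ Rabs (y - l) < e).
  { intros e He. assert (HP : locally l (fun y => Rabs (y - l) < e)) by (exists (mkposreal e He); intros y Hy; exact Hy).
    destruct (Hl _ HP) as [Q1 Q2 [d Hd] [M HM] HQ]. pose proof (cond_pos d).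
    exists (d / 2), (Rmax (M + 1) (d / 2 + 1)). pose proof (Rmax_l (M + 1) (d / 2 + 1)). pose proof (Rmax_r (M + 1) (d / 2 + 1)).
    split; [lra|]. intros a b Ha Hb. apply (HQ a b); [|apply HM; lra].
    apply Hd; [|lra]. apply ball_right; lra. }
  assert (I1 : forall a b, 0 < a <= b -> ex_RInt B a b).
  { intros a b Hab. destruct (EV 1 Rlt_0_1) as [a0 [b0 [H0 H]]].
    pose proof (Rmin_l a a0). pose proof (Rmin_r a a0). pose proof (Rmin_glb_lt a a0 0 ltac:(lra) ltac:(lra)). pose proof (Rmax_l b b0). pose proof (Rmax_r b b0).
    destruct (H (Rmin a a0) (Rmax b b0) ltac:(lra) ltac:(lra)) as [y [Hy _]].
    apply (ex_RInt_Chasles_2 B (Rmin a a0)); [lra|]. apply (ex_RInt_Chasles_1 B _ _ (Rmax b b0)); [lra|]. exists y; exact Hy. }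
  split; auto. intros e He. destruct (EV (e / 2) ltac:(lra)) as [a0 [b0 [H0 H]]]. exists a0, b0; split; auto.
  intros a' a b b' Ha Ha0 Hb.
  destruct (H a b ltac:(lra) ltac:(lra)) as [y [Hy Ly]]. destruct (H a' b' ltac:(lra) ltac:(lra)) as [y' [Hy' Ly']].
  pose proof (RInt_Chasles B a' a b (I1 a' a ltac:(lra)) (I1 a b ltac:(lra))) as C1.
  pose proof (RInt_Chasles B a' b b' (I1 a' b ltac:(lra)) (I1 b b' ltac:(lra))) as C2.
  rewrite (is_RInt_unique _ _ _ _ Hy) in C1. rewrite (is_RInt_unique _ _ _ _ Hy') in C2. unfold plus in C1, C2; simpl in C1, C2.
  apply Rabs_def2 in Ly. apply Rabs_def2 in Ly'. lra.
Qed.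

Lemma swap_ct {V : UniformSpace} (f : R -> R -> V) x t : continuous (fun q : R * R => f (fst q) (snd q)) (x, t) -> continuous (fun q : R * R => f (snd q) (fst q)) (t, x).
Proof.
  intros H; apply (continuous_comp (fun q : R * R => (snd q, fst q)) (fun q : R * R => f (fst q) (snd q))); [|exact H].
  apply filterlim_locally; intros e; exists e; intros [y1 y2] [B1 B2]; split; auto.
Qed.
Lemma ct_2 {V : UniformSpace} (f : R -> R -> V) x t : continuous (fun q : R * R => f (fst q) (snd q)) (x, t) -> continuous (fun x => f x t) x.
Proof. intros H; apply (ct_1 (fun t x => f x t) t x), swap_ct, H. Qed.

Lemma lim_small {T} (F : (T -> Prop) -> Prop) {FF : Filter F} (h : T -> C) e : filterlim h F (locally (RtoC 0)) -> 0 < e -> F (fun x => Cmod (h x) < e).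
Proof.
  intros H He. pose proof (proj1 (lim_Cmod F h (RtoC 0)) H e He) as L. revert L; apply filter_imp. intros x Hx.
  replace (h x - 0)%C with (h x) in Hx by ringC. exact Hx.
Qed.

(* Over [a, b], [d/dt int |W|^2] equals the increment of
   [|W_x|^2 - 2 W . W_xx]; at 0 the first term has the favourable sign, and the domination makes
   the tails uniformly small in time. *)
Lemma energy (W W1 W2 Wt : R -> R -> C) :
  (forall x t, 0 < x -> 0 < t -> is_derive (fun x => W x t) x (W1 x t) /\ is_derive (fun x => W1 x t) x (W2 x t) /\
     is_derive (fun x => W2 x t) x (- Wt x t)%C /\ is_derive (fun t => W x t) t (Wt x t)) ->
  (forall x t, 0 < x -> 0 < t -> continuous (fun q : R * R => W (fst q) (snd q)) (x, t) /\ continuous (fun q : R * R => Wt (fst q) (snd q)) (x, t)) ->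
  (forall x, 0 < x -> filterlim (fun t => W x t) (at_right 0) (locally (RtoC 0))) ->
  (forall t, 0 < t -> filterlim (fun x => W x t) (at_right 0) (locally (RtoC 0)) /\ exists K, at_right 0 (fun x => Cmod (W2 x t) <= K)) ->
  (forall t, 0 < t -> filterlim (fun x => W x t) (Rbar_locally p_infty) (locally (RtoC 0)) /\ filterlim (fun x => W1 x t) (Rbar_locally p_infty) (locally (RtoC 0)) /\
     exists K, forall x, 1 <= x -> Cmod (W2 x t) <= K) ->
  (forall T, 0 < T -> exists B : R -> R, (forall x, 0 < x -> 0 <= B x) /\ ex_RInt_gen B (at_right 0) (Rbar_locally p_infty) /\
     forall x t, 0 < x -> 0 < t <= T -> Cmod (W x t) ^ 2 <= B x /\ Cmod (Wt x t) ^ 2 <= B x) ->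
  forall x t, 0 < x -> 0 < t -> W x t = RtoC 0.
Proof.
  intros HD HC Ht0 Hx0 Hinf HB x0 T Hx HT.
  destruct (HB T HT) as [B [B0 [BI BW]]]. destruct (integrable_facts B B0 BI) as [I1 I2].
  set (w := fun x t => dot (W x t) (W x t)). set (p := fun x t => 2 * dot (W x t) (Wt x t)).
  set (bd := fun x t => dot (W1 x t) (W1 x t) - 2 * dot (W x t) (W2 x t)).
  assert (CWx : forall x t, 0 < x -> 0 < t -> continuous (fun x => W x t) x) by (intros x t H1 H2; exact (ct_2 W x t (proj1 (HC x t H1 H2)))).
  assert (CWtx : forall x t, 0 < x -> 0 < t -> continuous (fun x => Wt x t) x) by (intros x t H1 H2; exact (ct_2 Wt x t (proj2 (HC x t H1 H2)))).
  assert (Cw : forall x t, 0 < x -> 0 < t -> continuous (fun x => w x t) x) by (intros; unfold w; apply dot_ct; auto).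
  assert (Cp : forall x t, 0 < x -> 0 < t -> continuous (fun x => p x t) x) by (intros; unfold p; apply rct_mult; [ct|apply dot_ct; auto]).
  assert (Iw : forall a b t, 0 < a <= b -> 0 < t -> ex_RInt (fun x => w x t) a b).
  { intros a b t Hab Ht; apply (ex_RInt_continuous (V := R_CompleteNormedModule)). intros x Hx'; rewrite Rmin_left, Rmax_right in Hx' by lra. apply Cw; lra. }
  assert (Ip : forall a b t, 0 < a <= b -> 0 < t -> ex_RInt (fun x => p x t) a b).
  { intros a b t Hab Ht; apply (ex_RInt_continuous (V := R_CompleteNormedModule)). intros x Hx'; rewrite Rmin_left, Rmax_right in Hx' by lra. apply Cp; lra. }
  assert (Pb : forall x t, 0 < x -> 0 < t <= T -> Rabs (p x t) <= 2 * B x).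
  { intros x t H1 H2; unfold p; eapply Rle_trans; [apply dot_half|]. destruct (BW x t H1 H2). lra. }
  assert (bd_dr : forall x t, 0 < x -> 0 < t -> is_derive (fun x => bd x t) x (p x t)).
  { intros x t H1 H2. destruct (HD x t H1 H2) as (D0 & D1 & D2 & _). unfold bd.
    eapply rdr_eq; [apply (rdr_minus (fun x => dot (W1 x t) (W1 x t)) (fun x => 2 * dot (W x t) (W2 x t))); [apply (dot_dr _ _ _ _ _ D1 D1)|apply (rdr_mult (fun _ => 2) (fun x => dot (W x t) (W2 x t))); [apply rdr_const|apply (dot_dr _ _ _ _ _ D0 D2)]]|].
    unfold p, dot; simpl; ring. }
  assert (Pint : forall a b t, 0 < a <= b -> 0 < t -> RInt (fun x => p x t) a b = bd b t - bd a t).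
  { intros a b t Hab Ht. apply is_RInt_unique. apply (is_RInt_derive (V := R_CompleteNormedModule) (fun x => bd x t)).
    - intros x Hx'; rewrite Rmin_left, Rmax_right in Hx' by lra. apply bd_dr; lra.
    - intros x Hx'; rewrite Rmin_left, Rmax_right in Hx' by lra. apply Cp; lra. }
  assert (Plow : forall a b t, 0 < a <= b -> 0 < t <= T -> - RInt (fun x => p x t) a b <= 2 * RInt B a b).
  { intros a b t Hab Ht.
    assert (G : 0 <= RInt (fun x => plus (p x t) (scal 2 (B x))) a b).
    { apply RInt_ge_0; [lra| |].
      - apply (ex_RInt_plus (V := R_NormedModule)); [apply Ip; lra|]. apply (ex_RInt_scal (V := R_NormedModule)), I1; lra.
      - intros x Hx'. pose proof (Pb x t ltac:(lra) Ht) as P. apply Rabs_le_between in P. unfold plus, scal; simpl; unfold mult; simpl. lra. }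
    rewrite (RInt_plus (V := R_CompleteNormedModule)), (RInt_scal (V := R_CompleteNormedModule)) in G; [|apply I1; lra|apply Ip; lra|apply (ex_RInt_scal (V := R_NormedModule)), I1; lra].
    unfold plus, scal in G; simpl in G; unfold mult in G; simpl in G. lra. }
  (* The interval is enlarged until the boundary terms are small; of the four e, one comes from each
     end of [bd] and two from the tails, by [Plow]. *)
  assert (Rate : forall e, 0 < e -> exists a0 b0, 0 < a0 < b0 /\ forall a b t, 0 < a <= a0 -> b0 <= b -> 0 < t <= T -> RInt (fun x => p x t) a b <= 4 * e).
  { intros e He. destruct (I2 e He) as [a0 [b0 [H0 HI]]]. exists a0, b0; split; auto. intros a b t Ha Hb Ht.
    destruct (Hx0 t ltac:(lra)) as [L0 [K0 HK0]]. destruct (Hinf t ltac:(lra)) as [L1 [L2 [K1 HK1]]].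
    assert (Pk : forall K, 0 < e / (2 * (Rabs K + 1))) by (intros K; pose proof (Rabs_pos K); apply Rdiv_lt_0_compat; lra).
    assert (Near : exists a', 0 < a' <= a /\ - bd a' t <= e).
    { destruct (filter_and _ _ (lim_small (at_right 0) _ _ L0 (Pk K0)) HK0) as [d Hd].
      pose proof (cond_pos d). exists (Rmin a (d / 2)). pose proof (Rmin_l a (d / 2)). pose proof (Rmin_r a (d / 2)). pose proof (Rmin_glb_lt a (d / 2) 0 ltac:(lra) ltac:(lra)).
      split; [lra|]. destruct (Hd (Rmin a (d / 2))) as [S1 S2]; [|lra|].
      { apply ball_right; lra. }
      set (a' := Rmin a (d / 2)) in *. unfold bd.
      assert (0 <= dot (W1 a' t) (W1 a' t)) by (rewrite dot_self; apply pow2_ge_0).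
      pose proof (dot_le (W a' t) (W2 a' t)) as DL. apply Rabs_le_between in DL. pose proof (Rabs_pos K0). pose proof (Rle_abs K0).
      assert (Cmod (W a' t) * Cmod (W2 a' t) <= e / (2 * (Rabs K0 + 1)) * (Rabs K0 + 1)) by (apply Rmult_le_compat; try apply Cmod_ge_0; lra).
      replace (e / (2 * (Rabs K0 + 1)) * (Rabs K0 + 1)) with (e / 2) in * by (field; lra). lra. }
    assert (Far : exists b', b <= b' /\ bd b' t <= e).
    { set (m := Rmin 1 (e / 2)). assert (Hm : 0 < m) by (apply Rmin_glb_lt; lra).
      assert (Hm1 : m <= 1) by apply Rmin_l. assert (Hm2 : m <= e / 2) by apply Rmin_r.
      assert (0 < e / (4 * (Rabs K1 + 1))) by (pose proof (Rabs_pos K1); apply Rdiv_lt_0_compat; lra).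
      destruct (filter_and _ _ (lim_small (Rbar_locally p_infty) _ _ L1 H) (lim_small (Rbar_locally p_infty) _ _ L2 Hm)) as [M HM].
      set (b' := Rmax (M + 1) (Rmax b 1)). pose proof (Rmax_l (M + 1) (Rmax b 1)). pose proof (Rmax_r (M + 1) (Rmax b 1)). pose proof (Rmax_l b 1). pose proof (Rmax_r b 1). fold b' in H1, H2.
      exists b'; split; [lra|]. destruct (HM b' ltac:(lra)) as [S1 S2]. specialize (HK1 b' ltac:(lra)). unfold bd. rewrite dot_self.
      pose proof (Cmod_ge_0 (W1 b' t)). assert (Cmod (W1 b' t) ^ 2 <= e / 2) by nra.
      pose proof (dot_le (W b' t) (W2 b' t)) as DL. apply Rabs_le_between in DL. pose proof (Rabs_pos K1). pose proof (Rle_abs K1).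
      assert (Cmod (W b' t) * Cmod (W2 b' t) <= e / (4 * (Rabs K1 + 1)) * (Rabs K1 + 1)) by (apply Rmult_le_compat; try apply Cmod_ge_0; lra).
      replace (e / (4 * (Rabs K1 + 1)) * (Rabs K1 + 1)) with (e / 4) in * by (field; lra). lra. }
    destruct Near as [a' [Ha' Na]]. destruct Far as [b' [Hb' Nb]].
    pose proof (HI a' a b b' ltac:(lra) ltac:(lra) ltac:(lra)) as Tail.
    pose proof (RInt_Chasles (V := R_CompleteNormedModule) (fun x => p x t) a' a b (Ip a' a t ltac:(lra) ltac:(lra)) (Ip a b t ltac:(lra) ltac:(lra))) as C1.
    pose proof (RInt_Chasles (V := R_CompleteNormedModule) (fun x => p x t) a' b b' (Ip a' b t ltac:(lra) ltac:(lra)) (Ip b b' t ltac:(lra) ltac:(lra))) as C2.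
    unfold plus in C1, C2; simpl in C1, C2. rewrite (Pint a' b') in C2 by lra.
    pose proof (Plow a' a t ltac:(lra) Ht). pose proof (Plow b b' t ltac:(lra) Ht). lra. }
  assert (E_dr : forall a b t, 0 < a <= b -> 0 < t -> is_derive (fun t => RInt (fun x => w x t) a b) t (RInt (fun x => p x t) a b)).
  { intros a b t Hab Ht.
    assert (D : is_derive (fun t => CInt (fun x => RtoC (w x t)) a b) t (CInt (fun x => RtoC (p x t)) a b)).
    { apply (CInt_dr (fun t x => RtoC (w x t)) (fun t x => RtoC (p x t))); [lra|].
      apply locally_pos; [lra|]. intros s Hs x Hx'.
      destruct (HC x s ltac:(lra) Hs) as [C1 C2]. apply swap_ct in C1; apply swap_ct in C2. split; [|split].
      - unfold jct, w; apply ct_RtoC. apply (dot_ct (fun q : R * R => W (snd q) (fst q)) (fun q : R * R => W (snd q) (fst q))); auto.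
      - unfold jct, p; apply ct_RtoC, rct_mult; [ct|]. apply (dot_ct (fun q : R * R => W (snd q) (fst q)) (fun q : R * R => Wt (snd q) (fst q))); auto.
      - destruct (HD x s ltac:(lra) Hs) as (_ & _ & _ & D). apply dr_RtoC. unfold w. eapply rdr_eq; [apply (dot_dr _ _ _ _ _ D D)|]. unfold p, dot; ring. }
    rewrite CInt_RtoC in D by (intros x Hx'; rewrite Rmin_left, Rmax_right in Hx' by lra; apply Cp; lra).
    pose proof (proj1 (proj1 (is_derive_C _ _ _) D)) as D1. revert D1; apply (is_derive_ext_loc (fun t => fst (CInt (fun x => RtoC (w x t)) a b)) (fun t => RInt (fun x => w x t) a b)).
    apply locally_pos; [lra|]. intros s Hs. pose proof (CInt_RtoC (fun x => w x s) a b ltac:(intros x Hx'; rewrite Rmin_left, Rmax_right in Hx' by lra; apply Cw; lra)) as E. apply (f_equal fst) in E. exact E. }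
  assert (Wsmall : forall x t, 0 < x -> 0 < t <= T -> w x t <= t ^ 2 * B x).
  { intros x t H1 H2. unfold w; rewrite dot_self. specialize (B0 x H1).
    (* The increment starts at a small s > 0, where |W| < e, because [Wt] is controlled only at
       positive times. *)
    assert (X : Cmod (W x t) <= sqrt (B x) * t).
    { apply le_epsilon; intros e He.
      destruct (lim_small (at_right 0) _ _ (Ht0 x H1) He) as [d Hd]. pose proof (cond_pos d).
      set (s := Rmin (t / 2) (d / 2)). pose proof (Rmin_l (t / 2) (d / 2)). pose proof (Rmin_r (t / 2) (d / 2)). pose proof (Rmin_glb_lt (t / 2) (d / 2) 0 ltac:(lra) ltac:(lra)). fold s in H0, H3, H4.
      assert (Cmod (W x s) < e).
      { apply Hd; [|lra]. apply ball_right; lra. }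
      assert (Inc : Cmod (W x t - W x s) <= sqrt (B x) * Rabs (t - s)).
      { apply (C_increment (fun t => W x t) (fun t => Wt x t)); intros r Hr; rewrite Rmin_left, Rmax_right in Hr by lra.
        - apply HD; lra.
        - exact (ct_1 Wt x r (proj2 (HC x r H1 ltac:(lra)))).
        - destruct (BW x r H1 ltac:(lra)) as [_ Bt]. rewrite <- (sqrt_pow2 (Cmod (Wt x r))) by apply Cmod_ge_0. now apply sqrt_le_1_alt. }
      rewrite Rabs_pos_eq in Inc by lra. replace (W x t) with (W x t - W x s + W x s)%C by ringC.
      eapply Rle_trans; [apply Cmod_triangle|]. pose proof (sqrt_pos (B x)). nra. }
    pose proof (sqrt_sqrt (B x) B0) as SS. pose proof (sqrt_pos (B x)). pose proof (Cmod_ge_0 (W x t)).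
    replace (t ^ 2 * B x) with ((sqrt (B x) * t) ^ 2) by (transitivity (t ^ 2 * (sqrt (B x) * sqrt (B x))); [ring|now rewrite SS]). apply pow_incr; lra. }
  assert (Key : forall a1 b1, 0 < a1 <= b1 -> RInt (fun x => w x T) a1 b1 <= 0).
  { intros a1 b1 H1. apply le_epsilon; intros e0 He0. rewrite Rplus_0_l.
    (* The rate 4 e over a time at most T, plus the initial energy e, must add up to e0. *)
    set (e := e0 / (4 * T + 1)). assert (He : 0 < e) by (apply Rdiv_lt_0_compat; lra).
    destruct (Rate e He) as [a0 [b0 [H0 HR]]].
    set (a := Rmin a1 a0). set (b := Rmax b1 b0).
    pose proof (Rmin_l a1 a0). pose proof (Rmin_r a1 a0). pose proof (Rmin_glb_lt a1 a0 0 ltac:(lra) ltac:(lra)). fold a in H, H2, H3.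
    pose proof (Rmax_l b1 b0). pose proof (Rmax_r b1 b0). fold b in H4, H5.
    assert (Mono : RInt (fun x => w x T) a1 b1 <= RInt (fun x => w x T) a b).
    { pose proof (RInt_Chasles (V := R_CompleteNormedModule) (fun x => w x T) a a1 b (Iw a a1 T ltac:(lra) HT) (Iw a1 b T ltac:(lra) HT)) as C1.
      pose proof (RInt_Chasles (V := R_CompleteNormedModule) (fun x => w x T) a1 b1 b (Iw a1 b1 T ltac:(lra) HT) (Iw b1 b T ltac:(lra) HT)) as C2.
      unfold plus in C1, C2; simpl in C1, C2.
      assert (W0 : forall x, 0 <= w x T) by (intros; unfold w; rewrite dot_self; apply pow2_ge_0).
      pose proof (RInt_ge_0 (fun x => w x T) a a1 ltac:(lra) (Iw a a1 T ltac:(lra) HT) ltac:(intros; apply W0)).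
      pose proof (RInt_ge_0 (fun x => w x T) b1 b ltac:(lra) (Iw b1 b T ltac:(lra) HT) ltac:(intros; apply W0)). lra. }
    set (IB := RInt B a b).
    assert (HIB : 0 <= IB) by (apply RInt_ge_0; [lra|apply I1; lra|intros; apply B0; lra]).
    (* The last two bounds give t1^2 IB <= e for the initial energy; the first keeps t1 below T. *)
    set (t1 := Rmin (T / 2) (Rmin 1 (e / (IB + 1)))).
    assert (He1 : 0 < e / (IB + 1)) by (apply Rdiv_lt_0_compat; lra).
    assert (Ht1 : 0 < t1) by (apply Rmin_glb_lt; [lra|apply Rmin_glb_lt; lra]).
    assert (Ht1T : t1 <= T / 2) by apply Rmin_l.
    assert (Ht1e : t1 <= 1 /\ t1 <= e / (IB + 1)).
    { pose proof (Rmin_r (T / 2) (Rmin 1 (e / (IB + 1)))). pose proof (Rmin_l 1 (e / (IB + 1))). pose proof (Rmin_r 1 (e / (IB + 1))). fold t1 in H6. lra. }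
    assert (Start : RInt (fun x => w x t1) a b <= e).
    { apply (Rle_trans _ (RInt (fun x => scal (t1 ^ 2) (B x)) a b)).
      - apply RInt_le; [lra|apply Iw; lra|apply (ex_RInt_scal (V := R_NormedModule)), I1; lra|]. intros x Hx'. apply Wsmall; lra.
      - rewrite (RInt_scal (V := R_CompleteNormedModule)) by (apply I1; lra). unfold scal; simpl; unfold mult; simpl. fold IB.
        assert (t1 * (IB + 1) <= e).
        { apply (Rle_trans _ (e / (IB + 1) * (IB + 1))); [apply Rmult_le_compat_r; lra|right; field; lra]. }
        assert (t1 * (t1 * 1) <= t1) by nra. nra. }
    destruct (MVT_gen (fun t => RInt (fun x => w x t) a b) t1 T (fun t => RInt (fun x => p x t) a b)) as [c [Hc Ec]].
    { intros t Ht; rewrite Rmin_left, Rmax_right in Ht by lra. apply E_dr; lra. }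
    { intros t Ht; rewrite Rmin_left, Rmax_right in Ht by lra. apply continuity_pt_filterlim.
      exact (ex_derive_continuous (V := R_NormedModule) (fun t => RInt (fun x => w x t) a b) t (ex_intro _ _ (E_dr a b t ltac:(lra) ltac:(lra)))). }
    rewrite Rmin_left, Rmax_right in Hc by lra.
    pose proof (HR a b c ltac:(lra) ltac:(lra) ltac:(lra)) as Rc.
    assert (RInt (fun x => p x c) a b * (T - t1) <= 4 * e * T).
    { apply (Rle_trans _ (4 * e * (T - t1))); [apply Rmult_le_compat_r; lra|]. apply Rmult_le_compat_l; lra. }
    assert (e0 = 4 * e * T + e) by (unfold e; field; lra). lra. }
  destruct (Req_dec (Cmod (W x0 T)) 0) as [Z|NZ]; [now apply Cmod_eq_0|exfalso].
  pose proof (Cmod_ge_0 (W x0 T)).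
  assert (Pw : 0 < w x0 T) by (unfold w; rewrite dot_self; apply pow_lt; lra).
  pose proof (Cw x0 T Hx HT) as Cx.
  destruct (Cx (fun y => w x0 T / 2 < y)) as [d Hd]; [apply (open_gt (w x0 T / 2)); lra|]. pose proof (cond_pos d).
  pose proof (Key x0 (x0 + d / 2) ltac:(lra)) as K.
  assert (RInt (fun _ => w x0 T / 2) x0 (x0 + d / 2) <= RInt (fun x => w x T) x0 (x0 + d / 2)).
  { apply RInt_le; [lra|apply (ex_RInt_const (V := R_NormedModule))|apply Iw; lra|]. intros x Hx'. left; apply Hd.
    apply ball_right; lra. }
  rewrite RInt_const in H1. unfold scal in H1; simpl in H1; unfold mult in H1; simpl in H1. nra.
Qed.

(** * From relative to ordinary derivatives in the open quadrant *)

Lemma Q_right_x x t : 0 < x -> 0 < t -> rightD (fun y => Q y t) x.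
Proof. intros Hx Ht y Hy; split; lra. Qed.
Lemma Q_right_t x t : 0 < x -> 0 < t -> rightD (fun s => Q x s) t.
Proof. intros Hx Ht y Hy; split; lra. Qed.

Lemma pdx_on W Z x t l : (forall y, 0 < y -> Z y t = W y t) -> 0 < x -> 0 < t -> is_derive (fun x => W x t) x l ->
  is_derive_on (fun y => Q y t) (fun y => Z y t) x l.
Proof.
  intros E Hx Ht D. apply (on_ext _ (fun y => W y t)); [intros y [Hy _]; symmetry; auto|split; auto|now apply dr_on].
Qed.

Lemma pdx_eq W Z x t l : (forall y, 0 < y -> Z y t = W y t) -> 0 < x -> 0 < t -> is_derive (fun x => W x t) x l -> pdx Q Z x t = l.
Proof. intros E Hx Ht D; apply Derive_on_eq; [now apply Q_right_x|now apply (pdx_on W)]. Qed.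

Lemma pdt_eq W x t l : 0 < x -> 0 < t -> is_derive (fun t => W x t) t l -> pdt Q W x t = l.
Proof. intros Hx Ht D; apply Derive_on_eq; [now apply Q_right_t|now apply dr_on]. Qed.

(** A relative derivative depends on its function only inside the open quadrant, so the explicit
    chain determines the iterated ones in turn. *)
Lemma pdx_chain W W1 W2 W3 Wt x t : (forall x t, 0 < x -> 0 < t -> is_derive (fun x => W x t) x (W1 x t) /\ is_derive (fun x => W1 x t) x (W2 x t) /\
     is_derive (fun x => W2 x t) x (W3 x t) /\ is_derive (fun t => W x t) t (Wt x t)) -> 0 < x -> 0 < t ->
  (ex_pdt Q W x t /\ ex_pdx Q W x t /\ ex_pdx Q (pdx Q W) x t /\ ex_pdx Q (pdx Q (pdx Q W)) x t) /\
  pdt Q W x t = Wt x t /\ pdx Q W x t = W1 x t /\ pdx Q (pdx Q W) x t = W2 x t /\ pdx Q (pdx Q (pdx Q W)) x t = W3 x t.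
Proof.
  intros H Hx Ht.
  assert (E1 : forall y, 0 < y -> pdx Q W y t = W1 y t) by (intros y Hy; apply (pdx_eq W); auto; apply H; auto).
  assert (E2 : forall y, 0 < y -> pdx Q (pdx Q W) y t = W2 y t) by (intros y Hy; apply (pdx_eq W1); auto; apply H; auto).
  assert (E3 : forall y, 0 < y -> pdx Q (pdx Q (pdx Q W)) y t = W3 y t) by (intros y Hy; apply (pdx_eq W2); auto; apply H; auto).
  destruct (H x t Hx Ht) as (D0 & D1 & D2 & D3).
  split; [|split; [now apply pdt_eq|auto]].
  split; [exists (Wt x t); now apply dr_on|]. split; [exists (W1 x t); now apply dr_on|].
  split; [exists (W2 x t); now apply (pdx_on W1)|exists (W3 x t); now apply (pdx_on W2)].
Qed.

Lemma interior_dx W x t : ex_pdx Qbar_minus_origin W x t -> 0 < x -> 0 < t -> is_derive (fun x => W x t) x (pdx Qbar_minus_origin W x t).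
Proof.
  intros E Hx Ht. apply (on_dr (fun y => Qbar_minus_origin y t)).
  - apply locally_pos; [lra|]. intros y Hy; split; [split; lra|lra].
  - apply Derive_on_is; auto. intros y Hy; split; [split; lra|lra].
Qed.
Lemma interior_dt W x t : ex_pdt Qbar_minus_origin W x t -> 0 < x -> 0 < t -> is_derive (fun t => W x t) t (pdt Qbar_minus_origin W x t).
Proof.
  intros E Hx Ht. apply (on_dr (fun y => Qbar_minus_origin x y)).
  - apply locally_pos; [lra|]. intros y Hy; split; [split; lra|lra].
  - apply Derive_on_is; auto. intros y Hy; split; [split; lra|lra].
Qed.
Lemma interior_ct W x t : continuous_in Qbar_minus_origin W -> 0 < x -> 0 < t -> continuous (fun q : R * R => W (fst q) (snd q)) (x, t).
Proof.
  intros H Hx Ht P HP. specialize (H x t ltac:(split; [split; lra|lra]) P HP). unfold filtermap, within in *.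
  assert (L : locally (x, t) (fun q : R * R => 0 < fst q /\ 0 < snd q)).
  { apply filter_and.
    - refine (continuous_fst x t (fun x => 0 < x) _). apply (open_gt 0); simpl; lra.
    - refine (continuous_snd x t (fun x => 0 < x) _). apply (open_gt 0); simpl; lra. }
  generalize (filter_and _ _ H L); apply filter_imp; intros q [H1 [H2 H3]]; apply H1. split; [split; lra|lra].
Qed.

(** Regularity up to the points (0, t) with t > 0 enters here: it bounds V_xx in the boundary term
    of the energy identity. *)
Lemma bounded_at_edge W t : continuous_in Qbar_minus_origin W -> 0 < t -> exists K, at_right 0 (fun x => Cmod (W x t) <= K).
Proof.
  intros H Ht. pose proof (H 0 t ltac:(split; [split; lra|lra])) as L.
  pose proof (proj1 (lim_Cmod (within (fun p : R * R => Qbar_minus_origin (fst p) (snd p)) (locally (0, t))) _ _) L 1 Rlt_0_1) as [d Hd].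
  exists (Cmod (W 0 t) + 1), d. intros x Bx Hx. specialize (Hd (x, t) ltac:(split; [exact Bx|apply ball_center]) ltac:(split; [split; simpl; lra|simpl; lra])).
  simpl in Hd. replace (W x t) with (W 0 t + (W x t - W 0 t))%C by ringC. eapply Rle_trans; [apply Cmod_triangle|]. lra.
Qed.

Lemma inv_lim (h : R -> C) K : (forall x, 1 <= x -> Cmod (h x) <= K / x) -> filterlim h (Rbar_locally p_infty) (locally (RtoC 0)).
Proof.
  intros H; apply (lim_Cmod (Rbar_locally p_infty)). intros e He. exists (Rmax 1 (Rabs K / e)); intros x Hx.
  pose proof (Rmax_l 1 (Rabs K / e)). pose proof (Rmax_r 1 (Rabs K / e)). replace (h x - 0)%C with (h x) by ringC.
  eapply Rle_lt_trans; [apply H; lra|]. pose proof (Rle_abs K).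
  apply (Rmult_lt_reg_r x); [lra|]. replace (K / x * x) with K by (field; lra).
  assert (Rabs K / e * e < x * e) by (apply Rmult_lt_compat_r; lra). replace (Rabs K / e * e) with (Rabs K) in * by (field; lra). lra.
Qed.

Lemma inv_sq_integrable : is_RInt_gen (fun r => 1 / (1 + r) ^ 2) (at_right 0) (Rbar_locally p_infty) 1.
Proof.
  intros P [e He]. pose proof (cond_pos e).
  exists (fun a => 0 < a < e / 2) (fun b => Rmax (e / 2) (2 / e) < b).
  - assert (He2 : 0 < e / 2) by lra. exists (mkposreal _ He2); intros a Ba Ha; split; auto. unfold ball in Ba; simpl in Ba; unfold AbsRing_ball, abs, minus, plus, opp in Ba; simpl in Ba.
    rewrite Rabs_pos_eq in Ba; lra.
  - exists (Rmax (e / 2) (2 / e)); auto.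
  - intros a b Ha Hb. pose proof (Rmax_l (e / 2) (2 / e)). pose proof (Rmax_r (e / 2) (2 / e)).
    exists (1 / (1 + a) - 1 / (1 + b)); split; [apply dom_int; simpl; lra|]. apply He.
    unfold ball; simpl; unfold AbsRing_ball, abs, minus, plus, opp; simpl.
    assert (1 - a <= 1 / (1 + a) <= 1).
    { split; apply (Rmult_le_reg_r (1 + a)); try lra; replace (1 / (1 + a) * (1 + a)) with 1 by (field; lra); nra. }
    assert (0 < 2 / e) by (apply Rdiv_lt_0_compat; lra).
    assert (0 < 1 / (1 + b) < e / 2).
    { split; [apply Rdiv_lt_0_compat; lra|]. apply (Rmult_lt_reg_r (1 + b)); [lra|]. replace (1 / (1 + b) * (1 + b)) with 1 by (field; lra).
      assert (2 / e * (e / 2) < b * (e / 2)) by (apply Rmult_lt_compat_r; lra). replace (2 / e * (e / 2)) with 1 in * by (field; lra). lra. }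
    apply Rabs_def1; lra.
Qed.

Lemma Cmod_sub_sq a b (A B : R) : Cmod a ^ 2 <= A -> Cmod b <= B -> Cmod (a - b) ^ 2 <= 2 * A + 2 * B ^ 2.
Proof.
  intros HA HB. assert (T : Cmod (a - b) <= Cmod a + Cmod b) by (unfold Cminus; eapply Rle_trans; [apply Cmod_triangle|rewrite Cmod_opp; lra]).
  pose proof (Cmod_ge_0 (a - b)). pose proof (Cmod_ge_0 a). pose proof (Cmod_ge_0 b).
  assert (Cmod (a - b) ^ 2 <= (Cmod a + Cmod b) ^ 2) by (apply pow_incr; lra).
  assert (Cmod b ^ 2 <= B ^ 2) by (apply pow_incr; lra). pose proof (Rle_0_sqr (Cmod a - Cmod b)). unfold Rsqr in *. nra.
Qed.

Theorem theorem1 :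
  forall (u0 g0 : R -> C) (f : R -> R -> C),
    Schwartz_halfline u0 ->
    Cinfty_halfline g0 ->
    Schwartz_Qbar f ->
    exists U : R -> R -> C,
      (forall x t : R, 0 < x -> 0 < t -> is_UTM_value u0 g0 f x t (U x t)) /\
      solves_ibvp u0 g0 f U /\
      (compatible u0 g0 f ->
       forall V : R -> R -> C,
         Ck Qbar_minus_origin 3 V ->
         solves_ibvp u0 g0 f V ->
         decay_at_infinity V ->
         L2_dominated V ->
         forall x t : R, 0 < x -> 0 < t -> V x t = U x t).
Proof.
  intros u0 g0 f Hu Hg Hf.
  destruct (existence u0 g0 f Hu Hg Hf) as (U & U1 & U2 & U3 & Ut & Hval & HD & Ht0 & Hx0 & HC & Hdec & Hcomp).
  exists U. split; [exact Hval|split].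
  - split; [|split; auto]. intros x t Hx Ht.
    destruct (pdx_chain U U1 U2 U3 Ut x t) as [(E0 & E1 & E2 & E3) (F0 & _ & _ & F3)]; auto.
    { intros y s Hy Hs; destruct (HD y s Hy Hs) as (D0 & D1 & D2 & D3 & _); auto. }
    split; [exact E0|split; [exact E1|split; [exact E2|split; [exact E3|]]]]. rewrite F0, F3. apply HD; auto.
  - intros Hc V HV (HVe & HVt0 & HVx0) HVdec HVL2.
    (* The regularity of [V] is stated relative to the closed quadrant without the origin, the
       equation relative to [Q]; inside, both kinds of derivative are the ordinary ones. *)
    set (V1 := pdx Qbar_minus_origin V). set (V2 := pdx Qbar_minus_origin V1). set (V3 := pdx Qbar_minus_origin V2). set (Vt := pdt Qbar_minus_origin V).
    destruct HV as (CV & EV & (CV1 & EV1 & (CV2 & EV2 & _) & _) & (CVt & _)).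
    fold V1 in CV1, EV1. fold V1 V2 in CV2, EV2. fold Vt in CVt.
    assert (DV : forall x t, 0 < x -> 0 < t -> is_derive (fun x => V x t) x (V1 x t) /\ is_derive (fun x => V1 x t) x (V2 x t) /\
       is_derive (fun x => V2 x t) x (V3 x t) /\ is_derive (fun t => V x t) t (Vt x t)).
    { intros x t Hx Ht. assert (Qo : Qbar_minus_origin x t) by (split; [split; lra|lra]).
      split; [exact (interior_dx V x t (proj1 (EV x t Qo)) Hx Ht)|]. split; [exact (interior_dx V1 x t (proj1 (EV1 x t Qo)) Hx Ht)|].
      split; [exact (interior_dx V2 x t (proj1 (EV2 x t Qo)) Hx Ht)|exact (interior_dt V x t (proj2 (EV x t Qo)) Hx Ht)]. }
    assert (PV := fun x t Hx Ht => pdx_chain V V1 V2 V3 Vt x t DV Hx Ht).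
    assert (Eq : forall x t, 0 < x -> 0 < t -> (Vt x t + V3 x t)%C = f x t).
    { intros x t Hx Ht. destruct (PV x t Hx Ht) as [_ (P0 & _ & _ & P3)]. destruct (HVe x t Hx Ht) as (_ & _ & _ & _ & E). now rewrite P0, P3 in E. }
    intros x t Hx Ht.
    assert (Z : (V x t - U x t)%C = RtoC 0).
    2: { replace (V x t) with (V x t - U x t + U x t)%C by ringC. rewrite Z; ringC. }
    apply (energy (fun x t => V x t - U x t)%C (fun x t => V1 x t - U1 x t)%C (fun x t => V2 x t - U2 x t)%C (fun x t => Vt x t - Ut x t)%C); auto; clear x t Hx Ht.
    + intros x t Hx Ht. destruct (DV x t Hx Ht) as (A0 & A1 & A2 & A3). destruct (HD x t Hx Ht) as (B0 & B1 & B2 & B3 & B4).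
      split; [now apply dr_minus|]. split; [now apply dr_minus|]. split; [|now apply dr_minus].
      eapply dr_eq; [apply (dr_minus _ _ _ _ _ A2 B2)|].
      replace (V3 x t) with (f x t - Vt x t)%C by (rewrite <- (Eq x t Hx Ht); ringC). rewrite <- B4. ringC.
    + intros x t Hx Ht. destruct (HC x t Hx Ht). split.
      * apply (ct_minus (fun q : R * R => V (fst q) (snd q)) (fun q => U (fst q) (snd q))); auto. now apply interior_ct.
      * apply (ct_minus (fun q : R * R => Vt (fst q) (snd q)) (fun q => Ut (fst q) (snd q))); auto. now apply interior_ct.
    + intros x Hx. replace (RtoC 0) with (u0 x - u0 x)%C by ringC. apply (lim_minus (at_right 0)); auto.
    + intros t Ht. split; [replace (RtoC 0) with (g0 t - g0 t)%C by ringC; apply (lim_minus (at_right 0)); auto|].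
      destruct (bounded_at_edge V2 t CV2 Ht) as [K1 H1]. destruct (Hdec t Ht) as [K2 [_ H2]]. exists (K1 + K2).
      assert (L : at_right 0 (fun x => 0 < x)) by (apply at_right_pos; auto).
      generalize (filter_and _ _ H1 L); apply filter_imp; intros x [H3 H4]. unfold Cminus; eapply Rle_trans; [apply Cmod_triangle|]; rewrite Cmod_opp. specialize (H2 x H4). lra.
    + intros t Ht. destruct (HVdec t Ht) as (L0 & L1 & M & HM). destruct (Hdec t Ht) as [K [HK HK2]].
      assert (P : Rbar_locally p_infty (fun x => pdx Q V x t = V1 x t)) by (exists 0; intros x Hx; apply (PV x t); auto).
      split; [|split].
      * replace (RtoC 0) with (0 - 0)%C by ringC. apply (lim_minus (Rbar_locally p_infty)); auto. apply (inv_lim _ K); intros; apply HK; auto.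
      * replace (RtoC 0) with (0 - 0)%C by ringC. apply (lim_minus (Rbar_locally p_infty)); [|apply (inv_lim _ K); intros; apply HK; auto].
        revert L1; apply filterlim_ext_loc; exact P.
      * exists (M + K); intros x Hx. specialize (HM x Hx). destruct (PV x t ltac:(lra) Ht) as [_ (_ & _ & P2 & _)]. rewrite P2 in HM.
        unfold Cminus; eapply Rle_trans; [apply Cmod_triangle|]; rewrite Cmod_opp. specialize (HK2 x ltac:(lra)). lra.
    + intros T HT. destruct (HVL2 T HT) as [B [PB [IB HB]]]. destruct (Hcomp Hc T HT) as [K HK].
      (* From |V - U|^2 <= 2 |V|^2 + 2 |U|^2 and the bound K/(1 + x) for U and U_t. *)
      exists (fun x => 2 * B x + 2 * (K ^ 2 * (1 / (1 + x) ^ 2))). split; [|split].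
      * intros x Hx. specialize (PB x Hx). assert (0 < 1 / (1 + x) ^ 2) by (apply Rdiv_lt_0_compat; [lra|apply pow_lt; lra]). pose proof (pow2_ge_0 K). nra.
      * destruct IB as [l Hl]. eexists.
        apply (is_RInt_gen_plus (V := R_NormedModule) (fun x => 2 * B x) (fun x => 2 * (K ^ 2 * (1 / (1 + x) ^ 2)))).
        -- apply (is_RInt_gen_scal (V := R_NormedModule) B 2 l Hl).
        -- apply (is_RInt_gen_scal (V := R_NormedModule) _ 2 _ (is_RInt_gen_scal (V := R_NormedModule) _ (K ^ 2) 1 inv_sq_integrable)).
      * intros x t Hx Ht. destruct (HB x t Hx Ht) as [B1 B2]. destruct (HK x t Hx Ht) as [K1 K2].
        destruct (PV x t Hx ltac:(lra)) as [_ (P0 & _)]. rewrite P0 in B2.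
        replace (K ^ 2 * (1 / (1 + x) ^ 2)) with ((K / (1 + x)) ^ 2) by (field; lra). split; now apply Cmod_sub_sq.
Qed.
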